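(* Let $r,d,\delta\in\mathbb N$ with $d>(r+1)^4\delta$, and let $\mathbb F$ be a field of characteristic $p$ with $p=0$ or $p>2rd\delta$. Suppose a nonzero $f\in\mathbb F[x]$ admits a minimal representation $f=\sum_{i=1}^{r'}\alpha_if_i(x)^d$ with $r'\le r$, $\alpha_i\in\mathbb F$, each $f_i$ monic with $\deg f_i\le\delta$, and $f_1,\dots,f_{r'}$ pairwise non-associate; let $B$ be the total bit complexity of this representation. Then there is a deterministic algorithm that, given black-box access to $f$ and the parameters $r,d,\delta$, outputs in time $\mathrm{poly}(r,\delta,d,B)$ (or $\mathrm{poly}(r,\delta,d,p,\log|\mathbb F|)$ if $\mathbb F$ is a finite field of characteristic $p$) a set $\{(\alpha'_i,f'_i)\}_{i=1}^{r'}$ such that for some permutation $\pi$ of $[r']$, $f=\sum_{i=1}^{r'}\alpha'_if'_i(x)^d$, $f'_i=f_{\pi(i)}$ and $\alpha'_i=\alpha_{\pi(i)}$.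
   Context: A representation $f=\sum_{i=1}^{r'}\alpha_if_i^d$ with $\deg f_i\le\delta$ is minimal if $f$ cannot be written as $\sum_{i=1}^{r''}\beta_ig_i^d$ with $r''<r'$ and $\deg g_i\le\delta$. Two nonzero polynomials are associate if one is a nonzero scalar multiple of the other. Black-box access means the algorithm can query $f$ at points of its choice. For a finite field, the bit complexity is $r'\delta\log|\mathbb F|$.
   Formalization: Bit complexity and running time are undefined over a bare field, so a general field is assumed to have a bit encoding with polynomial-time linear systems and univariate factoring; the rationals and all finite fields (given as F_p[t]/(h)) need no such assumption. *)

(* Defs.v *)
From HB Require Import structures.
From mathcomp Require Import all_boot all_order all_algebra all_fingroup.

Set Implicit Arguments.
Unset Strict Implicit.
Unset Printing Implicit Defensive.

Import Order.TTheory GRing.Theory Num.Theory.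
Local Open Scope ring_scope.

(** * Deterministic oracle programs with bit cost

    The machine model is a WHILE language over binary trees with integer
    leaves.  Every evaluation step is charged the bit size of the value it
    produces, so running time is polynomially related to time on a
    deterministic oracle Turing machine. *)

Inductive value : Type :=
  | VInt of int
  | VPair of value & value.

Fixpoint vsize (v : value) : nat :=
  match v with
  | VInt z => (trunc_log 2 (absz z)).+1
  | VPair a b => (vsize a + vsize b).+1
  end.

Definition vnat (n : nat) : value := VInt (Posz n).

Definition vlist (s : seq value) : value := foldr VPair (vnat 0) s.

Inductive binop : Type := Plus | Minus | Times | Quot | Le.

Inductive expr : Type :=
  | Var of nat
  | Const of int
  | EPair of expr & expr
  | Fst of expr
  | Snd of expr
  | IsPair of expr
  | Op of binop & expr & expr.

Inductive cmd : Type :=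
  | Skip
  | Assign of nat & expr
  | Sequence of cmd & cmd
  | If of expr & cmd & cmd
  | While of expr & cmd
  | Query of nat & expr.

Definition store : Type := nat -> value.

Definition update (s : store) (x : nat) (v : value) : store :=
  fun y => if y == x then v else s y.

Definition to_int (v : value) : int := if v is VInt z then z else 0.

Definition truthy (v : value) : bool := if v is VInt z then z != 0 else true.

Definition binop_eval (o : binop) (a b : int) : int :=
  match o with
  | Plus => a + b
  | Minus => a - b
  | Times => a * b
  | Quot => (a %/ b)%Z
  | Le => if a <= b then 1 else 0
  end.

Fixpoint eval (s : store) (e : expr) : value :=
  match e with
  | Var x => s x
  | Const z => VInt z
  | EPair e1 e2 => VPair (eval s e1) (eval s e2)
  | Fst e1 => if eval s e1 is VPair a _ then a else vnat 0
  | Snd e1 => if eval s e1 is VPair _ b then b else vnat 0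
  | IsPair e1 => if eval s e1 is VPair _ _ then vnat 1 else vnat 0
  | Op o e1 e2 => VInt (binop_eval o (to_int (eval s e1)) (to_int (eval s e2)))
  end.

Fixpoint ecost (s : store) (e : expr) : nat :=
  (vsize (eval s e) +
   match e with
   | Var _ | Const _ => 0
   | EPair e1 e2 | Op _ e1 e2 => ecost s e1 + ecost s e2
   | Fst e1 | Snd e1 | IsPair e1 => ecost s e1
   end)%N.

(** [exec O c s t s']: started in store [s], the program [c] halts in store
    [s'] after time [t].  [O q a] means that the black box answers [a] to the
    query [q]; a query that has no answer blocks the program. *)
Inductive exec (O : value -> value -> Prop) :
    cmd -> store -> nat -> store -> Prop :=
  | exec_skip s : exec O Skip s 1 s
  | exec_assign s x e :
      exec O (Assign x e) s (ecost s e).+1 (update s x (eval s e))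
  | exec_seq s1 s2 s3 c1 c2 t1 t2 :
      exec O c1 s1 t1 s2 -> exec O c2 s2 t2 s3 ->
      exec O (Sequence c1 c2) s1 (t1 + t2).+1 s3
  | exec_if_true s s' e c1 c2 t :
      truthy (eval s e) -> exec O c1 s t s' ->
      exec O (If e c1 c2) s (ecost s e + t).+1 s'
  | exec_if_false s s' e c1 c2 t :
      ~~ truthy (eval s e) -> exec O c2 s t s' ->
      exec O (If e c1 c2) s (ecost s e + t).+1 s'
  | exec_while_true s1 s2 s3 e c t1 t2 :
      truthy (eval s1 e) -> exec O c s1 t1 s2 ->
      exec O (While e c) s2 t2 s3 ->
      exec O (While e c) s1 (ecost s1 e + t1 + t2).+1 s3
  | exec_while_false s e c :
      ~~ truthy (eval s e) -> exec O (While e c) s (ecost s e).+1 s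
  | exec_query s x e a :
      O (eval s e) a ->
      exec O (Query x e) s (ecost s e + vsize a).+1 (update s x a).

(** Input and output are passed in variable 0. *)
Definition runs (O : value -> value -> Prop) (c : cmd) (input : value) (t : nat)
    (output : value) : Prop :=
  exists s', exec O c (update (fun=> vnat 0) 0%N input) t s' /\ s' 0%N = output.

Definition no_oracle : value -> value -> Prop := fun _ _ => False.

(** A quantity is polynomially bounded in [n] iff it is at most
    [poly_bound k n] for some fixed [k]. *)
Definition poly_bound (k n : nat) : nat := (k * n.+1 ^ k)%N.

Definition polytime_search (R : value -> value -> Prop) : Prop :=
  exists (c : cmd) (k : nat), forall input : value, (exists w, R input w) ->
    exists (output : value) (t : nat),
      [/\ runs no_oracle c input t output, R input output
        & (t <= poly_bound k (vsize input))%N].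

(** * Fields whose elements are written as bit strings *)

Section Encoding.
Variables (F : fieldType) (enc : F -> value).

Definition enc_poly (q : {poly F}) : value := vlist (map enc (polyseq q)).

Definition enc_mx (m n : nat) (A : 'M[F]_(m, n)) : value :=
  vlist [seq vlist [seq enc (A i j) | j <- enum 'I_n] | i <- enum 'I_m].

Definition black_box (g : {poly F}) : value -> value -> Prop :=
  fun q a => exists x : F, q = enc x /\ a = enc g.[x].

Definition linear_solution (input output : value) : Prop :=
  exists (m n : nat) (A : 'M[F]_(m, n)) (b : 'rV[F]_n),
    input = VPair (enc_mx A) (enc_mx b) /\
    ((exists x : 'rV[F]_m, x *m A = b /\ output = VPair (vnat 1) (enc_mx x)) \/
     ((forall x : 'rV[F]_m, x *m A <> b) /\ output = vnat 0)).

Definition factorization (input output : value) : Prop :=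
  exists (q : {poly F}) (hs : seq {poly F}),
    [/\ q != 0, input = enc_poly q, output = vlist (map enc_poly hs),
        forall h, h \in hs -> h \is monic /\ irreducible_poly h
      & q = lead_coef q *: \prod_(h <- hs) h].

(** The operations on field elements are polynomial-time in bit length.
    (Field arithmetic, including iterated sums and products, is a special case
    of solving linear systems.) *)
Definition polytime_field : Prop :=
  [/\ injective enc, polytime_search linear_solution
    & polytime_search factorization].

Definition bit_complexity (n : nat) (alpha : 'I_n -> F)
    (f : 'I_n -> {poly F}) : nat :=
  (\sum_(i < n) (vsize (enc (alpha i)) +
                 \sum_(j < size (f i)) vsize (enc (f i)`_j)))%N.

End Encoding.

(** * Sums of powers *)

Section SumsOfPowers.
Variable F : fieldType.

Definition sum_powers (d n : nat) (alpha : 'I_n -> F)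
    (f : 'I_n -> {poly F}) : {poly F} :=
  \sum_(i < n) alpha i *: f i ^+ d.

Definition deg_le (delta n : nat) (f : 'I_n -> {poly F}) : Prop :=
  forall i, (size (f i) <= delta.+1)%N.

Definition minimal_representation (d delta n : nat) (g : {poly F})
    (alpha : 'I_n -> F) (f : 'I_n -> {poly F}) : Prop :=
  [/\ g = sum_powers d alpha f, deg_le delta f
    & forall (m : nat) (beta : 'I_m -> F) (h : 'I_m -> {poly F}),
        (m < n)%N -> deg_le delta h -> g <> sum_powers d beta h].

(** Characteristic zero is the case where [[pchar F]] is empty. *)
Definition reconstruction_instance (r d delta n : nat) (g : {poly F})
    (alpha : 'I_n -> F) (f : 'I_n -> {poly F}) : Prop :=
  [/\ (r.+1 ^ 4 * delta < d)%N,
      forall p, p \in [pchar F] -> (2 * r * d * delta < p)%N,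
      g != 0, (n <= r)%N
    & [/\ minimal_representation d delta g alpha f,
          forall i, f i \is monic
        & forall i j, i != j -> ~~ (f i %= f j)]].

Definition reconstructed (enc : F -> value) (d n : nat) (g : {poly F})
    (alpha : 'I_n -> F) (f : 'I_n -> {poly F}) (output : value) : Prop :=
  exists (alpha' : 'I_n -> F) (f' : 'I_n -> {poly F}),
    output = vlist [seq VPair (enc (alpha' i)) (enc_poly enc (f' i))
                   | i <- enum 'I_n] /\
    exists pi : 'S_n,
      [/\ g = sum_powers d alpha' f', forall i, f' i = f (pi i)
        & forall i, alpha' i = alpha (pi i)].

End SumsOfPowers.

Definition parameters (r d delta : nat) : value :=
  vlist [:: vnat r; vnat d; vnat delta].

(** The algorithm is given the parameters and the black box only; [n], the
    representation and its bit complexity are unknown to it. *)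
Definition reconstructible (F : fieldType) (enc : F -> value) : Prop :=
  exists (c : cmd) (k : nat),
    forall (r d delta n : nat) (g : {poly F}) (alpha : 'I_n -> F)
           (f : 'I_n -> {poly F}),
      reconstruction_instance r d delta g alpha f ->
      exists (output : value) (t : nat),
        [/\ runs (black_box enc g) c (parameters r d delta) t output,
            (t <= poly_bound k (r + delta + d + bit_complexity enc alpha f))%N
          & reconstructed enc d g alpha f output].

Definition enc_rat (q : rat) : value := VPair (VInt (numq q)) (VInt (denq q)).

(** * Finite fields

    [F] is presented as [F_p[t]/(h)] with [h] of degree [m]: [theta] is the
    class of [t], [digits x] lists the coefficients of [x] in the basis
    [1, theta, ..., theta^(m-1)], and [digits (theta ^+ m)] determines [h]. *)
Definition power_basis (F : finFieldType) (p m : nat) (theta : F)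
    (digits : F -> seq nat) : Prop :=
  [/\ p \in [pchar F], #|F| = (p ^ m)%N
    & forall x : F,
        [/\ size (digits x) = m, all (fun a => (a < p)%N) (digits x)
          & x = \sum_(j < m) (nth 0%N (digits x) j)%:R * theta ^+ j]].

Definition enc_digits (F : finFieldType) (digits : F -> seq nat) (x : F) : value :=
  vlist (map vnat (digits x)).

Definition finite_field_description (F : finFieldType) (p m : nat) (theta : F)
    (digits : F -> seq nat) : value :=
  VPair (vnat p) (enc_digits digits (theta ^+ m)).

(** Here the program is uniform in [F], whose description is part of the
    input. *)
Definition finite_fields_reconstructible : Prop :=
  exists (c : cmd) (k : nat),
    forall (F : finFieldType) (p m : nat) (theta : F) (digits : F -> seq nat),
      power_basis p m theta digits ->
    forall (r d delta n : nat) (g : {poly F}) (alpha : 'I_n -> F)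
           (f : 'I_n -> {poly F}),
      reconstruction_instance r d delta g alpha f ->
      exists (output : value) (t : nat),
        [/\ runs (black_box (enc_digits digits) g) c
              (VPair (finite_field_description p m theta digits)
                     (parameters r d delta)) t output,
            (t <= poly_bound k (r + delta + d + p + trunc_log 2 #|F|))%N
          & reconstructed (enc_digits digits) d g alpha f output].

(* Main.v *)
Require Import Defs.
From HB Require Import structures.
From mathcomp Require Import all_boot all_order all_algebra all_fingroup.
From mathcomp Require Import finfield.
From mathcomp Require Import zify ring.
From Stdlib Require Import ClassicalEpsilon.

(** The degree gap [d > (r+1)^4 delta] makes the powers [f_i^d] independent
    even over low-degree polynomial coefficients, and this determines the
    representation by linear algebra.  Let [theta = x d/dx].

    After interpolating [f], compute all operators of order at most [r] with
    coefficients of degree at most [r^2 delta] that annihilate [f].  As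
    [theta^j (f_i^d)] is divisible by [f_i^(d-j)], the gap forces such an
    operator to annihilate every [f_i^d]; conversely, the polynomials
    annihilated by all of them form the span [W] of the [f_i^d], since an
    operator of order [n] has at most [n] independent polynomial solutions of
    degree smaller than the characteristic.

    Next, find a nonzero polynomial [a] of degree at most [r delta] for which
    [a * theta f] is a combination of the [x^m w] with [w] in [W].  Then
    [a * theta (f_i^d) = p_i * f_i^d] for polynomials [p_i], which are distinct
    because the [f_i] are pairwise non-associate.  Evaluating the coefficients
    [x^m] at a point [t] that separates the [p_i] turns [a * theta] into an
    endomorphism of [W] with eigenvectors [f_i^d] and distinct eigenvalues
    [p_i(t)].  The minimal polynomial of [f] under it has exactly these roots;
    Lagrange interpolation at them extracts [alpha_i f_i^d], and the equation
    [d * theta(f_i) * G = f_i * theta(G)] for [G = alpha_i f_i^d] is a linear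
    system that determines the monic [f_i].

    The procedure needs only linear systems and the roots of one split
    polynomial with simple roots.  The bit size of everything else is
    controlled because each intermediate quantity is the solution of a linear
    system with small entries.  Over the rationals, elimination is bounded by
    Cramer's rule and the largest root is found by bisection, a point being an
    upper bound of the roots iff the Taylor coefficients there are all
    nonnegative.  Over a finite field a root is found by fixing, one after the
    other, its traces against the power basis, each by trying all elements of
    the prime field. *)

Set Implicit Arguments.
Unset Strict Implicit.
Unset Printing Implicit Defensive.

Import Order.TTheory GRing.Theory Num.Theory.

(** * Polynomial-time composition of programs *)

(** The number of summands, the [f i] and their bit sizes are unknown to the program, yet every
    intermediate value must stay small. So the annihilators are taken of order [r] instead of the
    unknown [n], and [n] is recovered as the number of independent iterates of an endomorphism. The
    predicate [comp] on families of values records computability and a size bound together, and its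
    closure rules replace explicit machine code. Over an abstract field repeated arithmetic gives no
    control of sizes, so even sums, powers and iterated matrix products are phrased as single linear
    systems. The quartic gap comes from the degree comparison in the Wronskian argument
    [lowdeg_indep], applied to cofactors of degree up to [(r^2 + r) delta] and exponents down to
    [d - r]. In the correctness proof the characteristic enters only through the distinctness of
    [0, ..., 2 r d delta] in the field: on polynomials of degree up to this bound, operators in
    [theta] behave as in characteristic zero. *)

Section PolyBound.

Lemma poly_bound_mono k k' n n' :
  k <= k' -> n <= n' -> poly_bound k n <= poly_bound k' n'.
Proof.
move=> lek len; rewrite /poly_bound leq_mul //.
apply: (@leq_trans (n'.+1 ^ k)); last by rewrite leq_pexp2l.
by case: (posnP k) => [-> //|k0]; rewrite leq_exp2r.
Qed.

Lemma poly_bound_add a b n :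
  poly_bound a n + poly_bound b n <= poly_bound (a + b) n.
Proof.
rewrite /poly_bound mulnDl leq_add // leq_mul2l leq_pexp2l ?orbT //.
  by rewrite leq_addr.
by rewrite leq_addl.
Qed.

Lemma poly_bound_mul a b n :
  poly_bound a n * poly_bound b n <= poly_bound (a * b + a + b) n.
Proof.
rewrite /poly_bound mulnACA -expnD leq_mul //; first lia.
by rewrite leq_pexp2l //; lia.
Qed.

Lemma poly_bound_comp a b n :
  poly_bound a (poly_bound b n) <= poly_bound (a * b.+1 ^ a + a * b) n.
Proof.
rewrite /poly_bound.
have le1 : (b * n.+1 ^ b).+1 <= b.+1 * n.+1 ^ b.
  by rewrite mulSn -addn1 addnC leq_add2r expn_gt0.
apply: (@leq_trans (a * (b.+1 * n.+1 ^ b) ^ a)).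
  by rewrite leq_mul2l; apply/orP; right; case: a => // a; rewrite leq_exp2r.
rewrite expnMn mulnA -expnM leq_mul //; first lia.
by rewrite leq_pexp2l //; lia.
Qed.

(** One exponent [k] serves the whole family [D], because a single program with a single time bound
    must handle all instances. *)
Definition pbd (T : Type) (D : T -> Prop) (N f : T -> nat) : Prop :=
  exists k, forall i, D i -> f i <= poly_bound k (N i).

Variables (T : Type) (D : T -> Prop) (N : T -> nat).

Lemma pbd_le f g : pbd D N g -> (forall i, D i -> f i <= g i) -> pbd D N f.
Proof.
by case=> k Hk Hfg; exists k => i Di; apply: leq_trans (Hfg i Di) (Hk i Di).
Qed.

Lemma pbd_const a : pbd D N (fun=> a).
Proof.
by exists a => i _; rewrite /poly_bound leq_pmulr // expn_gt0.
Qed.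

Lemma pbd_id : pbd D N N.
Proof. by exists 1%N => i _; rewrite /poly_bound expn1 mul1n. Qed.

Lemma pbd_add f g : pbd D N f -> pbd D N g -> pbd D N (fun i => f i + g i).
Proof.
move=> [a Ha] [b Hb]; exists (a + b) => i Di.
by apply: leq_trans (poly_bound_add _ _ _); rewrite leq_add ?Ha ?Hb.
Qed.

Lemma pbd_mul f g : pbd D N f -> pbd D N g -> pbd D N (fun i => f i * g i).
Proof.
move=> [a Ha] [b Hb]; exists (a * b + a + b) => i Di.
by apply: leq_trans (poly_bound_mul _ _ _); rewrite leq_mul ?Ha ?Hb.
Qed.

Lemma pbd_S f : pbd D N f -> pbd D N (fun i => (f i).+1).
Proof.
move=> H; apply: (pbd_le (pbd_add H (pbd_const 1))) => i _.
by rewrite addn1.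
Qed.

Lemma pbd_sub f g : pbd D N f -> (forall i, D i -> g i <= f i) ->
  forall (k : nat), pbd D N (fun i => poly_bound k (g i)).
Proof.
move=> [a Ha] Hg k; exists (k * a.+1 ^ k + k * a) => i Di.
apply: leq_trans (poly_bound_comp _ _ _); apply: poly_bound_mono => //.
exact: leq_trans (Hg i Di) (Ha i Di).
Qed.

Lemma pbd_reindex (T' : Type) (D' : T' -> Prop) (N' f : T' -> nat)
    (phi : T -> T') :
  pbd D' N' f -> (forall i, D i -> D' (phi i)) ->
  pbd D N (fun i => N' (phi i)) -> pbd D N (fun i => f (phi i)).
Proof.
move=> [k Hk] HD HN.
apply: (pbd_le (pbd_sub HN (fun i _ => leqnn _) k)) => i Di.
by apply: Hk; apply: HD.
Qed.

End PolyBound.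

Ltac pbdtac := repeat first
  [ assumption | apply: pbd_add | apply: pbd_mul | apply: pbd_S
  | exact: pbd_const | exact: pbd_id ].

(** * Value sizes and running times *)

Section Sizes.

Lemma vsize_gt0 v : 0 < vsize v.
Proof. by case: v. Qed.

Lemma absz_lt_vsize z : absz z < 2 ^ vsize (VInt z).
Proof. by rewrite /= trunc_log_ltn. Qed.

Lemma vsize_int_le z k : absz z < 2 ^ k -> vsize (VInt z) <= k.+1.
Proof.
move=> Hz /=; rewrite ltnS.
case: (posnP `|z|%N) => [-> //|z0].
have := leq_ltn_trans (trunc_logP (isT : 1 < 2) z0) Hz.
by rewrite ltn_exp2l // => /ltnW.
Qed.

Lemma vsize_nat_le n : vsize (vnat n) <= n.+1.
Proof. by apply: vsize_int_le => /=; apply: ltn_expl. Qed.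

Lemma absz_divz_le (a b : int) : absz (divz a b) <= absz a.
Proof.
have sg1 : absz (sgz b) <= 1 by case: b => // -[].
rewrite /divz; case: a => n; rewrite abszM.
  by rewrite (leq_trans (leq_mul sg1 (leqnn _))) // mul1n /= leq_div.
by rewrite (leq_trans (leq_mul sg1 (leqnn _))) // mul1n /= ltnS leq_div.
Qed.

Lemma vsize_binop o a b :
  vsize (VInt (binop_eval o a b)) <= (vsize (VInt a) + vsize (VInt b)).+2.
Proof.
set x := vsize (VInt a); set y := vsize (VInt b).
have ax : absz a < 2 ^ x by apply: absz_lt_vsize.
have by_ : absz b < 2 ^ y by apply: absz_lt_vsize.
apply: vsize_int_le.
have hx : 2 ^ x + 2 ^ y <= 2 ^ (x + y).+1.
  rewrite expnS mul2n -addnn leq_add // expnD.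
    by rewrite leq_pmulr // expn_gt0.
  by rewrite leq_pmull // expn_gt0.
have le_xs : 2 ^ x <= 2 ^ (x + y).+1 by rewrite leq_pexp2l //; lia.
case: o => /=; [lia|lia| | |].
- rewrite abszM; apply: (@leq_trans (2 ^ (x + y))); last by rewrite leq_exp2l.
  rewrite expnD; have [->|a0] := posnP `|a|%N; first by rewrite mul0n muln_gt0 !expn_gt0.
  by apply: ltn_mul.
- by apply: leq_ltn_trans (absz_divz_le _ _) _; apply: leq_trans ax _.
- by case: ifP => _ /=; rewrite ?expn_gt0 // -{1}(expn0 2) ltn_exp2l.
Qed.

(** Every assignment and query is charged the size of the value it stores, so a time bound is at the
    same time a size bound for each variable that has changed. *)
Lemma exec_size O c s t s' : exec O c s t s' ->
  forall x, s' x = s x \/ vsize (s' x) <= t.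
Proof.
elim=> {c s t s'}.
- by move=> s x; left.
- move=> s x e y; rewrite /update; case: eqP => [_|]; last by left.
  by right; case: e => *; rewrite /= ?addn0; lia.
- move=> s1 s2 s3 c1 c2 t1 t2 _ IH1 _ IH2 x.
  case: (IH2 x) => [->|?]; last by right; lia.
  by case: (IH1 x) => [->|?]; [left | right; lia].
- by move=> s s' e c1 c2 t _ _ IH x; case: (IH x) => [->|?]; [left | right; lia].
- by move=> s s' e c1 c2 t _ _ IH x; case: (IH x) => [->|?]; [left | right; lia].
- move=> s1 s2 s3 e c t1 t2 _ _ IH1 _ IH2 x.
  case: (IH2 x) => [->|?]; last by right; lia.
  by case: (IH1 x) => [->|?]; [left | right; lia].
- by move=> s e c _ x; left.
- move=> s x e a _ y; rewrite /update; case: eqP => [_|]; last by left.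
  by right; lia.
Qed.

Lemma exec_assign_eq O s x e v : eval s e = v ->
  exec O (Assign x e) s (ecost s e).+1 (update s x v).
Proof. by move <-; apply: exec_assign. Qed.

End Sizes.

(** An index is a problem instance together with the counters of the enclosing loops; [wt] is the
    quantity in which costs must be polynomial, [orc] the black box, and [env] the content of
    variable 0 at the start. Statements about one program on all inputs become statements about
    functions on [ix]. *)
Record ctx := Ctx {
  ix : Type;
  dom : ix -> Prop;
  wt : ix -> nat;
  orc : ix -> value -> value -> Prop;
  env : ix -> value }.

(** Calling convention: a program reads its argument from and leaves its result
    in variable 0, variable 1 holds a stack that it must preserve (and whose
    size enters the running time, since every push copies it), and all other
    variables are scratch. *)
Definition prog (c : ctx) (p : cmd) (y : ix c -> value) : Prop :=
  exists tm : ix c -> value -> nat,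
    pbd (fun iv => dom iv.1) (fun iv => wt iv.1 + vsize iv.2)
        (fun iv : ix c * value => tm iv.1 iv.2) /\
    forall i s, dom i -> s 0 = env i ->
      exists t s', [/\ exec (@orc c i) p s t s', s' 0 = y i, s' 1 = s 1
                     & t <= tm i (s 1)].

Definition nbnd (c : ctx) (n : ix c -> nat) : Prop := pbd (@dom c) (@wt c) n.

Definition vbnd (c : ctx) (y : ix c -> value) : Prop :=
  nbnd (fun i => vsize (y i)).

(** The size bound on the input is part of the predicate, since saving the input on the stack must
    be paid for. *)
Definition comp (c : ctx) (y : ix c -> value) : Prop :=
  vbnd (@env c) /\ exists p, prog p y.

Definition setenv (c : ctx) (x : ix c -> value) : ctx :=
  Ctx (@dom c) (@wt c) (@orc c) x.

Definition when (c : ctx) (P : ix c -> Prop) : ctx :=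
  Ctx (fun i => dom i /\ P i) (@wt c) (@orc c) (@env c).

Definition vfst (v : value) : value := if v is VPair a _ then a else vnat 0.
Definition vsnd (v : value) : value := if v is VPair _ b then b else vnat 0.
Definition vispair (v : value) : value := if v is VPair _ _ then vnat 1 else vnat 0.

Lemma vsize_fst v : vsize (vfst v) <= vsize v.
Proof. by case: v => //= *; lia. Qed.
Lemma vsize_snd v : vsize (vsnd v) <= vsize v.
Proof. by case: v => //= *; lia. Qed.

Section Primitives.
Variable c : ctx.
Implicit Types (x y : ix c -> value).

Lemma vbnd_pair x y : vbnd x -> vbnd y -> vbnd (fun i => VPair (x i) (y i)).
Proof. by move=> bx yb; rewrite /vbnd /nbnd /=; pbdtac. Qed.

Lemma pbd_fst (n : ix c -> nat) : nbnd n ->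
  pbd (fun iv : ix c * value => dom iv.1) (fun iv => wt iv.1 + vsize iv.2)
      (fun iv => n iv.1).
Proof.
move=> bn; apply: (pbd_reindex (phi := fst) bn) => //.
by apply: (pbd_le (@pbd_id _ _ _)) => i _ /=; rewrite leq_addr.
Qed.

Lemma pbd_stack : pbd (fun iv : ix c * value => dom iv.1)
  (fun iv => wt iv.1 + vsize iv.2) (fun iv => vsize iv.2).
Proof. by apply: (pbd_le (@pbd_id _ _ _)) => i _ /=; rewrite leq_addl. Qed.

(** The time of a called program is polynomial in the size of the stack it is given, and a push
    enlarges the stack only polynomially. *)
Lemma pbd_push (tm : ix c -> value -> nat) (f : ix c -> value) :
  pbd (fun iv => dom iv.1) (fun iv => wt iv.1 + vsize iv.2)
      (fun iv : ix c * value => tm iv.1 iv.2) -> vbnd f ->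
  pbd (fun iv => dom iv.1) (fun iv => wt iv.1 + vsize iv.2)
      (fun iv : ix c * value => tm iv.1 (VPair (f iv.1) iv.2)).
Proof.
move=> btm bf.
apply: (pbd_reindex (phi := fun iv : ix c * value => (iv.1, VPair (f iv.1) iv.2)) btm) => //=.
pbdtac.
- by apply: (pbd_le (@pbd_id _ _ _)) => i _ /=; rewrite leq_addr.
- exact: (pbd_fst bf).
- exact: pbd_stack.
Qed.

(** A run from the empty stack bounds the output by its time, by [exec_size], unless variable 0 is
    unchanged; then the bound on the input applies. *)
Lemma comp_vbnd y : comp y -> vbnd y.
Proof.
move=> [be [p [tm [btm Hp]]]].
have bt : pbd (@dom c) (@wt c) (fun i => tm i (vnat 0)).
  apply: (pbd_reindex (phi := fun i => (i, vnat 0)) btm) => //=.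
  by pbdtac.
apply: (pbd_le (pbd_add bt be)) => i Di.
have [t [s' [Hex Hy _ Ht]]] := Hp i (update (fun=> vnat 0) 0 (env i)) Di erefl.
rewrite -Hy; case: (exec_size Hex 0) => [->|Hs].
  by rewrite /update eqxx leq_addl.
by apply: leq_trans Hs _; apply: leq_trans Ht _; rewrite leq_addr.
Qed.

Lemma comp_env_bnd y : comp y -> vbnd (@env c).
Proof. by case. Qed.

Lemma comp_id : vbnd (@env c) -> comp (@env c).
Proof.
move=> be; split=> //; exists Skip, (fun _ _ => 1); split; first exact: pbd_const.
by move=> i s Di Hs; exists 1, s; split=> //; apply: exec_skip.
Qed.

Lemma comp_ext x y : comp x -> (forall i, dom i -> x i = y i) -> comp y.
Proof.
move=> [be [p [tm [btm Hp]]]] Hxy; split=> //; exists p, tm; split=> // i s Di Hs.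
by have [t [s' [? ? ? ?]]] := Hp i s Di Hs; exists t, s'; rewrite -Hxy.
Qed.

Lemma comp_trans x y : comp x -> @comp (setenv x) y -> comp y.
Proof.
move=> [be [p [tp [btp Hp]]]] [bx [q [tq [btq Hq]]]]; split=> //.
exists (Sequence p q), (fun i v => (tp i v + tq i v).+1); split.
  by apply: pbd_S; apply: pbd_add.
move=> i s Di Hs; have [t [s' [Hex H0 H1 Ht]]] := Hp i s Di Hs.
have [t' [s'' [Hex' H0' H1' Ht']]] := Hq i s' Di H0.
exists (t + t').+1, s''; split=> //; first exact: exec_seq Hex Hex'.
  by rewrite H1'.
by rewrite ltnS leq_add // -H1.
Qed.

Lemma comp_assign_env (e : expr) y :
  vbnd (@env c) ->
  (forall i s, dom i -> s 0 = env i -> eval s e = y i) ->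
  (exists2 n : ix c -> nat, nbnd n & forall i s, dom i -> s 0 = env i -> ecost s e <= n i) ->
  comp y.
Proof.
move=> be He [n bn Hn]; split=> //; exists (Assign 0 e), (fun i _ => (n i).+1); split.
  by apply: pbd_S; apply: pbd_fst.
move=> i s Di Hs; exists (ecost s e).+1, (update s 0 (eval s e)); split=> //.
- exact: exec_assign.
- by rewrite /update eqxx; apply: He.
- by rewrite ltnS; apply: Hn.
Qed.

Lemma comp_const v : vbnd (@env c) -> @comp c (fun=> v).
Proof.
move=> be; have bnd1 n : exists2 m, @nbnd c m & forall i : ix c, n <= m i.
  by exists (fun=> n) => //; apply: pbd_const.
elim: v => [z|a [_ [p [tp [btp Hp]]]] b [_ [q [tq [btq Hq]]]]].
  apply: (comp_assign_env (e := Const z)) => //.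
  by have [m bm Hm] := bnd1 (ecost (fun=> vnat 0) (Const z)); exists m.
(* [qe v] is a closed expression with value [v], of a cost that does not depend on the store. *)
pose fix qe (v : value) : expr :=
  match v with VInt z => Const z | VPair u v => EPair (qe u) (qe v) end.
have ev s v : eval s (qe v) = v by elim: v => //= u -> v ->.
have ec s v : ecost s (qe v) = ecost (fun=> vnat 0) (qe v).
  by elim: v => //= u -> v ->; rewrite !ev.
apply: (comp_assign_env (e := qe (VPair a b))) => //.
have [m bm Hm] := bnd1 (ecost (fun=> vnat 0) (qe (VPair a b))).
by exists m => // i s _ _; rewrite ec.
Qed.

End Primitives.

Section Unary.
Variable c : ctx.
Implicit Types (x y : ix c -> value).

Lemma comp_unary (f : value -> value) (e : expr) x :
  (forall s, eval s e = f (s 0)) ->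
  (forall s, ecost s e <= (vsize (s 0)).*2 + 2) ->
  comp x -> comp (fun i => f (x i)).
Proof.
move=> He Hc cx; apply: (comp_trans cx); apply: (comp_assign_env (e := e)).
- exact: (comp_vbnd cx).
- by move=> i s _ /= Hs; rewrite He Hs.
- exists (fun i => (vsize (x i)).*2 + 2).
    apply: (pbd_le (g := fun i => vsize (x i) + vsize (x i) + 2)).
      by apply: pbd_add (pbd_const _ _ _); apply: pbd_add; exact: (comp_vbnd cx).
    by move=> i _; rewrite addnn.
  by move=> i s _ /= Hs; rewrite -Hs.
Qed.

Lemma comp_vfst x : comp x -> comp (fun i => vfst (x i)).
Proof.
apply: (comp_unary (e := Fst (Var 0))) => // s /=.
have := vsize_fst (s 0); rewrite /vfst -addnn addn0 => H.
by apply: leq_trans (leq_add H (leqnn _)) _; rewrite leq_addr.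
Qed.

Lemma comp_vsnd x : comp x -> comp (fun i => vsnd (x i)).
Proof.
apply: (comp_unary (e := Snd (Var 0))) => // s /=.
have := vsize_snd (s 0); rewrite /vsnd -addnn addn0 => H.
by apply: leq_trans (leq_add H (leqnn _)) _; rewrite leq_addr.
Qed.

Lemma comp_ispair x : comp x -> comp (fun i => vispair (x i)).
Proof.
apply: (comp_unary (e := IsPair (Var 0))) => // s /=.
by case: (s 0) => [z|u v] /=; rewrite ?trunc_log0 ?trunc_log1; lia.
Qed.

Lemma comp_fst x y : comp (fun i => VPair (x i) (y i)) -> comp x.
Proof. exact: comp_vfst. Qed.

Lemma comp_snd x y : comp (fun i => VPair (x i) (y i)) -> comp y.
Proof. exact: comp_vsnd. Qed.

(** The input waits on the stack while [p] runs; then the result of [p] takes its place while [q]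
    runs on the restored input. Variable 2 is used only for the exchange, when no subprogram is
    active. *)
Definition pair_cmd (p q : cmd) : cmd :=
  Sequence (Assign 1 (EPair (Var 0) (Var 1)))
 (Sequence p
 (Sequence (Assign 2 (Fst (Var 1)))
 (Sequence (Assign 1 (EPair (Var 0) (Snd (Var 1))))
 (Sequence (Assign 0 (Var 2))
 (Sequence q
 (Sequence (Assign 0 (EPair (Fst (Var 1)) (Var 0)))
           (Assign 1 (Snd (Var 1))))))))).

Lemma comp_pair x y : comp x -> comp y -> comp (fun i => VPair (x i) (y i)).
Proof.
move=> cx cy; have bx := comp_vbnd cx; have yb := comp_vbnd cy.
move: cx cy => [be [p [tp [btp Hp]]]] [_ [q [tq [btq Hq]]]]; split=> //.
exists (pair_cmd p q), (fun i v => tp i (VPair (env i) v) + tq i (VPair (x i) v)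
  + 20 * (vsize (env i) + vsize (x i) + vsize (y i) + vsize v + 3)); split.
  have := pbd_push btp be; have := pbd_push btq bx => H1 H2.
  have H3 := pbd_fst be; have H4 := pbd_fst bx; have H5 := pbd_fst yb.
  have H6 := pbd_stack c.
  by pbdtac.
move=> i s Di Hs.
set s1 := update s 1 (VPair (env i) (s 1)).
have [t2 [s2 [Ex2 H20 H21 Ht2]]] := Hp i s1 Di Hs.
have H21' : s2 1 = VPair (env i) (s 1) by rewrite H21.
set s5 := update (update (update s2 2 (env i)) 1 (VPair (x i) (s 1))) 0 (env i).
have [t6 [s6 [Ex6 H60 H61 Ht6]]] := Hq i s5 Di erefl.
have H61' : s6 1 = VPair (x i) (s 1) by rewrite H61.
eexists; exists (update (update s6 0 (VPair (x i) (y i))) 1 (s 1)); split; [ |done|done| ].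
- rewrite /pair_cmd.
  apply: exec_seq.
    by apply: exec_assign_eq; rewrite /= Hs.
  apply: exec_seq; first exact: Ex2.
  apply: exec_seq.
    by apply: exec_assign_eq; rewrite /= H21'.
  apply: exec_seq.
    by apply: exec_assign_eq; rewrite /= /update /= ?H21' ?H20 ?H61' ?H60.
  apply: exec_seq.
    by apply: exec_assign_eq; rewrite /= /update /= ?H21' ?H20 ?H61' ?H60.
  apply: exec_seq; first exact: Ex6.
  apply: exec_seq.
    by apply: exec_assign_eq; rewrite /= /update /= ?H21' ?H20 ?H61' ?H60.
  by apply: exec_assign_eq; rewrite /= /update /= ?H21' ?H20 ?H61' ?H60.
- have E1 : s5 1 = VPair (x i) (s 1) by [].
  have E2 : s1 1 = VPair (env i) (s 1) by [].
  rewrite E1 in Ht6; rewrite E2 in Ht2.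
  rewrite /= /update /= ?H21' ?H20 ?H61' ?H60 ?Hs /=; lia.
Qed.

Lemma comp_op o (a b : ix c -> int) :
  comp (fun i => VInt (a i)) -> comp (fun i => VInt (b i)) ->
  comp (fun i => VInt (binop_eval o (a i) (b i))).
Proof.
move=> ca cb; apply: (comp_trans (comp_pair ca cb)).
have ba := comp_vbnd ca; have bb := comp_vbnd cb.
apply: (comp_assign_env (e := Op o (Fst (Var 0)) (Snd (Var 0)))).
- exact: vbnd_pair.
- by move=> i s _ /= ->.
- exists (fun i => 4 * (vsize (VInt (a i)) + vsize (VInt (b i))) + 4).
    by rewrite /nbnd /vbnd in ba bb *; pbdtac.
  move=> i s _ Hs; rewrite [ecost _ _]/= Hs /=.
  have := vsize_binop o (a i) (b i); rewrite /=; lia.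
Qed.

Lemma comp_query x a : comp x -> vbnd a ->
  (forall i, dom i -> @orc c i (x i) (a i)) -> comp a.
Proof.
move=> cx ba HO; apply: (comp_trans cx); split; first exact: (comp_vbnd cx).
exists (Query 0 (Var 0)), (fun i _ => (vsize (x i) + vsize (a i)).+1); split.
  exact: (pbd_S (pbd_add (pbd_fst (comp_vbnd cx)) (pbd_fst ba))).
move=> i s Di Hs; eexists; exists (update s 0 (a i)); split; [ |done|done| ].
  by apply: exec_query; rewrite /= Hs; apply: HO.
by rewrite /= Hs addn0.
Qed.

(** The stack is popped before the branch, so either branch starts from a store that respects the
    calling convention. *)
Definition test_cmd (pb px py : cmd) : cmd :=
  Sequence (Assign 1 (EPair (Var 0) (Var 1)))
 (Sequence pb
 (Sequence (Assign 2 (Var 0))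
 (Sequence (Assign 0 (Fst (Var 1)))
 (Sequence (Assign 1 (Snd (Var 1)))
           (If (Var 2) px py))))).

Lemma comp_if (b : ix c -> bool) x y :
  comp (fun i => vnat (b i)) -> @comp (when b) x -> @comp (when (fun i => ~~ b i)) y ->
  comp (fun i => if b i then x i else y i).
Proof.
move=> cb cx cy; have bb := comp_vbnd cb.
move: cb cx cy => [be [p [tp [btp Hp]]]] [_ [q [tq [[kq Hkq] Hq]]]] [_ [r [tr [[kr Hkr] Hr]]]].
split=> //.
(* [tq] and [tr] are controlled only on the domain of their branch, so the time bound uses the
   polynomials that bound them there. *)
pose T1 i v := poly_bound kq (@wt c i + vsize v).
pose T2 i v := poly_bound kr (@wt c i + vsize v).
exists (test_cmd p q r), (fun i v => tp i (VPair (env i) v) + T1 i v + T2 i v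
  + 20 * (vsize (env i) + vsize (vnat (b i)) + vsize v + 3)); split.
  have H1 := pbd_push btp be; have H2 := pbd_fst be; have H3 := pbd_fst bb.
  have H4 := pbd_stack c.
  have H5 : pbd (fun iv : ix c * value => dom iv.1) (fun iv => wt iv.1 + vsize iv.2)
     (fun iv => T1 iv.1 iv.2).
     by apply: (pbd_sub (f := fun iv : ix c * value => wt iv.1 + vsize iv.2)) => //; exact: pbd_id.
  have H6 : pbd (fun iv : ix c * value => dom iv.1) (fun iv => wt iv.1 + vsize iv.2)
     (fun iv => T2 iv.1 iv.2).
     by apply: (pbd_sub (f := fun iv : ix c * value => wt iv.1 + vsize iv.2)) => //; exact: pbd_id.
  by pbdtac.
move=> i s Di Hs.
set s1 := update s 1 (VPair (env i) (s 1)).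
have [t2 [s2 [Ex2 H20 H21 Ht2]]] := Hp i s1 Di Hs.
have H21' : s2 1 = VPair (env i) (s 1) by rewrite H21.
set s5 := update (update (update s2 2 (vnat (b i))) 0 (env i)) 1 (s 1).
have pre t s' cc : exec (@orc c i) (If (Var 2) q r) s5 t s' -> cc = If (Var 2) q r ->
   exists2 t', exec (@orc c i) (test_cmd p q r) s t' s'
    & t' <= t + t2 + 18 * (vsize (env i) + vsize (vnat (b i)) + vsize (s 1) + 3).
  move=> Hex _; eexists.
    apply: exec_seq.
      by apply: exec_assign_eq; rewrite /= Hs.
    apply: exec_seq; first exact: Ex2.
    apply: exec_seq.
      by apply: exec_assign_eq; rewrite /= H20.
    apply: exec_seq.
      by apply: exec_assign_eq; rewrite /= /update /= ?H21' ?H20 ?H61' ?H60.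
    apply: exec_seq.
      by apply: exec_assign_eq; rewrite /= /update /= ?H21' ?H20 ?H61' ?H60.
    exact: Hex.
  by rewrite /= /update /= ?H21' ?H20 ?Hs /=; lia.
have E2 : s1 1 = VPair (env i) (s 1) by [].
rewrite E2 in Ht2.
have Ec : ecost s5 (Var 2) = vsize (vnat (b i)) by rewrite /= addn0.
have [bi|bi] := boolP (b i).
  have [t6 [s6 [Ex6 H60 H61 Ht6]]] := Hq i s5 (conj Di bi) erefl.
  have {}Ht6 : t6 <= T1 i (s 1).
    by apply: leq_trans Ht6 _; apply: (Hkq (i, s 1)).
  have E : exec (@orc c i) (If (Var 2) q r) s5 (ecost s5 (Var 2) + t6).+1 s6.
    by apply: exec_if_true => //=; rewrite bi.
  have [t' Ht' Hle] := pre _ _ _ E erefl.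
  exists t', s6; split=> //.
  rewrite Ec in Hle; lia.
have [t6 [s6 [Ex6 H60 H61 Ht6]]] := Hr i s5 (conj Di bi) erefl.
have {}Ht6 : t6 <= T2 i (s 1).
  by apply: leq_trans Ht6 _; apply: (Hkr (i, s 1)).
have E : exec (@orc c i) (If (Var 2) q r) s5 (ecost s5 (Var 2) + t6).+1 s6.
  by apply: exec_if_false => //=; rewrite (negbTE bi).
have [t' Ht' Hle] := pre _ _ _ E erefl.
exists t', s6; split=> //.
rewrite Ec in Hle; lia.
Qed.

End Unary.

(** * Loops, subprogram calls and counters *)

Definition loopctx (c : ctx) (n : ix c -> nat) (st : ix c -> nat -> value) : ctx :=
  @Ctx (ix c * nat) (fun z => dom z.1 /\ z.2 < n z.1) (fun z => wt z.1)
       (fun z => @orc c z.1) (fun z => st z.1 z.2).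

(** The program does not know [n]: the first component of the state is the guard. The bound on all
    states is given in advance, so the cost per round is uniform and no growth accumulates over the
    rounds. *)
Lemma comp_while c (n : ix c -> nat) (st : ix c -> nat -> value) :
  nbnd n ->
  (exists2 b : ix c -> nat, nbnd b & forall i k, dom i -> k <= n i -> vsize (st i k) <= b i) ->
  (forall i k, dom i -> k < n i -> truthy (vfst (st i k))) ->
  (forall i, dom i -> ~~ truthy (vfst (st i (n i)))) ->
  @comp (loopctx n st) (fun z => st z.1 z.2.+1) ->
  comp (fun i => st i 0) -> comp (fun i => st i (n i)).
Proof.
move=> bn [b bb Hb] Ht Hf [_ [p [tp [[k Hk] Hp]]]] c0.
apply: (comp_trans c0); split; first exact: (comp_vbnd c0).
pose B i v := (poly_bound k (@wt c i + vsize v) + 2 * b i + 3)%N.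
exists (While (Fst (Var 0)) p), (fun i v => (n i).+1 * B i v); split.
  have H1 := pbd_fst bn; have H2 := pbd_fst bb.
  have H4 := pbd_stack c.
  have H5 : pbd (fun iv : ix c * value => dom iv.1) (fun iv => wt iv.1 + vsize iv.2)
     (fun iv => poly_bound k (@wt c iv.1 + vsize iv.2)).
     by apply: (pbd_sub (f := fun iv : ix c * value => wt iv.1 + vsize iv.2)) => //; exact: pbd_id.
  by rewrite /setenv /= /B; pbdtac.
move=> i s0 Di Hs0.
(* Induction on the number [m] of rounds still to be made. *)
suff H m s : m <= n i -> s 0 = st i (n i - m) -> exists t s',
   [/\ exec (@orc c i) (While (Fst (Var 0)) p) s t s', s' 0 = st i (n i), s' 1 = s 1
     & t <= m.+1 * B i (s 1)].
  by apply: H => //; rewrite subnn.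
have costb s' : forall j, j <= n i -> s' 0 = st i j -> ecost s' (Fst (Var 0)) <= 2 * b i.
  move=> j lej Hs /=; rewrite Hs addn0.
  have := vsize_fst (st i j); rewrite /vfst.
  have := Hb i j Di lej; lia.
elim: m s => [|m IH] s lem Hs.
  rewrite subn0 in Hs; exists (ecost s (Fst (Var 0))).+1, s; split=> //.
    by apply: exec_while_false; rewrite /= Hs; apply: Hf.
  by have := costb s (n i) (leqnn _) Hs; rewrite /B; lia.
have lt : n i - m.+1 < n i by lia.
have [t1 [s1 [Ex1 H10 H11 Ht1]]] := Hp (i, n i - m.+1) s (conj Di lt) Hs.
have Hs1 : s1 0 = st i (n i - m) by rewrite H10 /=; congr st; lia.
have [t2 [s2 [Ex2 H20 H21 Ht2]]] := IH s1 (ltnW lem) Hs1.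
exists (ecost s (Fst (Var 0)) + t1 + t2).+1, s2; split=> //.
- by apply: exec_while_true Ex1 Ex2; rewrite /= Hs; apply: Ht.
- by rewrite H21 H11.
have Hc := costb s (n i - m.+1) (ltnW lt) Hs; rewrite H11 in Ht2.
have Hk' : tp (i, n i - m.+1) (s 1) <= poly_bound k (@wt c i + vsize (s 1)).
  exact: (Hk ((i, n i - m.+1), s 1) (conj Di lt)).
rewrite mulSn; move: Ht2; set X := (m.+1 * _)%N; rewrite /B; lia.
Qed.

(** A program for the instance [phi i] runs unchanged on the instance [i] once the input of [phi i]
    has been prepared. Weights must not grow under [phi], since the program's time is measured in
    the weight of [phi i]. *)
Lemma comp_sub (c' c : ctx) (phi : ix c -> ix c') (y : ix c' -> value) :
  comp y -> (forall i, dom i -> dom (phi i)) ->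
  (forall i, dom i -> wt (phi i) <= wt i) ->
  (forall i, dom i -> @orc c' (phi i) = @orc c i) ->
  comp (fun i => env (phi i)) -> comp (fun i => y (phi i)).
Proof.
move=> [_ [p [tp [[k Hk] Hp]]]] HD HW HO ce; apply: (comp_trans ce).
split; first exact: (comp_vbnd ce).
exists p, (fun i v => poly_bound k (@wt c i + vsize v)); split.
  by apply: (pbd_sub (f := fun iv : ix c * value => wt iv.1 + vsize iv.2)) => //; exact: pbd_id.
move=> i s Di Hs; have [t [s' [Ex H0 H1 Ht]]] := Hp (phi i) s (HD i Di) Hs.
exists t, s'; split=> //; first by rewrite /= -HO.
apply: leq_trans Ht _; apply: leq_trans (Hk (phi i, s 1) (HD i Di)) _.
by apply: poly_bound_mono => //=; rewrite leq_add2r HW.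
Qed.

Lemma comp_when c (P : ix c -> Prop) y : @comp c y -> @comp (when P) y.
Proof.
move=> cy; apply: (@comp_sub c (when P) id y cy) => //; first by move=> i [].
apply: comp_id; have [k Hk] := comp_env_bnd cy.
by exists k => i [Di _]; apply: Hk.
Qed.

(** The context of a loop body or table entry: the counter [z.2] is passed beside the input. *)
Definition ext (c : ctx) (n : ix c -> nat) : ctx :=
  @Ctx (ix c * nat) (fun z => dom z.1 /\ z.2 < n z.1) (fun z => wt z.1)
       (fun z => @orc c z.1) (fun z => VPair (env z.1) (vnat z.2)).

Definition addenv (c : ctx) (x : ix c -> value) : ctx :=
  setenv (fun i => VPair (env i) (x i)).

Section Contexts.
Variable c : ctx.
Implicit Types (n m : ix c -> nat) (x y : ix c -> value).

Lemma nbnd_le m n : nbnd n -> (forall i, dom i -> m i <= n i) -> nbnd m.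
Proof. exact: pbd_le. Qed.

Lemma nbnd_up n m : nbnd m -> @nbnd (ext n) (fun z => m z.1).
Proof. by case=> k Hk; exists k => z [Dz _]; apply: Hk. Qed.

Lemma nbnd_ix n : nbnd n -> @nbnd (ext n) (fun z => z.2).
Proof. by case=> k Hk; exists k => z [Dz /ltnW lt]; apply: leq_trans lt (Hk _ Dz). Qed.

Lemma nbnd_when (P : ix c -> Prop) m : nbnd m -> @nbnd (when P) m.
Proof. by case=> k Hk; exists k => z [Dz _]; apply: Hk. Qed.

Lemma vbnd_ext_env n : vbnd (@env c) -> nbnd n -> vbnd (@env (ext n)).
Proof.
move=> be bn; have := nbnd_up n be; have := nbnd_ix bn => H1 H2.
apply: (pbd_le (pbd_add (pbd_add H2 H1) (pbd_const _ _ 2))) => z _ /=.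
have := vsize_nat_le z.2; rewrite /=; lia.
Qed.

Lemma comp_up n y : nbnd n -> comp y -> @comp (ext n) (fun z => y z.1).
Proof.
move=> bn cy; have be := comp_env_bnd cy.
apply: (@comp_sub c (ext n) fst y cy) => //; first by move=> z [].
exact: (@comp_fst (ext n) _ _ (comp_id (vbnd_ext_env be bn))).
Qed.

Lemma comp_ix n : nbnd n -> vbnd (@env c) -> @comp (ext n) (fun z => vnat z.2).
Proof.
move=> bn be; exact: (@comp_snd (ext n) _ _ (comp_id (vbnd_ext_env be bn))).
Qed.

Lemma comp_strengthen (D : ix c -> Prop) y : comp y -> (forall i, D i -> dom i) ->
  @comp (Ctx D (@wt c) (@orc c) (@env c)) y.
Proof.
move=> cy HD; apply: (@comp_sub c (Ctx D _ _ _) (fun i => i) y cy) => //.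
apply: comp_id; have [k Hk] := comp_env_bnd cy.
by exists k => i Di; apply: Hk; apply: HD.
Qed.

Lemma comp_weak x y : vbnd x -> comp y -> @comp (addenv x) y.
Proof.
move=> bx cy; apply: (@comp_sub c (addenv x) id y cy) => //.
apply: (@comp_fst (addenv x) _ x); apply: comp_id.
by apply: vbnd_pair => //; apply: (comp_env_bnd cy).
Qed.

Lemma comp_added x : vbnd (@env c) -> vbnd x -> @comp (addenv x) x.
Proof.
move=> be bx; apply: (@comp_snd (addenv x) (@env c) x); apply: comp_id.
exact: vbnd_pair.
Qed.

Lemma comp_app (c2 : ctx) (pi : ix c2 -> ix c) n (x : ix c -> nat -> value)
    (k : ix c2 -> nat) :
  @comp (ext n) (fun z => x z.1 z.2) ->
  (forall i, dom i -> dom (pi i)) -> (forall i, dom i -> wt (pi i) <= wt i) ->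
  (forall i, dom i -> @orc c (pi i) = @orc c2 i) ->
  comp (fun i => env (pi i)) -> comp (fun i => vnat (k i)) ->
  (forall i, dom i -> k i < n (pi i)) -> comp (fun i => x (pi i) (k i)).
Proof.
move=> cx HD HW HO ce ck lt.
apply: (@comp_sub (ext n) c2 (fun i => (pi i, k i)) (fun z => x z.1 z.2)) => //.
  by move=> i Di; split; [apply: HD | apply: lt].
exact: comp_pair.
Qed.

Lemma ncomp_const (k : nat) : vbnd (@env c) -> @comp c (fun=> vnat k).
Proof. exact: comp_const. Qed.

Lemma ncompD m n : comp (fun i => vnat (m i)) -> comp (fun i => vnat (n i)) ->
  comp (fun i => vnat (m i + n i)).
Proof. by move=> cm cn; apply: (comp_ext (comp_op Plus cm cn)). Qed.

Lemma ncompM m n : comp (fun i => vnat (m i)) -> comp (fun i => vnat (n i)) ->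
  comp (fun i => vnat (m i * n i)).
Proof. by move=> cm cn; apply: (comp_ext (comp_op Times cm cn)). Qed.

Lemma ncompS m : comp (fun i => vnat (m i)) -> comp (fun i => vnat (m i).+1).
Proof.
move=> cm; have := ncompD cm (ncomp_const 1 (comp_env_bnd cm)) => H.
by apply: (comp_ext H) => i _; rewrite addn1.
Qed.

Lemma ncompV m n : comp (fun i => vnat (m i)) -> comp (fun i => vnat (n i)) ->
  comp (fun i => vnat (m i %/ n i)).
Proof.
move=> cm cn; apply: (comp_ext (comp_op Quot cm cn)) => i _ /=.
by rewrite divz_nat.
Qed.

Lemma bcomp_leq m n : comp (fun i => vnat (m i)) -> comp (fun i => vnat (n i)) ->
  comp (fun i => vnat (m i <= n i)).
Proof.
move=> cm cn; apply: (comp_ext (comp_op Le cm cn)) => i _ /=.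
by rewrite lez_nat; case: leqP.
Qed.

Lemma bcomp_and (a b : ix c -> bool) :
  comp (fun i => vnat (a i)) -> comp (fun i => vnat (b i)) ->
  comp (fun i => vnat (a i && b i)).
Proof.
by move=> ca cb; apply: (comp_ext (ncompM ca cb)) => i _; rewrite mulnb.
Qed.

Lemma bcomp_eq m n : comp (fun i => vnat (m i)) -> comp (fun i => vnat (n i)) ->
  comp (fun i => vnat (m i == n i)).
Proof.
move=> cm cn.
apply: (comp_ext (bcomp_and (bcomp_leq cm cn) (bcomp_leq cn cm))) => i _.
by rewrite -eqn_leq.
Qed.

Lemma bcomp_neg (a : ix c -> bool) :
  comp (fun i => vnat (a i)) -> comp (fun i => vnat (~~ a i)).
Proof.
move=> ca; apply: (comp_ext (bcomp_leq ca (ncomp_const 0 (comp_env_bnd ca)))) => i _.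
by case: (a i).
Qed.

Lemma bcomp_or (a b : ix c -> bool) :
  comp (fun i => vnat (a i)) -> comp (fun i => vnat (b i)) ->
  comp (fun i => vnat (a i || b i)).
Proof.
move=> ca cb.
apply: (comp_ext (bcomp_neg (bcomp_and (bcomp_neg ca) (bcomp_neg cb)))) => i _.
by rewrite -negb_or negbK.
Qed.

Lemma ncompB m n : comp (fun i => vnat (m i)) -> comp (fun i => vnat (n i)) ->
  comp (fun i => vnat (m i - n i)).
Proof.
move=> cm cn; have be := comp_env_bnd cm.
have := comp_if (bcomp_leq cn cm) (comp_when _ (comp_op Minus cm cn))
         (comp_when _ (ncomp_const 0 be)) => H.
apply: (comp_ext H) => i _ /=.
by case: leqP => [le|lt]; [rewrite subzn | have /eqP -> : m i - n i == 0 by lia].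
Qed.

Lemma ncomp_mod m n : comp (fun i => vnat (m i)) -> comp (fun i => vnat (n i)) ->
  comp (fun i => vnat (m i %% n i)).
Proof.
move=> cm cn; apply: (comp_ext (ncompB cm (ncompM (ncompV cm cn) cn))) => i _.
by rewrite {1}(divn_eq (m i) (n i)) addKn.
Qed.

End Contexts.

Lemma comp_iter c (n : ix c -> nat) (st : ix c -> nat -> value) :
  comp (fun i => vnat (n i)) -> nbnd n ->
  (exists2 b : ix c -> nat, nbnd b
     & forall i k, dom i -> k <= n i -> vsize (st i k) <= b i) ->
  comp (fun i => st i 0) ->
  @comp (@addenv (ext n) (fun z => st z.1 z.2)) (fun z => st z.1 z.2.+1) ->
  comp (fun i => st i (n i)).
Proof.
move=> cn bn [b bb Hb] c0 cs; have be := comp_env_bnd cn.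
(* The countdown is the guard of the while loop; the input and the counter travel along because the
   step may depend on them. *)
pose sg i k := VPair (vnat (n i - k)) (VPair (VPair (env i) (vnat k)) (st i k)).
suff H : comp (fun i => sg i (n i)) by exact: (comp_snd (comp_snd H)).
have bsg : exists2 b' : ix c -> nat, nbnd b'
    & forall i k, dom i -> k <= n i -> vsize (sg i k) <= b' i.
  exists (fun i => n i + n i + vsize (env i) + b i + 5).
    by rewrite /nbnd /vbnd in bn bb be *; pbdtac.
  move=> i k Di lek; rewrite /sg [vsize _]/= -!/(vsize (vnat _)).
  have := Hb i k Di lek; have := vsize_nat_le (n i - k); have := vsize_nat_le k.
  rewrite /=; lia.
apply: (@comp_while c n sg bn bsg).
- move=> i k Di lt; rewrite /sg /=; have : 0 < n i - k by rewrite subn_gt0.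
  by case: (n i - k).
- by move=> i Di; rewrite /= subnn.
- set L := loopctx _ _.
  have bL : vbnd (@env L).
    have [b' [k Hk] Hb'] := bsg; exists k => z [Dz /ltnW lez].
    by apply: leq_trans (Hb' _ _ Dz lez) (Hk _ Dz).
  have cL := comp_id bL; have c1 := comp_fst cL; have c2 := comp_snd cL.
  have c3 := comp_fst c2.
  have c_env := comp_fst c3; have c_k := comp_snd c3.
  apply: (@comp_pair L); last apply: (@comp_pair L); last 2 first.
  + exact: (comp_pair c_env (ncompS c_k)).
  + by apply: (@comp_sub (@addenv (ext n) (fun z => st z.1 z.2)) L (fun z => z)
        (fun z => st z.1 z.2.+1) cs).
  + apply: (comp_ext (comp_op Minus c1 (ncomp_const 1 bL))) => z [Dz lez] /=.
    have lt0 : 0 < n z.1 - z.2 by rewrite subn_gt0.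
    by rewrite subzn // subn1 subnS.
- apply: comp_pair; first by apply: (comp_ext cn) => i _; rewrite subn0.
  apply: comp_pair => //; apply: comp_pair; first exact: comp_id.
  exact: comp_const.
Qed.

(** * Lists and tables *)

Definition vtab (n : nat) (x : nat -> value) : value := vlist (mkseq x n).

Lemma size_lt_vlist s : size s < vsize (vlist s).
Proof. by elim: s => //= v s IH; have := vsize_gt0 v; lia. Qed.

Lemma vsize_vlist_le s B : (forall v, List.In v s -> vsize v <= B) ->
  vsize (vlist s) <= size s * B.+1 + 1.
Proof.
elim: s => //= v s IH H.
have := H v (or_introl erefl).
have := IH (fun u Hu => H u (or_intror Hu)); rewrite mulSn; lia.
Qed.

Lemma vsize_vtab_le n x B : (forall k, k < n -> vsize (x k) <= B) ->
  vsize (vtab n x) <= n * B.+1 + 1.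
Proof.
move=> H; have := @vsize_vlist_le (mkseq x n) B; rewrite size_mkseq; apply.
move=> v; rewrite /mkseq.
suff G m : forall k, m + k <= n -> List.In v (map x (iota m k)) -> vsize v <= B.
  by apply: G.
move=> k; elim: k m => //= k IH m le [<-|]; first by apply: H; lia.
by apply: IH; lia.
Qed.

Lemma eq_vtab n x y : (forall k, k < n -> x k = y k) -> vtab n x = vtab n y.
Proof.
move=> H; congr vlist; apply/eq_in_map => k; rewrite mem_iota => /andP[_].
exact: H.
Qed.

Lemma iter_vsnd_vlist k s : k <= size s -> iter k vsnd (vlist s) = vlist (drop k s).
Proof.
elim: k => [|k IH] lt; first by rewrite drop0.
by rewrite iterS IH ?(ltnW lt) // (drop_nth (vnat 0)).
Qed.

Lemma vnth_vlist k s : k < size s -> vfst (iter k vsnd (vlist s)) = nth (vnat 0) s k.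
Proof. by move=> lt; rewrite iter_vsnd_vlist ?(ltnW lt) // (drop_nth (vnat 0)). Qed.

Section Lists.
Variable c : ctx.
Implicit Types (n m : ix c -> nat) (x y : ix c -> value).

Lemma vbnd_tab n (x : ix c -> nat -> value) : nbnd n ->
  @vbnd (ext n) (fun z => x z.1 z.2) -> vbnd (fun i => vtab (n i) (x i)).
Proof.
move=> bn [k Hk].
apply: (pbd_le (g := fun i => n i * (poly_bound k (wt i)).+1 + 1)).
  have bp : pbd (@dom c) (@wt c) (fun i => poly_bound k (wt i)) by exists k.
  by rewrite /nbnd in bn; pbdtac.
by move=> i Di; apply: vsize_vtab_le => j lt; apply: (Hk (i, j)).
Qed.

Lemma comp_tab n (x : ix c -> nat -> value) :
  comp (fun i => vnat (n i)) -> nbnd n -> @comp (ext n) (fun z => x z.1 z.2) ->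
  comp (fun i => vtab (n i) (x i)).
Proof.
move=> cn bn cx; have be := comp_env_bnd cn.
(* The list is built from its end: after [k] rounds it holds the last [k] entries. *)
pose st i k := vlist [seq x i j | j <- iota (n i - k) k].
suff H : comp (fun i => st i (n i)).
  by apply: (comp_ext H) => i _; rewrite /st subnn.
have [k Hk] := comp_vbnd cx.
have bst i j : dom i -> j <= n i -> vsize (st i j) <= n i * (poly_bound k (wt i)).+1 + 1.
  move=> Di le; rewrite /st.
  have -> : vlist [seq x i l | l <- iota (n i - j) j] = vtab j (fun l => x i (n i - j + l)).
    rewrite /vtab /mkseq; congr vlist.
    by rewrite -[X in iota X]addn0 iotaDl -map_comp.
  apply: leq_trans (vsize_vtab_le (B := poly_bound k (wt i)) _) _.
    by move=> l lt; apply: (Hk (i, n i - j + l)); split=> //=; lia.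
  by rewrite leq_add2r leq_mul2r le orbT.
have bn' : nbnd (fun i => n i * (poly_bound k (wt i)).+1 + 1).
  have bp : pbd (@dom c) (@wt c) (fun i => poly_bound k (wt i)) by exists k.
  by rewrite /nbnd in bn *; pbdtac.
apply: comp_iter => //; first by eexists; [exact: bn' | exact: bst].
  exact: comp_const.
set A := addenv _.
have bA : @vbnd (ext n) (fun z => st z.1 z.2).
  have [k' Hk'] := bn'; exists k' => z [Dz /ltnW lez].
  by apply: leq_trans (bst _ _ Dz lez) (Hk' _ Dz).
have bE : vbnd (@env (ext n)) by apply: vbnd_ext_env.
have c1 : @comp A (fun z => vnat (n z.1 - z.2.+1)).
  apply: ncompB.
    by apply: comp_weak => //; apply: (@comp_up c n (fun i => vnat (n i))).
  by apply: ncompS; apply: comp_weak => //; apply: comp_ix.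
have c2 : @comp A (fun z => x z.1 (n z.1 - z.2.+1)).
  apply: (@comp_app c A (fun z => z.1) n x (fun z => n z.1 - z.2.+1)) => //.
  + by move=> z [].
  + apply: comp_weak => //.
    by apply: (@comp_up c n (@env c)) => //; apply: comp_id.
  + by move=> z [Dz lt]; lia.
have c3 : @comp A (fun z => st z.1 z.2) by apply: comp_added.
apply: (comp_ext (comp_pair c2 c3)) => z [Dz lt].
by rewrite /st /= -subSn // subSS.
Qed.

Lemma comp_vnth (v : ix c -> value) k :
  comp v -> comp (fun i => vnat (k i)) -> nbnd k ->
  comp (fun i => vfst (iter (k i) vsnd (v i))).
Proof.
move=> cv ck bk; apply: comp_vfst; have be := comp_env_bnd cv.
have Hb i j : vsize (iter j vsnd (v i)) <= vsize (v i).
  by elim: j => //= j IH; apply: leq_trans (vsize_snd _) IH.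
apply: (@comp_iter c k (fun i j => iter j vsnd (v i))) => //.
  by exists (fun i => vsize (v i)) => //; apply: (comp_vbnd cv).
apply: comp_vsnd; apply: (@comp_added (ext k) (fun z => iter z.2 vsnd (v z.1))).
  exact: vbnd_ext_env.
by have [l Hl] := comp_vbnd cv; exists l => z [Dz _]; apply: leq_trans (Hb _ _) (Hl _ Dz).
Qed.

Lemma comp_nth (s : ix c -> seq value) k :
  comp (fun i => vlist (s i)) -> comp (fun i => vnat (k i)) ->
  (forall i, dom i -> k i < size (s i)) ->
  comp (fun i => nth (vnat 0) (s i) (k i)).
Proof.
move=> cs ck lt; have bk : nbnd k.
  apply: (nbnd_le (comp_vbnd cs)) => i Di.
  by apply: ltnW; apply: ltn_trans (lt i Di) (size_lt_vlist _).
by apply: (comp_ext (comp_vnth cs ck bk)) => i Di; rewrite vnth_vlist // lt.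
Qed.

Lemma comp_tabnth n (x : ix c -> nat -> value) k :
  comp (fun i => vtab (n i) (x i)) -> comp (fun i => vnat (k i)) ->
  (forall i, dom i -> k i < n i) -> comp (fun i => x i (k i)).
Proof.
move=> cs ck lt; have H := comp_nth cs ck.
apply: (comp_ext (H _)) => i Di; last by rewrite nth_mkseq // lt.
by rewrite size_mkseq lt.
Qed.

Lemma comp_size (s : ix c -> seq value) :
  comp (fun i => vlist (s i)) -> comp (fun i => vnat (size (s i))).
Proof.
move=> cs; have be := comp_env_bnd cs; have bs := comp_vbnd cs.
have bn : nbnd (fun i => size (s i)).
  by apply: (nbnd_le bs) => i _; apply: ltnW; apply: size_lt_vlist.
(* A nonempty list is a pair, hence truthy, and its terminator is [0], so the remaining list is
   itself the guard. *)
pose st i k := VPair (vlist (drop k (s i))) (vnat k).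
suff H : comp (fun i => st i (size (s i))) by exact: (comp_snd H).
have dropb i k : k <= size (s i) -> vsize (vlist (drop k (s i))) <= vsize (vlist (s i)).
  move=> le; rewrite -iter_vsnd_vlist //; elim: k {le} => //= k IH.
  by apply: leq_trans (vsize_snd _) IH.
have Hb i k : k <= size (s i) -> vsize (st i k) <= vsize (vlist (s i)) + size (s i) + 2.
  move=> le; rewrite /st /= -/(vsize (vnat k)).
  by have := dropb i k le; have := vsize_nat_le k; rewrite /=; lia.
have Hb' : nbnd (fun i => vsize (vlist (s i)) + size (s i) + 2).
  by rewrite /nbnd /vbnd in bn bs *; pbdtac.
apply: (@comp_while c (fun i => size (s i)) st) => //.
- by exists (fun i => vsize (vlist (s i)) + size (s i) + 2) => // i k _; apply: Hb.
- by move=> i k _ lt; rewrite /st /= (drop_nth (vnat 0)).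
- by move=> i _; rewrite /st /= drop_size.
- set L := loopctx _ _.
  have bL : vbnd (@env L).
    have [k Hk] := Hb'; exists k => z [Dz /ltnW le].
    by apply: leq_trans (Hb _ _ le) (Hk _ Dz).
  have cL := comp_id bL.
  have c1 := comp_vsnd (comp_fst cL); have c2 := ncompS (comp_snd cL).
  apply: (comp_ext (comp_pair c1 c2)) => z [Dz lt].
  by rewrite /st /= (drop_nth (vnat 0) lt).
- apply: comp_pair; last exact: comp_const.
  by apply: (comp_ext cs) => i _; rewrite drop0.
Qed.

Lemma ncomp_find n (b : ix c -> nat -> bool) :
  comp (fun i => vnat (n i)) -> nbnd n ->
  @comp (ext n) (fun z => vnat (b z.1 z.2)) ->
  comp (fun i => vnat (find (b i) (iota 0 (n i)))).
Proof.
move=> cn bn cb; have be := comp_env_bnd cn.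
have le i k : find (b i) (iota 0 k) <= k.
  by apply: leq_trans (find_size _ _) _; rewrite size_iota.
have Hb i k : k <= n i -> vsize (vnat (find (b i) (iota 0 k))) <= (n i).+1.
  by move=> lek; apply: leq_trans (vsize_nat_le _) _; rewrite ltnS (leq_trans (le i k)).
apply: (@comp_iter c n (fun i k => vnat (find (b i) (iota 0 k)))) => //.
- by exists (fun i => (n i).+1); [apply: pbd_S | move=> i k _; apply: Hb].
- exact: (comp_const (vnat 0) be).
set A := addenv _.
have bA : @vbnd (ext n) (fun z => vnat (find (b z.1) (iota 0 z.2))).
  have [k Hk] := pbd_S bn; exists k => z [Dz /ltnW lt].
  by apply: leq_trans (Hb _ _ lt) (Hk _ Dz).
have bE : vbnd (@env (ext n)) by apply: vbnd_ext_env.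
have cf : @comp A (fun z => vnat (find (b z.1) (iota 0 z.2))) by apply: comp_added.
have ck : @comp A (fun z => vnat z.2) by apply: comp_weak => //; apply: comp_ix.
have cb' : @comp A (fun z => vnat (b z.1 z.2)) by apply: comp_weak.
(* A value below the counter is a hit already found and is kept; otherwise the search stops at the
   counter or moves on by one, according to [b]. *)
have H1 := bcomp_leq (ncompS cf) ck.
have H2 := ncompD ck (bcomp_neg cb').
apply: (comp_ext (comp_if H1 (comp_when _ cf) (comp_when _ H2))) => z _.
have -> : iota 0 z.2.+1 = iota 0 z.2 ++ [:: z.2] by rewrite -addn1 iotaD.
rewrite find_cat has_find size_iota /=.
by case: ifP => // _; case: (b z.1 z.2); rewrite ?addn0.
Qed.

End Lists.

Ltac nauto := repeat first
  [ assumption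
  | match goal with
    | |- @nbnd (ext _) (fun z => z.2) => apply: nbnd_ix
    | |- @nbnd _ (fun z => @?a z + @?b z) => apply: (@pbd_add _ _ _ a b)
    | |- @nbnd _ (fun z => @?a z * @?b z) => apply: (@pbd_mul _ _ _ a b)
    | |- @nbnd _ (fun z => (@?a z).+1) => apply: (@pbd_S _ _ _ a)
    | |- @nbnd _ (fun z => @?a z - @?b z) =>
        apply: (@nbnd_le _ _ a); [ | by move=> *; rewrite leq_subr]
    | |- @nbnd _ (fun=> ?k) => exact: (pbd_const _ _ k)
    | |- @nbnd (@ext ?c ?n) ?y =>
        let y' := eval cbn beta iota delta [fst snd] in
           (fun (i : ix c) (k : nat) => y ((i, k) : ix (@ext c n))) in
        lazymatch y' with (fun i _ => @?w i) => apply (@nbnd_up c n w) end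
    | |- @nbnd (@when ?c ?P) ?y => apply (@nbnd_when c P y)
    | |- @nbnd (@addenv ?c ?x) ?y => change (@nbnd c y)
    | |- @pbd _ (@dom ?c) (@wt ?c) ?y => change (@nbnd c y)
    end ].

Ltac envb := match goal with
  | |- @vbnd (@ext _ ?n) (@env _) => apply: vbnd_ext_env; [ envb | solve [nauto] ]
  | |- @vbnd (@when ?c ?P) (@env _) =>
      apply: (@nbnd_when c P (fun i => vsize (@env c i))); change (@vbnd c (@env c)); envb
  | |- @vbnd (@addenv ?c ?x) (@env _) => apply: (@vbnd_pair c (@env c) x); [ envb | assumption ]
  | H : @comp ?c _ |- @vbnd ?c (@env ?c) => exact: (comp_env_bnd H)
  | _ => assumption
  end.

Ltac cstep := match goal with
  | |- @comp ?C (fun z => vnat (@?a z + @?b z)) => apply: (@ncompD C a b)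
  | |- @comp ?C (fun z => vnat (@?a z * @?b z)) => apply: (@ncompM C a b)
  | |- @comp ?C (fun z => vnat (@?a z - @?b z)) => apply: (@ncompB C a b)
  | |- @comp ?C (fun z => vnat (@?a z %/ @?b z)) => apply: (@ncompV C a b)
  | |- @comp ?C (fun z => vnat (@?a z %% @?b z)) => apply: (@ncomp_mod C a b)
  | |- @comp ?C (fun z => vnat (nat_of_bool (~~ (@?a z)))) => apply: (@bcomp_neg C a)
  | |- @comp ?C (fun z => vnat (nat_of_bool (@?a z && @?b z))) => apply: (@bcomp_and C a b)
  | |- @comp ?C (fun z => vnat (nat_of_bool (@?a z || @?b z))) => apply: (@bcomp_or C a b)
  | |- @comp ?C (fun z => vnat (nat_of_bool (leq (@?a z) (@?b z)))) => apply: (@bcomp_leq C a b)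
  | |- @comp ?C (fun z => vnat (nat_of_bool (@eq_op _ (@?a z) (@?b z)))) => apply: (@bcomp_eq C a b)
  | |- @comp ?C (fun z => vnat ((@?a z).+1)) => apply: (@ncompS C a)
  | |- @comp ?C (fun z => VPair (@?a z) (@?b z)) => apply: (@comp_pair C a b)
  | |- @comp (ext _) (fun z => vnat z.2) => apply: comp_ix; [ solve [nauto] | envb ]
  | |- @comp ?C (fun=> ?v) => apply: (@comp_const C v); envb
  end.

Ltac clift := match goal with
  | |- @comp (@ext ?c ?n) ?y =>
     let y' := eval cbn beta iota delta [fst snd] in
        (fun (i : ix c) (k : nat) => y ((i, k) : ix (@ext c n))) in
     lazymatch y' with (fun i _ => @?w i) => apply (@comp_up c n w); [ solve [nauto] | ] end
  | |- @comp (@when ?c ?P) ?y => apply (@comp_when c P y)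
  | |- @comp (@addenv ?c ?x) ?y => first
     [ apply: (@comp_added c x); [ envb | assumption ]
     | apply (@comp_weak c x y); [ assumption | ] ]
  end.

Ltac cauto := repeat first [ assumption | cstep | clift ].

(** * Euler operators *)

Local Open Scope ring_scope.

Section Theta.
Variable F : fieldType.
Implicit Types (f g h A R : {poly F}).

(** Unlike the derivative, [x d/dx] acts diagonally on monomials and preserves every bound on the
    degree, so one size bound serves all iterates. *)
Definition theta h : {poly F} := 'X * h^`().

Lemma coef_theta h k : (theta h)`_k = h`_k * k%:R.
Proof.
rewrite /theta coefXM; case: k => [|k] /=; first by rewrite mulr0.
by rewrite coef_deriv mulr_natr.
Qed.

Lemma coef_iter_theta j h k : (iter j theta h)`_k = h`_k * k%:R ^+ j.
Proof.
elim: j => [|j IH]; first by rewrite expr0 mulr1.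
by rewrite iterS coef_theta IH exprSr mulrA.
Qed.

Lemma theta_is_linear : linear theta.
Proof. by move=> a g h; rewrite /theta linearP mulrDr -scalerAr. Qed.
HB.instance Definition _ := GRing.isLinear.Build F {poly F} {poly F} _ theta theta_is_linear.

Lemma iter_theta_is_linear j : linear (iter j theta).
Proof. by move=> a g h; elim: j => //= j ->; rewrite linearP. Qed.
HB.instance Definition _ j :=
  GRing.isLinear.Build F {poly F} {poly F} _ (iter j theta) (iter_theta_is_linear j).

Lemma thetaM g h : theta (g * h) = theta g * h + g * theta h.
Proof. by rewrite /theta derivM; ring. Qed.

Lemma thetaX f n : theta (f ^+ n) = (theta f * f ^+ n.-1) *+ n.
Proof. by rewrite /theta deriv_exp mulrnAr mulrA. Qed.

Lemma size_theta h : (size (theta h) <= size h)%N.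
Proof. by apply/leq_sizeP => j le; rewrite coef_theta nth_default ?mul0r. Qed.

Lemma size_iter_theta j h : (size (iter j theta h) <= size h)%N.
Proof. by elim: j => //= j IH; apply: leq_trans (size_theta _) IH. Qed.

Lemma size_mul_le g h a b :
  (size g <= a.+1)%N -> (size h <= b.+1)%N -> (size (g * h)%R <= (a + b).+1)%N.
Proof. by move=> sg sh; apply: leq_trans (size_polyMleq _ _) _; lia. Qed.

Lemma size_add_le g h a :
  (size g <= a)%N -> (size h <= a)%N -> (size (g + h)%R <= a)%N.
Proof. by move=> sg sh; apply: leq_trans (size_polyD _ _) _; rewrite geq_max sg. Qed.

Lemma size_exp_le f a n : (size f <= a.+1)%N -> (size (f ^+ n) <= (a * n).+1)%N.
Proof.
move=> sf; elim: n => [|n IH]; first by rewrite expr0 size_poly1.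
by rewrite exprS mulnS; apply: size_mul_le.
Qed.

Lemma size_sum_le (I : Type) (s : seq I) (P : pred I) (G : I -> {poly F}) a :
  (forall i, P i -> (size (G i) <= a)%N) -> (size (\sum_(i <- s | P i) G i)%R <= a)%N.
Proof.
move=> H; elim/big_ind: _ => //; first by rewrite size_poly0.
by move=> g h; apply: size_add_le.
Qed.

(* Differentiating [f ^+ e] at most [j] times leaves the factor
   [f ^+ (e - j)]; the cofactor stays of low degree. *)
Lemma iter_theta_powP j R f e a delta :
  (size R <= a.+1)%N -> (size f <= delta.+1)%N ->
  exists2 A, iter j theta (R * f ^+ e) = A * f ^+ (e - j)
           & (size A <= (a + j * delta).+1)%N.
Proof.
move=> sR sf; elim: j => [|j [A eqA sA]].
  by exists R; rewrite ?subn0 // mul0n addn0.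
have sA' : (size (theta A) <= (a + j * delta).+1)%N.
  exact: leq_trans (size_theta _) sA.
have stf : (size (theta f) <= delta.+1)%N by apply: leq_trans (size_theta _) sf.
rewrite iterS eqA thetaM subnS; case E: (e - j)%N => [|m] /=.
  exists (theta A); first by rewrite expr0 /theta derivC mulr0 mulr0 addr0.
  by apply: leq_trans sA' _; rewrite mulSn; lia.
exists (theta A * f + A * theta f *+ m.+1).
  rewrite thetaX /= exprS mulrDl mulrA mulrnAr mulrnAl; congr (_ + _ *+ _).
  by rewrite mulrA.
apply: size_add_le.
  by rewrite mulSn addnCA addnC; apply: size_mul_le.
rewrite -scaler_nat; apply: leq_trans (size_scale_leq _ _) _.
by rewrite mulSn addnCA addnC; apply: size_mul_le.
Qed.

(** The form in which the characteristic is used: the numbers below [K] remain distinct in the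
    field, as they are in characteristic zero. *)
Definition inj_nat (K : nat) : Prop :=
  forall a b, (a < K)%N -> (b < K)%N -> a%:R = b%:R :> F -> a = b.

Lemma inj_nat_le K K' : (K <= K')%N -> inj_nat K' -> inj_nat K.
Proof. by move=> le H a b la lb; apply: H; apply: leq_trans le. Qed.

Lemma wide_ker k n (A : 'M[F]_(k, n)) : (n < k)%N ->
  exists2 v : 'rV_k, v != 0 & v *m A = 0.
Proof.
move=> lt; have : kermx A != 0.
  rewrite -mxrank_eq0 mxrank_ker subn_eq0 -ltnNge.
  exact: leq_ltn_trans (rank_leq_col A) lt.
by case/rowV0Pn => v /sub_kermxP vA v0; exists v.
Qed.

(* The coefficient of [x^(k+N)] in [L x^k] is [c(k)] for a polynomial [c] of
   degree below the order bound [m], and the degrees of the solutions are roots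
   of [c]. *)
Lemma theta_kernel (m k K : nat) (Q : 'I_m -> {poly F}) (h : 'I_k -> {poly F}) :
  inj_nat K -> (exists j, Q j != 0) -> (m <= k)%N ->
  (forall i, (size (h i) <= K)%N) ->
  (forall i, \sum_j Q j * iter j theta (h i) = 0) ->
  exists2 c : 'rV_k, c != 0 & \sum_i c 0 i *: h i = 0.
Proof.
move=> injK [j1 Qj1] lemk szh Lh.
have [j0 Qle] : exists j0, forall j, (size (Q j) <= size (Q j0))%N.
  exists [arg max_(j > j1) size (Q j)]%N.
  by case: arg_maxnP => // i _ H j; apply: H.
have Q0 : (0 < size (Q j0))%N by apply: leq_trans (Qle j1); rewrite size_poly_gt0.
set N := (size (Q j0)).-1.
pose c := \sum_(j < m) (Q j)`_N *: 'X^j.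
have coefc (j : 'I_m) : c`_j = (Q j)`_N.
  rewrite coef_sum (bigD1 j) //= coefZ coefXn eqxx mulr1 big1 ?addr0 // => i ij.
  by rewrite coefZ coefXn eq_sym (negbTE (ij : (i : nat) != j)) mulr0.
have c0 : c != 0.
  apply/eqP => c0; have := coefc j0; rewrite c0 coef0 => /esym/eqP.
  by rewrite -/(lead_coef (Q j0)) lead_coef_eq0 -size_poly_eq0 => /eqP E; rewrite E in Q0.
have szc : (size c <= m)%N.
  apply: size_sum_le => j _; apply: leq_trans (size_scale_leq _ _) _.
  by rewrite size_polyXn.
pose bad := [seq b <- iota 0 K | root c b%:R].
have badm : (size bad < m)%N.
  rewrite -(size_map (fun b => b%:R : F)); apply: leq_trans szc.
  apply: max_poly_roots c0 _ _.
    by apply/allP => x /mapP[b]; rewrite mem_filter => /andP[rb _] ->.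
  rewrite map_inj_in_uniq ?filter_uniq ?iota_uniq // => a b.
  by rewrite !mem_filter !mem_iota !add0n => /andP[_ /= la] /andP[_ /= lb]; apply: injK.
(* There are fewer bad exponents than polynomials [h i], so some combination has no coefficient at
   any bad exponent. Its degree would have to be bad, hence it is zero. *)
pose A := \matrix_(i < k, j < size bad) (h i)`_(nth 0%N bad j).
have [v v0 vA] := wide_ker A (leq_trans badm lemk).
have [H EH] : exists H, H = \sum_i v 0 i *: h i by eexists.
exists v => //; rewrite -EH; apply/eqP/negPn/negP => H0.
have szH : (size H <= K)%N.
  rewrite EH; apply: size_sum_le => i _.
  exact: leq_trans (size_scale_leq _ _) (szh i).
have LH : \sum_j Q j * iter j theta H = 0.
  rewrite EH; under eq_bigr => j _ do rewrite linear_sum mulr_sumr.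
  rewrite exchange_big big1 // => i _.
  under eq_bigr => j _ do rewrite linearZ /= -scalerAr.
  by rewrite -scaler_sumr Lh scaler0.
set D := (size H).-1.
have szH0 : (0 < size H)%N by rewrite size_poly_gt0.
have DK : (D < K)%N by apply: leq_trans szH; rewrite prednK.
have lcH : H`_D != 0 by rewrite -/(lead_coef H) lead_coef_eq0.
have : c.[D%:R] * H`_D = 0.
  transitivity ((\sum_j Q j * iter j theta H)`_(N + D)); last by rewrite LH coef0.
  rewrite coef_sum horner_sum mulr_suml; apply: eq_bigr => j _.
  rewrite hornerZ hornerXn coefM.
  have ltN : (N < (N + D).+1)%N by rewrite ltnS leq_addr.
  rewrite (bigD1 (Ordinal ltN)) //= addKn coef_iter_theta big1 ?addr0.
    by rewrite -mulrA [H`_D * _]mulrC.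
  move=> i iN; have [lt|gt] : (i < N)%N \/ (N < i)%N.
    by apply/orP; rewrite -neq_ltn; apply: contraNneq iN => eqi; apply/eqP/val_inj.
    have -> : (iter j theta H)`_(N + D - i) = 0; last by rewrite mulr0.
    rewrite coef_iter_theta nth_default ?mul0r //.
    by rewrite -(prednK szH0) -/D; lia.
  rewrite nth_default ?mul0r //; apply: leq_trans (Qle j) _.
  by rewrite -(prednK Q0) -/N.
move/eqP; rewrite mulf_eq0 (negbTE lcH) orbF => rD.
have Dbad : D \in bad by rewrite mem_filter mem_iota /root rD add0n DK.
have ltb : (index D bad < size bad)%N by rewrite index_mem.
case/eqP: lcH; rewrite EH coef_sum.
transitivity ((v *m A) 0 (Ordinal ltb)); last by rewrite vA mxE.
by rewrite mxE; apply: eq_bigr => i _; rewrite coefZ mxE /= nth_index.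
Qed.

Lemma size_det_le n (A : 'M[{poly F}]_n) (s : 'I_n -> nat) :
  (forall i j, (size (A i j) <= (s i).+1)%N) ->
  (size (\det A) <= (\sum_i s i).+1)%N.
Proof.
move=> H; apply: size_sum_le => sg _.
have -> : size ((-1) ^+ sg * \prod_i A i (sg i)) = size (\prod_i A i (sg i)).
  by rewrite mulr_sign; case: ifP => _ //; rewrite size_polyN.
elim/big_rec2: _ => [|i m p _ IH]; first by rewrite size_poly1.
exact: size_mul_le.
Qed.

Lemma det_row_factor n (dv : 'I_n -> {poly F}) (A B : 'M[{poly F}]_n) :
  (forall i j, A i j = dv i * B i j) -> \det A = (\prod_i dv i) * \det B.
Proof.
move=> H; have -> : A = diag_mx (\row_i dv i) *m B.
  by apply/matrixP => i j; rewrite mul_diag_mx !mxE.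
by rewrite det_mulmx det_diag; congr (_ * _); apply: eq_bigr => i _; rewrite mxE.
Qed.

(** Powers of coprime polynomials are coprime, so the [e]-th power of a gcd [c] is a combination of
    the [f i ^+ e]; the induction adds one polynomial at a time. *)
Lemma bezout_pow n (f : 'I_n -> {poly F}) e : (0 < e)%N ->
  exists (c : {poly F}) (u : 'I_n -> {poly F}),
    (forall i, c %| f i) /\ \sum_(i < n) u i * f i ^+ e = c ^+ e.
Proof.
rewrite lt0n => /negbTE e0; elim: n f => [|n IH] f.
  by exists 0, (fun=> 0); split=> [[]//|]; rewrite big_ord0 expr0n e0.
have [c1 [u1 [dv1 eq1]]] := IH (fun i => f (lift ord0 i)).
pose c := gcdp (f ord0) c1.
have cf : c %| f ord0 by apply: dvdp_gcdl.
have cc : c %| c1 by apply: dvdp_gcdr.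
suff [a [b ab]] : exists a b : {poly F}, a * f ord0 ^+ e + b * c1 ^+ e = c ^+ e.
  exists c, (fun i => oapp (fun j => b * u1 j) a (unlift ord0 i)); split.
    by move=> i; case: (unliftP ord0 i) => [j ->|-> //]; apply: dvdp_trans cc (dv1 j).
  rewrite big_ord_recl unlift_none /= -ab -eq1 mulr_sumr; congr (_ + _).
  by apply: eq_bigr => i _; rewrite liftK /= mulrA.
have [c0|c0] := eqVneq c 0.
  move/eqP: (c0); rewrite gcdp_eq0 => /andP[/eqP -> /eqP ->].
  by exists 0, 0; rewrite c0 !mul0r addr0 expr0n e0.
have nz : (f ord0 != 0) || (c1 != 0).
  by rewrite -negb_and -gcdp_eq0.
have cop := coprimep_div_gcd nz; rewrite -/c in cop.
have : coprimep ((f ord0 %/ c) ^+ e) ((c1 %/ c) ^+ e).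
  by rewrite coprimep_expl // coprimep_expr.
case/Bezout_eq1_coprimepP => -[a b] /= ab; exists a, b.
rewrite -(divpK cf) -(divpK cc) !divpK //.
rewrite -{1}(divpK cf) -{1}(divpK cc) !exprMn !mulrA -mulrDl ab mul1r.
by [].
Qed.

(** A Wronskian argument in the manner of Mason's theorem. In a shortest relation the Wronskians
    [W j] of all terms but the [j]-th agree up to sign, and [W j] is divisible by high powers of all
    [f i] with [i != j]. Combined through [bezout_pow], these divisibilities show that the product
    of all the powers divides [c ^+ e'] times the Wronskian, [c] being a common divisor. Some [f j]
    has larger degree than [c], and [e'] times the difference exceeds what the low-degree cofactors
    can contribute. *)
Lemma lowdeg_indep k (e a delta K : nat) (f R : 'I_k -> {poly F}) :
  inj_nat K -> (forall i, f i != 0) -> (forall i, (size (f i) <= delta.+1)%N) ->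
  (forall i j, i != j -> ~~ (f i %= f j)) -> (forall i, (size (R i) <= a.+1)%N) ->
  ((1 < k)%N -> (k * (a + k * delta) + k < e)%N) -> (a + e * delta < K)%N ->
  \sum_i R i * f i ^+ e = 0 -> forall i, R i = 0.
Proof.
elim: k f R => [|k IH] f R injK f0 szf nassoc szR le_e leK; first by move=> _ [].
have IHl (j : 'I_k.+1) (R' : 'I_k -> {poly F}) : (forall i, (size (R' i) <= a.+1)%N) ->
    \sum_i R' i * f (lift j i) ^+ e = 0 -> forall i, R' i = 0.
  move=> szR' sum0; apply: (IH (fun i => f (lift j i)) R') => //.
    by move=> i i' ii'; apply: nassoc; rewrite (inj_eq lift_inj).
  move=> k1; apply: leq_ltn_trans (le_e _); last by lia.
  have : (k * delta <= k.+1 * delta)%N by rewrite leq_mul2r leqnSn orbT.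
  by move=> ?; apply: leq_add; [apply: leq_mul; lia | lia].
move=> sum0 i0; apply/eqP/negPn/negP => Ri0.
(* A vanishing cofactor would leave a relation with one term less. *)
have Rn0 j : R j != 0.
  apply/negP => /eqP Rj0; case/eqP: Ri0.
  have := sum0; rewrite (bigD1_ord j) //= Rj0 mul0r add0r => /IHl H.
  case: (unliftP j i0) => [i ->|-> //]; exact: H.
case: k => [|k] in f R injK f0 szf nassoc szR le_e leK IH IHl sum0 i0 Ri0 Rn0 *.
  move: sum0; rewrite big_ord1 => /eqP; rewrite mulf_eq0 expf_eq0 (negbTE (f0 _)) andbF orbF.
  by rewrite (negbTE (Rn0 _)).
have {}le_e : (k.+2 * (a + k.+2 * delta) + k.+2 < e)%N by apply: le_e.
pose h i := R i * f i ^+ e.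
have szh i : (size (h i) <= K)%N.
  apply: leq_trans (_ : ((a + delta * e).+1 <= _)%N); last by rewrite mulnC.
  by apply: size_mul_le => //; apply: size_exp_le.
pose W (i : 'I_k.+2) := \matrix_(b < k.+1, j < k.+1) iter j theta (h (lift i b)).
(* A zero Wronskian yields an operator of order at most [k] killing all the [h (lift ord0 i)];
   [theta_kernel] turns it into a relation with constant coefficients, which the induction
   hypothesis excludes. *)
have W0 : \det (W ord0) != 0.
  apply/negP; rewrite -det_tr => /det0P[v v0 vW].
  have [c c0 cz] : exists2 c : 'rV_k.+1, c != 0 & \sum_i c 0 i *: h (lift ord0 i) = 0.
    apply: (theta_kernel (m := k.+1) (Q := fun j => v 0 j) injK) => //.
      apply/existsP; apply: contraNT v0; rewrite negb_exists => /forallP v0.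
      by apply/eqP/rowP => j; have := v0 j; rewrite negbK mxE => /eqP.
    move=> i; transitivity ((v *m (W ord0)^T) 0 i); last by rewrite vW mxE.
    by rewrite mxE; apply: eq_bigr => j _; rewrite !mxE.
  have [i ci] : exists i, c 0 i != 0.
    apply/existsP; apply: contraNT c0; rewrite negb_exists => /forallP c0.
    by apply/eqP/rowP => j; have := c0 j; rewrite negbK mxE => /eqP.
  have := IHl ord0 (fun i => c 0 i *: R (lift ord0 i)) _ _ i.
  have -> //: \sum_i c 0 i *: R (lift ord0 i) * f (lift ord0 i) ^+ e = 0.
    by rewrite -[RHS]cz; apply: eq_bigr => l _; rewrite -scalerAl.
  move=> H; have {H} := H (fun l => leq_trans (size_scale_leq _ _) (szR _)) erefl.
  by move/eqP; rewrite scaler_eq0 (negbTE ci) (negbTE (Rn0 _)).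
have Wj (j : 'I_k.+2) : \det (W ord0) = (-1) ^+ j * \det (W j).
  have [->|j0] := eqVneq j ord0; first by rewrite expr0 mul1r.
  (* Column 0 has 1 in row [j] and -1 in row 0, and the other columns list the iterates of [theta]
     on the [h i]. Every column sums to zero, so the determinant vanishes, and its expansion along
     column 0 compares the two minors. *)
  pose M := \matrix_(i < k.+2, b < k.+2) oapp (fun l : 'I_k.+1 => iter l theta (h i))
     ((i == j)%:R - (i == ord0)%:R) (unlift ord0 b).
  have cofM (i : 'I_k.+2) : cofactor M i ord0 = (-1) ^+ i * \det (W i).
    rewrite /cofactor addn0; congr (_ * \det _); apply/matrixP => b l.
    by rewrite !mxE liftK.
  have : \det M == 0.
    apply/det0P; exists (const_mx 1).
      by apply/eqP => /matrixP/(_ 0 0)/eqP; rewrite !mxE oner_eq0.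
    apply/rowP => b; rewrite !mxE.
    under eq_bigr => i _ do rewrite !mxE mul1r.
    case: (unliftP ord0 b) => [l _|_] /=; last first.
      have d1 (l : 'I_k.+2) : \sum_(i < k.+2) (i == l)%:R = 1 :> {poly F}.
        by rewrite (bigD1 l) //= eqxx big1 ?addr0 // => i /negbTE ->.
      by rewrite sumrB !d1 subrr.
    rewrite -linear_sum /=.
    by rewrite (_ : \sum_i h i = 0) ?linear0 //.
  rewrite (expand_det_col _ ord0) (bigD1 ord0) //= (bigD1 j) //= big1 ?addr0.
    have M00 : M ord0 ord0 = -1.
      rewrite mxE unlift_none /=; have -> : (ord0 == j) = false.
        by rewrite eq_sym; apply: negbTE.
      exact: sub0r.
    have Mj0 : M j ord0 = 1.
      rewrite mxE unlift_none /= eqxx (negbTE j0); exact: subr0.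
    by rewrite M00 Mj0 mulN1r mul1r !cofM expr0 mul1r addrC subr_eq0 => /eqP ->.
  by move=> i /andP[i0' ij]; rewrite mxE unlift_none /= (negbTE i0') (negbTE ij) subrr mul0r.
(* The Wronskian involves at most [k] applications of [theta], each costing one factor [f i]. *)
set e' := (e - k)%N.
have e'0 : (0 < e')%N by rewrite subn_gt0; lia.
have dvW (j : 'I_k.+2) : \prod_(b < k.+1) f (lift j b) ^+ e' %| \det (W j).
  pose C := \matrix_(b < k.+1, l < k.+1)
    ((iter l theta (h (lift j b))) %/ f (lift j b) ^+ e').
  rewrite (@det_row_factor _ (fun b => f (lift j b) ^+ e') _ C) ?dvdp_mulr //.
  move=> b l; rewrite !mxE [RHS]mulrC divpK //.
  have [A -> _] := iter_theta_powP l e (szR (lift j b)) (szf (lift j b)).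
  by rewrite dvdp_mull // dvdp_exp2l //; have := ltn_ord l; rewrite /e'; lia.
have [c [u [dvc sumu]]] := bezout_pow f e'0.
set P := \prod_i f i ^+ e'.
have Pj (j : 'I_k.+2) : P = f j ^+ e' * \prod_(b < k.+1) f (lift j b) ^+ e'.
  by rewrite /P (bigD1_ord j).
have dvP : P %| c ^+ e' * \det (W ord0).
  rewrite -sumu mulr_suml; apply: (big_ind (fun q => P %| q)).
  - exact: dvdp0.
  - by move=> x y; apply: dvdp_add.
  move=> j _; rewrite -mulrA dvdp_mull // (Pj j) dvdp_mul2l ?expf_neq0 //.
  by rewrite (Wj j) dvdp_mull.
(* Otherwise [c] would be associate to every [f j], and so these to each other. *)
have [j szj] : exists j : 'I_k.+2, (size c < size (f j))%N.
  apply/existsP; apply: contraT; rewrite negb_exists => /forallP Hs.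
  have eqc (j : 'I_k.+2) : c %= f j.
    rewrite -(dvdp_size_eqp (dvc j)) eqn_leq dvdp_leq //=.
    by have := Hs j; rewrite -leqNgt.
  have /negP H := nassoc ord0 (lift ord0 ord0) isT; case: H.
  by apply: eqp_trans (eqc _); rewrite eqp_sym.
have c0 : c != 0 by apply: contraTneq (dvc j) => ->; rewrite dvd0p.
have : P %| c ^+ e' * \det (W j).
  by move: dvP; rewrite (Wj j) -signr_odd mulr_sign; case: ifP => _ //; rewrite mulrN dvdpNr.
have Wj0 : \det (W j) != 0.
  by apply: contraNneq W0; rewrite (Wj j) => ->; rewrite mulr0.
move/(dvdp_leq (mulf_neq0 (expf_neq0 _ c0) Wj0)).
have szexp (g : {poly F}) m : g != 0 -> size (g ^+ m) = ((size g).-1 * m).+1.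
  by move=> g0; rewrite -(size_exp g m) prednK // size_poly_gt0 expf_neq0.
pose dg i := (size (f i)).-1.
have szf' i : size (f i) = (dg i).+1 by rewrite /dg prednK // size_poly_gt0.
have szprod : size (\prod_(b < k.+1) f (lift j b) ^+ e') = (\sum_(b < k.+1) dg (lift j b) * e').+1.
  rewrite size_prod; last by move=> b _; rewrite expf_neq0.
  under eq_bigr => b _ do rewrite szexp // -/(dg _) -addn1.
  by rewrite big_split /= sum1_card -addSn addnK.
have szP : size P = (dg j * e' + \sum_(b < k.+1) dg (lift j b) * e').+1.
  rewrite (Pj j) size_mul ?expf_neq0 //; last first.
    by rewrite prodf_seq_neq0; apply/allP => b _; rewrite expf_neq0.
  by rewrite szprod szexp // addnS addSn.
have szW : (size (\det (W j)) <= (\sum_(b < k.+1) (a + dg (lift j b) * e)).+1)%N.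
  apply: size_det_le => b l; rewrite mxE; apply: leq_trans (size_iter_theta _ _) _.
  by apply: size_mul_le => //; apply: size_exp_le; rewrite szf'.
rewrite szP => H.
have : (size (c ^+ e' * \det (W j))%R <= ((size c).-1 * e' + \sum_(b < k.+1) (a + dg (lift j b) * e)).+1)%N.
  by apply: size_mul_le => //; rewrite szexp.
move/(leq_trans H); rewrite ltnS.
have -> : (\sum_(b < k.+1) (a + dg (lift j b) * e) =
   \sum_(b < k.+1) (a + dg (lift j b) * k) + \sum_(b < k.+1) dg (lift j b) * e')%N.
  rewrite -big_split; apply: eq_bigr => b _ /=; rewrite -addnA -mulnDr; congr (_ + _ * _)%N.
  by rewrite /e' subnKC //; lia.
rewrite addnA leq_add2r => {}H.
have : (\sum_(b < k.+1) (a + dg (lift j b) * k) <= k.+1 * (a + k * delta))%N.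
  rewrite -[X in (_ <= X * _)%N]card_ord -sum_nat_const; apply: leq_sum => b _.
  by rewrite leq_add2l mulnC leq_mul2l; have := szf (lift j b); rewrite szf' ltnS => ->; rewrite orbT.
have cj : ((size c).-1 < dg j)%N.
  by move: szj; rewrite szf' -[in X in (X < _)%N](prednK (_ : 0 < size c)%N) ?size_poly_gt0.
have : ((size c).-1 * e' + e' <= dg j * e')%N by rewrite -mulSnr leq_mul2r cj orbT.
have : (k.+1 * (a + k * delta) + k.+2 <= k.+2 * (a + k.+2 * delta) + k.+2)%N.
  by rewrite leq_add2r; apply: leq_mul => //; rewrite leq_add2l leq_mul2r; apply/orP; right; lia.
move: H; rewrite /e'; set X := (k.+1 * _)%N; set Y := (k.+2 * _)%N in le_e *.
set S := (\sum_(b < _) _)%N; lia.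
Qed.

End Theta.

(** * The reconstruction procedure *)

Section Sums.
Variable V : nmodType.
Implicit Types (G : nat -> V).

Lemma sum_split3 m s G : (s < m)%N ->
  \sum_(i < m) G i = \sum_(i < s) G i + (G s + \sum_(i < m - s.+1) G (s.+1 + i)%N).
Proof.
move=> lt; have -> : m = (s.+1 + (m - s.+1))%N by rewrite subnKC.
rewrite big_split_ord /= big_ord_recr /= -addrA; congr (_ + (_ + _)).
by rewrite addKn.
Qed.

Lemma sum_divmod M K (G : nat -> nat -> V) :
  \sum_(q < M * K) G (q %/ K)%N (q %% K)%N = \sum_(m < M) \sum_(l < K) G m l.
Proof.
elim: M => [|M IH]; first by rewrite mul0n !big_ord0.
rewrite mulSnr big_split_ord big_ord_recr /= -IH; congr (_ + _).
apply: eq_bigr => l _; have lt := ltn_ord l; have K0 := leq_ltn_trans (leq0n _) lt.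
by rewrite divnMDl // modnMDl divn_small // modn_small // addn0.
Qed.

Lemma sum_delta m s (x : V) : (s < m)%N ->
  \sum_(i < m) (if i == s :> nat then x else 0) = x.
Proof.
move=> lt; rewrite (bigD1 (Ordinal lt)) //= eqxx big1 ?addr0 // => i ne.
by rewrite (negbTE (ne : (i : nat) != s)).
Qed.

End Sums.

(** * Kernels and coordinates from a linear solver *)

Section Solver.
Variable F : fieldType.

(** Systems are given by total functions on [nat], of which the specification reads only the entries
    below [m] and [n]; the dimensions can then vary with the instance without dependent types. *)
Definition solver_spec (solve : nat -> nat -> (nat -> nat -> F) -> (nat -> F) -> option (nat -> F)) :=
  forall m n a b,
    match solve m n a b with
    | Some x => forall j, (j < n)%N -> \sum_(i < m) x i * a i j = b j
    | None => forall x, ~ (forall j, (j < n)%N -> \sum_(i < m) x i * a i j = b j)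
    end.

Variable solve : nat -> nat -> (nat -> nat -> F) -> (nat -> F) -> option (nat -> F).
Hypothesis solveP : solver_spec solve.

Definition pspan m B (rows : nat -> {poly F}) (t : {poly F}) : nat -> F :=
  odflt (fun=> 0) (solve m B (fun i b => (rows i)`_b) (fun b => t`_b)).

Lemma poly_eqP B (p q : {poly F}) : (size p <= B)%N -> (size q <= B)%N ->
  (forall b, (b < B)%N -> p`_b = q`_b) -> p = q.
Proof.
move=> sp sq H; apply/polyP => b; case: (ltnP b B) => [|le]; first exact: H.
by rewrite !nth_default // (leq_trans _ le).
Qed.

Lemma pspanP m B (rows : nat -> {poly F}) (t : {poly F}) (x : nat -> F) : (forall i, (i < m)%N -> (size (rows i) <= B)%N) ->
  \sum_(i < m) x i *: rows i = t -> \sum_(i < m) pspan m B rows t i *: rows i = t.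
Proof.
move=> sr xt; have st : (size t <= B)%N.
  rewrite -xt; apply: size_sum_le => i _.
  by apply: leq_trans (size_scale_leq _ _) (sr i _).
have coefs y b : (\sum_(i < m) y i *: rows i)`_b = \sum_(i < m) y i * (rows i)`_b.
  by rewrite coef_sum; apply: eq_bigr => i _; rewrite coefZ.
rewrite /pspan; have := solveP m B (fun i b => (rows i)`_b) (fun b => t`_b).
case: solve => [y|] Hy /=.
  apply: (@poly_eqP B) => // [|b lt]; last by rewrite coefs Hy.
  apply: size_sum_le => i _.
  by apply: leq_trans (size_scale_leq _ _) (sr i _).
by case: (Hy x) => j lt; rewrite -coefs xt.
Qed.

(** Row [s] is a combination of the later rows iff some vector of the left kernel has its first
    nonzero entry at [s]. One solver call per [s] thus yields an echelon basis: [kervec] is that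
    vector, normalized to 1 at [s], or zero if there is none. *)
Definition kersol m B (rows : nat -> nat -> F) s : option (nat -> F) :=
  solve (m - s.+1) B (fun i => rows (s.+1 + i)%N) (rows s).

Definition kervec m B (rows : nat -> nat -> F) s : nat -> F :=
  if kersol m B rows s is Some c
  then fun i => if (i < s)%N then 0 else if i == s then 1 else - c (i - s.+1)%N
  else fun=> 0.

Lemma kervec_ker m B (rows : nat -> nat -> F) s j : (s < m)%N -> (j < B)%N ->
  \sum_(i < m) kervec m B rows s i * rows i j = 0.
Proof.
move=> sm jB; rewrite /kervec.
have := solveP (m - s.+1)%N B (fun i => rows (s.+1 + i)%N) (rows s).
rewrite -/(kersol m B rows s); case: kersol => [c|] Hc; last first.
  by rewrite big1 // => i _; rewrite mul0r.
rewrite (sum_split3 (fun i => (if (i < s)%N then 0 else if i == s then 1 else - c (i - s.+1)%N) * rows i j) sm).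
rewrite big1 ?add0r; last by move=> i _; rewrite ltn_ord mul0r.
rewrite ltnn eqxx mul1r -(Hc j jB) -big_split big1 //= => i _.
by rewrite addKn ltnNge (leq_trans (leqnSn s)) ?leq_addr //= gtn_eqF ?ltnS ?leq_addr // mulNr subrr.
Qed.

Lemma kersol_some m B (rows : nat -> nat -> F) s (x : nat -> F) : (s < m)%N ->
  (forall j, (j < B)%N -> \sum_(i < m) x i * rows i j = 0) ->
  (forall i, (i < s)%N -> x i = 0) -> x s != 0 -> kersol m B rows s.
Proof.
move=> sm Hx x0 xs; rewrite /kersol.
have := solveP (m - s.+1)%N B (fun i => rows (s.+1 + i)%N) (rows s).
case: solve => // H; case: (H (fun i => - (x s)^-1 * x (s.+1 + i)%N)) => j jB.
have := Hx j jB; rewrite (sum_split3 (fun i => x i * rows i j) sm).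
rewrite big1 ?add0r; last by move=> i _; rewrite x0 ?mul0r.
move/eqP; rewrite addr_eq0 => /eqP E.
rewrite -[RHS](mulKf xs) E mulrN mulr_sumr -sumrN.
by apply: eq_bigr => i _; rewrite mulNr mulNr mulrA.
Qed.

(** At the first nonzero entry [s] of [x] an echelon vector starts; subtracting [x s] times it moves
    the first nonzero entry to the right. *)
Lemma kervec_gen m B (rows : nat -> nat -> F) (x : nat -> F) :
  (forall j, (j < B)%N -> \sum_(i < m) x i * rows i j = 0) ->
  exists y : nat -> F, forall i, (i < m)%N ->
    x i = \sum_(s < m) y s * kervec m B rows s i.
Proof.
suff H n s : (s + n)%N = m -> forall x : nat -> F,
  (forall j, (j < B)%N -> \sum_(i < m) x i * rows i j = 0) ->
  (forall i, (i < s)%N -> x i = 0) ->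
  exists y : nat -> F, forall i, (i < m)%N ->
    x i = \sum_(s < m) y s * kervec m B rows s i.
  by move=> Hx; apply: (H m 0%N).
elim: n s => [|n IH] s sn {}x Hx x0.
  exists (fun=> 0) => i lt; rewrite x0; last by lia.
  by rewrite big1 // => k _; rewrite mul0r.
have sm : (s < m)%N by lia.
have [xs|xs] := eqVneq (x s) 0.
  apply: (IH s.+1) => //; first by lia.
  by move=> i; rewrite ltnS leq_eqVlt => /orP[/eqP -> //|]; apply: x0.
have Hk := kersol_some sm Hx x0 xs.
have kvlt i : (i < s)%N -> kervec m B rows s i = 0.
  by rewrite /kervec; case: kersol => // c ->.
have kvs : kervec m B rows s s = 1.
  by rewrite /kervec; case: kersol Hk => // c _; rewrite ltnn eqxx.
have sn' : (s.+1 + n)%N = m by lia.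
have [||y Hy] := IH s.+1 sn' (fun i => x i - x s * kervec m B rows s i).
- move=> j jB; under eq_bigr => i _ do rewrite mulrBl -mulrA.
  by rewrite sumrB Hx // -mulr_sumr kervec_ker // mulr0 subr0.
- move=> i; rewrite ltnS leq_eqVlt => /orP[/eqP ->|lt].
    by rewrite kvs mulr1 subrr.
  by rewrite x0 // kvlt // mulr0 subr0.
exists (fun k => y k + (if k == s then x s else 0)) => i lt.
under eq_bigr => k _ do rewrite mulrDl.
rewrite big_split /= -Hy // (bigD1 (Ordinal sm)) //= eqxx [X in _ + (_ + X)]big1 ?addr0 ?subrK //.
by move=> k ne; rewrite (negbTE (ne : (k : nat) != s)) mul0r.
Qed.

Definition kry n (C : nat -> nat -> F) (y : nat -> F) j : nat -> F :=
  iter j (fun (v : nat -> F) (l : nat) => \sum_(k < n) v k * C k l) y.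

End Solver.

Section Algorithm.
Variable F : fieldType.
Variable solve : nat -> nat -> (nat -> nat -> F) -> (nat -> F) -> option (nat -> F).
Variable roots : nat -> (nat -> F) -> nat -> F.
Variables (r d delta : nat) (val : nat -> F).

(** [rK] bounds the size of the input polynomial [g], [rD] the coefficients of the
    annihilators, [rE] the degree of the multiplier [aa] and of the [p_i]; [rS]
    and [rM] count unknowns, [rT] evaluation points. *)
Definition rK := (d * delta).+1.
Definition rD := (r * r * delta)%N.
Definition rE := (r * delta)%N.
Definition rB := (rK + rD)%N.
Definition rS := (r.+1 * rD.+1)%N.
Definition rT := (r * r * rE).+1.
Definition rBE := (rK + rE)%N.
Definition rM := (rE.+1 + rE.+1 * rK)%N.
Definition rBd := (rK + delta)%N.

Definition ag : {poly F} :=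
  \poly_(j < rK) odflt (fun=> 0) (solve rK rK (fun j t => t%:R ^+ j) val) j.

(** The index packs a power of [x] and an order at most [r], so that operators with polynomial
    coefficients become vectors of length [rS]. *)
Definition xth (i : nat) (h : {poly F}) : {poly F} :=
  'X^(i %/ r.+1) * iter (i %% r.+1) (@theta F) h.

Lemma xth_is_linear i : linear (xth i).
Proof. by move=> c g h; rewrite /xth linearP /= mulrDr -scalerAr. Qed.
HB.instance Definition _ i :=
  GRing.isLinear.Build F {poly F} {poly F} _ (xth i) (xth_is_linear i).

(** The [akap s] generate the annihilators of [g] and the [aw k] their common
    kernel [W]; [ac k] expands [aa * theta (aw k)] over the [x^m * aw l], so that
    [aC t] is the matrix of the endomorphism obtained at [x = t], and [az t j]
    is its [j]-th iterate on [g]. *)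
Definition akap s := kervec solve rS rB (fun i b => (xth i ag)`_b) s.

Definition aL s (h : {poly F}) : {poly F} := \sum_(i < rS) akap s i *: xth i h.

(** Column [q] stands for the annihilator [q %/ rB] and the coefficient [q %% rB] of its value, so
    the left kernel consists of the polynomials killed by all annihilators. *)
Definition aN k q : F := (aL (q %/ rB) 'X^k)`_(q %% rB).

Definition aw k : {poly F} := \poly_(i < rK) kervec solve rK (rS * rB) aN k i.

Definition axw q : {poly F} := 'X^(q %/ rK) * aw (q %% rK).

(** The first [rE.+1] unknowns are the coefficients of [aa]; the others give the expansion over the
    [axw], with opposite sign. *)
Definition arow q : {poly F} :=
  if (q < rE.+1)%N then 'X^q * theta ag else axw (q - rE.+1).

(** A kernel vector whose first nonzero entry lies among the coefficients of [aa] guarantees that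
    [aa] is nonzero. *)
Definition aidx :=
  find (fun s => isSome (kersol solve rM rBE (fun i b => (arow i)`_b) s)) (iota 0 rE.+1).

Definition aa : {poly F} :=
  \poly_(l < rE.+1) kervec solve rM rBE (fun i b => (arow i)`_b) aidx l.

Definition ac k : nat -> F := pspan solve (rE.+1 * rK) rBE axw (aa * theta (aw k)).

Definition ay : nat -> F := pspan solve rK rK aw ag.

Definition aC t k l : F := \sum_(m < rE.+1) t%:R ^+ m * ac k (m * rK + l)%N.

Definition az t j : {poly F} := \sum_(l < rK) kry rK (aC t) ay j l *: aw l.

(** [q] encodes the pair [(r - q %/ rT, q %% rT)] of a guess for the number of
    summands, in decreasing order, and an evaluation point. *)
Definition atest q : bool :=
  find (fun s => isSome (kersol solve (r - q %/ rT) rK (fun i b => (az (q %% rT) i)`_b) s))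
       (iota 0 (r - q %/ rT)) == (r - q %/ rT)%N.

Definition aq := find atest (iota 0 (r * rT)).
Definition anu := (r - aq %/ rT)%N.
Definition at_ := (aq %% rT)%N.

(** The recurrence of the iterates: ['X^anu] minus the polynomial with these coefficients, applied
    to the endomorphism, annihilates [ag]. *)
Definition achi : nat -> F := pspan solve anu rK (az at_) (az at_ anu).
Definition alam : nat -> F := roots anu achi.
(** The coefficients of the [i]-th Lagrange polynomial at the [alam j], from a Vandermonde
    system. *)
Definition alag i : nat -> F :=
  odflt (fun=> 0) (solve anu anu (fun k j => alam j ^+ k) (fun j => (j == i)%:R)).
Definition agi i : {poly F} := \sum_(k < anu) alag i k *: az at_ k.
(** The unknown coefficients are indexed from the top degree down, so that the
    kernel vector is normalized at its leading coefficient. *)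
Definition afrow i s : {poly F} :=
  'X^(delta - s) * ((d * (delta - s))%:R *: agi i - theta (agi i)).
Definition asidx i :=
  find (fun s => isSome (kersol solve delta.+1 rBd (fun k b => (afrow i k)`_b) s))
       (iota 0 delta.+1).
Definition afi i : {poly F} :=
  \poly_(k < delta.+1) kervec solve delta.+1 rBd (fun k b => (afrow i k)`_b) (asidx i) (delta - k)%N.
(** A power of a monic polynomial is monic, so the scalar is the coefficient of [agi i] at [d] times
    the degree of the root. *)
Definition aal i : F := (agi i)`_(d * (delta - asidx i)).

End Algorithm.

Lemma choice_fun (A B : Type) (R : A -> B -> Prop) :
  (forall a, exists b, R a b) -> exists f, forall a, R a (f a).
Proof.
move=> H; exists (fun a => proj1_sig (constructive_indefinite_description _ (H a))).
by move=> a; case: constructive_indefinite_description.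
Qed.

Definition split_ok (F : fieldType) n (c : nat -> F) : Prop :=
  exists l : nat -> F,
    'X^n - \poly_(k < n) c k = \prod_(i < n) ('X - (l i)%:P) /\
    (forall i j, (i < n)%N -> (j < n)%N -> l i = l j -> i = j).

(** Only polynomials with distinct roots in the field are prescribed, and their roots in any order:
    the procedure meets no others, and the order is absorbed by the permutation in the
    conclusion. *)
Definition roots_spec (F : fieldType) (roots : nat -> (nat -> F) -> nat -> F) : Prop :=
  forall n (c l : nat -> F),
    'X^n - \poly_(k < n) c k = \prod_(i < n) ('X - (l i)%:P) ->
    (forall i j, (i < n)%N -> (j < n)%N -> l i = l j -> i = j) ->
    perm_eq (mkseq (roots n c) n) (mkseq l n).

(** Since [theta] multiplies ['X^k] by [k], the rows express the logarithmic derivative equation for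
    the unknown root of [G], with its coefficients listed from the top degree down. *)
Lemma log_deriv_rows (F : fieldType) (d delta : nat) (x : nat -> F) (G : {poly F}) :
  \sum_(s < delta.+1) x s *: ('X^(delta - s) * ((d * (delta - s))%:R *: G - theta G))
  = d%:R *: (theta (\poly_(k < delta.+1) x (delta - k)%N) * G)
    - (\poly_(k < delta.+1) x (delta - k)%N) * theta G.
Proof.
transitivity (\sum_(k < delta.+1) x (delta - k)%N *: ('X^k * ((d * k)%:R *: G - theta G))).
  rewrite (reindex_inj rev_ord_inj); apply: eq_bigr => k _.
  have E : rev_ord k = (delta - k)%N :> nat by rewrite /= subSS.
  have lek : (k <= delta)%N by rewrite -ltnS.
  by rewrite E subKn.
have theta_sum (h : 'I_delta.+1 -> {poly F}) : theta (\sum_k h k) = \sum_k theta (h k).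
  exact: linear_sum.
rewrite poly_def theta_sum !mulr_suml scaler_sumr -sumrB.
apply: eq_bigr => k _.
have -> : theta (x (delta - k)%N *: 'X^k) = (x (delta - k)%N * k%:R) *: 'X^k.
  apply/polyP => b; rewrite coef_theta !coefZ coefXn.
  by case: eqP => [->|_]; rewrite ?mulr1 // !mulr0 mul0r.
rewrite mulrBr scalerBr -!scalerAl -scalerAr !scalerA natrM; congr (_ *: _ - _).
by rewrite mulrCA.
Qed.

(** * Correctness of the procedure *)

Section Correctness.
Variable F : fieldType.
Variable solve : nat -> nat -> (nat -> nat -> F) -> (nat -> F) -> option (nat -> F).
Variable roots : nat -> (nat -> F) -> nat -> F.
Hypothesis solveP : solver_spec solve.
Hypothesis rootsP : roots_spec roots.
Variables (r d delta n : nat) (val : nat -> F).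
Variables (alpha : 'I_n -> F) (f : 'I_n -> {poly F}).
Hypothesis hd : (r.+1 ^ 4 * delta < d)%N.
Hypothesis hinj : inj_nat F (2 * r * d * delta).+1.
Hypothesis nr : (n <= r)%N.
Hypothesis n_gt0 : (0 < n)%N.
Hypothesis fmonic : forall i, f i \is monic.
Hypothesis szf : forall i, (size (f i) <= delta.+1)%N.
Hypothesis nassoc : forall i j, i != j -> ~~ (f i %= f j).
Hypothesis alpha0 : forall i, alpha i != 0.

Local Notation K := (rK d delta).
Local Notation D := (rD r delta).
Local Notation E := (rE r delta).
Local Notation B := (rB r d delta).
Local Notation S := (rS r delta).
Local Notation T := (rT r delta).
Local Notation BE := (rBE r d delta).
Local Notation M := (rM r d delta).

Let fd i := f i ^+ d.
Let g0 := \sum_i alpha i *: fd i.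
Hypothesis valE : forall t, (t < K)%N -> val t = g0.[t%:R].

Local Notation g := (ag solve d delta val).
Local Notation w := (aw solve r d delta val).
Local Notation kap := (akap solve r d delta val).
Local Notation L := (aL solve r d delta val).

Let r_gt0 : (0 < r)%N. Proof. exact: leq_trans n_gt0 nr. Qed.
Let d_gt0 : (0 < d)%N. Proof. exact: leq_ltn_trans hd. Qed.

Let f_neq0 i : f i != 0. Proof. exact: monic_neq0. Qed.

Let delta_gt0 : (1 < n)%N -> (0 < delta)%N.
Proof.
move=> n1; rewrite lt0n; apply/negP => /eqP d0.
have f1 i : f i = 1.
  have := szf i; rewrite d0 => /size1_polyC E1.
  by have := fmonic i; rewrite E1 monicE lead_coefC => /eqP ->.
by have /negP := @nassoc (Ordinal n_gt0) (Ordinal n1) isT; rewrite !f1 eqpxx.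
Qed.

Let ltr_d : (0 < delta)%N -> (r < d)%N.
Proof.
move=> dl; apply: leq_ltn_trans hd.
apply: (@leq_trans (r.+1 ^ 4)); last by rewrite leq_pmulr.
by rewrite (leq_trans (leqnSn r)) // -{1}(expn1 r.+1) leq_pexp2l.
Qed.

(** The gap between [d] and [delta] is spent here: the left side is at most
    [r^3 delta + 2 r^2 delta + r], the exponent may fall short of [d] by [r], and
    [r^3 + 2 r^2 + 2 r] is at most [(r+1)^4]. With two summands [delta] is positive, which absorbs
    the terms free of [delta]. *)
Let num1 e a : (1 < n)%N -> (d - r <= e)%N -> (a <= D + r * delta)%N ->
  (n * (a + n * delta) + n < e)%N.
Proof.
move=> n1 le_e le_a; have dl := delta_gt0 n1.
apply: leq_trans le_e.
apply: (@leq_ltn_trans (r * (D + r * delta + r * delta) + r)%N).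
  apply: leq_add => //; apply: leq_mul => //; apply: leq_add => //.
  by rewrite leq_mul2r nr orbT.
rewrite ltn_subRL; apply: leq_ltn_trans hd; rewrite /rD.
have H : (r * r * r + 2 * (r * r) + 2 * r <= r.+1 ^ 4)%N.
  by rewrite !expnS expn0 muln1; lia.
apply: leq_trans (leq_mul H (leqnn delta)).
have : (2 * r <= 2 * r * delta)%N by rewrite leq_pmulr.
lia.
Qed.

(** One half of [2 r d delta] covers [e delta], the other half the cofactor degree
    [(r^2 + r) delta]. *)
Let num2 e a : (e <= d)%N -> (a <= D + r * delta)%N ->
  (a + e * delta < (2 * r * d * delta).+1)%N.
Proof.
move=> le_e le_a; rewrite ltnS.
have [d0|dl] := posnP delta.
  by move: le_a; rewrite /rD d0 !muln0 !addn0.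
have H1 : (e * delta <= r * d * delta)%N.
  by rewrite leq_mul2r (leq_trans le_e) ?orbT // leq_pmull.
have H2 : (D + r * delta <= r * d * delta)%N.
  rewrite /rD -mulnDl -mulnSr leq_mul2r leq_mul2l; have := ltr_d dl.
  by move=> ->; rewrite !orbT.
have -> : (2 * r * d * delta = r * d * delta + r * d * delta)%N by lia.
by apply: leq_add => //; apply: leq_trans le_a H2.
Qed.

Let lowd e a (R : 'I_n -> {poly F}) : (d - r <= e)%N -> (e <= d)%N ->
  (a <= D + r * delta)%N -> (forall i, (size (R i) <= a.+1)%N) ->
  \sum_i R i * f i ^+ e = 0 -> forall i, R i = 0.
Proof.
move=> le_e ge_e le_a szR sum0.
apply: (lowdeg_indep (e := e) (a := a) (delta := delta) hinj f_neq0 szf nassoc szR) => //.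
  by move=> n1; apply: num1.
exact: num2.
Qed.

Let lowd_d (R R' : 'I_n -> {poly F}) :
  (forall i, (size (R i) <= E.+1)%N) -> (forall i, (size (R' i) <= E.+1)%N) ->
  \sum_i R i * fd i = \sum_i R' i * fd i -> forall i, R i = R' i.
Proof.
move=> szR szR' eqR i; apply/eqP; rewrite -subr_eq0; apply/eqP.
apply: (lowd (e := d) (a := E) (R := fun i => R i - R' i)) => //.
- exact: leq_subr.
- exact: leq_addl.
- by move=> j; apply: size_add_le; rewrite ?size_polyN.
by under eq_bigr => j _ do rewrite mulrBl; rewrite sumrB eqR subrr.
Qed.

Let indep (c c' : 'I_n -> F) :
  \sum_i c i *: fd i = \sum_i c' i *: fd i -> forall i, c i = c' i.
Proof.
move=> H i; apply: (@polyC_inj F).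
apply: (@lowd_d (fun i => (c i)%:P) (fun i => (c' i)%:P)) => [j|j|].
- exact: leq_trans (size_polyC_leq1 _) _.
- exact: leq_trans (size_polyC_leq1 _) _.
by under eq_bigr => j _ do rewrite mul_polyC; rewrite H; apply: eq_bigr => j _; rewrite mul_polyC.
Qed.

Let szfd i : (size (fd i) <= K)%N.
Proof. by rewrite /rK mulnC; apply: size_exp_le. Qed.

Let szcomb (c : 'I_n -> F) : (size (\sum_i c i *: fd i)%R <= K)%N.
Proof. by apply: size_sum_le => i _; apply: leq_trans (size_scale_leq _ _) (szfd i). Qed.

Let injK : inj_nat F K.
Proof.
apply: inj_nat_le hinj; rewrite ltnS -mulnA leq_pmull //.
by rewrite muln_gt0.
Qed.

Lemma ag_eq : g = g0.
Proof.
rewrite /ag; have := solveP K K (fun j t => t%:R ^+ j) val.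
case: solve => [y|] Hy /=; last first.
  case: (Hy (fun j => g0`_j)) => j lt.
  by rewrite valE // (horner_coef_wide _ (szcomb alpha)).
apply/eqP; rewrite -subr_eq0; apply/eqP.
apply: (@roots_geq_poly_eq0 _ _ [seq t%:R | t <- iota 0 K]).
- apply/allP => x /mapP[t]; rewrite mem_iota add0n => /andP[_ lt] ->.
  by rewrite /root hornerD hornerN horner_poly Hy // valE // subrr.
- rewrite map_inj_in_uniq ?iota_uniq // => a b.
  by rewrite !mem_iota !add0n => /andP[_ la] /andP[_ lb]; apply: injK.
rewrite size_map size_iota; apply: size_add_le; first exact: size_poly.
by rewrite size_polyN szcomb.
Qed.

(** Lower iterates leave more factors [f i]; the surplus is moved into the cofactor, so that all
    orders up to [m] share the factor [f i ^+ (d - m)]. *)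
Let xpow m j b i : (j <= m)%N -> exists2 A : {poly F}, 'X^b * iter j (@theta F) (fd i) = A * f i ^+ (d - m)
   & (size A <= (b + m * delta).+1)%N.
Proof.
move=> jm; have sz1 : (size (1 : {poly F})%R <= 1)%N by rewrite size_poly1.
have [A0] := iter_theta_powP j d sz1 (szf i); rewrite mul1r add0n => -> sA0.
exists ('X^b * (A0 * f i ^+ (d - j - (d - m)))).
  by rewrite -!mulrA -exprD subnK //; lia.
apply: (@leq_trans (b + (j * delta + delta * (d - j - (d - m)))).+1%N).
  apply: size_mul_le; first by rewrite size_polyXn.
  by apply: size_mul_le => //; apply: size_exp_le.
rewrite ltnS leq_add2l mulnC -mulnDr mulnC leq_mul2r; apply/orP; right; lia.
Qed.

Let size_xth i (h : {poly F}) : (i < S)%N -> (size h <= K)%N -> (size (xth r i h) <= B)%N.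
Proof.
move=> iS sh; rewrite /rB /rK addSn addnC; apply: size_mul_le.
  by rewrite size_polyXn ltnS -ltnS ltn_divLR // mulnC.
exact: leq_trans (size_iter_theta _ _) sh.
Qed.

Let L_sum s m (c : 'I_m -> F) (h : 'I_m -> {poly F}) :
  L s (\sum_k c k *: h k) = \sum_k c k *: L s (h k).
Proof.
rewrite /aL; under eq_bigr => i _ do rewrite linear_sum scaler_sumr.
rewrite exchange_big; apply: eq_bigr => k _ /=; rewrite scaler_sumr.
by apply: eq_bigr => i _; rewrite linearZ /= !scalerA mulrC.
Qed.

Let size_L s (h : {poly F}) : (size h <= K)%N -> (size (L s h) <= B)%N.
Proof.
move=> sh; apply: size_sum_le => i _.
by apply: leq_trans (size_scale_leq _ _) (size_xth _ sh).
Qed.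

(** The value [L s g] is the sum of the [alpha i *: R i * f i ^+ (d - r)] with cofactors of low
    degree, and independence forces each of them to vanish. *)
Let L_fd s i : (s < S)%N -> L s (fd i) = 0.
Proof.
move=> sS; have Lg : L s g = 0.
  have szg : (size g <= K)%N by rewrite ag_eq szcomb.
  apply: (@poly_eqP _ B); rewrite ?size_poly0 ?size_L // => b bB.
  rewrite coef0 coef_sum -[RHS](kervec_ker solveP (fun i b => (xth r i g)`_b) sS bB).
  by apply: eq_bigr => k _; rewrite coefZ.
have HA i' k : exists A : {poly F}, (i' < S)%N -> xth r i' (fd k) = A * f k ^+ (d - r)
     /\ (size A <= (D + r * delta).+1)%N.
  case: (ltnP i' S) => [lt|]; last by exists 0.
  have [A eqA sA] := @xpow r (i' %% r.+1) (i' %/ r.+1) k (ltn_pmod _ (ltn0Sn r)).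
  exists A => _; split=> //; apply: leq_trans sA _; rewrite ltnS leq_add2r.
  by rewrite -ltnS ltn_divLR // mulnC.
have {HA} [A HA] := choice_fun (fun ik : nat * 'I_n => HA ik.1 ik.2).
pose R k := \sum_(i' < S) kap s i' *: A (i' : nat, k).
have LR k : L s (fd k) = R k * f k ^+ (d - r).
  rewrite /aL /R mulr_suml; apply: eq_bigr => i' _.
  by have [-> _] := HA (i' : nat, k) (ltn_ord i'); rewrite scalerAl.
rewrite LR; suff /eqP -> : R i == 0 by rewrite mul0r.
have : alpha i *: R i = 0.
  apply: (lowd (e := d - r) (a := D + r * delta) (R := fun i => alpha i *: R i)) => //.
  - exact: leq_subr.
  - move=> k; apply: leq_trans (size_scale_leq _ _) _; apply: size_sum_le => i' _.
    by apply: leq_trans (size_scale_leq _ _) _; case: (HA (i' : nat, k) (ltn_ord i')).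
  move: Lg; rewrite ag_eq /g0 L_sum => Lg; rewrite -[RHS]Lg.
  by apply: eq_bigr => k _; rewrite LR scalerAl.
by move/eqP; rewrite scaler_eq0 (negbTE (alpha0 i)).
Qed.

(* Counting coefficients gives a nonzero operator of order at most [n] and
   degree at most [D] that kills every [f i ^+ d]; [theta_kernel] then bounds
   its solution space by [n] dimensions. *)
Let L_ker (h : {poly F}) : (size h <= K)%N -> (forall s, (s < S)%N -> L s h = 0) ->
  exists c : 'I_n -> F, h = \sum_i c i *: fd i.
Proof.
move=> szh Lh.
pose U := (n.+1 * D.+1)%N; pose Cn := (D + n * delta).+1.
have HA u k : exists A : {poly F}, (u < U)%N ->
    'X^(u %/ n.+1) * iter (u %% n.+1) (@theta F) (fd k) = A * f k ^+ (d - n)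
     /\ (size A <= Cn)%N.
  case: (ltnP u U) => [lt|]; last by exists 0.
  have [A eqA sA] := @xpow n (u %% n.+1) (u %/ n.+1) k (ltn_pmod _ (ltn0Sn n)).
  exists A => _; split=> //; apply: leq_trans sA _; rewrite ltnS leq_add2r.
  by rewrite -ltnS ltn_divLR // mulnC.
have {HA} [A HA] := choice_fun (fun ik : nat * 'I_n => HA ik.1 ik.2).
pose i0 := Ordinal n_gt0.
pose Mx := \matrix_(u < U, q < n * Cn) (A (u : nat, insubd i0 (q %/ Cn)%N))`_(q %% Cn).
(* This count fixes [rD]: [(n+1)(D+1)] unknowns face [n (D + n delta + 1)] equations, so [D] must be
   at least [n^2 delta]. *)
have ltU : (n * Cn < U)%N.
  rewrite /U /Cn mulSn mulnS [(n * (D + _))%N]mulnDr /rD.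
  have : (n * (n * delta) <= r * r * delta)%N.
    by rewrite mulnA leq_mul2r leq_mul ?orbT.
  by rewrite mulnS; lia.
have [v v0 vM] := wide_ker Mx ltU.
have kA k : \sum_(u < U) v 0 u *: A (u : nat, k) = 0.
  apply: (@poly_eqP _ Cn); rewrite ?size_poly0 //.
    apply: size_sum_le => u _; apply: leq_trans (size_scale_leq _ _) _.
    by case: (HA (u : nat, k) (ltn_ord u)).
  move=> b bC; rewrite coef0 coef_sum.
  have ltq : (k * Cn + b < n * Cn)%N.
    apply: (@leq_trans (k.+1 * Cn)); last by rewrite leq_mul2r ltn_ord orbT.
    by rewrite mulSnr ltn_add2l.
  transitivity ((v *m Mx) 0 (Ordinal ltq)); last by rewrite vM mxE.
  rewrite mxE; apply: eq_bigr => u _; rewrite mxE coefZ /=.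
  rewrite divnMDl // modnMDl divn_small // modn_small // addn0.
  by congr (_ * (A (_, _))`_ _); apply: val_inj; rewrite val_insubd ltn_ord.
pose Lv (h : {poly F}) := \sum_(u < U) v 0 u *: ('X^(u %/ n.+1) * iter (u %% n.+1) (@theta F) h).
have Lvfd k : Lv (fd k) = 0.
  rewrite -[RHS](mul0r (f k ^+ (d - n))) -(kA k) mulr_suml.
  by apply: eq_bigr => u _; have [-> _] := HA (u : nat, k) (ltn_ord u); rewrite scalerAl.
have ltiu (u : nat) : (u %% n.+1 < r.+1)%N.
  by apply: leq_trans (ltn_pmod _ (ltn0Sn n)) _.
(* The operator has order at most [n <= r]; [iu] translates its index into the encoding of [xth]. *)
pose iu u := (u %/ n.+1 * r.+1 + u %% n.+1)%N.
have xthu u h' : xth r (iu u) h' = 'X^(u %/ n.+1) * iter (u %% n.+1) (@theta F) h'.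
  have e1 : (iu u %/ r.+1 = u %/ n.+1)%N by rewrite /iu divnMDl // (divn_small (ltiu u)) addn0.
  have e2 : (iu u %% r.+1 = u %% n.+1)%N by rewrite /iu modnMDl (modn_small (ltiu u)).
  by rewrite /xth e1 e2.
have iuS u : (u < U)%N -> (iu u < S)%N.
  move=> lt; rewrite /rS mulnC; apply: (@leq_trans ((u %/ n.+1).+1 * r.+1)%N).
    by rewrite mulSnr ltn_add2l ltiu.
  by rewrite leq_mul2r ltn_divLR // mulnC lt orbT.
pose x i := \sum_(u < U) (if i == iu u then v 0 u else 0).
have Lx h' : \sum_(i < S) x i *: xth r i h' = Lv h'.
  rewrite /x; under eq_bigr => i _ do rewrite scaler_suml.
  rewrite exchange_big; apply: eq_bigr => u _ /=.
  rewrite -xthu -[RHS](@sum_delta _ S (iu u)) ?iuS //.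
  by apply: eq_bigr => i _; case: eqP => [->|_]; rewrite ?scale0r.
have Lvg : Lv g0 = 0.
  rewrite -Lx /g0; under eq_bigr => i _ do rewrite linear_sum scaler_sumr.
  rewrite exchange_big big1 // => k _ /=.
  under eq_bigr => i _ do rewrite linearZ /= scalerA mulrC -scalerA.
  by rewrite -scaler_sumr Lx Lvfd scaler0.
(* As [Lv] kills [g], it is a combination of the generators [L s] and so kills [h]. *)
have [y Hy] : exists y : nat -> F, forall i, (i < S)%N ->
     x i = \sum_(s < S) y s * kap s i.
  apply: (kervec_gen solveP) => b bB.
  rewrite -[RHS](coef0 F b) -Lvg -Lx coef_sum ag_eq.
  by apply: eq_bigr => i _; rewrite coefZ.
have Lvh : Lv h = 0.
  rewrite -Lx; under eq_bigr => i _ do rewrite Hy ?ltn_ord // scaler_suml.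
  rewrite exchange_big big1 // => s _ /=.
  under eq_bigr => i _ do rewrite -scalerA.
  by rewrite -scaler_sumr -/(L s h) Lh ?scaler0.
pose Q (j : 'I_n.+1) := \sum_(u < U) (if (u %% n.+1 == j)%N then v 0 u *: 'X^(u %/ n.+1) else 0).
have QL h' : \sum_j Q j * iter j (@theta F) h' = Lv h'.
  rewrite /Q; under eq_bigr => j _ do rewrite mulr_suml.
  rewrite exchange_big; apply: eq_bigr => u _ /=.
  have ltm : (u %% n.+1 < n.+1)%N by rewrite ltn_pmod.
  rewrite (bigD1 (Ordinal ltm)) //= eqxx big1 ?addr0 ?scalerAl // => j ne.
  by rewrite eq_sym (negbTE (ne : (j : nat) != _)) mul0r.
(* The [n] powers and [h] are [n.+1] solutions of an operator with [n.+1] coefficients, so they are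
   dependent; the coefficient of [h] is nonzero because the powers alone are independent. *)
pose H (i : 'I_n.+1) := oapp fd h (unlift ord_max i).
have [c c0 cH] : exists2 c : 'rV_n.+1, c != 0 & \sum_i c 0 i *: H i = 0.
  apply: (theta_kernel (Q := Q) injK) => //.
  - have [u vu] : exists u, v 0 u != 0.
      apply/existsP; apply: contraNT v0; rewrite negb_exists => /forallP v0.
      by apply/eqP/rowP => j; have := v0 j; rewrite negbK mxE => /eqP.
    have ltm : (u %% n.+1 < n.+1)%N by rewrite ltn_pmod.
    exists (Ordinal ltm); apply: contraNneq vu => Q0.
    have := congr1 (fun p : {poly F} => p`_(u %/ n.+1)) Q0; rewrite coef0 coef_sum => <-.
    rewrite (bigD1 u) //= eqxx coefZ coefXn eqxx mulr1 big1 ?addr0 // => u' ne.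
    case: eqP => [Em|_]; last by rewrite coef0.
    rewrite coefZ coefXn; case: eqP => [Ed|_]; last by rewrite mulr0.
    case/eqP: ne; apply: val_inj; rewrite /= (divn_eq u' n.+1) (divn_eq u n.+1).
    by rewrite Em Ed.
  - by move=> i; rewrite /H; case: unliftP => [k _|_] /=.
  - by move=> i; rewrite QL /H; case: unliftP => [k _|_] /=.
move: cH; rewrite big_ord_recr /= {2}/H unlift_none /=.
have -> : \sum_(i < n) c 0 (widen_ord (leqnSn n) i) *: H (widen_ord (leqnSn n) i)
   = \sum_(i < n) c 0 (widen_ord (leqnSn n) i) *: fd i.
  apply: eq_bigr => i _; congr (_ *: _); rewrite /H.
  have -> : widen_ord (leqnSn n) i = lift ord_max i.
    by apply: val_inj; rewrite /= /bump leqNgt ltn_ord.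
  by rewrite liftK.
set cm := c 0 ord_max => cH.
have cm0 : cm != 0.
  apply: contraNneq c0 => cm0; move: cH; rewrite cm0 scale0r addr0 => cH.
  apply/eqP/rowP => i; rewrite mxE; case: (unliftP ord_max i) => [k ->|->]; last exact: cm0.
  have -> : lift ord_max k = widen_ord (leqnSn n) k.
    by apply: val_inj; rewrite /= /bump leqNgt ltn_ord.
  apply: (@indep (fun k => c 0 (widen_ord (leqnSn n) k)) (fun=> 0)); rewrite cH.
  by rewrite big1 // => j _; rewrite scale0r.
exists (fun i => - cm^-1 * c 0 (widen_ord (leqnSn n) i)).
under eq_bigr => i _ do rewrite -scalerA.
rewrite -scaler_sumr; move/eqP: cH; rewrite addr_eq0 => /eqP ->.
by rewrite scaleNr scalerN opprK scalerA mulVf ?scale1r.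
Qed.

Let Nrow_sum (x : nat -> F) q :
  \sum_(k < K) x k * aN solve r d delta val k q
  = (L (q %/ B) (\poly_(k < K) x k))`_(q %% B).
Proof.
rewrite poly_def L_sum coef_sum; apply: eq_bigr => k _; by rewrite coefZ.
Qed.

(** Together with [comb_w]: the [w k] span the same space as the powers [fd i]. They need not form a
    basis, as [w k] is zero where no kernel vector starts. *)
Let w_comb k : (k < K)%N -> exists c : 'I_n -> F, w k = \sum_i c i *: fd i.
Proof.
move=> kK; apply: L_ker; first exact: size_poly.
move=> s sS; apply: (@poly_eqP _ B); rewrite ?size_poly0 ?size_L ?size_poly // => b bB.
rewrite coef0.
have lt : (s * B + b < S * B)%N.
  apply: (@leq_trans (s.+1 * B)); last by rewrite leq_mul2r sS orbT.
  by rewrite [(s.+1 * _)%N]mulSnr ltn_add2l.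
have := kervec_ker solveP (aN solve r d delta val) kK lt; rewrite Nrow_sum => {2}<-.
by rewrite divnMDl // modnMDl divn_small // modn_small // addn0.
Qed.

Let comb_w (c : 'I_n -> F) : exists y : nat -> F,
  \sum_(k < K) y k *: w k = \sum_i c i *: fd i.
Proof.
set h := \sum_i _.
have [y Hy] : exists y : nat -> F, forall i, (i < K)%N -> h`_i =
     \sum_(s < K) y s * kervec solve K (S * B) (aN solve r d delta val) s i.
  apply: (kervec_gen solveP) => q qlt; rewrite Nrow_sum.
  have -> : \poly_(k < K) h`_k = h.
    by apply: (@poly_eqP _ K); rewrite ?size_poly ?szcomb // => b bK; rewrite coef_poly bK.
  rewrite /h L_sum big1 ?coef0 // => k _; rewrite L_fd ?scaler0 //.
  by rewrite ltn_divLR.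
exists y; apply: (@poly_eqP _ K); rewrite ?szcomb //.
  by apply: size_sum_le => k _; apply: leq_trans (size_scale_leq _ _) (size_poly _ _).
move=> b bK; rewrite Hy // coef_sum; apply: eq_bigr => k _.
by rewrite coefZ coef_poly bK.
Qed.

Let wsum_comb (y : nat -> F) : exists c : 'I_n -> F,
  \sum_(k < K) y k *: w k = \sum_i c i *: fd i.
Proof.
have H k : exists c : 'I_n -> F, (k < K)%N -> w k = \sum_i c i *: fd i.
  case: (ltnP k K) => [lt|]; last by exists (fun=> 0).
  by have [c Hc] := w_comb lt; exists c.
have [c Hc] := choice_fun H.
exists (fun i => \sum_(k < K) y k * c k i).
under eq_bigr => k _ do rewrite Hc ?ltn_ord // scaler_sumr.
rewrite exchange_big; apply: eq_bigr => i _ /=; rewrite scaler_suml.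
by apply: eq_bigr => k _; rewrite scalerA.
Qed.

Let theta_fd i : theta (fd i) = d%:R *: (theta (f i) * f i ^+ d.-1).
Proof. by rewrite /fd thetaX scaler_nat. Qed.

Let fdS i : fd i = f i * f i ^+ d.-1.
Proof. by rewrite -exprS prednK. Qed.

Let sum_axw (x : nat -> F) :
  \sum_(q < E.+1 * K) x q *: axw solve r d delta val q
  = \sum_(m < E.+1) 'X^m * \sum_(l < K) x (m * K + l)%N *: w l.
Proof.
transitivity (\sum_(m < E.+1) \sum_(l < K) 'X^m * (x (m * K + l)%N *: w l)); last first.
  by apply: eq_bigr => m _; rewrite mulr_sumr.
rewrite -(@sum_divmod _ E.+1 K (fun m l => 'X^m * (x (m * K + l)%N *: w l))).
by apply: eq_bigr => q _ /=; rewrite /axw -divn_eq -scalerAr.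
Qed.

(** The same polynomials [P i] describe a combination of the [x^m w l] and what it becomes when only
    the coefficients [x^m] are evaluated at [t]. This links [a * theta] to its specialization. *)
Let blocks_comb (x : nat -> F) : exists P : 'I_n -> {poly F},
  [/\ forall i, (size (P i) <= E.+1)%N,
      forall t, \sum_(m < E.+1) t ^+ m *: \sum_(l < K) x (m * K + l)%N *: w l
          = \sum_i (P i).[t] *: fd i
    & \sum_(q < E.+1 * K) x q *: axw solve r d delta val q = \sum_i P i * fd i].
Proof.
have [c Hc] := choice_fun (fun m => wsum_comb (fun l => x (m * K + l)%N)).
exists (fun i => \poly_(m < E.+1) c m i); split=> [i|t|]; first exact: size_poly.
  under eq_bigr => m _ do rewrite Hc scaler_sumr.
  rewrite exchange_big; apply: eq_bigr => i _ /=; rewrite horner_poly scaler_suml.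
  by apply: eq_bigr => m _; rewrite scalerA mulrC.
rewrite sum_axw; under eq_bigr => m _ do rewrite Hc mulr_sumr.
rewrite exchange_big; apply: eq_bigr => i _ /=; rewrite poly_def mulr_suml.
by apply: eq_bigr => m _; rewrite -scalerAr -scalerAl.
Qed.

Let comb_blocks (P : 'I_n -> {poly F}) : (forall i, (size (P i) <= E.+1)%N) ->
  exists x : nat -> F,
   \sum_(q < E.+1 * K) x q *: axw solve r d delta val q = \sum_i P i * fd i.
Proof.
move=> szP; have [y Hy] := choice_fun (fun m => comb_w (fun i => (P i)`_m)).
exists (fun q => y (q %/ K)%N (q %% K)%N).
rewrite (sum_axw (fun q => y (q %/ K)%N (q %% K)%N)).
transitivity (\sum_(m < E.+1) 'X^m * \sum_i (P i)`_m *: fd i).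
  apply: eq_bigr => m _; congr (_ * _); rewrite -Hy; apply: eq_bigr => l _.
  by rewrite divnMDl // modnMDl divn_small // modn_small // addn0.
under eq_bigr => m _ do rewrite mulr_sumr.
rewrite exchange_big; apply: eq_bigr => i _ /=.
have {2}-> : P i = \sum_(m < E.+1) (P i)`_m *: 'X^m.
  by rewrite -poly_def; apply: (@poly_eqP _ E.+1); rewrite ?size_poly // => b bE; rewrite coef_poly bE.
by rewrite mulr_suml; apply: eq_bigr => m _; rewrite -scalerAr -scalerAl.
Qed.

Let size_prodf (P : pred 'I_n) : (size (\prod_(j | P j) f j)%R <= (#|P| * delta).+1)%N.
Proof.
rewrite -sum_nat_const; elim/big_rec2: _ => [|i m p _ IH]; first by rewrite size_poly1.
exact: size_mul_le.
Qed.

Local Notation a := (aa solve r d delta val).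

Let a_exists : exists x : nat -> F, (exists2 s, (s < E.+1)%N & x s != 0) /\
  \sum_(q < M) x q *: arow solve r d delta val q = 0.
Proof.
(* The common denominator of the logarithmic derivatives of the [fd i]; its degree bound is the
   origin of [rE]. *)
pose a0 := \prod_j f j.
pose p0 i := d%:R *: (theta (f i) * \prod_(j | j != i) f j).
have sza0 : (size a0 <= E.+1)%N.
  by apply: leq_trans (size_prodf _) _; rewrite ltnS leq_mul2r card_ord nr orbT.
have szp0 i : (size (p0 i) <= E.+1)%N.
  apply: leq_trans (size_scale_leq _ _) _.
  apply: (@leq_trans (delta + #|predC1 i| * delta).+1%N).
    apply: size_mul_le; first exact: leq_trans (size_theta _) (szf i).
    exact: size_prodf.
  rewrite ltnS -mulSn leq_mul2r; apply/orP; right.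
  by rewrite cardC1 card_ord prednK.
have ap i : a0 * theta (fd i) = p0 i * fd i.
  rewrite theta_fd /a0 (bigD1 i) //= fdS /p0 -!scalerAr -!scalerAl; congr (_ *: _); ring.
have a00 : a0 != 0 by apply/prodf_neq0 => i _.
have [y Hy] := comb_blocks (P := fun i => alpha i *: p0 i)
   (fun i => leq_trans (size_scale_leq _ _) (szp0 i)).
exists (fun q => if (q < E.+1)%N then a0`_q else - y (q - E.+1)%N); split.
  exists (size a0).-1; first by rewrite prednK ?size_poly_gt0.
  by rewrite prednK ?size_poly_gt0 // sza0 -/(lead_coef a0) lead_coef_eq0.
rewrite /rM big_split_ord /=.
have -> : \sum_(i < E.+1) (if (i < E.+1)%N then a0`_i else - y (i - E.+1)%N) *: arow solve r d delta val i
    = a0 * theta g.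
  transitivity (\sum_(i < E.+1) (a0`_i *: 'X^i) * theta g).
    by apply: eq_bigr => i _; rewrite /arow !ltn_ord scalerAl.
  rewrite -mulr_suml -poly_def; congr (_ * _).
  by apply: (@poly_eqP _ E.+1); rewrite ?size_poly // => b bE; rewrite coef_poly bE.
have -> : a0 * theta g = \sum_i (alpha i *: p0 i) * fd i.
  rewrite ag_eq linear_sum mulr_sumr; apply: eq_bigr => i _ /=.
  by rewrite linearZ /= -scalerAr ap scalerAl.
rewrite -Hy -big_split big1 // => q _ /=.
rewrite /arow ltnNge leq_addr /= addKn scaleNr.
by rewrite addrN.
Qed.

Let size_axw q : (q < E.+1 * K)%N -> (size (axw solve r d delta val q) <= BE)%N.
Proof.
move=> lt; rewrite /rBE /rK addSn addnC; apply: size_mul_le; last exact: size_poly.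
by rewrite size_polyXn ltn_divLR.
Qed.

Let size_arow q : (q < M)%N -> (size (arow solve r d delta val q) <= BE)%N.
Proof.
rewrite /rM /arow; case: (ltnP q E.+1) => [lt _|le lt].
  rewrite /rBE /rK addSn addnC; apply: size_mul_le; first by rewrite size_polyXn.
  by apply: leq_trans (size_theta _) _; rewrite ag_eq szcomb.
by apply: size_axw; rewrite ltn_subLR.
Qed.

Let aidxP : exists2 kv : nat -> F,
    (forall l, (l < E.+1)%N -> a`_l = kv l) /\ (exists2 s, (s < E.+1)%N & kv s = 1)
    & \sum_(q < M) kv q *: arow solve r d delta val q = 0.
Proof.
set rows := fun i b => (arow solve r d delta val i)`_b.
have EM s : (s < E.+1)%N -> (s < M)%N by move=> lt; apply: leq_trans lt (leq_addr _ _).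
have [x [[s0 s0E xs0] Hx]] := a_exists.
have ex : exists s, x s != 0 by exists s0.
case: (ex_minnP ex) => s xs smin.
have sE : (s < E.+1)%N by apply: leq_ltn_trans (smin _ xs0) s0E.
have Hs : kersol solve M BE rows s.
  apply: (kersol_some solveP (EM _ sE) (x := x)) => //.
    move=> j jB; rewrite -[RHS](coef0 F j) -Hx coef_sum.
    by apply: eq_bigr => i _; rewrite coefZ.
  by move=> i lt; apply/eqP; apply: contraTT lt => xi; rewrite -leqNgt smin.
set p := fun s => isSome (kersol solve M BE rows s).
have hasp : has p (iota 0 E.+1) by apply/hasP; exists s => //; rewrite mem_iota.
set i := aidx solve r d delta val.
have lti : (i < E.+1)%N by move: hasp; rewrite has_find size_iota.
have Hi : p i by have := nth_find 0%N hasp; rewrite nth_iota.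
exists (kervec solve M BE rows i); first split.
- by move=> l lt; rewrite /aa coef_poly lt.
- exists i => //; move: Hi; rewrite /p /kervec; case: kersol => // c _.
  by rewrite ltnn eqxx.
apply: (@poly_eqP _ BE); rewrite ?size_poly0 //.
  apply: size_sum_le => q _; apply: leq_trans (size_scale_leq _ _) _.
  exact: size_arow.
move=> b bB; rewrite coef0 -[RHS](kervec_ker solveP rows (EM _ lti) bB) coef_sum.
by apply: eq_bigr => q _; rewrite coefZ.
Qed.

(** The multiplier found may differ from the product of the [f i], but the relation for [g] alone
    still splits: with the factors [f i ^+ d.-1] taken out, the cofactors [R i] have low degree and
    vanish one by one. *)
Lemma aa_spec : a != 0 /\ exists2 p : 'I_n -> {poly F},
  forall i, (size (p i) <= E.+1)%N & forall i, a * theta (fd i) = p i * fd i.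
Proof.
have [kv [kva [s sE kvs]] rel] := aidxP; split.
  apply/eqP => a0; have := kva s sE; rewrite a0 coef0 kvs => /esym/eqP.
  by rewrite oner_eq0.
have [P [szP _ HP]] := blocks_comb (fun q => - kv (E.+1 + q)%N).
have rel' : a * theta g = \sum_i P i * fd i.
  rewrite -HP; move: rel; rewrite /rM big_split_ord /= => /eqP.
  have -> : \sum_(i < E.+1) kv i *: arow solve r d delta val i = a * theta g.
    transitivity (\sum_(i < E.+1) (a`_i *: 'X^i) * theta g).
      by apply: eq_bigr => i _; rewrite /arow ltn_ord kva // scalerAl.
    rewrite -mulr_suml -poly_def; congr (_ * _).
    by apply: (@poly_eqP _ E.+1); rewrite ?size_poly // => b bE; rewrite coef_poly bE.
  rewrite addr_eq0 => /eqP ->; rewrite -sumrN; apply: eq_bigr => q _.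
  by rewrite /arow ltnNge leq_addr /= addKn scaleNr.
pose R i := (alpha i * d%:R) *: (a * theta (f i)) - P i * f i.
have R0 i : R i = 0.
  apply: (lowd (e := d.-1) (a := E + delta) (R := R)).
  - by rewrite -subn1 leq_sub2l.
  - exact: leq_pred.
  - rewrite /rE /rD addnC leq_add2r -mulnA; apply: (@leq_trans (r * delta)); first exact: leq_pmull.
    by rewrite leq_pmull.
  - move=> j; apply: size_add_le; rewrite ?size_polyN; last exact: size_mul_le.
    apply: leq_trans (size_scale_leq _ _) _; apply: size_mul_le; first exact: size_poly.
    exact: leq_trans (size_theta _) (szf j).
  under eq_bigr => j _ do rewrite mulrBl.
  rewrite sumrB; apply/eqP; rewrite subr_eq0; apply/eqP.
  transitivity (a * theta g).
    rewrite ag_eq linear_sum mulr_sumr; apply: eq_bigr => j _ /=.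
    by rewrite linearZ /= theta_fd scalerA -!scalerAr -scalerAl -mulrA.
  by rewrite rel'; apply: eq_bigr => j _; rewrite fdS mulrA.
exists (fun i => (alpha i)^-1 *: P i) => i.
  exact: leq_trans (size_scale_leq _ _) (szP i).
have E1 : P i * fd i = (alpha i * d%:R) *: (a * theta (f i)) * f i ^+ d.-1.
  by have /eqP := R0 i; rewrite subr_eq0 => /eqP ->; rewrite fdS mulrA.
rewrite -scalerAl E1 theta_fd -scalerAl scalerA mulKf // -scalerAr.
by congr (_ *: _); apply: mulrA.
Qed.

Let size_prod_le (I : finType) (P : pred I) (G : I -> {poly F}) (s : I -> nat) :
  (forall i, P i -> (size (G i) <= (s i).+1)%N) ->
  (size (\prod_(i | P i) G i)%R <= (\sum_(i | P i) s i).+1)%N.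
Proof.
move=> H; elim/big_rec2: _ => [|i m p Pi IH]; first by rewrite size_poly1.
by apply: size_mul_le => //; apply: H.
Qed.

(** The operator [h1 theta - theta(h1)] of order one kills both polynomials, so [theta_kernel] makes
    them proportional. *)
Let dep2 (h1 h2 : {poly F}) (m : nat) : inj_nat F m ->
  (size h1 <= m)%N -> (size h2 <= m)%N -> h1 != 0 ->
  h1 * theta h2 = theta h1 * h2 ->
  exists c1 c2 : F, ((c1 != 0) || (c2 != 0)) /\ c1 *: h1 + c2 *: h2 = 0.
Proof.
move=> injm s1 s2 h10 eqh.
pose Q (j : 'I_2) := if j == ord0 then - theta h1 else h1.
pose h (j : 'I_2) := if j == ord0 then h1 else h2.
have [||||c c0] := @theta_kernel F 2 2 m Q h injm.
- by exists (lift ord0 ord0).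
- by [].
- by move=> i; rewrite /h; case: ifP.
- move=> i; rewrite !big_ord_recl big_ord0 /= addr0 /Q /h /=.
  case: ifP => _; first by rewrite mulNr [h1 * _]mulrC addNr.
  by rewrite eqh mulNr addNr.
rewrite !big_ord_recl big_ord0 /= addr0 /h /= => ch.
exists (c 0 ord0), (c 0 (lift ord0 ord0)); split=> //.
rewrite -negb_and; apply: contra c0 => /andP[/eqP c1 /eqP c2].
by apply/eqP/rowP => j; rewrite mxE; case: (unliftP ord0 j) => [k ->|->] //; rewrite (ord1 k).
Qed.

Section WithExponents.
Variable p : 'I_n -> {poly F}.
Hypothesis szp : forall i, (size (p i) <= E.+1)%N.
Hypothesis ap : forall i, a * theta (fd i) = p i * fd i.
Hypothesis a_neq0 : a != 0.

Local Notation z := (az solve r d delta val).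
Local Notation nu := (anu solve r d delta val).
Local Notation tt := (at_ solve r d delta val).

Let atheta (c : 'I_n -> F) :
  a * theta (\sum_i c i *: fd i) = \sum_i (c i *: p i) * fd i.
Proof.
rewrite linear_sum mulr_sumr; apply: eq_bigr => i _ /=.
by rewrite linearZ /= -scalerAr ap scalerAl.
Qed.

Let szcp (c : 'I_n -> F) i : (size (c i *: p i) <= E.+1)%N.
Proof. exact: leq_trans (size_scale_leq _ _) (szp i). Qed.

Let acP k : (k < K)%N ->
  \sum_(q < E.+1 * K) ac solve r d delta val k q *: axw solve r d delta val q
  = a * theta (w k).
Proof.
move=> kK; have [c Hc] := w_comb kK; have [x Hx] := comb_blocks (szcp c).
apply: (pspanP solveP (x := x)); first by move=> i; apply: size_axw.
by rewrite Hx Hc atheta.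
Qed.

Let ayP : \sum_(l < K) ay solve r d delta val l *: w l = g.
Proof.
have [y Hy] := comb_w alpha.
apply: (pspanP solveP (x := y)); first by move=> i _; apply: size_poly.
by rewrite Hy ag_eq.
Qed.

(** The expansions [ac k] are not unique, but the cofactors of the [fd i] are, by [lowd_d]; hence
    [aC t] multiplies the [i]-th component by the value of [p i] at [t], whatever the solver
    returned. *)
Let stepP t (v : nat -> F) (c : 'I_n -> F) :
  \sum_(l < K) v l *: w l = \sum_i c i *: fd i ->
  \sum_(l < K) (\sum_(k < K) v k * aC solve r d delta val t k l) *: w l
  = \sum_i (c i * (p i).[t%:R]) *: fd i.
Proof.
move=> Hv; pose gm q := \sum_(k < K) v k * ac solve r d delta val k q.
have [P [szP HP1 HP2]] := blocks_comb gm.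
have PE i : P i = c i *: p i.
  apply: (@lowd_d P (fun i => c i *: p i)) => //; rewrite -HP2 -atheta -Hv.
  rewrite linear_sum mulr_sumr.
  under eq_bigr => q _ do rewrite /gm scaler_suml.
  rewrite exchange_big; apply: eq_bigr => k _ /=.
  rewrite linearZ /= -scalerAr -acP // scaler_sumr.
  by apply: eq_bigr => q _; rewrite scalerA.
transitivity (\sum_(m < E.+1) t%:R ^+ m *: \sum_(l < K) gm (m * K + l)%N *: w l); last first.
  by rewrite HP1; apply: eq_bigr => i _; rewrite PE hornerZ.
under [RHS]eq_bigr => m _ do rewrite scaler_sumr.
rewrite [RHS]exchange_big; apply: eq_bigr => l _ /=.
under [RHS]eq_bigr => m _ do rewrite scalerA.
rewrite -scaler_suml; congr (_ *: _); rewrite /aC /gm.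
under eq_bigr => k _ do rewrite mulr_sumr.
rewrite exchange_big; apply: eq_bigr => m _ /=; rewrite mulr_sumr.
by apply: eq_bigr => k _; rewrite mulrCA.
Qed.

Let pt t i := (p i).[t%:R : F].

Let azE t j : z t j = \sum_i (alpha i * pt t i ^+ j) *: fd i.
Proof.
elim: j => [|j IH].
  by rewrite /az /= ayP ag_eq; apply: eq_bigr => i _; rewrite expr0 mulr1.
rewrite /az /kry iterS -/(kry _ _ _ j).
rewrite (stepP _ (c := fun i => alpha i * pt t i ^+ j)) //.
by apply: eq_bigr => i _; rewrite exprSr mulrA.
Qed.

Let zrel t m (u : nat -> F) : \sum_(k < m) u k *: z t k
  = \sum_i (alpha i * (\poly_(k < m) u k).[pt t i]) *: fd i.
Proof.
under eq_bigr => k _ do rewrite azE scaler_sumr.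
rewrite exchange_big; apply: eq_bigr => i _ /=.
under eq_bigr => k _ do rewrite scalerA mulrCA.
by rewrite -scaler_suml horner_poly mulr_sumr.
Qed.

(** A relation among the iterates is a polynomial in the endomorphism that kills [g]; as no
    [alpha i] vanishes, it must be zero at every eigenvalue. *)
Let zrel0 t m (u : nat -> F) : \sum_(k < m) u k *: z t k = 0 <->
  forall i, (\poly_(k < m) u k).[pt t i] = 0.
Proof.
rewrite zrel; split=> [H i|H]; last first.
  by rewrite big1 // => i _; rewrite H mulr0 scale0r.
have := @indep (fun i => alpha i * (\poly_(k < m) u k).[pt t i]) (fun=> 0) _ i.
rewrite H big1 => [/(_ erefl)/eqP|j _]; last by rewrite scale0r.
by rewrite mulf_eq0 (negbTE (alpha0 i)) => /eqP.
Qed.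

Let szz t k : (size (z t k) <= K)%N.
Proof. by rewrite azE szcomb. Qed.

Let tst t m := find (fun s => isSome (kersol solve m K (fun i b => (z t i)`_b) s)) (iota 0 m) == m.

Let tst_indep t m : tst t m -> forall u : nat -> F,
  \sum_(k < m) u k *: z t k = 0 -> forall k, (k < m)%N -> u k = 0.
Proof.
move=> ts u Hu k0 k0m; apply/eqP/negPn/negP => uk0.
have ex : exists k, u k != 0 by exists k0.
case: (ex_minnP ex) => k uk kmin.
have km : (k < m)%N by apply: leq_ltn_trans (kmin _ uk0) k0m.
have Hk : kersol solve m K (fun i b => (z t i)`_b) k.
  apply: (kersol_some solveP km (x := u)) => //.
    move=> j jK; rewrite -[RHS](coef0 F j) -Hu coef_sum.
    by apply: eq_bigr => i _; rewrite coefZ.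
  by move=> i lt; apply/eqP; apply: contraTT lt => ui; rewrite -leqNgt kmin.
have : has (fun s => isSome (kersol solve m K (fun i b => (z t i)`_b) s)) (iota 0 m).
  by apply/hasP; exists k => //; rewrite mem_iota.
by rewrite has_find size_iota; move/eqP: ts => ->; rewrite ltnn.
Qed.

Let indep_tst t m : (forall u : nat -> F,
  \sum_(k < m) u k *: z t k = 0 -> forall k, (k < m)%N -> u k = 0) -> tst t m.
Proof.
move=> H; rewrite /tst; set q := fun s => _.
have [hq|/hasNfind ->] := boolP (has q (iota 0 m)); last by rewrite size_iota.
have lt : (find q (iota 0 m) < m)%N by move: hq; rewrite has_find size_iota.
have := nth_find 0%N hq; rewrite nth_iota // add0n /q => Hs.
set s := find _ _ in lt Hs.
have kvs : kervec solve m K (fun i b => (z t i)`_b) s s = 1.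
  by move: Hs; rewrite /kervec; case: kersol => // c _; rewrite ltnn eqxx.
have rel : \sum_(k < m) kervec solve m K (fun i b => (z t i)`_b) s k *: z t k = 0.
  apply: (@poly_eqP _ K); rewrite ?size_poly0 //.
    by apply: size_sum_le => k _; apply: leq_trans (size_scale_leq _ _) (szz _ _).
  move=> b bK; rewrite coef0 -[RHS](kervec_ker solveP (fun i b => (z t i)`_b) lt bK) coef_sum.
  by apply: eq_bigr => k _; rewrite coefZ.
by have /eqP := H _ rel s lt; rewrite kvs oner_eq0.
Qed.

(** Equal [p i] and [p j] give [fd i] and [fd j] the same logarithmic derivative, so [dep2] makes
    them proportional, against their independence. *)
Let p_inj i j : p i = p j -> i = j.
Proof.
move=> pij; apply/eqP/negPn/negP => ij.
have eqh : fd i * theta (fd j) = theta (fd i) * fd j.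
  have e1 : a * (fd i * theta (fd j)) = fd i * (a * theta (fd j)) by rewrite mulrCA.
  have e2 : a * (theta (fd i) * fd j) = a * theta (fd i) * fd j by apply: mulrA.
  by apply: (mulfI a_neq0); rewrite e1 e2 !ap pij; ring.
have fd0 : fd i != 0 by rewrite expf_neq0.
have [c1 [c2 [c12 rel]]] := dep2 injK (szfd i) (szfd j) fd0 eqh.
pose c l : F := (if l == i then c1 else 0) + (if l == j then c2 else 0).
have cz : \sum_l c l *: fd l = \sum_l (0 : F) *: fd l.
  rewrite [RHS]big1 => [|l _]; last by rewrite scale0r.
  rewrite -[RHS]rel /c; under eq_bigr => l _ do rewrite scalerDl.
  rewrite big_split /=; congr (_ + _).
    by rewrite (bigD1 i) //= eqxx big1 ?addr0 // => l /negbTE ->; rewrite scale0r.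
  by rewrite (bigD1 j) //= eqxx big1 ?addr0 // => l /negbTE ->; rewrite scale0r.
have := indep cz i; have := indep cz j; rewrite /c !eqxx (negbTE ij) eq_sym (negbTE ij).
by rewrite add0r addr0 => c20 c10; move: c12; rewrite c10 c20 eqxx.
Qed.

Let good_t : exists2 t, (t < T)%N & injective (pt t).
Proof.
(* A nonzero value of this product at [t] separates all the [p i]; its degree is at most [r^2] times
   [rE], less than the number [rT] of points. *)
pose De := \prod_i \prod_(j | j != i) (p i - p j).
have De0 : De != 0.
  apply/prodf_neq0 => i _; apply/prodf_neq0 => j ji; rewrite subr_eq0.
  by apply: contra ji => /eqP/p_inj ->.
have szDe : (size De <= T)%N.
  apply: (@leq_trans (\sum_(i < n) \sum_(j < n | j != i) E).+1%N).
    apply: size_prod_le => i _; apply: size_prod_le => j _.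
    by apply: size_add_le; rewrite ?size_polyN.
  rewrite ltnS /rT -mulnA; apply: (@leq_trans (\sum_(i < n) r * E)%N).
    apply: leq_sum => i _; rewrite sum_nat_const leq_mul2r; apply/orP; right.
    by apply: leq_trans (max_card _) _; rewrite card_ord.
  by rewrite sum_nat_const card_ord leq_mul2r nr orbT.
have injT : inj_nat F T.
  apply: inj_nat_le hinj; rewrite ltnS /rE; have [->|dl] := posnP delta; first by rewrite !muln0.
  rewrite !mulnA leq_mul2r; apply/orP; right; rewrite -mulnA mulnC -!mulnA.
  have H : (r * r <= d)%N.
    apply: ltnW; apply: leq_ltn_trans hd; apply: leq_trans (leq_pmulr _ dl).
    by rewrite !expnS expn0 muln1; lia.
  by rewrite mulnCA leq_mul2l; apply/orP; right; lia.
have [t /andP[tT Dt]] : exists t, (t < T)%N && (De.[t%:R] != 0).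
  apply: NNPP => Hno; case/eqP: De0.
  apply: (@roots_geq_poly_eq0 _ _ [seq t%:R | t <- iota 0 T]).
  - apply/allP => x /mapP[t]; rewrite mem_iota add0n => /andP[_ lt] ->.
    by apply: contraT => Dt; case: Hno; exists t; rewrite lt.
  - rewrite map_inj_in_uniq ?iota_uniq // => x y.
    by rewrite !mem_iota !add0n => /andP[_ la] /andP[_ lb]; apply: injT.
  by rewrite size_map size_iota.
exists t => // i j pij; apply/eqP/negPn/negP => ij; case/eqP: Dt.
rewrite /De (bigD1 i) //= hornerM (bigD1 j) 1?eq_sym //= hornerM hornerD hornerN.
by rewrite -/(pt t i) pij subrr !mul0r.
Qed.

Let prodX (P : pred 'I_n) t := \prod_(i | P i) ('X - (pt t i)%:P).

(** The product of all ['X - (pt t i)%:P] has degree [n] and kills [g], so more than [n] iterates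
    are dependent. *)
Let no_wide t m : (n < m)%N -> ~~ tst t m.
Proof.
move=> nm; apply/negP => /tst_indep H.
have mon : prodX predT t \is monic by apply: monic_prod_XsubC.
have sz : size (prodX predT t) = n.+1 by rewrite size_prod_XsubC -[X in _ = X.+1]card_ord cardE enumT.
have Hp : \poly_(k < m) (prodX predT t)`_k = prodX predT t.
  by apply: (@poly_eqP _ m); rewrite ?size_poly ?sz // => b bm; rewrite coef_poly bm.
have := H (fun k => (prodX predT t)`_k) _ n nm.
have -> : (prodX predT t)`_n = 1 by have /eqP := mon; rewrite /lead_coef sz.
move=> /(_ _)/eqP; rewrite oner_eq0 => H1; suff: false by []; apply: H1.
apply/zrel0 => i; rewrite Hp horner_prod (bigD1 i) //=.
by rewrite hornerD hornerN hornerX hornerC subrr mul0r.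
Qed.

(** If two eigenvalues coincide, the product over all indices but one already kills [g] and makes
    [n] iterates dependent. *)
Let narrow t : tst t n -> injective (pt t).
Proof.
move=> /tst_indep H i j pij; apply/eqP/negPn/negP => ij.
pose U := prodX (predC1 j) t.
have szU : (size U <= n)%N.
  apply: (@leq_trans (\sum_(i < n | predC1 j i) 1).+1%N).
    by apply: size_prod_le => k _; rewrite size_XsubC.
  by rewrite sum1_card cardC1 card_ord prednK.
have mon : U \is monic by apply: monic_prod_XsubC.
have U0 : (0 < size U)%N by rewrite size_poly_gt0 monic_neq0.
have Hp : \poly_(k < n) U`_k = U.
  by apply: (@poly_eqP _ n); rewrite ?size_poly // => b bm; rewrite coef_poly bm.
have rel : \sum_(k < n) U`_k *: z t k = 0.
  apply/zrel0 => l; rewrite Hp horner_prod.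
  have [->|lj] := eqVneq l j.
    by rewrite (bigD1 i) //= hornerD hornerN hornerX hornerC pij subrr mul0r.
  by rewrite (bigD1 l) //= hornerD hornerN hornerX hornerC subrr mul0r.
have := H _ rel (size U).-1; rewrite -/(lead_coef U) (eqP mon) prednK // => /(_ szU)/eqP.
by rewrite oner_eq0.
Qed.

(** Guesses above [n] fail at every point, and the guess [n] succeeds exactly at separating points,
    one of which is among the candidates. As guesses come in decreasing order, the first success has
    both the right number and a separating point. *)
Lemma anu_eq : nu = n /\ injective (pt tt).
Proof.
have [t0 t0T inj0] := good_t.
have tst0 : tst t0 n.
  apply: indep_tst => u /zrel0 H k kn.
  have : \poly_(k < n) u k = 0.
    apply: (@roots_geq_poly_eq0 _ _ [seq pt t0 i | i <- enum 'I_n]).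
    - by apply/allP => x /mapP[i _ ->]; apply/rootP; apply: H.
    - by rewrite map_inj_uniq ?enum_uniq.
    by rewrite size_map size_enum_ord size_poly.
  by move/polyP/(_ k); rewrite coef_poly kn coef0.
pose q0 := ((r - n) * T + t0)%N.
have q0d : (q0 %/ T = r - n)%N by rewrite /q0 divnMDl // divn_small // addn0.
have q0m : (q0 %% T = t0)%N by rewrite /q0 modnMDl modn_small.
have q0lt : (q0 < r * T)%N.
  apply: (@leq_trans ((r - n).+1 * T)); first by rewrite mulSnr ltn_add2l.
  by rewrite leq_mul2r; apply/orP; right; lia.
have tq0 : atest solve r d delta val q0.
  by rewrite /atest q0d q0m subKn.
have hs : has (atest solve r d delta val) (iota 0 (r * T)).
  by apply/hasP; exists q0 => //; rewrite mem_iota.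
set q := aq solve r d delta val.
have qlt : (q < r * T)%N by move: hs; rewrite has_find size_iota.
have tq : atest solve r d delta val q by have := nth_find 0%N hs; rewrite nth_iota.
have qle : (q <= q0)%N.
  rewrite leqNgt; apply/negP => /(before_find 0%N); rewrite nth_iota // add0n.
  by rewrite tq0.
have qd : (q %/ T <= r - n)%N by rewrite -q0d leq_div2r.
have nuge : (n <= nu)%N by rewrite /anu -/q; lia.
have tq' : tst tt nu by [].
have nuE : nu = n.
  apply/eqP; rewrite eqn_leq nuge andbT leqNgt; apply/negP => lt.
  by have := no_wide tt lt; rewrite tq'.
by split=> //; apply: narrow; rewrite -[X in tst _ X]nuE.
Qed.

Let nuE : nu = n. Proof. by case: anu_eq. Qed.
Let pinj : injective (pt tt). Proof. by case: anu_eq. Qed.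

Let i0 : 'I_n := Ordinal n_gt0.

(** Both sides are monic of degree [n] and vanish at the [n] distinct eigenvalues. *)
Lemma chiP : 'X^n - \poly_(k < n) achi solve r d delta val k
  = \prod_(i < n) ('X - (pt tt (insubd i0 (i : nat)))%:P).
Proof.
have -> : \prod_(i < n) ('X - (pt tt (insubd i0 (i : nat)))%:P) = prodX predT tt.
  by apply: eq_bigr => i _; congr ('X - (pt tt _)%:P); apply: val_inj; rewrite val_insubd ltn_ord.
set U := prodX predT tt.
have mon : U \is monic by apply: monic_prod_XsubC.
have szU : size U = n.+1 by rewrite size_prod_XsubC -[X in _ = X.+1]card_ord cardE enumT.
have Un : U`_n = 1 by have /eqP := mon; rewrite /lead_coef szU.
have U0 i : U.[pt tt i] = 0.
  by rewrite horner_prod (bigD1 i) //= hornerD hornerN hornerX hornerC subrr mul0r.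
have Uexp : U = \poly_(k < n) U`_k + 'X^n.
  apply: (@poly_eqP _ n.+1); rewrite ?szU //.
    by apply: size_add_le; rewrite ?size_polyXn // (leq_trans (size_poly _ _)).
  move=> b; rewrite ltnS leq_eqVlt coefD coefXn coef_poly => /orP[/eqP ->|lt].
    by rewrite ltnn eqxx add0r.
  by rewrite lt ltn_eqF // addr0.
have rel : \sum_(k < n) achi solve r d delta val k *: z tt k = z tt n.
  have := pspanP solveP (m := nu) (B := K) (rows := z tt) (t := z tt nu) (x := fun k => - U`_k).
  rewrite /achi nuE; apply; first by move=> i _; apply: szz.
  rewrite (zrel tt n (fun k => - U`_k)) azE; apply: eq_bigr => i _; congr (_ * _ *: _).
  have E2 : (\poly_(k < n) U`_k).[pt tt i] + pt tt i ^+ n = 0.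
    by rewrite -hornerXn -hornerD -Uexp U0.
  move/eqP: E2; rewrite addrC addr_eq0 => /eqP ->.
  by rewrite !horner_poly -sumrN; apply: eq_bigr => k _; rewrite mulNr.
have root_chi i : (\poly_(k < n) achi solve r d delta val k).[pt tt i] = pt tt i ^+ n.
  by move: rel; rewrite zrel azE => /indep/(_ i) E1; exact: (mulfI (alpha0 i) E1).
apply/eqP; rewrite -subr_eq0; apply/eqP.
apply: (@roots_geq_poly_eq0 _ _ [seq pt tt i | i <- enum 'I_n]).
- apply/allP => x /mapP[i _ ->]; apply/rootP.
  by rewrite !(hornerD, hornerN) hornerXn root_chi U0 subrr subr0.
- by rewrite map_inj_uniq ?enum_uniq //; apply: pinj.
rewrite size_map size_enum_ord; set P := \poly_(k < n) achi _ _ _ _ _ _.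
have -> : 'X^n - P - U = - P - \poly_(k < n) U`_k by rewrite {1}Uexp; ring.
by apply: size_add_le; rewrite size_polyN size_poly.
Qed.

Local Notation lam := (alam solve roots r d delta val).

Let lamP : exists pi : 'S_n, forall i : 'I_n, lam i = pt tt (pi i).
Proof.
have Hp : perm_eq (mkseq lam n) (mkseq (fun k => pt tt (insubd i0 k)) n).
  rewrite /alam nuE; apply: rootsP; first exact: chiP.
  by move=> i j lti ltj /pinj E1; have := congr1 \val E1; rewrite !val_insubd lti ltj.
have uq : uniq (mkseq lam n).
  rewrite (perm_uniq Hp); apply/mkseq_uniqP => i j; rewrite !inE => lti ltj /pinj E1.
  by have := congr1 \val E1; rewrite !val_insubd lti ltj.
have ex (i : 'I_n) : exists j, lam i = pt tt j.
  have : lam i \in mkseq lam n by apply/mapP; exists (i : nat) => //; rewrite mem_iota ltn_ord.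
  by rewrite (perm_mem Hp) => /mapP[k _ ->]; eexists.
have [s Hs] := choice_fun ex.
have sinj : injective s.
  move=> i j sij; apply: val_inj; move/mkseq_uniqP: uq; apply; rewrite ?inE ?ltn_ord //.
  by rewrite !Hs sij.
by exists (perm sinj) => i; rewrite permE.
Qed.

Lemma agi_spec : exists pi : 'S_n, forall i : 'I_n,
  agi solve roots r d delta val i = alpha (pi i) *: fd (pi i).
Proof.
have [pi Hpi] := lamP; exists pi => i.
have laminj (j k : 'I_n) : lam j = lam k -> j = k.
  by rewrite !Hpi => /pinj/perm_inj.
pose lg := alag solve roots r d delta val i.
have lgP (j : 'I_n) : (\poly_(k < n) lg k).[lam j] = (j == i)%:R.
  rewrite horner_poly /lg /alag nuE.
  have := solveP n n (fun k j => lam j ^+ k) (fun j => (j == i :> nat)%:R).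
  case: solve => [y /= Hy|Hno]; first by rewrite Hy.
  (* The explicit Lagrange polynomial shows that the solver cannot report failure. *)
  pose L0 := \prod_(l | l != i) ('X - (lam l)%:P).
  pose L1 := (L0.[lam i])^-1 *: L0.
  have szL : (size L1 <= n)%N.
    apply: leq_trans (size_scale_leq _ _) _.
    apply: (@leq_trans (\sum_(l < n | predC1 i l) 1).+1%N).
      by apply: size_prod_le => k _; rewrite size_XsubC.
    by rewrite sum1_card cardC1 card_ord prednK.
  case: (Hno (fun k => L1`_k)) => k kn.
  rewrite -(horner_coef_wide _ szL) hornerZ.
  have [ki|ki] := eqVneq k i.
    rewrite ki mulVf // horner_prod; apply/prodf_neq0 => l li.
    rewrite hornerD hornerN hornerX hornerC subr_eq0; apply: contra li => /eqP.
    by move=> /laminj ->.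
  have -> : L0.[lam k] = 0; last by rewrite mulr0.
  rewrite horner_prod (bigD1 (Ordinal kn)) //=.
  by rewrite hornerD hornerN hornerX hornerC subrr mul0r.
rewrite /agi nuE zrel (bigD1 (pi i)) //= big1 ?addr0 => [|l li].
  by rewrite -Hpi lgP eqxx mulr1.
have -> : pt tt l = lam (pi^-1%g l) by rewrite Hpi permKV.
rewrite lgP; case: eqP => [E1|_]; last by rewrite mulr0 scale0r.
by case/eqP: li; rewrite -E1 permKV.
Qed.

End WithExponents.

Let monic1 q : q \is monic -> (size q <= 1)%N -> q = 1 :> {poly F}.
Proof.
by move=> mq /size1_polyC E1; move: mq; rewrite E1 monicE lead_coefC => /eqP ->.
Qed.

(** After cancelling [d], [alpha j] and [f j ^+ d.-1], the equation says that [ph] and [f j] have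
    the same logarithmic derivative; [dep2] makes them proportional, and monicity makes them
    equal. *)
Let pow_root_unique j (ph : {poly F}) : ph \is monic -> (size ph <= delta.+1)%N ->
  d%:R *: (theta ph * (alpha j *: fd j)) - ph * theta (alpha j *: fd j) = 0 -> ph = f j.
Proof.
move=> monph szph rel.
have [d0|dl] := posnP delta.
  rewrite d0 in szph; have szj := szf j; rewrite d0 in szj.
  exact: etrans (monic1 monph szph) (esym (monic1 (fmonic j) szj)).
have dn0 : d%:R != 0 :> F.
  apply/eqP => E0; have := @hinj d 0 _ _ E0.
  have : (d <= 2 * r * d * delta)%N.
    by rewrite mulnAC leq_pmull // !muln_gt0 /= r_gt0.
  by move=> le H; move: d_gt0; rewrite H // ltnS.
have eqh : f j * theta ph = theta (f j) * ph.
  have fn0 : f j ^+ d.-1 != 0 by rewrite expf_neq0.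
  have cn0 : d%:R * alpha j != 0 by rewrite mulf_neq0.
  have thZ : theta (alpha j *: fd j) = (alpha j * d%:R) *: (theta (f j) * f j ^+ d.-1).
    by rewrite -scalerA -theta_fd; exact: linearZ.
  apply: (mulIf fn0); apply: (scalerI cn0); apply/eqP; rewrite -subr_eq0 -[X in _ == X]rel thZ fdS.
  move: (theta (f j)) (theta ph) (f j ^+ d.-1) => t1 t2 X.
  rewrite -!scalerAr scalerA [alpha j * _]mulrC; apply/eqP; congr (_ *: _ - _ *: _).
    by rewrite mulrA [f j * t2]mulrC.
  by rewrite mulrA [ph * t1]mulrC.
have injd : inj_nat F delta.+1.
  apply: inj_nat_le hinj; rewrite ltnS leq_pmull // !muln_gt0 /= r_gt0 //.
have [c1 [c2 [c12 rel2]]] := dep2 injd (szf j) szph (f_neq0 j) eqh.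
have c20 : c2 != 0.
  apply/eqP => c20; move: rel2 c12; rewrite c20 scale0r addr0 eqxx orbF => /eqP.
  by rewrite scaler_eq0 (negbTE (f_neq0 j)) orbF => /eqP ->; rewrite eqxx.
have phc : ph = (- c2^-1 * c1) *: f j.
  move/eqP: rel2; rewrite addrC addr_eq0 => /eqP E2.
  by rewrite -[LHS](scalerK c20) E2 scalerN scalerA mulNr scaleNr.
have := congr1 lead_coef phc; rewrite lead_coefZ (eqP monph) (eqP (fmonic j)) mulr1 => c1E.
by rewrite phc -c1E scale1r.
Qed.

Section Factor.
Variables (i : nat) (j : 'I_n).
Hypothesis giE : agi solve roots r d delta val i = alpha j *: fd j.

Local Notation G := (agi solve roots r d delta val i).
Local Notation rows := (fun k b => (afrow solve roots r d delta val i k)`_b).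
Local Notation s1 := (asidx solve roots r d delta val i).

Let frow_sum (x : nat -> F) :
  \sum_(s < delta.+1) x s *: afrow solve roots r d delta val i s
  = d%:R *: (theta (\poly_(k < delta.+1) x (delta - k)%N) * G)
    - (\poly_(k < delta.+1) x (delta - k)%N) * theta G.
Proof. exact: log_deriv_rows. Qed.

Let szG : (size G <= K)%N.
Proof. by rewrite giE; apply: leq_trans (size_scale_leq _ _) (szfd j). Qed.

Let size_frow s : (size (afrow solve roots r d delta val i s) <= rBd d delta)%N.
Proof.
rewrite /rBd /rK addSn addnC; apply: size_mul_le; first by rewrite size_polyXn ltnS leq_subr.
apply: size_add_le; first exact: leq_trans (size_scale_leq _ _) szG.
by rewrite size_polyN; apply: leq_trans (size_theta _) szG.
Qed.

Let s1P : (s1 < delta.+1)%N /\ kersol solve delta.+1 (rBd d delta) rows s1.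
Proof.
pose df := (size (f j)).-1.
have szj : size (f j) = df.+1 by rewrite prednK // size_poly_gt0.
have dfd : (df <= delta)%N by rewrite -ltnS -szj.
have lt0 : (delta - df < delta.+1)%N by rewrite ltnS leq_subr.
have fE : \poly_(k < delta.+1) (f j)`_(delta - (delta - k)) = f j.
  apply: (@poly_eqP _ delta.+1); rewrite ?size_poly // => b bd.
  by rewrite coef_poly bd subKn.
(* The coefficients of [f j] form a kernel vector; its first nonzero entry, counted from the top
   degree, is the leading coefficient. *)
have Hs : kersol solve delta.+1 (rBd d delta) rows (delta - df)%N.
  apply: (kersol_some solveP lt0 (x := fun s => (f j)`_(delta - s))).
  - move=> b bB; transitivity ((\sum_(s < delta.+1) (f j)`_(delta - s) *: afrow solve roots r d delta val i s)`_b).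
      by rewrite coef_sum; apply: eq_bigr => s _; rewrite coefZ.
    rewrite (frow_sum (fun s => (f j)`_(delta - s))) fE giE linearZ /= theta_fd fdS.
    rewrite -!scalerAr !scalerA [d%:R * _]mulrC.
    rewrite (_ : theta (f j) * (f j * f j ^+ d.-1) = f j * (theta (f j) * f j ^+ d.-1)).
      by rewrite subrr coef0.
    exact: mulrCA.
  - by move=> s lt; rewrite nth_default // szj; lia.
  by rewrite subKn // -/(lead_coef (f j)) (eqP (fmonic j)) oner_eq0.
set q := fun s => isSome (kersol solve delta.+1 (rBd d delta) rows s).
have hq : has q (iota 0 delta.+1) by apply/hasP; exists (delta - df)%N => //; rewrite mem_iota.
have lt : (s1 < delta.+1)%N by move: hq; rewrite has_find size_iota.
by split=> //; have := nth_find 0%N hq; rewrite nth_iota.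
Qed.

(** Whatever pivot the search finds, the normalized kernel vector is a monic solution of the
    equation, and [f j] is the only one; the pivot therefore reveals the degree of [f j]. *)
Lemma afi_spec : [/\ afi solve roots r d delta val i = f j,
  aal solve roots r d delta val i = alpha j,
  size (f j) = (delta - s1).+1 & (s1 < delta.+1)%N].
Proof.
have [lt Hs] := s1P; set ph := afi solve roots r d delta val i.
have kvlt k : (k < s1)%N -> kervec solve delta.+1 (rBd d delta) rows s1 k = 0.
  by rewrite /kervec; case: kersol => // c ->.
have kvs : kervec solve delta.+1 (rBd d delta) rows s1 s1 = 1.
  by rewrite /kervec; case: kersol Hs => // c _; rewrite ltnn eqxx.
have rel : d%:R *: (theta ph * G) - ph * theta G = 0.
  rewrite -(frow_sum (kervec solve delta.+1 (rBd d delta) rows s1)).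
  apply: (@poly_eqP _ (rBd d delta)); rewrite ?size_poly0 //.
    by apply: size_sum_le => k _; apply: leq_trans (size_scale_leq _ _) (size_frow _).
  move=> b bB; rewrite coef0 -[RHS](kervec_ker solveP rows lt bB) coef_sum.
  by apply: eq_bigr => k _; rewrite coefZ.
have szph : size ph = (delta - s1).+1.
  apply: anti_leq; apply/andP; split.
    apply/leq_sizeP => k lek; rewrite coef_poly; case: ifP => // ltk.
    by apply: kvlt; lia.
  rewrite ltnNge; apply/negP => /leq_sizeP/(_ _ (leqnn _))/eqP.
  by rewrite coef_poly ltnS leq_subr subKn ?kvs ?oner_eq0.
have monph : ph \is monic.
  by rewrite monicE /lead_coef szph coef_poly ltnS leq_subr subKn ?kvs.
have phE : ph = f j.
  apply: pow_root_unique => //; first by rewrite szph ltnS leq_subr.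
  by rewrite -giE.
have szj : size (f j) = (delta - s1).+1 by rewrite -phE.
split=> //; rewrite /aal giE coefZ.
have : fd j \is monic by apply: monic_exp.
rewrite monicE /lead_coef size_exp szj /= mulnC => /eqP ->; exact: mulr1.
Qed.

End Factor.

Lemma achi_split : split_ok (anu solve r d delta val) (achi solve r d delta val).
Proof.
have [an0 [p szp ap]] := aa_spec.
have [nuE pinj] := anu_eq szp ap an0; rewrite nuE.
exists (fun k => (p (insubd (Ordinal n_gt0) k)).[(at_ solve r d delta val)%:R]).
split; first exact: (chiP szp ap an0).
by move=> i j lti ltj /pinj E1; have := congr1 \val E1; rewrite !val_insubd lti ltj.
Qed.

Theorem reconstruct_correct : anu solve r d delta val = n /\
  exists pi : 'S_n, forall i : 'I_n,
   [/\ afi solve roots r d delta val i = f (pi i),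
       aal solve roots r d delta val i = alpha (pi i),
       size (f (pi i)) = (delta - asidx solve roots r d delta val i).+1
     & (asidx solve roots r d delta val i < delta.+1)%N].
Proof.
have [an0 [p szp ap]] := aa_spec.
have [nuE _] := anu_eq szp ap an0; split=> //.
have [pi Hpi] := agi_spec szp ap an0; exists pi => i.
exact: (afi_spec (Hpi i)).
Qed.

End Correctness.

(** * Running time over a family of fields *)

Ltac dtac := let z := fresh "z" in move=> z; cbn [dom ext when addenv setenv fst snd];
  intros; repeat match goal with H : _ /\ _ |- _ => destruct H end.

(** A named conditional, so that the tactics recognize a branch by its head symbol. *)
Definition vif (b : bool) (x y : value) : value := if b then x else y.

Lemma comp_vif c (b : ix c -> bool) (x y : ix c -> value) :
  comp (fun i => vnat (b i)) -> @comp (when b) x -> @comp (when (fun i => ~~ b i)) y ->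
  comp (fun i => vif (b i) (x i) (y i)).
Proof. exact: comp_if. Qed.

Ltac cif := match goal with
  | |- @comp ?C (fun z => vif (@?b z) (@?x z) (@?y z)) => apply: (@comp_vif C b x y)
  end.

Ltac cleaf := repeat first [ assumption
  | match goal with |- @comp (ext _) (fun z => vnat z.2) => apply: comp_ix; [ solve [nauto] | envb ] end
  | clift ].

Tactic Notation "tnth" uconstr(n) uconstr(x) uconstr(k) :=
  match goal with |- @comp ?C _ => refine (@comp_tabnth C n x k _ _ _) end.

Ltac cgo := repeat first [ assumption | cif | cstep | solve [cleaf] ].

(** * Iterates, powers and dot products as single linear systems *)

Section KrylovSystem.
Variable F : fieldType.

Lemma kryS n (C : nat -> nat -> F) (y : nat -> F) j l :
  kry n C y j.+1 l = \sum_(k < n) kry n C y j k * C k l.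
Proof. by []. Qed.

(** The block matrix with 1 on the diagonal and [-C] in the adjacent blocks: with right side [y] in
    block 0, its unique solution lists all iterates of [y] under [C]. The solver thus bounds the
    sizes of the iterates, which repeated multiplication would not. *)
Definition krymx n (C : nat -> nat -> F) q q' : F :=
  if q == q' then 1 else
  if (q' %/ n == (q %/ n).+1)%N then - C (q %% n)%N (q' %% n)%N else 0.

Lemma krymx_sum n (C : nat -> nat -> F) J (x : nat -> F) q' : (q' < J * n)%N ->
  \sum_(q < J * n) x q * krymx n C q q'
  = x q' - (if (q' %/ n)%N is j.+1 then \sum_(l < n) x (j * n + l)%N * C l (q' %% n)%N else 0).
Proof.
move=> lt; have n0 : (0 < n)%N by case: (n) lt; rewrite ?muln0.
have E q : x q * krymx n C q q' = (if q == q' then x q' else 0)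
   - (if (q' %/ n == (q %/ n).+1)%N then x (q %/ n * n + q %% n)%N * C (q %% n)%N (q' %% n)%N else 0).
  rewrite /krymx; case: eqP => [->|_].
    by rewrite mulr1 ltn_eqF // subr0.
  by case: eqP => _; rewrite ?mulr0 ?subrr // mulrN sub0r -divn_eq.
under eq_bigr => q _ do rewrite E.
rewrite sumrB; congr (_ - _); first by rewrite sum_delta.
rewrite (@sum_divmod _ J n (fun m l => if (q' %/ n == m.+1)%N then x (m * n + l)%N * C l (q' %% n)%N else 0)).
case Ej: (q' %/ n)%N => [|j].
  by rewrite big1 // => m _; rewrite big1.
have ltj : (j < J)%N by rewrite -ltnS -Ej ltnS -ltn_divLR // in lt *; lia.
rewrite (bigD1 (Ordinal ltj)) //= eqxx [X in _ + X]big1 ?addr0 // => m ne.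
rewrite big1 // => l _; rewrite eqSS eq_sym.
by rewrite (negbTE (ne : (m : nat) != j)).
Qed.

Lemma krymx_sol n (C : nat -> nat -> F) (y : nat -> F) J (x : nat -> F) :
  (forall q', (q' < J * n)%N ->
     \sum_(q < J * n) x q * krymx n C q q' = if (q' < n)%N then y q' else 0) ->
  forall j l, (j < J)%N -> (l < n)%N -> x (j * n + l)%N = kry n C y j l.
Proof.
move=> H; elim=> [|j IH] l jJ ln.
  have lt : (l < J * n)%N by apply: leq_trans ln (leq_pmull _ jJ).
  by rewrite mul0n add0n; have := H l lt; rewrite krymx_sum // divn_small // ln subr0.
have n0 : (0 < n)%N by case: (n) ln.
have lt : (j.+1 * n + l < J * n)%N.
  by apply: (@leq_trans (j.+2 * n)); [rewrite [(j.+2 * n)%N]mulSnr ltn_add2l | rewrite leq_mul2r jJ orbT].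
have e1 : ((j.+1 * n + l) %/ n = j.+1)%N by rewrite divnMDl // divn_small // addn0.
have e2 : ((j.+1 * n + l) %% n = l)%N by rewrite modnMDl modn_small.
have := H _ lt; rewrite krymx_sum // e1 e2.
rewrite ltnNge mulSn -addnA leq_addr /= => /eqP; rewrite subr_eq0 addnA -mulSn => /eqP ->.
by apply: eq_bigr => k _; rewrite IH // ltnW.
Qed.

Lemma krymx_ex n (C : nat -> nat -> F) (y : nat -> F) J q' : (q' < J * n)%N ->
  \sum_(q < J * n) kry n C y (q %/ n) (q %% n) * krymx n C q q' = if (q' < n)%N then y q' else 0.
Proof.
move=> lt; have n0 : (0 < n)%N by case: (n) lt; rewrite ?muln0.
rewrite (krymx_sum C (fun q => kry n C y (q %/ n) (q %% n)) lt).
case: ltnP => [ltn|le]; first by rewrite divn_small // modn_small // subr0.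
have : (0 < q' %/ n)%N by rewrite divn_gt0.
case: (q' %/ n)%N => // j _; rewrite kryS; apply/eqP; rewrite subr_eq0.
apply/eqP/eq_bigr => l _.
have e1 : ((j * n + l) %/ n = j)%N by rewrite divnMDl // divn_small // addn0.
have e2 : ((j * n + l) %% n = l)%N by rewrite modnMDl modn_small.
by rewrite e1 e2.
Qed.

Lemma kry_pow (x : F) j : kry 1 (fun _ _ => x) (fun=> 1) j 0%N = x ^+ j.
Proof.
elim: j => [|j IH]; first by [].
by rewrite kryS big_ord1 IH exprSr.
Qed.

(** The shear sends [(j, 1)] to [(j + 1, 1)], so the image of a natural number in the field is also
    an entry of a Krylov sequence. *)
Lemma kry_nat j :
  kry 2 (fun k l => if (k == 0%N) && (l == 1%N) then 0 else 1)
      (fun l => if l == 0%N then 0 else 1) j 0%N = j%:R :> F /\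
  kry 2 (fun k l => if (k == 0%N) && (l == 1%N) then 0 else 1)
      (fun l => if l == 0%N then 0 else 1) j 1%N = 1 :> F.
Proof.
elim: j => [|j [IH0 IH1]]; first by [].
by rewrite !kryS !big_ord_recl !big_ord0 /= IH0 IH1 !(mulr0, mulr1, addr0, add0r) natr1.
Qed.

(** The first [n] equations prescribe one factor, and the last one makes unknown [n] the dot
    product. *)
Definition dotmx n (b : nat -> F) k j : F :=
  if (j < n)%N then (if k == j then 1 else 0) else if (k < n)%N then b k else -1.

Lemma dotmx_sum n (b x : nat -> F) j : (j < n.+1)%N ->
  \sum_(k < n.+1) x k * dotmx n b k j =
  if (j < n)%N then x j else \sum_(k < n) x k * b k - x n.
Proof.
move=> lt; rewrite /dotmx; case: ltnP => [ltn|_].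
  rewrite -[RHS](@sum_delta _ n.+1 j) //.
  by apply: eq_bigr => k _; case: eqP => [->|_]; rewrite ?mulr1 ?mulr0.
rewrite big_ord_recr /= ltnn mulrN1; congr (_ - _).
by apply: eq_bigr => k _; rewrite ltn_ord.
Qed.

End KrylovSystem.

(** * Field arithmetic from a polynomial-time solver *)

Section Family.
Variables (Phi : Type) (F : Phi -> fieldType) (enc : forall phi, F phi -> value).
Variables (desc : Phi -> value) (pw : Phi -> nat).

Definition eopt phi m (o : option (nat -> F phi)) : value :=
  if o is Some x then VPair (vnat 1) (vtab m (fun k => enc (x k))) else vnat 0.

(** For one fixed field the description is a constant; for finite fields it is read from the input,
    which makes the program uniform in the field. *)
Definition good (c : ctx) (fi : ix c -> Phi) : Prop :=
  comp (fun i => desc (fi i)) /\ nbnd (fun i => pw (fi i)).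

Variable solve : forall phi, nat -> nat -> (nat -> nat -> F phi) -> (nat -> F phi) ->
  option (nat -> F phi).
Hypothesis solveP : forall phi, solver_spec (@solve phi).

(** Apart from the constants 0, 1, -1 and the root finder, this is the only arithmetic the procedure
    relies on; products and sums are dot products, read off a solved system. *)
Definition solver_comp : Prop :=
  forall (c : ctx) (fi : ix c -> Phi) (m n : ix c -> nat)
    (a : forall i, nat -> nat -> F (fi i)) (b : forall i, nat -> F (fi i)),
  good fi -> comp (fun i => vnat (m i)) -> comp (fun i => vnat (n i)) ->
  comp (fun i => vtab (m i) (fun k => vtab (n i) (fun j => enc (a i k j)))) ->
  comp (fun i => vtab (n i) (fun j => enc (b i j))) ->
  comp (fun i => eopt (m i) (solve (m i) (n i) (a i) (b i))).

Definition consts_comp : Prop :=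
  forall (c : ctx) (fi : ix c -> Phi), good fi ->
  [/\ comp (fun i => enc (0 : F (fi i))), comp (fun i => enc (1 : F (fi i)))
    & comp (fun i => enc (-1 : F (fi i)))].

Hypotheses (Hsolve : solver_comp) (Hconsts : consts_comp).

Lemma good_ext c fi (n : ix c -> nat) : good fi -> nbnd n -> good (c := ext n) (fun z => fi z.1).
Proof.
by case=> cd bp bn; split; [apply: (comp_up bn cd) | apply: (nbnd_up n bp)].
Qed.

Lemma good_when c fi (P : ix c -> Prop) : good fi -> good (c := when P) fi.
Proof. by case=> cd bp; split; [apply: comp_when | apply: nbnd_when]. Qed.

Section Ops.
Variables (c : ctx) (fi : ix c -> Phi).
Hypothesis gd : good fi.

Let be : vbnd (@env c). Proof. exact: (comp_env_bnd gd.1). Qed.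
Let H0 : comp (fun i => enc (0 : F (fi i))). Proof. by case: (Hconsts gd). Qed.
Let H1 : comp (fun i => enc (1 : F (fi i))). Proof. by case: (Hconsts gd). Qed.
Let HN1 : comp (fun i => enc (-1 : F (fi i))). Proof. by case: (Hconsts gd). Qed.

Section Solve.
Variables (m n : ix c -> nat) (a : forall i, nat -> nat -> F (fi i)) (b : forall i, nat -> F (fi i)).
Hypotheses (cm : comp (fun i => vnat (m i))) (bm : nbnd m)
  (cn : comp (fun i => vnat (n i))) (bn : nbnd n).
Hypothesis ca : @comp (@ext (ext m) (fun z => n z.1)) (fun z => enc (a z.1.1 z.1.2 z.2)).
Hypothesis cb : @comp (ext n) (fun z => enc (b z.1 z.2)).

Lemma fsolve : comp (fun i => eopt (m i) (solve (m i) (n i) (a i) (b i))).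
Proof.
apply: Hsolve => //; last exact: (@comp_tab c n (fun i j => enc (b i j))).
apply: (@comp_tab c m (fun i k => vtab (n i) (fun j => enc (a i k j)))) => //.
apply: (@comp_tab (ext m) (fun z => n z.1) (fun z j => enc (a z.1 z.2 j))) => //.
  exact: (comp_up bm cn).
exact: (nbnd_up m bn).
Qed.

Lemma fsolve_some : comp (fun i => vnat (isSome (solve (m i) (n i) (a i) (b i)))).
Proof.
apply: (comp_ext (comp_ispair fsolve)) => i _; by case: solve.
Qed.

Lemma fsolve_nth (k : ix c -> nat) : comp (fun i => vnat (k i)) ->
  (forall i, dom i -> (k i < m i)%N) ->
  comp (fun i => enc (odflt (fun=> 0) (solve (m i) (n i) (a i) (b i)) (k i))).
Proof.
move=> ck lt; have bk : nbnd k by apply: (nbnd_le bm) => i Di; apply: ltnW; apply: lt.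
have cv := comp_vnth (comp_vsnd fsolve) ck bk.
apply: (comp_ext (comp_if fsolve_some (comp_when _ cv) (comp_when _ H0))) => i Di.
case: solve => //= x; rewrite vnth_vlist ?size_mkseq ?lt //.
by rewrite nth_mkseq // lt.
Qed.

End Solve.

Lemma fdot (n : ix c -> nat) (x y : forall i, nat -> F (fi i)) :
  comp (fun i => vnat (n i)) -> nbnd n ->
  @comp (ext n) (fun z => enc (x z.1 z.2)) -> @comp (ext n) (fun z => enc (y z.1 z.2)) ->
  comp (fun i => enc (\sum_(k < n i) x i k * y i k)).
Proof.
move=> cn bn cx cy.
have tx := @comp_tab c n (fun i k => enc (x i k)) cn bn cx.
have ty := @comp_tab c n (fun i k => enc (y i k)) cn bn cy.
have := @fsolve_nth (fun i => (n i).+1) (fun i => (n i).+1)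
  (fun i => dotmx (n i) (y i)) (fun i j => if (j < n i)%N then x i j else 0).
move=> /(_ _ _ _ _ _ _ n) H; apply: (comp_ext (H _ _ _ _ _ _ cn _)).
- by cauto.
- by nauto.
- by cauto.
- by nauto.
- set C := ext _.
  apply: (@comp_ext C (fun z => vif (z.2 < n z.1.1)%N
     (vif (z.1.2 == z.2) (enc (1 : F (fi z.1.1))) (enc (0 : F (fi z.1.1))))
     (vif (z.1.2 < n z.1.1)%N (enc (y z.1.1 z.1.2)) (enc (-1 : F (fi z.1.1)))))); last first.
    by move=> z _; rewrite /vif /dotmx; do 2!case: ifP.
  rewrite /C; cgo.
  tnth (fun z => n z.1.1) (fun z k => enc (y z.1.1 k)) (fun z => z.1.2); [by cgo | by cgo | by dtac].
- set C := ext _.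
  apply: (@comp_ext C (fun z => vif (z.2 < n z.1)%N (enc (x z.1 z.2)) (enc (0 : F (fi z.1))))); last first.
    by move=> z _; rewrite /vif; case: ifP.
  rewrite /C; cgo.
  tnth (fun z => n z.1) (fun z k => enc (x z.1 k)) (fun z => z.2); [by cgo | by cgo | by dtac].
- by move=> i _.
- move=> i Di; congr enc.
  have := solveP (n i).+1 (n i).+1 (dotmx (n i) (y i)) (fun j => if (j < n i)%N then x i j else 0).
  case: solve => [s|Hn] /=.
    move=> Hs; have := Hs (n i) (ltnSn _); rewrite dotmx_sum // ltnn => /eqP.
    rewrite subr_eq0 => /eqP <-; apply: eq_bigr => k _; congr (_ * _).
    have lt : (k < (n i).+1)%N by apply: leq_trans (ltn_ord k) _.
    by have := Hs k lt; rewrite dotmx_sum // ltn_ord.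
  case: (Hn (fun k => if (k < n i)%N then x i k else \sum_(k < n i) x i k * y i k)) => j lt.
  rewrite (dotmx_sum (y i) (fun k => if (k < n i)%N then x i k else \sum_(k < n i) x i k * y i k) lt).
  case: (j < n i)%N => //; rewrite ltnn; apply/eqP; rewrite subr_eq0; apply/eqP.
  by apply: eq_bigr => k _; rewrite ltn_ord.
Qed.

Lemma fmul (x y : forall i, F (fi i)) : comp (fun i => enc (x i)) -> comp (fun i => enc (y i)) ->
  comp (fun i => enc (x i * y i)).
Proof.
move=> cx cy.
have b1 : @nbnd c (fun=> 1%N) by apply: pbd_const.
have := @fdot (fun=> 1%N) (fun i _ => x i) (fun i _ => y i) (ncomp_const 1 be) b1.
move=> /(_ (comp_up b1 cx) (comp_up b1 cy)) H.
by apply: (comp_ext H) => i _; rewrite big_ord1.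
Qed.

Lemma fadd (x y : forall i, F (fi i)) : comp (fun i => enc (x i)) -> comp (fun i => enc (y i)) ->
  comp (fun i => enc (x i + y i)).
Proof.
move=> cx cy.
have b1 : @nbnd c (fun=> 2%N) by apply: pbd_const.
have := @fdot (fun=> 2%N) (fun i k => if k == 0%N then x i else y i) (fun i _ => 1) (ncomp_const 2 be) b1.
move=> H; apply: (comp_ext (H _ (comp_up b1 H1))).
  apply: (@comp_ext (ext (fun=> 2%N)) (fun z => vif (z.2 == 0%N) (enc (x z.1)) (enc (y z.1)))).
    by cgo.
  by move=> z _; rewrite /vif; case: ifP.
by move=> i _; rewrite !big_ord_recl big_ord0 /= !mulr1 addr0.
Qed.

Lemma fopp (x : forall i, F (fi i)) : comp (fun i => enc (x i)) -> comp (fun i => enc (- x i)).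
Proof. by move=> cx; apply: (comp_ext (fmul HN1 cx)) => i _; rewrite mulN1r. Qed.

Lemma fsub (x y : forall i, F (fi i)) : comp (fun i => enc (x i)) -> comp (fun i => enc (y i)) ->
  comp (fun i => enc (x i - y i)).
Proof. by move=> cx cy; apply: fadd => //; apply: fopp. Qed.

End Ops.

Section Kry.
Variables (c : ctx) (fi : ix c -> Phi).
Hypothesis gd : good fi.
Let be : vbnd (@env c). Proof. exact: (comp_env_bnd gd.1). Qed.
Let H0 : comp (fun i => enc (0 : F (fi i))). Proof. by case: (Hconsts gd). Qed.
Let H1 : comp (fun i => enc (1 : F (fi i))). Proof. by case: (Hconsts gd). Qed.

Lemma fkry (n j l : ix c -> nat) (C : forall i, nat -> nat -> F (fi i)) (y : forall i, nat -> F (fi i)) :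
  comp (fun i => vnat (n i)) -> nbnd n -> comp (fun i => vnat (j i)) -> nbnd j ->
  comp (fun i => vnat (l i)) -> (forall i, dom i -> (l i < n i)%N) ->
  @comp (@ext (ext n) (fun z => n z.1)) (fun z => enc (C z.1.1 z.1.2 z.2)) ->
  @comp (ext n) (fun z => enc (y z.1 z.2)) ->
  comp (fun i => enc (kry (n i) (C i) (y i) (j i) (l i))).
Proof.
move=> cn bn cj bj cl lt cC cy.
have cnC : @comp (@ext (ext n) (fun z => n z.1)) (fun z => enc (- C z.1.1 z.1.2 z.2)).
  pose X := @ext (ext n) (fun z => n z.1).
  have gX : @good X (fun z => fi z.1.1).
    by apply: (@good_ext (ext n) (fun z => fi z.1)); [apply: good_ext | apply: nbnd_up].
  exact: (@fopp X (fun z => fi z.1.1) gX (fun z => C z.1.1 z.1.2 z.2) cC).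
have ty := @comp_tab c n (fun i k => enc (y i k)) cn bn cy.
have tC : comp (fun i => vtab (n i) (fun k => vtab (n i) (fun k' => enc (- C i k k')))).
  apply: (@comp_tab c n (fun i k => vtab (n i) (fun k' => enc (- C i k k')))) => //.
  apply: (@comp_tab (ext n) (fun z => n z.1) (fun z k' => enc (- C z.1 z.2 k'))) => //.
    by cauto.
  exact: nbnd_up.
pose M i := ((j i).+1 * n i)%N.
have cM : comp (fun i => vnat (M i)) by rewrite /M; cauto.
have bM : nbnd M by rewrite /M; nauto.
have H := @fsolve_nth c fi gd M M (fun i => krymx (n i) (C i))
  (fun i q => if (q < n i)%N then y i q else 0) cM bM cM bM.
have ck : comp (fun i => vnat (j i * n i + l i)) by cauto.
have n0 (z : ix c) q : (q < M z)%N -> (0 < n z)%N by rewrite /M; case: (n z); rewrite ?muln0.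
apply: (comp_ext (H _ _ _ ck _)).
- set X := @ext _ _.
  apply: (@comp_ext X (fun z => vif (z.1.2 == z.2) (enc (1 : F (fi z.1.1)))
     (vif (z.2 %/ n z.1.1 == (z.1.2 %/ n z.1.1).+1)%N
     (enc (- C z.1.1 (z.1.2 %% n z.1.1)%N (z.2 %% n z.1.1)%N)) (enc (0 : F (fi z.1.1)))))); last first.
    by move=> z _; rewrite /vif /krymx; case: ifP => // _; case: ifP.
  rewrite /X; cgo.
  tnth (fun z => n z.1.1) (fun z k => enc (- C z.1.1 (z.1.2 %% n z.1.1)%N k)) (fun z => z.2 %% n z.1.1)%N.
  + tnth (fun z => n z.1.1) (fun z k => vtab (n z.1.1) (fun k' => enc (- C z.1.1 k k')))
         (fun z => z.1.2 %% n z.1.1)%N; [by cgo | by cgo | ].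
    by dtac; rewrite ltn_mod; apply: n0; eassumption.
  + by cgo.
  + by dtac; rewrite ltn_mod; apply: n0; eassumption.
- set X := @ext _ _.
  apply: (@comp_ext X (fun z => vif (z.2 < n z.1)%N (enc (y z.1 z.2)) (enc (0 : F (fi z.1))))); last first.
    by move=> z _; rewrite /vif; case: ifP.
  rewrite /X; cgo.
  tnth (fun z => n z.1) (fun z k => enc (y z.1 k)) (fun z => z.2); [by cgo | by cgo | by dtac].
- by move=> i Di; rewrite /M mulSnr ltn_add2l lt.
- move=> i Di; congr enc.
  have := solveP (M i) (M i) (krymx (n i) (C i)) (fun q => if (q < n i)%N then y i q else 0).
  case: solve => [s|Hn] /=; first by move/krymx_sol; apply => //; apply: lt.
  case: (Hn (fun q => kry (n i) (C i) (y i) (q %/ n i) (q %% n i))) => q ltq.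
  exact: krymx_ex.
Qed.

Lemma fpow (x : forall i, F (fi i)) (j : ix c -> nat) :
  comp (fun i => enc (x i)) -> comp (fun i => vnat (j i)) -> nbnd j ->
  comp (fun i => enc (x i ^+ j i)).
Proof.
move=> cx cj bj; have b1 : @nbnd c (fun=> 1%N) by apply: pbd_const.
have := @fkry (fun=> 1%N) j (fun=> 0%N) (fun i _ _ => x i) (fun i _ => 1).
move=> H; apply: (comp_ext (H _ _ _ _ _ _ _ _)) => //; try by cgo.
by move=> i _; rewrite kry_pow.
Qed.

Lemma fnat (j : ix c -> nat) : comp (fun i => vnat (j i)) -> nbnd j ->
  comp (fun i => enc ((j i)%:R : F (fi i))).
Proof.
move=> cj bj; have b1 : @nbnd c (fun=> 2%N) by apply: pbd_const.
have := @fkry (fun=> 2%N) j (fun=> 0%N)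
   (fun i k l => if (k == 0%N) && (l == 1%N) then 0 else 1) (fun i l => if l == 0%N then 0 else 1).
move=> H; apply: (comp_ext (H _ _ _ _ _ _ _ _)) => //; try by cgo.
- apply: (@comp_ext (@ext (@ext c (fun=> 2%N)) (fun=> 2%N)) (fun z => vif ((z.1.2 == 0%N) && (z.2 == 1%N)) (enc (0 : F (fi z.1.1))) (enc (1 : F (fi z.1.1))))).
    by cgo.
  by move=> z _; rewrite /vif; case: ifP.
- apply: (@comp_ext (@ext c (fun=> 2%N)) (fun z => vif (z.2 == 0%N) (enc (0 : F (fi z.1))) (enc (1 : F (fi z.1))))).
    by cgo.
  by move=> z _; rewrite /vif; case: ifP.
by move=> i _; case: (kry_nat (F (fi i)) (j i)) => ->.
Qed.

Section Ker.
Variables (m B s : ix c -> nat) (a : forall i, nat -> nat -> F (fi i)).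
Hypotheses (cm : comp (fun i => vnat (m i))) (bm : nbnd m)
  (cB : comp (fun i => vnat (B i))) (bB : nbnd B)
  (cs : comp (fun i => vnat (s i))) (lts : forall i, dom i -> (s i < m i)%N).
Hypothesis ta : comp (fun i => vtab (m i) (fun k => vtab (B i) (fun j => enc (a i k j)))).

Let bs : nbnd s. Proof. by apply: (nbnd_le bm) => i Di; apply: ltnW; apply: lts. Qed.

Let lookup (C : ctx) (pi : ix C -> ix c) (k j : ix C -> nat) :
  comp (fun z => vtab (m (pi z)) (fun k => vtab (B (pi z)) (fun j => enc (a (pi z) k j)))) ->
  comp (fun z => vnat (k z)) -> comp (fun z => vnat (j z)) ->
  (forall z, dom z -> (k z < m (pi z))%N) -> (forall z, dom z -> (j z < B (pi z))%N) ->
  comp (fun z => enc (a (pi z) (k z) (j z))).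
Proof.
move=> ct ck cj ltk ltj.
apply: (@comp_tabnth C (fun z => B (pi z)) (fun z j => enc (a (pi z) (k z) j)) j) => //.
exact: (@comp_tabnth C (fun z => m (pi z)) (fun z k => vtab (B (pi z)) (fun j => enc (a (pi z) k j))) k).
Qed.

Tactic Notation "look" uconstr(pi) uconstr(k) uconstr(j) := match goal with |- @comp ?C _ => refine (@lookup C pi k j _ _ _ _ _) end.

Let ksys : @comp (@ext (@ext c (fun i => m i - (s i).+1)%N) (fun z => B z.1))
    (fun z => enc (a z.1.1 ((s z.1.1).+1 + z.1.2)%N z.2)).
Proof.
have bms : nbnd (fun i => m i - (s i).+1)%N by nauto.
look (fun z => z.1.1) (fun z => (s z.1.1).+1 + z.1.2)%N (fun z => z.2); try by cgo.
- by dtac; have := lts H; lia.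
- by dtac.
Qed.

Let krhs : @comp (ext B) (fun z => enc (a z.1 (s z.1) z.2)).
Proof.
look (fun z => z.1) (fun z => s z.1) (fun z => z.2); try by cgo.
- by dtac; apply: lts.
- by dtac.
Qed.

Let cms : comp (fun i => vnat (m i - (s i).+1)). Proof. by cauto. Qed.
Let bms : nbnd (fun i => m i - (s i).+1)%N. Proof. by nauto. Qed.

Lemma fkersol : comp (fun i => vnat (isSome (kersol (@solve _) (m i) (B i) (a i) (s i)))).
Proof.
exact: (@fsolve_some c fi gd _ B (fun i k => a i ((s i).+1 + k)%N) (fun i => a i (s i)) cms bms cB bB ksys krhs).
Qed.

Lemma fkervec (k : ix c -> nat) : comp (fun i => vnat (k i)) ->
  (forall i, dom i -> (k i < m i)%N) ->
  comp (fun i => enc (kervec (@solve _) (m i) (B i) (a i) (s i) (k i))).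
Proof.
move=> ck ltk.
pose P i := isSome (kersol (@solve _) (m i) (B i) (a i) (s i)) && (s i < k i)%N.
have cP : comp (fun i => vnat (P i)).
  by apply: bcomp_and; [exact: fkersol | cauto].
have gd' : @good (when P) fi by apply: good_when.
have csol : @comp (when P) (fun i => enc (odflt (fun=> 0)
   (solve (m i - (s i).+1) (B i) (fun k => a i ((s i).+1 + k)%N) (a i (s i))) (k i - (s i).+1)%N)).
  apply: (@fsolve_nth (when P) fi gd' (fun i => m i - (s i).+1)%N B
     (fun i k => a i ((s i).+1 + k)%N) (fun i => a i (s i))).
  - exact: comp_when.
  - exact: nbnd_when.
  - exact: comp_when.
  - exact: nbnd_when.
  - refine (@comp_strengthen (@ext (@ext c (fun i => m i - (s i).+1)%N) (fun z => B z.1))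
      (fun z => @dom (@ext (@ext (when P) (fun i => m i - (s i).+1)%N) (fun z => B z.1)) z)
      (fun z => enc (a z.1.1 ((s z.1.1).+1 + z.1.2)%N z.2)) ksys _).
    by move=> z [[[]]].
  - refine (@comp_strengthen (@ext c B) (fun z => @dom (@ext (when P) B) z)
      (fun z => enc (a z.1 (s z.1) z.2)) krhs _).
    by move=> z [[]].
  - by apply: comp_when; cauto.
  - by move=> z [Dz /andP[_ lt]]; have := ltk z Dz; lia.
have cneg := @fopp (when P) fi gd' _ csol.
have ck1 : comp (fun i => if (P i) then enc (- odflt (fun=> 0)
   (solve (m i - (s i).+1) (B i) (fun k => a i ((s i).+1 + k)%N) (a i (s i))) (k i - (s i).+1)%N)
   else if isSome (kersol (@solve _) (m i) (B i) (a i) (s i)) && (k i == s i)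
     then enc (1 : F (fi i)) else enc (0 : F (fi i))).
  apply: comp_if => //.
  apply: (@comp_when c (fun i => ~~ P i)); apply: comp_if; last 2 first.
  - exact: comp_when.
  - exact: comp_when.
  by apply: bcomp_and; [exact: fkersol | cauto].
apply: (comp_ext ck1) => i Di; rewrite /P /kervec /kersol.
case: solve => [x|] //=; case: ltngtP => //=.
Qed.

End Ker.

Section Span.
Variables (m B : ix c -> nat) (rows : forall i, nat -> {poly F (fi i)}) (t : forall i, {poly F (fi i)}).
Hypotheses (cm : comp (fun i => vnat (m i))) (bm : nbnd m)
  (cB : comp (fun i => vnat (B i))) (bB : nbnd B).
Hypothesis ta : @comp (@ext (ext m) (fun z => B z.1)) (fun z => enc (rows z.1.1 z.1.2)`_z.2).
Hypothesis tt : @comp (ext B) (fun z => enc (t z.1)`_z.2).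

Lemma fpspan (k : ix c -> nat) : comp (fun i => vnat (k i)) ->
  (forall i, dom i -> (k i < m i)%N) ->
  comp (fun i => enc (pspan (@solve _) (m i) (B i) (rows i) (t i) (k i))).
Proof.
move=> ck lt.
exact: (@fsolve_nth c fi gd m B (fun i k j => (rows i k)`_j) (fun i j => (t i)`_j)).
Qed.

End Span.

End Kry.

End Family.

Ltac gauto := repeat first
  [ assumption
  | match goal with
    | |- @good ?Phi ?desc ?pw (@ext ?c ?n) ?f =>
        let f' := eval cbn beta iota delta [fst snd] in
          (fun (i : ix c) (k : nat) => f ((i, k) : ix (@ext c n))) in
        lazymatch f' with (fun i _ => @?w i) =>
          refine (@good_ext Phi desc pw c w n _ _); [ | solve [nauto] ] end
    | |- @good ?Phi ?desc ?pw (@when ?c ?P) ?f => refine (@good_when Phi desc pw c f P _)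
    end ].

Tactic Notation "tnth2" uconstr(n1) uconstr(n2) uconstr(x) uconstr(k1) uconstr(k2) :=
  match goal with |- @comp ?C _ =>
    refine (@comp_tabnth C n2 (fun z k => x z (k1 z) k) k2
      (@comp_tabnth C n1 (fun z k => vtab (n2 z) (x z k)) k1 _ _ _) _ _); cbv beta end.

Tactic Notation "tnth3" uconstr(n1) uconstr(n2) uconstr(n3) uconstr(x) uconstr(k1) uconstr(k2) uconstr(k3) :=
  match goal with |- @comp ?C _ =>
    refine (@comp_tabnth C n3 (fun z k => x z (k1 z) (k2 z) k) k3
      (@comp_tabnth C n2 (fun z k => vtab (n3 z) (x z (k1 z) k)) k2
      (@comp_tabnth C n1 (fun z k => vtab (n2 z) (fun k' => vtab (n3 z) (x z k k'))) k1 _ _ _) _ _) _ _);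
    cbv beta end.

(** * Computability of each stage of the procedure *)

Section Pipeline.
Variables (Phi : Type) (F : Phi -> fieldType) (enc : forall phi, F phi -> value).
Variables (desc : Phi -> value) (pw : Phi -> nat).
Variable solve : forall phi, nat -> nat -> (nat -> nat -> F phi) -> (nat -> F phi) ->
  option (nat -> F phi).
Hypothesis solveP : forall phi, solver_spec (@solve phi).
Hypotheses (Hsolve : solver_comp enc desc pw solve) (Hconsts : consts_comp enc desc pw).

Local Notation good := (good desc pw).

Ltac fstep := match goal with
  | |- @comp ?C (fun z => enc (GRing.mul (@?x z) (@?y z))) =>
     refine (@fmul Phi F enc desc pw solve solveP Hsolve Hconsts C _ _ x y _ _); [ solve [gauto] | | ]
  | |- @comp ?C (fun z => enc (GRing.add (@?x z) (GRing.opp (@?y z)))) =>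
     refine (@fsub Phi F enc desc pw solve solveP Hsolve Hconsts C _ _ x y _ _); [ solve [gauto] | | ]
  | |- @comp ?C (fun z => enc (GRing.exp (@?x z) (@?j z))) =>
     refine (@fpow Phi F enc desc pw solve solveP Hsolve Hconsts C _ _ x j _ _ _); [ solve [gauto] | | | solve [nauto] ]
  | |- @comp ?C (fun z => enc (GRing.natmul (GRing.one _) (@?j z))) =>
     refine (@fnat Phi F enc desc pw solve solveP Hsolve Hconsts C _ _ j _ _); [ solve [gauto] | | solve [nauto] ]
  end.

Ltac fgo := repeat first [ assumption | cif | fstep | cstep | solve [cleaf] ].

Ltac ctab := match goal with
  | |- @comp ?C (fun i => vtab (@?n i) (@?x i)) => refine (@comp_tab C n x _ _ _);
     [ by fgo | by nauto | cbv beta ]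
  end.

Lemma plook (C : ctx) (p : ix C -> Phi) (n k : ix C -> nat) (P : forall z, {poly F (p z)}) :
  good p -> comp (fun z => vnat (n z)) ->
  comp (fun z => vtab (n z) (fun k => enc (P z)`_k)) ->
  comp (fun z => vnat (k z)) -> (forall z, dom z -> (size (P z) <= n z)%N) ->
  comp (fun z => enc (P z)`_(k z)).
Proof.
move=> g cn ct ck sz; have [H0 _ _] := Hconsts g.
apply: (@comp_ext C (fun z => vif (k z < n z)%N (enc (P z)`_(k z)) (enc (0 : F (p z))))).
  by fgo; tnth n (fun z k => enc (P z)`_k) k; [by fgo | by fgo | by dtac].
by move=> z Dz; rewrite /vif; case: ltnP => // le; rewrite nth_default // (leq_trans (sz z Dz)).
Qed.

Tactic Notation "plk" uconstr(n) uconstr(P) uconstr(k) :=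
  match goal with |- @comp ?C _ => refine (@plook C _ n k P _ _ _ _ _) end.

Lemma coef_xth phi r i (h : {poly F phi}) b :
  (xth r i h)`_b = if (b < i %/ r.+1)%N then 0
    else h`_(b - i %/ r.+1) * (b - i %/ r.+1)%:R ^+ (i %% r.+1).
Proof. by rewrite /xth coefXnM coef_iter_theta. Qed.

Variable roots : forall phi, nat -> (nat -> F phi) -> nat -> F phi.

Definition roots_comp : Prop :=
  forall (c : ctx) (fi : ix c -> Phi) (n : ix c -> nat) (x : forall i, nat -> F (fi i)),
  good fi -> comp (fun i => vnat (n i)) -> nbnd n ->
  comp (fun i => vtab (n i) (fun k => enc (x i k))) ->
  (forall i, dom i -> split_ok (n i) (x i)) ->
  comp (fun i => vtab (n i) (fun k => enc (roots (n i) (x i) k))).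

Hypothesis Hroots : roots_comp.

Section Stages.
Variables (c : ctx) (fi : ix c -> Phi) (r d delta : ix c -> nat) (val : forall i, nat -> F (fi i)).
Hypotheses (gd : good fi)
  (cr : comp (fun i => vnat (r i))) (br : nbnd r)
  (cd : comp (fun i => vnat (d i))) (bd : nbnd d)
  (ce : comp (fun i => vnat (delta i))) (bde : nbnd delta).

Local Notation K i := (rK (d i) (delta i)).
Local Notation D i := (rD (r i) (delta i)).
Local Notation E i := (rE (r i) (delta i)).
Local Notation B i := (rB (r i) (d i) (delta i)).
Local Notation S i := (rS (r i) (delta i)).
Local Notation T i := (rT (r i) (delta i)).
Local Notation BE i := (rBE (r i) (d i) (delta i)).
Local Notation M i := (rM (r i) (d i) (delta i)).
Local Notation Bd i := (rBd (d i) (delta i)).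

Hypothesis tval : comp (fun i => vtab (K i) (fun t => enc (val i t))).

Let be : vbnd (@env c). Proof. exact: (comp_env_bnd gd.1). Qed.
Let H0 : comp (fun i => enc (0 : F (fi i))). Proof. by case: (Hconsts gd). Qed.
Let H1 : comp (fun i => enc (1 : F (fi i))). Proof. by case: (Hconsts gd). Qed.

Let cK : comp (fun i => vnat (K i)). Proof. by rewrite /rK; cauto. Qed.
Let bK : nbnd (fun i => K i). Proof. by rewrite /rK; nauto. Qed.
Let cE : comp (fun i => vnat (E i)). Proof. by rewrite /rE; cauto. Qed.
Let bE : nbnd (fun i => E i). Proof. by rewrite /rE; nauto. Qed.
Let cB : comp (fun i => vnat (B i)). Proof. by rewrite /rB /rD; cauto. Qed.
Let bB : nbnd (fun i => B i). Proof. by rewrite /rB /rD; nauto. Qed.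
Let cS : comp (fun i => vnat (S i)). Proof. by rewrite /rS /rD; cauto. Qed.
Let bS : nbnd (fun i => S i). Proof. by rewrite /rS /rD; nauto. Qed.
Let cT : comp (fun i => vnat (T i)). Proof. by rewrite /rT; cauto. Qed.
Let bT : nbnd (fun i => T i). Proof. by rewrite /rT; nauto. Qed.
Let cBE : comp (fun i => vnat (BE i)). Proof. by rewrite /rBE; cauto. Qed.
Let bBE : nbnd (fun i => BE i). Proof. by rewrite /rBE; nauto. Qed.
Let cM : comp (fun i => vnat (M i)). Proof. by rewrite /rM; cauto. Qed.
Let bM : nbnd (fun i => M i). Proof. by rewrite /rM; nauto. Qed.
Let cBd : comp (fun i => vnat (Bd i)). Proof. by rewrite /rBd; cauto. Qed.
Let bBd : nbnd (fun i => Bd i). Proof. by rewrite /rBd; nauto. Qed.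

Local Notation g i := (ag (@solve _) (d i) (delta i) (val i)).

Lemma tab_ag : comp (fun i => vtab (K i) (fun k => enc (g i)`_k)).
Proof.
ctab; apply: (@comp_ext (ext (fun i => K i)) (fun z => enc (odflt (fun=> 0)
  (solve (K z.1) (K z.1) (fun j t => (t%:R : F (fi z.1)) ^+ j) (val z.1)) z.2))); last first.
  by move=> z [_ lt]; rewrite coef_poly lt.
refine (@fsolve_nth Phi F enc desc pw solve Hsolve Hconsts (ext (fun i => K i)) (fun z => fi z.1) _
  (fun z => K z.1) (fun z => K z.1) (fun z j t => t%:R ^+ j) (fun z => val z.1) _ _ _ _ _ _ (fun z => z.2) _ _).
- by gauto.
- by fgo.
- by nauto.
- by fgo.
- by nauto.
- by fgo.
- by tnth (fun z => K z.1.1) (fun z k => enc (val z.1.1 k)) (fun z => z.2); [fgo | fgo | dtac].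
- by fgo.
- by dtac.
Qed.

Let szag i : (size (g i) <= K i)%N. Proof. exact: size_poly. Qed.

Lemma tab_xth : comp (fun i => vtab (S i) (fun s => vtab (B i) (fun b => enc (xth (r i) s (g i))`_b))).
Proof.
have tg := tab_ag.
ctab; ctab; set X := ext _.
apply: (@comp_ext X (fun z => vif (z.2 < z.1.2 %/ (r z.1.1).+1)%N (enc (0 : F (fi z.1.1)))
   (enc ((g z.1.1)`_(z.2 - z.1.2 %/ (r z.1.1).+1) * (z.2 - z.1.2 %/ (r z.1.1).+1)%:R ^+ (z.1.2 %% (r z.1.1).+1))))); last first.
  by move=> z _; rewrite coef_xth /vif; case: ifP.
have bX : @nbnd X (fun z => z.1.2 %% (r z.1.1).+1)%N.
  by apply: (@nbnd_le X _ (fun z => z.1.2)); [rewrite /X; nauto | move=> z _; apply: leq_mod].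
rewrite /X in bX *; fgo.
by plk (fun z => K z.1.1) (fun z => g z.1.1) (fun z => z.2 - z.1.2 %/ (r z.1.1).+1)%N; [gauto | fgo | fgo | fgo | dtac].
Qed.

Local Notation kap i := (akap (@solve _) (r i) (d i) (delta i) (val i)).

Lemma tab_kap : comp (fun i => vtab (S i) (fun s => vtab (S i) (fun k => enc (kap i s k)))).
Proof.
have tx := tab_xth; ctab; ctab; set X := ext _.
refine (@fkervec Phi F enc desc pw solve solveP Hsolve Hconsts X (fun z => fi z.1.1) _
  (fun z => S z.1.1) (fun z => B z.1.1) (fun z => z.1.2) (fun z k b => (xth (r z.1.1) k (g z.1.1))`_b)
  _ _ _ _ _ _ _ (fun z => z.2) _ _); rewrite /X.
- by gauto.
- by fgo.
- by nauto.
- by fgo.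
- by nauto.
- by fgo.
- by dtac.
- by fgo.
- by fgo.
- by dtac.
Qed.

Local Notation N i := (aN (@solve _) (r i) (d i) (delta i) (val i)).

Let bSB : nbnd (fun i => S i * B i)%N. Proof. by nauto. Qed.

Lemma tab_aN : comp (fun i => vtab (K i) (fun k => vtab (S i * B i) (fun q => enc (N i k q)))).
Proof.
have tk := tab_kap; ctab; ctab; set X := ext _.
refine (@comp_ext X (fun z => enc (\sum_(s < S z.1.1) kap z.1.1 (z.2 %/ B z.1.1)%N s *
   (xth (r z.1.1) s ('X^(z.1.2) : {poly F (fi z.1.1)}))`_(z.2 %% B z.1.1)))
   (fun z => enc (N z.1.1 z.1.2 z.2)) _ _); last first.
  by move=> z _; rewrite /aN /aL coef_sum; congr enc; apply: eq_bigr => s _; rewrite coefZ.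
refine (@fdot Phi F enc desc pw solve solveP Hsolve Hconsts X (fun z => fi z.1.1) _
  (fun z => S z.1.1) (fun z s => kap z.1.1 (z.2 %/ B z.1.1)%N s)
  (fun z s => (xth (r z.1.1) s ('X^(z.1.2) : {poly F (fi z.1.1)}))`_(z.2 %% B z.1.1)) _ _ _ _); rewrite /X.
- by gauto.
- by fgo.
- by nauto.
- tnth2 (fun z => S z.1.1.1) (fun z => S z.1.1.1) (fun z s k => enc (kap z.1.1.1 s k))
    (fun z => z.1.2 %/ B z.1.1.1)%N (fun z => z.2); [by fgo | by fgo | | by fgo | by dtac].
  by dtac; rewrite ltn_divLR.
set Y := ext _.
apply: (@comp_ext Y (fun z => vif (z.1.2 %% B z.1.1.1 < z.2 %/ (r z.1.1.1).+1)%N (enc (0 : F (fi z.1.1.1)))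
   (vif (z.1.2 %% B z.1.1.1 - z.2 %/ (r z.1.1.1).+1 == z.1.1.2)%N
     (enc ((z.1.1.2%:R : F (fi z.1.1.1)) ^+ (z.2 %% (r z.1.1.1).+1))) (enc (0 : F (fi z.1.1.1)))))); last first.
  move=> z _; rewrite coef_xth /vif; case: ifP => // _; rewrite coefXn.
  by case: eqP => [->|_]; rewrite ?mul1r ?mul0r.
have bY : @nbnd Y (fun z => z.2 %% (r z.1.1.1).+1)%N.
  by apply: (@nbnd_le Y _ (fun z => z.2)); [rewrite /Y; nauto | move=> z _; apply: leq_mod].
by rewrite /Y in bY *; fgo.
Qed.

Local Notation w i := (aw (@solve _) (r i) (d i) (delta i) (val i)).

Lemma tab_aw : comp (fun i => vtab (K i) (fun k => vtab (K i) (fun b => enc (w i k)`_b))).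
Proof.
have tn := tab_aN; ctab; ctab; set X := ext _.
apply: (@comp_ext X (fun z => enc (kervec (@solve _) (K z.1.1) (S z.1.1 * B z.1.1) (N z.1.1) z.1.2 z.2))); last first.
  by move=> z [_ lt]; rewrite coef_poly lt.
refine (@fkervec Phi F enc desc pw solve solveP Hsolve Hconsts X (fun z => fi z.1.1) _
  (fun z => K z.1.1) (fun z => S z.1.1 * B z.1.1)%N (fun z => z.1.2) (fun z => N z.1.1)
  _ _ _ _ _ _ _ (fun z => z.2) _ _); rewrite /X.
- by gauto.
- by fgo.
- by nauto.
- by fgo.
- by nauto.
- by fgo.
- by dtac.
- by fgo.
- by fgo.
- by dtac.
Qed.

Let szaw i k : (size (w i k) <= K i)%N. Proof. exact: size_poly. Qed.

Local Notation xw i := (axw (@solve _) (r i) (d i) (delta i) (val i)).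

Let bEK : nbnd (fun i => (E i).+1 * K i)%N. Proof. by nauto. Qed.

Lemma tab_axw : comp (fun i => vtab ((E i).+1 * K i) (fun q => vtab (BE i) (fun b => enc (xw i q)`_b))).
Proof.
have tw := tab_aw; ctab; ctab; set X := ext _.
apply: (@comp_ext X (fun z => vif (z.2 < z.1.2 %/ K z.1.1)%N (enc (0 : F (fi z.1.1)))
   (enc (w z.1.1 (z.1.2 %% K z.1.1)%N)`_(z.2 - z.1.2 %/ K z.1.1)))); last first.
  by move=> z _; rewrite /axw coefXnM /vif; case: ifP.
rewrite /X; fgo.
plk (fun z => K z.1.1) (fun z => w z.1.1 (z.1.2 %% K z.1.1)%N) (fun z => z.2 - z.1.2 %/ K z.1.1)%N; [by gauto | by fgo | | by fgo | by dtac].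
tnth (fun z => K z.1.1) (fun z k => vtab (K z.1.1) (fun b => enc (w z.1.1 k)`_b)) (fun z => z.1.2 %% K z.1.1)%N; [by fgo | by fgo | ].
by dtac; rewrite ltn_mod.
Qed.

Local Notation row i := (arow (@solve _) (r i) (d i) (delta i) (val i)).

Lemma tab_arow : comp (fun i => vtab (M i) (fun q => vtab (BE i) (fun b => enc (row i q)`_b))).
Proof.
have tx := tab_axw; have tg := tab_ag; ctab; ctab; set X := ext _.
apply: (@comp_ext X (fun z => vif (z.1.2 < (E z.1.1).+1)%N
   (vif (z.2 < z.1.2)%N (enc (0 : F (fi z.1.1))) (enc ((g z.1.1)`_(z.2 - z.1.2) * (z.2 - z.1.2)%:R)))
   (enc (xw z.1.1 (z.1.2 - (E z.1.1).+1)%N)`_z.2))); last first.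
  by move=> z _; rewrite /arow /vif; case: ifP => // _; rewrite coefXnM coef_theta; case: ifP.
rewrite /X; fgo.
  by plk (fun z => K z.1.1) (fun z => g z.1.1) (fun z => z.2 - z.1.2)%N; [gauto | fgo | fgo | fgo | dtac].
tnth2 (fun z => (E z.1.1).+1 * K z.1.1)%N (fun z => BE z.1.1) (fun z q b => enc (xw z.1.1 q)`_b)
  (fun z => z.1.2 - (E z.1.1).+1)%N (fun z => z.2); [by fgo | by fgo | | by fgo | by dtac].
move=> z [[[Dz lt1] lt2] /negP ge] /=; rewrite /rM /= in lt1.
by rewrite ltn_subLR // leqNgt; apply/negP.
Qed.

Local Notation ai i := (aidx (@solve _) (r i) (d i) (delta i) (val i)).

Let EM i s : (s <= (E i).+1)%N -> (s < M i)%N.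
Proof. by rewrite /rM => le; apply: leq_ltn_trans le _; rewrite -[X in (X < _)%N]addn0 ltn_add2l. Qed.

Lemma comp_aidx : comp (fun i => vnat (ai i)).
Proof.
have tr := tab_arow.
refine (@ncomp_find c (fun i => (E i).+1)
   (fun i s => isSome (kersol (@solve _) (M i) (BE i) (fun k b => (row i k)`_b) s)) _ _ _).
- by fgo.
- by nauto.
set X := ext _.
refine (@fkersol Phi F enc desc pw solve Hsolve X (fun z => fi z.1) _
  (fun z => M z.1) (fun z => BE z.1) (fun z => z.2) (fun z k b => (row z.1 k)`_b)
  _ _ _ _ _ _ _); rewrite /X.
- by gauto.
- by fgo.
- by nauto.
- by fgo.
- by nauto.
- by fgo.
- by dtac; apply: EM; apply: ltnW.
- by fgo.
Qed.

Let aile i : (ai i <= (E i).+1)%N.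
Proof. by apply: leq_trans (find_size _ _) _; rewrite size_iota. Qed.

Let bai : nbnd (fun i => ai i).
Proof. by apply: (@nbnd_le c _ (fun i => (E i).+1)); [nauto | move=> i _; apply: aile]. Qed.

Local Notation a i := (aa (@solve _) (r i) (d i) (delta i) (val i)).

Lemma tab_aa : comp (fun i => vtab (E i).+1 (fun l => enc (a i)`_l)).
Proof.
have tr := tab_arow; have ca := comp_aidx; ctab; set X := ext _.
apply: (@comp_ext X (fun z => enc (kervec (@solve _) (M z.1) (BE z.1) (fun k b => (row z.1 k)`_b) (ai z.1) z.2))); last first.
  by move=> z [_ lt]; rewrite coef_poly lt.
refine (@fkervec Phi F enc desc pw solve solveP Hsolve Hconsts X (fun z => fi z.1) _
  (fun z => M z.1) (fun z => BE z.1) (fun z => ai z.1) (fun z k b => (row z.1 k)`_b)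
  _ _ _ _ _ _ _ (fun z => z.2) _ _); rewrite /X.
- by gauto.
- by fgo.
- by nauto.
- by fgo.
- by nauto.
- by fgo.
- by dtac; apply: EM; apply: aile.
- by fgo.
- by fgo.
- by dtac; apply: EM; apply: ltnW.
Qed.

Let szaa i : (size (a i) <= (E i).+1)%N. Proof. exact: size_poly. Qed.

Local Notation acc i := (ac (@solve _) (r i) (d i) (delta i) (val i)).

Lemma tab_ac : comp (fun i => vtab (K i) (fun k => vtab ((E i).+1 * K i) (fun q => enc (acc i k q)))).
Proof.
have tx := tab_axw; have tw := tab_aw; have ta := tab_aa; ctab; ctab; set X := ext _.
refine (@fpspan Phi F enc desc pw solve Hsolve Hconsts X (fun z => fi z.1.1) _
  (fun z => (E z.1.1).+1 * K z.1.1)%N (fun z => BE z.1.1) (fun z => xw z.1.1)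
  (fun z => a z.1.1 * theta (w z.1.1 z.1.2)) _ _ _ _ _ _ (fun z => z.2) _ _); rewrite /X.
- by gauto.
- by fgo.
- by nauto.
- by fgo.
- by nauto.
- by tnth2 (fun z => (E z.1.1.1.1).+1 * K z.1.1.1.1)%N (fun z => BE z.1.1.1.1)
    (fun z q b => enc (xw z.1.1.1.1 q)`_b) (fun z => z.1.2) (fun z => z.2); [fgo | fgo | dtac | fgo | dtac].
- set Y := ext _.
  apply: (@comp_ext Y (fun z => enc (\sum_(j < z.2.+1) (a z.1.1.1)`_j *
     (theta (w z.1.1.1 z.1.1.2))`_(z.2 - j)))); last by move=> z _; rewrite coefM.
  refine (@fdot Phi F enc desc pw solve solveP Hsolve Hconsts Y (fun z => fi z.1.1.1) _
    (fun z => z.2.+1) (fun z j => (a z.1.1.1)`_j) (fun z j => (theta (w z.1.1.1 z.1.1.2))`_(z.2 - j)) _ _ _ _); rewrite /Y.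
  + by gauto.
  + by fgo.
  + by nauto.
  + by plk (fun z => (E z.1.1.1.1).+1) (fun z => a z.1.1.1.1) (fun z => z.2); [gauto | fgo | fgo | fgo | dtac].
  set Z := ext _.
  apply: (@comp_ext Z (fun z => enc ((w z.1.1.1.1 z.1.1.1.2)`_(z.1.2 - z.2) * (z.1.2 - z.2)%:R))); last first.
    by move=> z _; rewrite coef_theta.
  rewrite /Z; fgo.
  plk (fun z => K z.1.1.1.1) (fun z => w z.1.1.1.1 z.1.1.1.2) (fun z => z.1.2 - z.2)%N; [by gauto | by fgo | | by fgo | by dtac].
  by tnth (fun z => K z.1.1.1.1) (fun z k => vtab (K z.1.1.1.1) (fun b => enc (w z.1.1.1.1 k)`_b)) (fun z => z.1.1.1.2); [fgo | fgo | dtac].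
- by fgo.
- by dtac.
Qed.

Local Notation yy i := (ay (@solve _) (r i) (d i) (delta i) (val i)).

Lemma tab_ay : comp (fun i => vtab (K i) (fun l => enc (yy i l))).
Proof.
have tw := tab_aw; have tg := tab_ag; ctab; set X := ext _.
refine (@fpspan Phi F enc desc pw solve Hsolve Hconsts X (fun z => fi z.1) _
  (fun z => K z.1) (fun z => K z.1) (fun z => w z.1) (fun z => g z.1) _ _ _ _ _ _ (fun z => z.2) _ _); rewrite /X.
- by gauto.
- by fgo.
- by nauto.
- by fgo.
- by nauto.
- by tnth2 (fun z => K z.1.1.1) (fun z => K z.1.1.1)
    (fun z q b => enc (w z.1.1.1 q)`_b) (fun z => z.1.2) (fun z => z.2); [fgo | fgo | dtac | fgo | dtac].
- by tnth (fun z => K z.1.1) (fun z b => enc (g z.1.1)`_b) (fun z => z.2); [fgo | fgo | dtac].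
- by fgo.
- by dtac.
Qed.

Local Notation CC i := (aC (@solve _) (r i) (d i) (delta i) (val i)).

Lemma tab_aC : comp (fun i => vtab (T i) (fun t => vtab (K i) (fun k => vtab (K i) (fun l => enc (CC i t k l))))).
Proof.
have ta := tab_ac; ctab; ctab; ctab; set X := ext _.
refine (@fdot Phi F enc desc pw solve solveP Hsolve Hconsts X (fun z => fi z.1.1.1) _
  (fun z => (E z.1.1.1).+1) (fun z m => (z.1.1.2%:R : F (fi z.1.1.1)) ^+ m)
  (fun z m => acc z.1.1.1 z.1.2 (m * K z.1.1.1 + z.2)%N) _ _ _ _); rewrite /X.
- by gauto.
- by fgo.
- by nauto.
- by fgo.
tnth2 (fun z => K z.1.1.1.1) (fun z => (E z.1.1.1.1).+1 * K z.1.1.1.1)%N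
   (fun z k q => enc (acc z.1.1.1.1 k q)) (fun z => z.1.1.2) (fun z => z.2 * K z.1.1.1.1 + z.1.2)%N; [by fgo | by fgo | by dtac | by fgo | ].
dtac; apply: (@leq_trans (z.2.+1 * K z.1.1.1.1)%N); first by rewrite mulSnr ltn_add2l.
by rewrite leq_mul2r; apply/orP; right.
Qed.

Local Notation zz i := (az (@solve _) (r i) (d i) (delta i) (val i)).

Lemma tab_az : comp (fun i => vtab (T i) (fun t => vtab (r i).+1 (fun j => vtab (K i) (fun b => enc (zz i t j)`_b)))).
Proof.
have tC := tab_aC; have tw := tab_aw; have ty := tab_ay; ctab; ctab; ctab; set X := ext _.
apply: (@comp_ext X (fun z => enc (\sum_(l < K z.1.1.1) kry (K z.1.1.1) (CC z.1.1.1 z.1.1.2) (yy z.1.1.1) z.1.2 l *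
   (w z.1.1.1 l)`_z.2))); last first.
  by move=> z _; rewrite /az coef_sum; congr enc; apply: eq_bigr => l _; rewrite coefZ.
refine (@fdot Phi F enc desc pw solve solveP Hsolve Hconsts X (fun z => fi z.1.1.1) _
  (fun z => K z.1.1.1) (fun z l => kry (K z.1.1.1) (CC z.1.1.1 z.1.1.2) (yy z.1.1.1) z.1.2 l)
  (fun z l => (w z.1.1.1 l)`_z.2) _ _ _ _); rewrite /X.
- by gauto.
- by fgo.
- by nauto.
- set Y := ext _.
  refine (@fkry Phi F enc desc pw solve solveP Hsolve Hconsts Y (fun z => fi z.1.1.1.1) _
    (fun z => K z.1.1.1.1) (fun z => z.1.1.2) (fun z => z.2) (fun z => CC z.1.1.1.1 z.1.1.1.2)
    (fun z => yy z.1.1.1.1) _ _ _ _ _ _ _ _); rewrite /Y.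
  + by gauto.
  + by fgo.
  + by nauto.
  + by fgo.
  + by nauto.
  + by fgo.
  + by dtac.
  + by tnth3 (fun z => T z.1.1.1.1.1.1) (fun z => K z.1.1.1.1.1.1) (fun z => K z.1.1.1.1.1.1)
      (fun z t k l => enc (CC z.1.1.1.1.1.1 t k l)) (fun z => z.1.1.1.1.1.2) (fun z => z.1.2) (fun z => z.2);
      [fgo | fgo | dtac | fgo | dtac | fgo | dtac].
  + by tnth (fun z => K z.1.1.1.1.1) (fun z b => enc (yy z.1.1.1.1.1 b)) (fun z => z.2); [fgo | fgo | dtac].
by tnth2 (fun z => K z.1.1.1.1) (fun z => K z.1.1.1.1) (fun z k b => enc (w z.1.1.1.1 k)`_b)
   (fun z => z.2) (fun z => z.1.2); [fgo | fgo | dtac | fgo | dtac].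
Qed.

Local Notation test i := (atest (@solve _) (r i) (d i) (delta i) (val i)).
Local Notation q0 i := (aq (@solve _) (r i) (d i) (delta i) (val i)).
Local Notation nu i := (anu (@solve _) (r i) (d i) (delta i) (val i)).
Local Notation t0 i := (at_ (@solve _) (r i) (d i) (delta i) (val i)).

Let bR : nbnd (fun i => r i * T i)%N. Proof. by nauto. Qed.

Lemma comp_atest : @comp (ext (fun i => r i * T i)%N) (fun z => vnat (test z.1 z.2)).
Proof.
have tz := tab_az; set X := ext _.
refine (@bcomp_eq X (fun z => find (fun s => isSome (kersol (@solve _) (r z.1 - z.2 %/ T z.1) (K z.1)
   (fun k b => (zz z.1 (z.2 %% T z.1) k)`_b) s)) (iota 0 (r z.1 - z.2 %/ T z.1)))
   (fun z => r z.1 - z.2 %/ T z.1)%N _ _); last by rewrite /X; fgo.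
refine (@ncomp_find X (fun z => r z.1 - z.2 %/ T z.1)%N
   (fun z s => isSome (kersol (@solve _) (r z.1 - z.2 %/ T z.1) (K z.1)
   (fun k b => (zz z.1 (z.2 %% T z.1) k)`_b) s)) _ _ _).
- by rewrite /X; fgo.
- by rewrite /X; nauto.
set Y := ext _.
refine (@fkersol Phi F enc desc pw solve Hsolve Y (fun z => fi z.1.1) _
  (fun z => r z.1.1 - z.1.2 %/ T z.1.1)%N (fun z => K z.1.1) (fun z => z.2)
  (fun z k b => (zz z.1.1 (z.1.2 %% T z.1.1)%N k)`_b)
  _ _ _ _ _ _ _); rewrite /Y /X.
- by gauto.
- by fgo.
- by nauto.
- by fgo.
- by nauto.
- by fgo.
- by dtac.
- ctab; ctab.
  tnth3 (fun z => T z.1.1.1.1) (fun z => (r z.1.1.1.1).+1) (fun z => K z.1.1.1.1)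
    (fun z t k b => enc (zz z.1.1.1.1 t k)`_b) (fun z => z.1.1.1.2 %% T z.1.1.1.1)%N (fun z => z.1.2) (fun z => z.2);
    [by fgo | by fgo | by dtac; rewrite ltn_mod | by fgo | | by fgo | by dtac].
  move=> z [[_ lt] _] /=; apply: ltnW; rewrite ltnS; apply: leq_trans lt _; apply: leq_subr.
Qed.

Lemma comp_aq : comp (fun i => vnat (q0 i)).
Proof.
refine (@ncomp_find c (fun i => r i * T i)%N (fun i q => test i q) _ _ _).
- by fgo.
- by nauto.
exact: comp_atest.
Qed.

Let bq0 : nbnd (fun i => q0 i).
Proof.
apply: (nbnd_le bR) => i _.
by apply: leq_trans (find_size _ _) _; rewrite size_iota.
Qed.

Lemma comp_anu : comp (fun i => vnat (nu i)).
Proof. by have cq := comp_aq; rewrite /anu; fgo. Qed.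

Let nule i : (nu i <= r i)%N. Proof. exact: leq_subr. Qed.

Let bnu : nbnd (fun i => nu i).
Proof. by apply: (nbnd_le br). Qed.

Lemma comp_at : comp (fun i => vnat (t0 i)).
Proof. by have cq := comp_aq; rewrite /at_; fgo. Qed.

Let t0lt i : (t0 i < T i)%N. Proof. by rewrite /at_ ltn_mod. Qed.

Local Notation zt i := (zz i (t0 i)).

Lemma tab_zt : comp (fun i => vtab (r i).+1 (fun j => vtab (K i) (fun b => enc (zt i j)`_b))).
Proof.
have tz := tab_az; have ct := comp_at.
by tnth (fun i => T i) (fun i t => vtab (r i).+1 (fun j => vtab (K i) (fun b => enc (zz i t j)`_b))) (fun i => t0 i).
Qed.

Let szaz i t j : (size (zz i t j) <= K i)%N.
Proof. by apply: size_sum_le => l _; apply: leq_trans (size_scale_leq _ _) (szaw _ _). Qed.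

Local Notation chi i := (achi (@solve _) (r i) (d i) (delta i) (val i)).

Lemma tab_achi : comp (fun i => vtab (nu i) (fun k => enc (chi i k))).
Proof.
have tz := tab_zt; have cn := comp_anu; ctab; set X := ext _.
refine (@fpspan Phi F enc desc pw solve Hsolve Hconsts X (fun z => fi z.1) _
  (fun z => nu z.1) (fun z => K z.1) (fun z => zt z.1) (fun z => zt z.1 (nu z.1)) _ _ _ _ _ _ (fun z => z.2) _ _); rewrite /X.
- by gauto.
- by fgo.
- by nauto.
- by fgo.
- by nauto.
- tnth2 (fun z => (r z.1.1.1).+1) (fun z => K z.1.1.1)
    (fun z q b => enc (zt z.1.1.1 q)`_b) (fun z => z.1.2) (fun z => z.2); [by fgo | by fgo | | by fgo | by dtac].
  by move=> z [[_ lt] _] /=; apply: ltnW; rewrite ltnS; apply: leq_trans lt _; apply: nule.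
- by tnth2 (fun z => (r z.1.1).+1) (fun z => K z.1.1)
    (fun z q b => enc (zt z.1.1 q)`_b) (fun z => nu z.1.1) (fun z => z.2); [fgo | fgo | dtac; rewrite ltnS nule | fgo | dtac].
- by fgo.
- by dtac.
Qed.

(** The root finder is promised only for split polynomials, so correctness of the earlier stages
    enters the running-time proof here. *)
Hypothesis Hsplit : forall i, dom i -> split_ok (nu i) (chi i).

Local Notation lam i := (alam (@solve _) (@roots _) (r i) (d i) (delta i) (val i)).

Lemma tab_alam : comp (fun i => vtab (nu i) (fun k => enc (lam i k))).
Proof. exact: (@Hroots c fi (fun i => nu i) (fun i => chi i) gd comp_anu bnu tab_achi Hsplit). Qed.

Local Notation lag i := (alag (@solve _) (@roots _) (r i) (d i) (delta i) (val i)).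

Lemma tab_alag : comp (fun i => vtab (nu i) (fun j => vtab (nu i) (fun k => enc (lag i j k)))).
Proof.
have tl := tab_alam; have cn := comp_anu; ctab; ctab; set X := ext _.
refine (@fsolve_nth Phi F enc desc pw solve Hsolve Hconsts X (fun z => fi z.1.1) _
  (fun z => nu z.1.1) (fun z => nu z.1.1) (fun z k j => lam z.1.1 j ^+ k)
  (fun z j => (j == z.1.2)%:R) _ _ _ _ _ _ (fun z => z.2) _ _); rewrite /X.
- by gauto.
- by fgo.
- by nauto.
- by fgo.
- by nauto.
- fgo.
  by tnth (fun z => nu z.1.1.1.1) (fun z k => enc (lam z.1.1.1.1 k)) (fun z => z.2); [fgo | fgo | dtac].
- set Y := ext _.
  apply: (@comp_ext Y (fun z => vif (z.2 == z.1.1.2) (enc (1 : F (fi z.1.1.1))) (enc (0 : F (fi z.1.1.1))))); last first.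
    by move=> z _; rewrite /vif; case: eqP.
  by rewrite /Y; fgo.
- by fgo.
- by dtac.
Qed.

Local Notation G i := (agi (@solve _) (@roots _) (r i) (d i) (delta i) (val i)).

Lemma tab_agi : comp (fun i => vtab (nu i) (fun j => vtab (K i) (fun b => enc (G i j)`_b))).
Proof.
have tl := tab_alag; have tz := tab_zt; have cn := comp_anu; ctab; ctab; set X := ext _.
refine (@comp_ext X (fun z => enc (\sum_(k < nu z.1.1) lag z.1.1 z.1.2 k * (zt z.1.1 k)`_z.2))
   (fun z => enc (G z.1.1 z.1.2)`_z.2) _ _); last first.
  by move=> z _; rewrite /agi coef_sum; congr enc; apply: eq_bigr => s _; rewrite coefZ.
refine (@fdot Phi F enc desc pw solve solveP Hsolve Hconsts X (fun z => fi z.1.1) _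
  (fun z => nu z.1.1) (fun z k => lag z.1.1 z.1.2 k)
  (fun z k => (zt z.1.1 k)`_z.2) _ _ _ _); rewrite /X.
- by gauto.
- by fgo.
- by nauto.
- by tnth2 (fun z => nu z.1.1.1) (fun z => nu z.1.1.1) (fun z j k => enc (lag z.1.1.1 j k))
   (fun z => z.1.1.2) (fun z => z.2); [fgo | fgo | dtac | fgo | dtac].
tnth2 (fun z => (r z.1.1.1).+1) (fun z => K z.1.1.1) (fun z k b => enc (zt z.1.1.1 k)`_b)
   (fun z => z.2) (fun z => z.1.2); [by fgo | by fgo | | by fgo | by dtac].
by move=> z [_ lt] /=; apply: ltnW; rewrite ltnS; apply: leq_trans lt _; apply: nule.
Qed.

Let szG i j : (size (G i j) <= K i)%N.
Proof. by apply: size_sum_le => l _; apply: leq_trans (size_scale_leq _ _) (szaz _ _ _). Qed.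

Local Notation fr i := (afrow (@solve _) (@roots _) (r i) (d i) (delta i) (val i)).

Lemma tab_afrow : comp (fun i => vtab (nu i) (fun j => vtab (delta i).+1 (fun s =>
  vtab (Bd i) (fun b => enc (fr i j s)`_b)))).
Proof.
have tG := tab_agi; have cn := comp_anu; ctab; ctab; ctab; set X := ext _.
refine (@comp_ext X (fun z => vif (z.2 < delta z.1.1.1 - z.1.2)%N (enc (0 : F (fi z.1.1.1)))
   (enc ((G z.1.1.1 z.1.1.2)`_(z.2 - (delta z.1.1.1 - z.1.2)) *
    ((d z.1.1.1 * (delta z.1.1.1 - z.1.2))%:R - (z.2 - (delta z.1.1.1 - z.1.2))%:R))))
   (fun z => enc (fr z.1.1.1 z.1.1.2 z.1.2)`_z.2) _ _); last first.
  move=> z _; rewrite /afrow coefXnM /vif; case: ifP => // _; congr enc.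
  by rewrite coefB coefZ coef_theta mulrBr [in RHS]mulrC.
rewrite /X; fgo.
plk (fun z => K z.1.1.1) (fun z => G z.1.1.1 z.1.1.2) (fun z => z.2 - (delta z.1.1.1 - z.1.2))%N;
  [by gauto | by fgo | | by fgo | by dtac].
by tnth (fun z => nu z.1.1.1) (fun z k => vtab (K z.1.1.1) (fun b => enc (G z.1.1.1 k)`_b)) (fun z => z.1.1.2); [fgo | fgo | dtac].
Qed.

Local Notation sx i := (asidx (@solve _) (@roots _) (r i) (d i) (delta i) (val i)).

Lemma tab_asidx : comp (fun i => vtab (nu i) (fun j => vnat (sx i j))).
Proof.
have tf := tab_afrow; have cn := comp_anu; ctab; set X := ext _.
refine (@ncomp_find X (fun z => (delta z.1).+1)
   (fun z s => isSome (kersol (@solve _) (delta z.1).+1 (Bd z.1) (fun k b => (fr z.1 z.2 k)`_b) s)) _ _ _).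
- by rewrite /X; fgo.
- by rewrite /X; nauto.
set Y := ext _.
refine (@fkersol Phi F enc desc pw solve Hsolve Y (fun z => fi z.1.1) _
  (fun z => (delta z.1.1).+1) (fun z => Bd z.1.1) (fun z => z.2)
  (fun z k b => (fr z.1.1 z.1.2 k)`_b)
  _ _ _ _ _ _ _); rewrite /Y /X.
- by gauto.
- by fgo.
- by nauto.
- by fgo.
- by nauto.
- by fgo.
- by dtac.
- by tnth (fun z => nu z.1.1) (fun z j => vtab (delta z.1.1).+1 (fun s => vtab (Bd z.1.1) (fun b => enc (fr z.1.1 j s)`_b)))
    (fun z => z.1.2); [fgo | fgo | dtac].
Qed.

Hypothesis Hsx : forall i j, dom i -> (j < nu i)%N -> (sx i j < (delta i).+1)%N.

Local Notation al i := (aal (@solve _) (@roots _) (r i) (d i) (delta i) (val i)).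
Local Notation ff i := (afi (@solve _) (@roots _) (r i) (d i) (delta i) (val i)).

Lemma comp_reconstruct : comp (fun i => vtab (nu i) (fun j =>
  VPair (enc (al i j)) (vtab (delta i - sx i j).+1 (fun b => enc (ff i j)`_b)))).
Proof.
have tf := tab_afrow; have ts := tab_asidx; have tG := tab_agi; have cn := comp_anu; ctab; set X := ext _.
have cs : @comp X (fun z => vnat (sx z.1 z.2)).
  by rewrite /X; tnth (fun z => nu z.1) (fun z j => vnat (sx z.1 j)) (fun z => z.2); [fgo | fgo | dtac].
apply: (@comp_pair X).
  plk (fun z => K z.1) (fun z => G z.1 z.2) (fun z => d z.1 * (delta z.1 - sx z.1 z.2))%N;
  [by rewrite /X; gauto | by rewrite /X; fgo | | by rewrite /X in cs *; fgo | by dtac].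
  by rewrite /X; tnth (fun z => nu z.1) (fun z k => vtab (K z.1) (fun b => enc (G z.1 k)`_b)) (fun z => z.2); [fgo | fgo | dtac].
have bs : @nbnd X (fun z => (delta z.1 - sx z.1 z.2).+1).
  by apply: (@nbnd_le X _ (fun z => (delta z.1).+1)); [rewrite /X; nauto | move=> z _; rewrite ltnS leq_subr].
refine (@comp_tab X (fun z => (delta z.1 - sx z.1 z.2).+1) (fun z b => enc (ff z.1 z.2)`_b) _ bs _).
  by rewrite /X in cs *; fgo.
set Y := ext _.
refine (@comp_ext Y (fun z => enc (kervec (@solve _) (delta z.1.1).+1 (Bd z.1.1) (fun k b => (fr z.1.1 z.1.2 k)`_b) (sx z.1.1 z.1.2) (delta z.1.1 - z.2)%N))
  (fun z => enc (ff z.1.1 z.1.2)`_z.2) _ _); last first.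
  move=> z [_ lt]; rewrite coef_poly ltnS; have -> // : (z.2 <= delta z.1.1)%N.
  by rewrite ltnS in lt; apply: leq_trans lt _; apply: leq_subr.
refine (@fkervec Phi F enc desc pw solve solveP Hsolve Hconsts Y (fun z => fi z.1.1) _
  (fun z => (delta z.1.1).+1) (fun z => Bd z.1.1) (fun z => sx z.1.1 z.1.2) (fun z k b => (fr z.1.1 z.1.2 k)`_b)
  _ _ _ _ _ _ _ (fun z => delta z.1.1 - z.2)%N _ _); rewrite /Y.
- by rewrite /X in bs *; gauto.
- by rewrite /X in bs *; fgo.
- by rewrite /X in bs *; nauto.
- by rewrite /X in bs *; fgo.
- by rewrite /X in bs *; nauto.
- by rewrite /X in bs cs *; fgo.
- by move=> z [[Dz lt] _]; apply: Hsx.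
- rewrite /X in bs *.
  by tnth (fun z => nu z.1.1) (fun z j => vtab (delta z.1.1).+1 (fun s => vtab (Bd z.1.1) (fun b => enc (fr z.1.1 j s)`_b)))
    (fun z => z.1.2); [fgo | fgo | dtac].
- by rewrite /X in bs *; fgo.
- by move=> z _; rewrite ltnS leq_subr.
Qed.

End Stages.

End Pipeline.

Lemma map_enum_ord (T : Type) n (G : nat -> T) : [seq G (nat_of_ord i) | i <- enum 'I_n] = mkseq G n.
Proof. by rewrite /mkseq -val_enum_ord -map_comp. Qed.

Lemma enc_polyE (F : fieldType) (enc : F -> value) (q : {poly F}) :
  enc_poly enc q = vtab (size q) (fun b => enc q`_b).
Proof. by rewrite /enc_poly /vtab; congr vlist; rewrite -{1}(mkseq_nth 0 q) /mkseq -map_comp. Qed.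

(** * Consequences of minimality and of the bound on the characteristic *)

Section Instances.
Variables (F : fieldType) (r d delta n : nat) (g : {poly F}) (alpha : 'I_n -> F) (f : 'I_n -> {poly F}).
Hypothesis inst : reconstruction_instance r d delta g alpha f.

Lemma instance_gt0 : (0 < n)%N.
Proof.
case: inst => _ _ g0 _ [[gE _ _] _ _].
by move: g0; rewrite gE lt0n; apply: contraNneq => n0; subst n; rewrite /sum_powers big_ord0.
Qed.

(** A term with zero coefficient could be dropped, against minimality. *)
Lemma instance_alpha_neq0 i : alpha i != 0.
Proof.
case: inst => _ _ _ _ [[gE sz Hmin] _ _].
move: n alpha f i gE sz Hmin => [|m] al ff i gE sz Hmin; first by case: i.
apply/eqP => a0.
apply: (Hmin m (fun j => al (lift i j)) (fun j => ff (lift i j))) => //.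
by rewrite gE /sum_powers (bigD1_ord i) //= a0 scale0r add0r.
Qed.

(** Two distinct naturals with the same image differ by a positive multiple of the characteristic,
    which exceeds [2 r d delta]. *)
Lemma instance_inj_nat : inj_nat F (2 * r * d * delta).+1.
Proof.
case: inst => _ Hp _ _ _ a b; rewrite !ltnS.
suff W a' b' : (b' <= 2 * r * d * delta)%N -> a'%:R = b'%:R :> F -> (b' <= a')%N.
  by move=> la lb E; apply: anti_leq; apply/andP; split; apply: W.
move=> lb E; rewrite leqNgt; apply/negP => lt.
have pos : (0 < b' - a')%N by rewrite subn_gt0.
have z : (b' - a')%:R == 0 :> F by rewrite natrB ?(ltnW lt) // E subrr.
have [p pF] := natf0_pchar pos z.
have : (p %| b' - a')%N by rewrite (dvdn_pcharf pF).
move/(dvdn_leq pos) => le; have := Hp p pF; lia.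
Qed.

End Instances.

(** * Assembly of the program and its time bound *)

Section Assembly.
Variables (Phi : Type) (F : Phi -> fieldType) (enc : forall phi, F phi -> value).
Variables (desc : Phi -> value) (pw : Phi -> nat).
Variable solve : forall phi, nat -> nat -> (nat -> nat -> F phi) -> (nat -> F phi) ->
  option (nat -> F phi).
Variable roots : forall phi, nat -> (nat -> F phi) -> nat -> F phi.
Hypothesis solveP : forall phi, solver_spec (@solve phi).
Hypothesis rootsP : forall phi, roots_spec (@roots phi).
Hypotheses (Hsolve : solver_comp enc desc pw solve) (Hconsts : consts_comp enc desc pw)
  (Hroots : roots_comp enc desc pw roots).

Record instance := Instance {
  iphi : Phi;
  ir : nat; id_ : nat; ide : nat; inn : nat;
  ig : {poly F iphi};
  ialpha : 'I_inn -> F iphi;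
  ipol : 'I_inn -> {poly F iphi} }.

Variables (P : Phi -> Prop) (W : instance -> nat) (E : instance -> value).

Definition inst_ctx : ctx :=
  @Ctx instance
    (fun x => P (iphi x) /\ reconstruction_instance (ir x) (id_ x) (ide x) (ig x) (@ialpha x) (@ipol x))
    W (fun x => black_box (@enc _) (ig x)) E.

Local Notation c := inst_ctx.

Hypotheses (gd : @good Phi desc pw c iphi)
  (cr : @comp c (fun x => vnat (ir x))) (br : @nbnd c ir)
  (cd : @comp c (fun x => vnat (id_ x))) (bd : @nbnd c id_)
  (ce : @comp c (fun x => vnat (ide x))) (bde : @nbnd c ide)
  (bB : @nbnd c (fun x => bit_complexity (@enc _) (@ialpha x) (@ipol x))).

Let nal (x : instance) k : F (iphi x) := if insub k is Some i then @ialpha x i else 0.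
Let npol (x : instance) k : {poly F (iphi x)} := if insub k is Some i then @ipol x i else 0.

Let nle x : @dom c x -> (inn x <= ir x)%N. Proof. by case=> _ []. Qed.

Let bnn : @nbnd c inn. Proof. exact: (nbnd_le br). Qed.

Let gE x (y : F (iphi x)) : @dom c x ->
  (ig x).[y] = \sum_(k < inn x) nal x k * (\sum_(b < (ide x).+1) (npol x k)`_b * y ^+ b) ^+ id_ x.
Proof.
case=> _ [_ _ _ _ [[-> sz _] _ _]]; rewrite /sum_powers horner_sum.
apply: eq_bigr => i _; rewrite /nal /npol !valK hornerZ horner_exp.
by rewrite (horner_coef_wide _ (sz i)).
Qed.

Let b0 : @nbnd c (fun x => vsize (enc (0 : F (iphi x)))).
Proof. by apply: (@comp_vbnd c); case: (Hconsts gd). Qed.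

Let bBz : @nbnd c (fun x => bit_complexity (@enc _) (@ialpha x) (@ipol x) + vsize (enc (0 : F (iphi x))))%N.
Proof. exact: pbd_add. Qed.

Let al_size x k : (vsize (enc (nal x k)) <=
  bit_complexity (@enc _) (@ialpha x) (@ipol x) + vsize (enc (0 : F (iphi x))))%N.
Proof.
rewrite /nal; case: insubP => [i _ _|_]; last exact: leq_addl.
apply: leq_trans (leq_addr _ _); rewrite /bit_complexity (bigD1 i) //=.
by rewrite -addnA leq_addr.
Qed.

Let pol_size x k b : (vsize (enc (npol x k)`_b) <=
  bit_complexity (@enc _) (@ialpha x) (@ipol x) + vsize (enc (0 : F (iphi x))))%N.
Proof.
rewrite /npol; case: insubP => [i _ _|_]; last by rewrite coef0 leq_addl.
have [lt|le] := ltnP b (size (@ipol x i)); last by rewrite nth_default ?leq_addl.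
apply: leq_trans (leq_addr _ _); rewrite /bit_complexity (bigD1 i) //=.
rewrite (bigD1 (Ordinal lt)) //=; lia.
Qed.

(** A fictitious input that contains the unknown representation. No such program is ever run: that
    the values of [ig x] can be computed from this input in polynomial time shows that the oracle
    answers have size polynomial in the weight, as [comp_query] demands. *)
Let V x := VPair (E x) (VPair (vnat (inn x)) (VPair (vtab (inn x) (fun k => enc (nal x k)))
   (vtab (inn x) (fun k => vtab (ide x).+1 (fun b => enc (npol x k)`_b))))).

Let c1 := @setenv c V.

Let bV : @vbnd c1 V.
Proof.
have bE : @vbnd c E by exact: (comp_env_bnd cr).
apply: (@vbnd_pair c) => //; apply: (@vbnd_pair c).
  by apply: (@pbd_le _ _ _ _ _ (pbd_S bnn)) => x _; apply: vsize_nat_le.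
apply: (@vbnd_pair c).
  apply: (@vbnd_tab c inn (fun x k => enc (nal x k)) bnn).
  have b1 := nbnd_up (c := c) inn bBz.
  refine (@nbnd_le (@ext c inn) (fun z => vsize (enc (nal z.1 z.2))) _ b1 _) => z _.
  exact: al_size.
apply: (@vbnd_tab c inn (fun x k => vtab (ide x).+1 (fun b => enc (npol x k)`_b)) bnn).
have b1 : @nbnd (@ext c inn) (fun z => (ide z.1).+1) by nauto.
apply: (@vbnd_tab (@ext c inn) (fun z => (ide z.1).+1) (fun z b => enc (npol z.1 z.2)`_b)) => //.
have b2 := nbnd_up (c := @ext c inn) (fun z => (ide z.1).+1) (nbnd_up (c := c) inn bBz).
refine (@nbnd_le (@ext (@ext c inn) (fun z => (ide z.1).+1)) (fun z => vsize (enc (npol z.1.1 z.1.2)`_z.2)) _ b2 _) => z _.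
exact: pol_size.
Qed.

Let lift1 y : @comp c y -> @comp c1 y.
Proof.
move=> cy; apply: (@comp_sub c c1 (fun x => x) y cy) => //.
exact: (@comp_fst c1 _ _ (comp_id bV)).
Qed.

Let bval : @vbnd (@ext c (fun x => rK (id_ x) (ide x))) (fun z => enc (ig z.1).[z.2%:R]).
Proof.
change (@vbnd (@ext c1 (fun x => rK (id_ x) (ide x))) (fun z => enc (ig z.1).[z.2%:R])).
have gd1 : @good Phi desc pw c1 iphi by split; [apply: lift1; case: gd | case: gd].
have cd1 : @comp c1 (fun x => vnat (id_ x)) by apply: lift1.
have ce1 : @comp c1 (fun x => vnat (ide x)) by apply: lift1.
have bd1 : @nbnd c1 id_ by [].
have be1 : @nbnd c1 ide by [].
have bn1 : @nbnd c1 inn by [].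
have H := @comp_snd c1 _ _ (comp_id bV).
have cn1 : @comp c1 (fun x => vnat (inn x)) := comp_fst H.
have ta := comp_fst (comp_snd H); have tp := comp_snd (comp_snd H).
have bK : @nbnd c1 (fun x => rK (id_ x) (ide x)) by rewrite /rK; nauto.
apply: comp_vbnd; set X := ext _.
refine (@comp_ext X (fun z => enc (\sum_(k < inn z.1) nal z.1 k *
   (\sum_(b < (ide z.1).+1) (npol z.1 k)`_b * (z.2%:R : F (iphi z.1)) ^+ b) ^+ id_ z.1)) _ _ _); last first.
  by move=> z [Dz _]; rewrite gE.
have gX : @good Phi desc pw X (fun z => iphi z.1) by apply: good_ext.
refine (@fdot Phi F enc desc pw solve solveP Hsolve Hconsts X (fun z => iphi z.1) gX
  (fun z => inn z.1) (fun z k => nal z.1 k) (fun z k => (\sum_(b < (ide z.1).+1) (npol z.1 k)`_b * (z.2%:R : F (iphi z.1)) ^+ b) ^+ id_ z.1) _ _ _ _).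
- by rewrite /X; cgo.
- by rewrite /X; nauto.
- by rewrite /X; tnth (fun z => inn z.1.1) (fun z k => enc (nal z.1.1 k)) (fun z => z.2); [cgo | cgo | dtac].
set Y := ext _.
have gY : @good Phi desc pw Y (fun z => iphi z.1.1).
  by apply: (@good_ext Phi desc pw X (fun z => iphi z.1)) => //; rewrite /X; nauto.
refine (@fpow Phi F enc desc pw solve solveP Hsolve Hconsts Y (fun z => iphi z.1.1) gY
   (fun z => \sum_(b < (ide z.1.1).+1) (npol z.1.1 z.2)`_b * (z.1.2%:R : F (iphi z.1.1)) ^+ b)
   (fun z => id_ z.1.1) _ _ _); last 2 first.
- by rewrite /Y /X; cgo.
- by rewrite /Y /X; nauto.
refine (@fdot Phi F enc desc pw solve solveP Hsolve Hconsts Y (fun z => iphi z.1.1) gY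
  (fun z => (ide z.1.1).+1) (fun z b => (npol z.1.1 z.2)`_b) (fun z b => (z.1.2%:R : F (iphi z.1.1)) ^+ b) _ _ _ _).
- by rewrite /Y /X; cgo.
- by rewrite /Y /X; nauto.
- rewrite /Y /X; tnth (fun z => (ide z.1.1.1).+1) (fun z b => enc (npol z.1.1.1 z.1.2)`_b) (fun z => z.2); [ | by cgo | by dtac].
  by tnth (fun z => inn z.1.1.1) (fun z k => vtab (ide z.1.1.1).+1 (fun b => enc (npol z.1.1.1 k)`_b)) (fun z => z.1.2); [cgo | cgo | dtac].
set Z := ext _.
have gZ : @good Phi desc pw Z (fun z => iphi z.1.1.1).
  by apply: (@good_ext Phi desc pw Y (fun z => iphi z.1.1)) => //; rewrite /Y /X; nauto.
refine (@fpow Phi F enc desc pw solve solveP Hsolve Hconsts Z (fun z => iphi z.1.1.1) gZ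
   (fun z => z.1.1.2%:R) (fun z => z.2) _ _ _); last 2 first.
- by rewrite /Z /Y /X; cgo.
- by rewrite /Z /Y /X; nauto.
refine (@fnat Phi F enc desc pw solve solveP Hsolve Hconsts Z (fun z => iphi z.1.1.1) gZ (fun z => z.1.1.2) _ _).
- by rewrite /Z /Y /X; cgo.
- by rewrite /Z /Y /X; nauto.
Qed.

Let val x t : F (iphi x) := (ig x).[t%:R].

Let tval : @comp c (fun x => vtab (rK (id_ x) (ide x)) (fun t => enc (val x t))).
Proof.
have bK : @nbnd c (fun x => rK (id_ x) (ide x)) by rewrite /rK; nauto.
refine (@comp_tab c (fun x => rK (id_ x) (ide x)) (fun x t => enc (val x t)) _ bK _).
  by rewrite /rK; cgo.
set X := ext _.
have gX : @good Phi desc pw X (fun z => iphi z.1) by apply: good_ext.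
refine (@comp_query X (fun z => enc (z.2%:R : F (iphi z.1))) _ _ bval _).
  refine (@fnat Phi F enc desc pw solve solveP Hsolve Hconsts X (fun z => iphi z.1) gX (fun z => z.2) _ _).
    by rewrite /X; cgo.
  by rewrite /X; nauto.
by move=> z _; exists z.2%:R.
Qed.

Let correct x (D : @dom c x) :=
  let: conj _ D' := D in
  let: And5 hd _ _ nr (And3 (And3 _ sz _) mon na) := D' in
  @reconstruct_correct (F (iphi x)) (@solve _) (@roots _) (@solveP _) (@rootsP _) (ir x) (id_ x) (ide x) (inn x)
   (val x) (@ialpha x) (@ipol x) hd (instance_inj_nat D') nr (instance_gt0 D') mon sz na (instance_alpha_neq0 D').

Theorem reconstruct_family : exists (p : cmd) (k : nat), forall x, @dom c x ->
  exists (output : value) (t : nat),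
    [/\ runs (black_box (@enc _) (ig x)) p (E x) t output,
        (t <= poly_bound k (W x))%N
      & reconstructed (@enc _) (id_ x) (ig x) (@ialpha x) (@ipol x) output].
Proof.
have valE x (D : @dom c x) t : (t < rK (id_ x) (ide x))%N ->
    val x t = (\sum_i @ialpha x i *: @ipol x i ^+ id_ x).[t%:R].
  by move=> _; rewrite /val; case: D => _ [_ _ _ _ [[-> _ _] _ _]].
have corr x (D : @dom c x) : anu (@solve _) (ir x) (id_ x) (ide x) (val x) = inn x /\
  exists pi : 'S_(inn x), forall i : 'I_(inn x),
   [/\ afi (@solve _) (@roots _) (ir x) (id_ x) (ide x) (val x) i = @ipol x (pi i),
       aal (@solve _) (@roots _) (ir x) (id_ x) (ide x) (val x) i = @ialpha x (pi i),
       size (@ipol x (pi i)) = (ide x - asidx (@solve _) (@roots _) (ir x) (id_ x) (ide x) (val x) i).+1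
     & (asidx (@solve _) (@roots _) (ir x) (id_ x) (ide x) (val x) i < (ide x).+1)%N].
  exact: (correct D (valE x D)).
have Hsplit x : @dom c x -> split_ok (anu (@solve _) (ir x) (id_ x) (ide x) (val x))
     (achi (@solve _) (ir x) (id_ x) (ide x) (val x)).
  move=> D; have vE := valE x D; case: (D) => _ D'.
  case: (D') => hd hp g0 nr [[gEE sz mn] mon na].
  exact: (@achi_split (F (iphi x)) (@solve _) (@solveP _) (ir x) (id_ x) (ide x) (inn x)
   (val x) (@ialpha x) (@ipol x) hd (instance_inj_nat D') nr (instance_gt0 D') mon sz na (instance_alpha_neq0 D') vE).
have Hsx x j : @dom c x -> (j < anu (@solve _) (ir x) (id_ x) (ide x) (val x))%N ->
    (asidx (@solve _) (@roots _) (ir x) (id_ x) (ide x) (val x) j < (ide x).+1)%N.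
  move=> D; have [-> [pi Hpi]] := corr x D => lt.
  by case: (Hpi (Ordinal lt)).
have [bE [p [tm [[k Hk] Hp]]]] := @comp_reconstruct Phi F enc desc pw solve solveP Hsolve Hconsts
  roots Hroots c iphi ir id_ ide val gd cr br cd bd ce bde tval Hsplit Hsx.
(* The empty stack has size 1; since [W x + 2] is at most twice [W x + 1], the factor [2 ^ k]
   absorbs it. *)
exists p, (k * 2 ^ k)%N => x D.
have [t [s' [Ex H0 _ Ht]]] := Hp x (update (fun=> vnat 0) 0%N (E x)) D erefl.
exists (s' 0%N), t; split.
- by exists s'.
- apply: leq_trans Ht _; apply: leq_trans (Hk (x, vnat 0) D) _.
  rewrite /poly_bound /= trunc_log0 addn1.
  apply: (@leq_trans (k * (2 * (W x).+1) ^ k)).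
    rewrite leq_mul2l; apply/orP; right; case: (k) => // k'; rewrite leq_exp2r //; lia.
  by rewrite expnMn mulnA leq_mul2l leq_pexp2l ?orbT // leq_pmulr // expn_gt0.
rewrite H0; have [nuE [pi Hpi]] := corr x D; rewrite nuE.
exists (fun i => @ialpha x (pi i)), (fun i => @ipol x (pi i)); split.
  rewrite /vtab -map_enum_ord; congr vlist; apply: eq_map => i.
  by case: (Hpi i) => -> -> sz _; rewrite enc_polyE sz.
exists pi; split=> //; case: D => _ [_ _ _ _ [[gEq _ _] _ _]].
by apply: (etrans gEq); rewrite /sum_powers (reindex_inj (@perm_inj _ pi)); apply: eq_bigr.
Qed.

End Assembly.

(** * Fields with polynomial-time arithmetic *)

(** Shifting all variables by two keeps a foreign program away from the argument and the stack of
    its caller. *)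
Fixpoint eshift (e : expr) : expr :=
  match e with
  | Var x => Var x.+2
  | Const z => Const z
  | EPair a b => EPair (eshift a) (eshift b)
  | Fst a => Fst (eshift a)
  | Snd a => Snd (eshift a)
  | IsPair a => IsPair (eshift a)
  | Op o a b => Op o (eshift a) (eshift b)
  end.

Fixpoint cshift (c : cmd) : cmd :=
  match c with
  | Skip => Skip
  | Assign x e => Assign x.+2 (eshift e)
  | Sequence a b => Sequence (cshift a) (cshift b)
  | If e a b => If (eshift e) (cshift a) (cshift b)
  | While e a => While (eshift e) (cshift a)
  | Query x e => Query x.+2 (eshift e)
  end.

Fixpoint evars (e : expr) : nat :=
  match e with
  | Var x => x.+1
  | Const _ => 0
  | EPair a b | Op _ a b => maxn (evars a) (evars b)
  | Fst a | Snd a | IsPair a => evars a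
  end.

Fixpoint cvars (c : cmd) : nat :=
  match c with
  | Skip => 0
  | Assign x e | Query x e => maxn x.+1 (evars e)
  | Sequence a b => maxn (cvars a) (cvars b)
  | If e a b => maxn (evars e) (maxn (cvars a) (cvars b))
  | While e a => maxn (evars e) (cvars a)
  end.

Definition shifted N (s S : store) := forall x, (x < N)%N -> S x.+2 = s x.

Lemma eval_shift N s S e : shifted N s S -> (evars e <= N)%N ->
  eval S (eshift e) = eval s e /\ ecost S (eshift e) = ecost s e.
Proof.
move=> H; elim: e => //=.
- by move=> x lt; rewrite H.
- by move=> a IHa b IHb; rewrite geq_max => /andP[/IHa[-> ->] /IHb[-> ->]].
- by move=> a IHa /IHa[-> ->].
- by move=> a IHa /IHa[-> ->].
- by move=> a IHa /IHa[-> ->].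
- by move=> o a IHa b IHb; rewrite geq_max => /andP[/IHa[-> ->] /IHb[-> ->]].
Qed.

Lemma shifted_update N s S x v : shifted N s S -> shifted N (update s x v) (update S x.+2 v).
Proof. by move=> H y lt; rewrite /update !eqSS; case: eqP => // _; apply: H. Qed.

Lemma exec_shift O N c s t s' : exec no_oracle c s t s' -> (cvars c <= N)%N ->
  forall S, shifted N s S ->
  exists S', [/\ exec O (cshift c) S t S', shifted N s' S', S' 0%N = S 0%N & S' 1%N = S 1%N].
Proof.
elim=> {c s t s'} //=.
- by move=> s _ S H; exists S; split=> //; apply: exec_skip.
- move=> s x e; rewrite geq_max => /andP[_ le] S H.
  exists (update S x.+2 (eval s e)); split=> //; last exact: shifted_update.
  by have [E1 E2] := eval_shift H le; rewrite -E1 -E2; apply: exec_assign.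
- move=> s1 s2 s3 c1 c2 t1 t2 _ IH1 _ IH2; rewrite geq_max => /andP[l1 l2] S H.
  have [S1 [X1 H1 A1 B1]] := IH1 l1 S H; have [S2 [X2 H2 A2 B2]] := IH2 l2 S1 H1.
  exists S2; split=> //; [exact: exec_seq X1 X2 | by rewrite A2 | by rewrite B2].
- move=> s s' e c1 c2 t tr _ IH; rewrite !geq_max => /and3P[le l1 l2] S H.
  have [E1 E2] := eval_shift H le; have [S1 [X1 H1 A1 B1]] := IH l1 S H.
  by exists S1; split=> //; rewrite -E2; apply: exec_if_true => //; rewrite E1.
- move=> s s' e c1 c2 t tr _ IH; rewrite !geq_max => /and3P[le l1 l2] S H.
  have [E1 E2] := eval_shift H le; have [S1 [X1 H1 A1 B1]] := IH l2 S H.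
  by exists S1; split=> //; rewrite -E2; apply: exec_if_false => //; rewrite E1.
- move=> s1 s2 s3 e c t1 t2 tr _ IH1 _ IH2; rewrite geq_max => /andP[le l1] S H.
  have [E1 E2] := eval_shift H le; have [S1 [X1 H1 A1 B1]] := IH1 l1 S H.
  have [|S2 [X2 H2 A2 B2]] := IH2 _ S1 H1; first by rewrite geq_max le.
  exists S2; split=> //; [ | by rewrite A2 | by rewrite B2].
  by rewrite -E2; apply: exec_while_true X1 X2; rewrite E1.
- move=> s e c tr; rewrite geq_max => /andP[le l1] S H.
  have [E1 E2] := eval_shift H le; exists S; split=> //.
  by rewrite -E2; apply: exec_while_false; rewrite E1.
Qed.

(** A search program is specified only from a store of zeros, so the variables it may read are reset
    before the call. *)
Fixpoint clear_cmd (n : nat) : cmd :=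
  if n is m.+1 then Sequence (clear_cmd m) (Assign m.+2 (Const 0)) else Skip.

Lemma exec_clear O n s : exists s',
  [/\ exec O (clear_cmd n) s (3 * n).+1 s', shifted n (fun=> vnat 0) s', s' 0%N = s 0%N & s' 1%N = s 1%N].
Proof.
elim: n => [|n [s' [X H A B]]]; first by exists s; split=> //; apply: exec_skip.
exists (update s' n.+2 (vnat 0)); split=> //.
  have -> : (3 * n.+1).+1 = ((3 * n).+1 + 2).+1 by rewrite mulnS; lia.
  apply: exec_seq X _.
  have -> : 2%N = (ecost s' (Const 0)).+1 by [].
  exact: exec_assign.
move=> x; rewrite ltnS leq_eqVlt /update !eqSS => /orP[/eqP ->|lt]; first by rewrite eqxx.
by rewrite ltn_eqF //; apply: H.
Qed.

(** Any choice of outputs produced by the search program can be computed inside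
    a larger program, at variables disjoint from those of the caller. *)
Lemma comp_extern (R : value -> value -> Prop) : polytime_search R ->
  exists f : value -> value,
    (forall v, (exists w, R v w) -> R v (f v)) /\
    forall (c : ctx) (x : ix c -> value), comp x ->
      (forall i, dom i -> exists w, R (x i) w) -> comp (fun i => f (x i)).
Proof.
case=> p [k Hp].
have /choice_fun[f Hf] : forall v, exists o, (exists w, R v w) -> exists t,
    [/\ runs no_oracle p v t o, R v o & (t <= poly_bound k (vsize v))%N].
  move=> v; case: (excluded_middle_informative (exists w, R v w)) => [ex|nex]; last first.
    by exists (vnat 0) => /nex.
  by have [o [t H]] := Hp v ex; exists o => _; exists t.
exists f; split; first by move=> v /Hf[t []].
move=> c x cx Hx; apply: (comp_trans cx); have bx := comp_vbnd cx; split=> //.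
pose N := maxn 1 (cvars p).
exists (Sequence (clear_cmd N) (Sequence (Assign 2%N (Var 0%N)) (Sequence (cshift p) (Assign 0%N (Var 2%N))))).
have bt : @nbnd c (fun i => poly_bound k (vsize (x i))) by apply: (pbd_sub bx).
exists (fun i _ => 3 * N + 2 * vsize (x i) + 2 * poly_bound k (vsize (x i)) + 20)%N; split.
  refine (@pbd_fst (setenv x) (fun i => 3 * N + 2 * vsize (x i) + 2 * poly_bound k (vsize (x i)) + 20)%N _).
  by rewrite /nbnd /vbnd in bx bt *; pbdtac.
move=> i s Di /= Hs; have [t [[s' [Ex H0]] _ le]] := Hf (x i) (Hx i Di).
have [s1 [X1 Z1 A1 B1]] := exec_clear (@orc c i) N s.
set s2 := update s1 2%N (x i).
have sh : shifted N (update (fun=> vnat 0) 0%N (x i)) s2 by apply: shifted_update.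
have [S' [X2 Z2 A2 B2]] := exec_shift (@orc c i) Ex (leq_maxr 1 _ : cvars p <= N)%N sh.
have S2 : S' 2%N = f (x i) by rewrite Z2 // /N leq_max.
have szf : (vsize (f (x i)) <= vsize (x i) + t)%N.
  rewrite -H0; case: (exec_size Ex 0%N) => [->|H]; first by rewrite /update eqxx leq_addr.
  by apply: leq_trans H _; apply: leq_addl.
eexists; exists (update S' 0%N (f (x i))); split.
- apply: exec_seq X1 _; apply: exec_seq.
    by apply: exec_assign_eq; rewrite /= A1 Hs.
  apply: exec_seq X2 _.
  by apply: exec_assign_eq.
- by [].
- by rewrite /update /= B2 /s2 /update /= B1.
rewrite /= A1 Hs S2 /=; lia.
Qed.

Lemma big_mkseq_ord (R : Type) (idx : R) (op : Monoid.law idx) (T : Type) (l : nat -> T) n (G : T -> R) :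
  \big[op/idx]_(x <- mkseq l n) G x = \big[op/idx]_(i < n) G (l i).
Proof. by rewrite big_map -{1}(subn0 n) -/(index_iota 0 n) big_mkord. Qed.

Lemma vlist_inj : injective vlist.
Proof. by elim=> [|v s IH] [|w t] //= [-> /IH ->]. Qed.

(** * A single fixed field *)

Section SingleField.
Variables (F : fieldType) (enc : F -> value).
Local Notation U := unit.
Local Notation D := (fun _ : unit => vnat 0).
Local Notation Z := (fun _ : unit => 0%N).

Lemma good_unit c (fi : ix c -> unit) : vbnd (@env c) -> good D Z fi.
Proof. by move=> be; split; [apply: comp_const | apply: pbd_const]. Qed.

Lemma consts_unit : @consts_comp U (fun=> F) (fun=> enc) D Z.
Proof.
move=> c fi g; have be := comp_env_bnd g.1.
by split; apply: comp_const.
Qed.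

Lemma reconstructible_field
  (solve : nat -> nat -> (nat -> nat -> F) -> (nat -> F) -> option (nat -> F))
  (roots : nat -> (nat -> F) -> nat -> F) :
  solver_spec solve -> roots_spec roots ->
  @solver_comp U (fun=> F) (fun=> enc) D Z (fun=> solve) ->
  @roots_comp U (fun=> F) (fun=> enc) D Z (fun=> roots) -> reconstructible enc.
Proof.
move=> solveP rootsP Hs Hr.
pose W (x : @instance U (fun=> F)) := (ir x + ide x + id_ x + bit_complexity enc (@ialpha _ _ x) (@ipol _ _ x))%N.
pose E (x : @instance U (fun=> F)) := parameters (ir x) (id_ x) (ide x).
pose c := @inst_ctx U (fun=> F) (fun=> enc) (fun=> True) W E.
have br : @nbnd c (fun x => ir x).
  by apply: (@pbd_le _ _ _ _ _ (@pbd_id _ _ _)) => x _; rewrite /= /W -!addnA leq_addr.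
have bd : @nbnd c (fun x => id_ x).
  by apply: (@pbd_le _ _ _ _ _ (@pbd_id _ _ _)) => x _; rewrite /= /W; lia.
have bde : @nbnd c (fun x => ide x).
  by apply: (@pbd_le _ _ _ _ _ (@pbd_id _ _ _)) => x _; rewrite /= /W; lia.
have bB : @nbnd c (fun x => bit_complexity enc (@ialpha _ _ x) (@ipol _ _ x)).
  by apply: (@pbd_le _ _ _ _ _ (@pbd_id _ _ _)) => x _; rewrite /= /W; lia.
have bv (n : ix c -> nat) : nbnd n -> vbnd (fun x => vnat (n x)).
  by move=> bn; apply: (@pbd_le _ _ _ _ _ (pbd_S bn)) => x _; apply: vsize_nat_le.
have be : @vbnd c E.
  apply: (@vbnd_pair c); first exact: bv.
  apply: (@vbnd_pair c); first exact: bv.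
  by apply: (@vbnd_pair c); [exact: bv | exact: pbd_const].
have cE := @comp_id c be.
have cr : @comp c (fun x => vnat (ir x)) := comp_fst cE.
have cd : @comp c (fun x => vnat (id_ x)) := comp_fst (comp_snd cE).
have ce : @comp c (fun x => vnat (ide x)) := comp_fst (comp_snd (comp_snd cE)).
have [p [k H]] := @reconstruct_family U (fun=> F) (fun=> enc) D Z (fun=> solve) (fun=> roots)
  (fun=> solveP) (fun=> rootsP) Hs consts_unit Hr (fun=> True) W E (good_unit _ be) cr br cd bd ce bde bB.
exists p, k => r d delta n g alpha f inst.
exact: (H (@Instance U (fun=> F) tt r d delta n g alpha f) (conj I inst)).
Qed.

End SingleField.

Section PolytimeField.
Variables (F : fieldType) (enc : F -> value).
Hypothesis ptF : polytime_field enc.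
Local Notation U := unit.
Local Notation D := (fun _ : unit => vnat 0).
Local Notation Z := (fun _ : unit => 0%N).

Let enc_inj : injective enc. Proof. by case: ptF. Qed.

Definition system_value m n (a : nat -> nat -> F) (b : nat -> F) : value :=
  VPair (vtab m (fun k => vtab n (fun j => enc (a k j)))) (vtab 1 (fun _ => vtab n (fun j => enc (b j)))).

Lemma enc_mx_tab m n (A : 'M[F]_(m, n)) (a : nat -> nat -> F) :
  (forall (i : 'I_m) (j : 'I_n), A i j = a i j) ->
  enc_mx enc A = vtab m (fun k => vtab n (fun j => enc (a k j))).
Proof.
move=> H; rewrite /enc_mx /vtab -map_enum_ord; congr vlist; apply: eq_map => i.
by rewrite -map_enum_ord; congr vlist; apply: eq_map => j; rewrite H.
Qed.

Lemma vtab_inj m n (x y : nat -> value) : vtab m x = vtab n y -> m = n /\ forall k, (k < n)%N -> x k = y k.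
Proof.
move/vlist_inj => E; have mn : m = n by have := congr1 size E; rewrite !size_mkseq.
subst m; split=> // k lt.
by rewrite -(nth_mkseq (vnat 0) x lt) E nth_mkseq.
Qed.

Lemma linear_solution_ex m n a b : exists w, linear_solution enc (system_value m n a b) w.
Proof.
pose A : 'M[F]_(m, n) := \matrix_(i, j) a i j; pose B : 'rV[F]_n := \row_j b j.
have E : system_value m n a b = VPair (enc_mx enc A) (enc_mx enc B).
  by rewrite (@enc_mx_tab m n A a) ?(@enc_mx_tab 1 n B (fun _ => b)) // => i j; rewrite mxE.
case: (excluded_middle_informative (exists x : 'rV[F]_m, x *m A = B)) => [[x xE]|nx].
  by exists (VPair (vnat 1) (enc_mx enc x)), m, n, A, B; split=> //; left; exists x.
exists (vnat 0), m, n, A, B; split=> //; right; split=> // x xE; apply: nx; by exists x.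
Qed.

(** Brings an answer of [linear_solution] into the format of [eopt]: the solution is the only row of
    a one-row matrix. *)
Definition solver_output (out : value) : value :=
  if out is VPair _ v then VPair (vnat 1) (vfst v) else vnat 0.

Lemma linear_solution_out m n a b out : linear_solution enc (system_value m n a b) out ->
  exists o : option (nat -> F), solver_output out = eopt (Phi := U) (F := fun=> F) (fun=> enc) (phi := tt) m o /\
    match o with
    | Some x => forall j, (j < n)%N -> \sum_(i < m) x i * a i j = b j
    | None => forall x : 'I_m -> F, ~ (forall j, (j < n)%N -> \sum_(i < m) x i * a i j = b j)
    end.
Proof.
case=> m' [n' [A [B [[]]]]].
pose A' k j := if insub k is Some i then if insub j is Some j' then A i j' else 0 else 0.
pose B' (k : nat) j := if insub j is Some j' then B 0 j' else 0.
rewrite (@enc_mx_tab m' n' A A'); last by move=> i j; rewrite /A' !valK.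
rewrite (@enc_mx_tab 1 n' B B'); last by move=> i j; rewrite /B' !valK ord1.
move=> EA /vtab_inj[_ /(_ 0%N isT)/vtab_inj[nn EB]]; subst n'.
move: EA => /vtab_inj[mm EA]; subst m'.
have Aa (i : 'I_m) (j : 'I_n) : A i j = a i j.
  by have /vtab_inj[_ /(_ j (ltn_ord j))/enc_inj ->] := EA i (ltn_ord i); rewrite /A' !valK.
have Bb (j : 'I_n) : B 0 j = b j.
  by have /enc_inj -> := EB j (ltn_ord j); rewrite /B' !valK.
case=> [[x [xE ->]]|[nx ->]].
  pose x' k := if insub k is Some i then x 0 i else 0.
  exists (Some x'); split.
    rewrite /solver_output /eopt (@enc_mx_tab 1 m x (fun _ => x')) //.
    by move=> i j; rewrite /x' valK ord1.
  move=> j lt; have := congr1 (fun M : 'rV_n => M 0 (Ordinal lt)) xE; rewrite Bb mxE => <-.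
  by apply: eq_bigr => i _; rewrite Aa /x' valK.
exists None; split=> // x H; apply: (nx (\row_i x i)); apply/rowP => j.
rewrite Bb -H // mxE; apply: eq_bigr => i _; by rewrite Aa mxE.
Qed.

Lemma polytime_solver : exists solve : nat -> nat -> (nat -> nat -> F) -> (nat -> F) -> option (nat -> F),
  solver_spec solve /\ @solver_comp U (fun=> F) (fun=> enc) D Z (fun=> solve).
Proof.
case: ptF => _ /comp_extern[f [fP fC]] _.
have /choice_fun[s Hs] : forall q : nat * nat * (nat -> nat -> F) * (nat -> F), exists o : option (nat -> F),
   let: (m, n, a, b) := q in
   solver_output (f (system_value m n a b)) = eopt (Phi := U) (F := fun=> F) (fun=> enc) (phi := tt) m o /\
    match o with
    | Some x => forall j, (j < n)%N -> \sum_(i < m) x i * a i j = b j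
    | None => forall x : 'I_m -> F, ~ (forall j, (j < n)%N -> \sum_(i < m) x i * a i j = b j)
    end.
  move=> [[[m n] a] b]; apply: linear_solution_out; apply: fP; exact: linear_solution_ex.
exists (fun m n a b => s (m, n, a, b)); split.
  by move=> m n a b; case: (Hs (m, n, a, b)).
move=> c fi m n a b gd cm cn ca cb; have be := comp_env_bnd cm.
have csys : comp (fun i => system_value (m i) (n i) (a i) (b i)).
  by apply: comp_pair => //; apply: comp_pair => //; apply: comp_const.
have cf := fC c _ csys (fun i _ => linear_solution_ex (m i) (n i) (a i) (b i)).
pose isp v := if v is VPair _ _ then true else false.
have cb1 : comp (fun i => vnat (isp (f (system_value (m i) (n i) (a i) (b i))))).
  by apply: (comp_ext (comp_ispair cf)) => i _; rewrite /isp; case: (f _).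
have c1 := comp_pair (comp_const (vnat 1) be) (comp_vfst (comp_vsnd cf)).
have c0 := comp_const (vnat 0) be.
have H := comp_if cb1 (comp_when _ c1) (comp_when _ c0).
refine (@comp_ext c _ _ H _) => i _.
have [E _] := Hs (m i, n i, a i, b i); apply: etrans E; rewrite /isp.
by case: (f _).
Qed.

Definition chi_poly n (c : nat -> F) : {poly F} := 'X^n - \poly_(k < n) c k.

Lemma chi_polyE n c : chi_poly n c = \poly_(k < n.+1) (if (k < n)%N then - c k else 1).
Proof.
apply/polyP => k; rewrite coefB coefXn !coef_poly ltnS.
by case: ltngtP => //= _; rewrite ?sub0r ?subr0 ?oppr0.
Qed.

Lemma size_chi_poly n c : size (chi_poly n c) = n.+1.
Proof. by rewrite chi_polyE size_poly_eq // ltnn oner_neq0. Qed.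

Lemma chi_monic n c : chi_poly n c \is monic.
Proof. by rewrite monicE /lead_coef size_chi_poly chi_polyE coef_poly ltnSn ltnn. Qed.

(** An irreducible factor of a product of linear polynomials shares a root with it and so is linear;
    as the roots are distinct, the factors are a rearrangement of the given ones. *)
Lemma split_factorization n (c l : nat -> F) hs :
  chi_poly n c = \prod_(i < n) ('X - (l i)%:P) ->
  (forall i j, (i < n)%N -> (j < n)%N -> l i = l j -> i = j) ->
  (forall h, h \in hs -> h \is monic /\ irreducible_poly h) ->
  chi_poly n c = lead_coef (chi_poly n c) *: \prod_(h <- hs) h ->
  exists rt : nat -> F, [/\ size hs = n, forall k, (k < n)%N -> nth 0 hs k = 'X - (rt k)%:P
     & perm_eq (mkseq rt n) (mkseq l n)].
Proof.
move=> El li Hhs; rewrite (monicP (chi_monic n c)) scale1r => Eh.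
have lin h : h \in hs -> exists x, h = 'X - x%:P.
  move=> hin; have [mon irr] := Hhs h hin.
  have dv : h %| \prod_(i < n) ('X - (l i)%:P).
    by rewrite -El Eh (big_rem h hin) /= dvdp_mulr.
  have [i ri] : exists i : 'I_n, root h (l i).
    apply: NNPP => nr; suff cop : coprimep h (\prod_(i < n) ('X - (l i)%:P)).
      have [sz _] := irr; have := coprimep_dvdl dv cop.
      rewrite coprimepp => /eqP sz1; by rewrite sz1 in sz.
    elim/big_ind: _ => //; first by rewrite coprimep1.
      by move=> p q; rewrite coprimepMr => -> ->.
    move=> i _; rewrite coprimep_XsubC.
    by apply/negP => ri; apply: nr; exists i.
  exists (l i); have [_ /(_ ('X - (l i)%:P))] := irr.
  rewrite size_XsubC dvdp_XsubCl => /(_ isT ri).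
  by rewrite eqp_sym eqp_monic ?monicXsubC // => /eqP.
pose rt k := - (nth 0 hs k)`_0.
have rtE k : (k < size hs)%N -> nth 0 hs k = 'X - (rt k)%:P.
  move=> lt; have [x E] := lin _ (mem_nth 0 lt).
  by rewrite /rt E coefB coefX coefC /= sub0r opprK.
have Er : chi_poly n c = \prod_(x <- mkseq rt (size hs)) ('X - x%:P).
  by rewrite big_mkseq_ord Eh (big_nth 0) big_mkord; apply: eq_bigr => i _; rewrite rtE.
have szhs : size hs = n.
  by have := size_chi_poly n c; rewrite Er size_prod_XsubC size_mkseq => -[].
rewrite szhs in rtE Er; exists rt; split=> //.
have El' : chi_poly n c = \prod_(x <- mkseq l n) ('X - x%:P) by rewrite big_mkseq_ord.
have ul : uniq (mkseq l n).
  by apply/mkseq_uniqP => i j; rewrite !inE; apply: li.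
have mem x : (x \in mkseq l n) = (x \in mkseq rt n).
  by rewrite -!root_prod_XsubC -El' -Er.
rewrite perm_sym; apply: uniq_perm => //.
by rewrite -(eq_uniq _ mem) // !size_mkseq.
Qed.

Lemma polytime_roots solve : solver_spec solve ->
  @solver_comp U (fun=> F) (fun=> enc) D Z (fun=> solve) ->
  exists roots : nat -> (nat -> F) -> nat -> F,
  roots_spec roots /\ @roots_comp U (fun=> F) (fun=> enc) D Z (fun=> roots).
Proof.
move=> solveP Hsolve; case: ptF => _ _ /comp_extern[f [fP fC]].
have Hsp n c : split_ok n c -> exists w, factorization enc (enc_poly enc (chi_poly n c)) w.
  case=> l [El li]; pose hs := mkseq (fun i : nat => ('X - (l i)%:P : {poly F})) n.
  exists (vlist (map (enc_poly enc) hs)), (chi_poly n c), hs; split=> //.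
  - by rewrite -size_poly_eq0 size_chi_poly.
  - move=> h /mapP[i _ ->]; split; first exact: monicXsubC.
    by apply: irredp_XsubC.
  - by rewrite (monicP (chi_monic n c)) scale1r /chi_poly El big_mkseq_ord; apply: eq_bigr.
(* The constant coefficient of a factor, the first entry of its encoding, is minus its root; the
   roots come in the order of the factoring program's output. *)
have /choice_fun[rt Hrt] : forall q : nat * (nat -> F), exists rt : nat -> F,
    let: (n, c) := q in split_ok n c ->
    (forall k, (k < n)%N -> vfst (vfst (iter k vsnd (f (enc_poly enc (chi_poly n c))))) = enc (- rt k)) /\
    (forall l : nat -> F, chi_poly n c = \prod_(i < n) ('X - (l i)%:P) ->
      (forall i j, (i < n)%N -> (j < n)%N -> l i = l j -> i = j) -> perm_eq (mkseq rt n) (mkseq l n)).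
  move=> [n c]; case: (excluded_middle_informative (split_ok n c)) => [sp|nsp]; last by exists (fun=> 0) => /nsp.
  have [q [hs [_ Eq Eo Hhs Ef]]] := fP _ (Hsp n c sp).
  have qE : q = chi_poly n c.
    by apply: poly_inj; apply: (inj_map enc_inj); apply: vlist_inj.
  rewrite qE in Ef; case: (sp) => l [El li].
  have [rt [szhs rtE pm]] := split_factorization El li Hhs Ef.
  exists rt => _; split.
    move=> k lt; rewrite Eo vnth_vlist ?size_map ?szhs // (nth_map 0) ?szhs // rtE //.
    by rewrite enc_polyE size_XsubC /= coefB coefX coefC /= sub0r.
  move=> l' El' li'; apply: perm_trans pm _.
  have ul : uniq (mkseq l n) by apply/mkseq_uniqP => i j; rewrite !inE; apply: li.
  have ul' : uniq (mkseq l' n) by apply/mkseq_uniqP => i j; rewrite !inE; apply: li'.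
  apply: uniq_perm => // x; by rewrite -!root_prod_XsubC !big_mkseq_ord -El -El'.
exists (fun n c => rt (n, c)); split.
  move=> n c l El li; have [|_] := Hrt (n, c); first by exists l.
  exact.
move=> c fi n x gd cn bn cx sp; have be := comp_env_bnd cn.
have Hc := @consts_unit F enc.
have [H0 H1 HN1] := Hc c fi gd.
have cin : comp (fun i => enc_poly enc (chi_poly (n i) (x i))).
  apply: (@comp_ext c (fun i => vtab (n i).+1 (fun k => vif (k < n i)%N (enc (- x i k)) (enc 1)))); last first.
    move=> i _; rewrite enc_polyE size_chi_poly; apply: eq_vtab => k lt.
    by rewrite chi_polyE coef_poly lt /vif; case: ifP.
  refine (@comp_tab c (fun i => (n i).+1) (fun i k => vif (k < n i)%N (enc (- x i k)) (enc 1)) _ _ _).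
  - by cgo.
  - by nauto.
  set X := ext _; apply: (@comp_vif X (fun z => z.2 < n z.1)%N (fun z => enc (- x z.1 z.2)) (fun=> enc 1)).
  - by rewrite /X; cgo.
  - set Y := when _.
    have gY : good D Z (fun _ : ix Y => tt) by apply: good_unit; rewrite /Y /X; envb.
    refine (@fopp U (fun=> F) (fun=> enc) D Z (fun=> solve) (fun=> solveP) Hsolve Hc Y (fun=> tt) gY (fun z => x z.1 z.2) _).
    by rewrite /Y /X; tnth (fun z => n z.1) (fun z k => enc (x z.1 k)) (fun z => z.2); [cgo | cgo | dtac].
  - by rewrite /X; cgo.
have cf := fC c _ cin (fun i Di => Hsp _ _ (sp i Di)).
refine (@comp_tab c n (fun i k => enc (rt (n i, x i) k)) cn bn _).
set X := ext _.
have gX : good D Z (fun _ : ix X => tt) by apply: good_unit; rewrite /X; envb.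
have cneg : @comp X (fun z => enc (- rt (n z.1, x z.1) z.2)).
  apply: (@comp_ext X (fun z => vfst (vfst (iter z.2 vsnd (f (enc_poly enc (chi_poly (n z.1) (x z.1)))))))).
    apply: comp_vfst; apply: (@comp_vnth X (fun z => f (enc_poly enc (chi_poly (n z.1) (x z.1)))) (fun z => z.2)).
    - exact: (comp_up bn cf).
    - by rewrite /X; cgo.
    - by rewrite /X; nauto.
  by move=> z [Dz lt]; have [H _] := Hrt (n z.1, x z.1) (sp _ Dz); apply: H.
apply: (comp_ext (@fopp U (fun=> F) (fun=> enc) D Z (fun=> solve) (fun=> solveP) Hsolve Hc X (fun=> tt) gX _ cneg)).
by move=> z _; rewrite opprK.
Qed.

Theorem polytime_field_reconstructible : reconstructible enc.
Proof.
have [solve [solveP Hs]] := polytime_solver.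
have [roots [rootsP Hr]] := polytime_roots solveP Hs.
exact: (reconstructible_field solveP rootsP Hs Hr).
Qed.

End PolytimeField.

(** * Linear systems by elimination *)

Section Elimination.
Variable F : fieldType.

Definition elcol M (a : nat -> F) (U : nat -> nat -> F) i : F := \sum_(l < M) U i l * a l.

Definition elpvt M (a : nat -> F) (U : nat -> nat -> F) : nat :=
  find (fun i => elcol M a U i != 0) (iota 0 M).

(** The pivot row is reduced by itself too and becomes zero, so neither row exchanges nor a list of
    pivots is kept. Without a pivot the whole column is already zero and the rows below [M] do not
    change. *)
Definition elstep M (a : nat -> F) (U : nat -> nat -> F) i l : F :=
  U i l - elcol M a U i / elcol M a U (elpvt M a U) * U (elpvt M a U) l.

(** The rows lie in the left kernel of the first [j] columns, by [elU_ker], and the matrix fixes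
    every vector of that kernel, by [elU_fix]: it is a projection onto the kernel. *)
Fixpoint elU M (a : nat -> nat -> F) j : nat -> nat -> F :=
  if j is j'.+1 then elstep M (fun l => a l j') (elU M a j') else fun i l => (i == l)%:R.

Lemma elpvt_neq0 M a U : (elpvt M a U < M)%N -> elcol M a U (elpvt M a U) != 0.
Proof.
move=> lt; have : has (fun i => elcol M a U i != 0) (iota 0 M) by rewrite has_find size_iota.
by move/(nth_find 0%N); rewrite nth_iota.
Qed.

Lemma elpvt_all0 M a U i : (M <= elpvt M a U)%N -> (i < M)%N -> elcol M a U i = 0.
Proof.
move=> le lt; apply/eqP/negPn; apply/negP => ne.
have : has (fun i => elcol M a U i != 0) (iota 0 M) by apply/hasP; exists i; rewrite ?mem_iota.
by rewrite has_find size_iota ltnNge le.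
Qed.

Lemma elcol_step M a U b i : elcol M b (elstep M a U) i =
  elcol M b U i - elcol M a U i / elcol M a U (elpvt M a U) * elcol M b U (elpvt M a U).
Proof.
rewrite /elcol /elstep mulr_sumr -sumrB; apply: eq_bigr => l _.
rewrite mulrBl -/(elcol M a U i) -/(elcol M a U (elpvt M a U)); congr (_ - _).
exact/esym/mulrA.
Qed.

Lemma elcol_step_self M a U i : (i < M)%N -> elcol M a (elstep M a U) i = 0.
Proof.
move=> lt; rewrite elcol_step; case: (ltnP (elpvt M a U) M) => [/elpvt_neq0 ne|le].
  by rewrite mulfVK ?subrr.
by rewrite (elpvt_all0 le lt) !mul0r subrr.
Qed.

Lemma elU_ker M a j i j' : (i < M)%N -> (j' < j)%N -> elcol M (fun l => a l j') (elU M a j) i = 0.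
Proof.
elim: j i => // j IH i lti; rewrite ltnS leq_eqVlt => /orP[/eqP ->|lt] /=.
  exact: elcol_step_self.
rewrite elcol_step IH // sub0r.
case: (ltnP (elpvt M (fun l => a l j) (elU M a j)) M) => [ltp|le].
  by rewrite IH // mulr0 oppr0.
by rewrite (elpvt_all0 le lti) !mul0r oppr0.
Qed.

(** A step changes the product of [v] and [U] by a multiple of its pairing with the next column,
    which is zero because this product is [v] itself. *)
Lemma elU_fix M (a : nat -> nat -> F) j (v : nat -> F) l :
  (forall j', (j' < j)%N -> \sum_(i < M) v i * a i j' = 0) -> (l < M)%N ->
  \sum_(i < M) v i * elU M a j i l = v l.
Proof.
elim: j l => [|j IH] l H lt.
  rewrite -[RHS](@sum_delta _ M l) //; apply: eq_bigr => i _ /=.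
  by case: eqP => [->|_]; rewrite ?mulr1 ?mulr0.
have {}IH l' : (l' < M)%N -> \sum_(i < M) v i * elU M a j i l' = v l'.
  by move=> lt'; apply: IH => // j' lt2; apply: H; apply: ltnW.
rewrite /=; set U := elU M a j in IH *; rewrite /elstep.
under eq_bigr => i _ do rewrite mulrBr !mulrA.
rewrite sumrB IH // -!mulr_suml.
have -> : \sum_(i < M) v i * elcol M (fun l0 => a l0 j) U i = 0.
  under eq_bigr => i _ do rewrite /elcol mulr_sumr.
  rewrite exchange_big -[RHS](H j (ltnSn j)) /=; apply: eq_bigr => l' _.
  by rewrite -[in RHS](IH l') // mulr_suml; apply: eq_bigr => i _; rewrite mulrA.
by rewrite !mul0r subr0.
Qed.

(** With [b] as an additional last row, a solution of the system is a kernel vector with nonzero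
    last entry, rescaled. *)
Definition elrow m (a : nat -> nat -> F) (b : nat -> F) i j : F := if (i < m)%N then a i j else b j.

Definition elidx m n (a : nat -> nat -> F) (b : nat -> F) : nat :=
  find (fun i => elU m.+1 (elrow m a b) n i m != 0) (iota 0 m.+1).

Definition elsolve m n (a : nat -> nat -> F) (b : nat -> F) : option (nat -> F) :=
  let U := elU m.+1 (elrow m a b) n in
  let s := elidx m n a b in
  if (s < m.+1)%N then Some (fun l => - U s l / U s m) else None.

Lemma elsolve_spec : solver_spec elsolve.
Proof.
move=> m n a b; rewrite /elsolve; set U := elU _ _ _; set s := elidx _ _ _ _.
have rowE (x : nat -> F) j : \sum_(i < m.+1) x i * elrow m a b i j = \sum_(i < m) x i * a i j + x m * b j.
  rewrite big_ord_recr /= /elrow ltnn; congr (_ + _).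
  by apply: eq_bigr => i _; rewrite ltn_ord.
case: ltnP => [lt|le].
  have ne : U s m != 0.
    have : has (fun i => U i m != 0) (iota 0 m.+1) by rewrite has_find size_iota.
    by move/(nth_find 0%N); rewrite nth_iota.
  move=> j ltj; have := elU_ker (elrow m a b) lt ltj; rewrite /elcol -/U rowE => /eqP.
  rewrite addrC addr_eq0 => /eqP E.
  under eq_bigr => i _ do rewrite mulrAC mulNr.
  by rewrite -mulr_suml sumrN -E mulrAC divff ?mul1r.
move=> x Hx.
pose v k := if insub k is Some i then x i else if k == m then -1 else 0.
have vm : v m = -1 by rewrite /v insubF ?ltnn // eqxx.
have Hv j : (j < n)%N -> \sum_(i < m.+1) v i * elrow m a b i j = 0.
  move=> lt; rewrite rowE vm mulN1r -(Hx j lt).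
  by apply/eqP; rewrite subr_eq0; apply/eqP/eq_bigr => i _; rewrite /v valK.
have := @elU_fix m.+1 (elrow m a b) n v m Hv (ltnSn m); rewrite vm big1 => [/eqP|i _].
  by rewrite eq_sym oppr_eq0 oner_eq0.
suff E : U i m = 0 by rewrite -/U E mulr0.
apply/eqP/negPn; apply/negP => ne.
have : has (fun i => U i m != 0) (iota 0 m.+1) by apply/hasP; exists (i : nat) => //; rewrite mem_iota /= add0n ltn_ord.
by rewrite has_find size_iota ltnNge le.
Qed.

End Elimination.

Tactic Notation "lku" constr(H) uconstr(pi) uconstr(k) uconstr(l) :=
  match goal with |- @comp ?C _ => refine (H C pi k l _ _ _ _ _) end.

Lemma nbnd_tab c (n : ix c -> nat) x : vbnd (fun i => vtab (n i) (x i)) -> nbnd n.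
Proof.
move=> b; apply: (nbnd_le b) => i _; apply: ltnW.
by have := size_lt_vlist (mkseq (x i) (n i)); rewrite size_mkseq.
Qed.

(** * Elimination as a program *)

Section FieldOps.
Variables (Phi : Type) (F : Phi -> fieldType) (enc : forall phi, F phi -> value).
Variables (desc : Phi -> value) (pw : Phi -> nat).

Definition ops_comp : Prop :=
  forall (c : ctx) (fi : ix c -> Phi) (x y : forall i, F (fi i)), good desc pw fi ->
  comp (fun i => enc (x i)) -> comp (fun i => enc (y i)) ->
  [/\ comp (fun i => enc (x i + y i)), comp (fun i => enc (x i * y i)), comp (fun i => enc (- x i)),
      comp (fun i => enc (x i)^-1) & comp (fun i => vnat (x i == 0))].

Definition sum_bnd : Prop :=
  forall (c : ctx) (fi : ix c -> Phi) (n : ix c -> nat) (x : forall i, nat -> F (fi i)),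
  good desc pw fi -> nbnd n -> @vbnd (ext n) (fun z => enc (x z.1 z.2)) ->
  @vbnd (ext (fun i => (n i).+1)) (fun z => enc (\sum_(k < z.2) x z.1 k)).

(** The cost of single operations says nothing about the growth of values over many rounds; this
    separate bound on all intermediate matrices closes the gap. *)
Definition elim_bnd : Prop :=
  forall (c : ctx) (fi : ix c -> Phi) (M n : ix c -> nat) (a : forall i, nat -> nat -> F (fi i)),
  good desc pw fi -> nbnd M -> nbnd n ->
  @vbnd (@ext (ext M) (fun z => n z.1)) (fun z => enc (a z.1.1 z.1.2 z.2)) ->
  @vbnd (@ext (@ext (ext (fun i => (n i).+1)) (fun z => M z.1)) (fun z => M z.1.1))
    (fun z => enc (elU (M z.1.1.1) (a z.1.1.1) z.1.1.2 z.1.2 z.2)).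

Hypotheses (Hops : ops_comp) (Hconsts : consts_comp enc desc pw) (Hsum : sum_bnd) (Helim : elim_bnd).

Lemma oadd c (fi : ix c -> Phi) (x y : forall i, F (fi i)) : good desc pw fi ->
  comp (fun i => enc (x i)) -> comp (fun i => enc (y i)) -> comp (fun i => enc (x i + y i)).
Proof. by move=> g cx cy; case: (Hops g cx cy). Qed.
Lemma omul c (fi : ix c -> Phi) (x y : forall i, F (fi i)) : good desc pw fi ->
  comp (fun i => enc (x i)) -> comp (fun i => enc (y i)) -> comp (fun i => enc (x i * y i)).
Proof. by move=> g cx cy; case: (Hops g cx cy). Qed.
Lemma oopp c (fi : ix c -> Phi) (x : forall i, F (fi i)) : good desc pw fi ->
  comp (fun i => enc (x i)) -> comp (fun i => enc (- x i)).
Proof. by move=> g cx; case: (Hops g cx cx). Qed.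
Lemma oinv c (fi : ix c -> Phi) (x : forall i, F (fi i)) : good desc pw fi ->
  comp (fun i => enc (x i)) -> comp (fun i => enc (x i)^-1).
Proof. by move=> g cx; case: (Hops g cx cx). Qed.
Lemma oeq0 c (fi : ix c -> Phi) (x : forall i, F (fi i)) : good desc pw fi ->
  comp (fun i => enc (x i)) -> comp (fun i => vnat (x i == 0)).
Proof. by move=> g cx; case: (Hops g cx cx). Qed.

Ltac ostep := match goal with
  | |- @comp ?C (fun z => enc (GRing.mul (@?x z) (@?y z))) =>
     refine (@omul C _ x y _ _ _); [ solve [gauto] | | ]
  | |- @comp ?C (fun z => enc (GRing.add (@?x z) (@?y z))) =>
     refine (@oadd C _ x y _ _ _); [ solve [gauto] | | ]
  | |- @comp ?C (fun z => enc (GRing.opp (@?x z))) =>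
     refine (@oopp C _ x _ _); [ solve [gauto] | ]
  | |- @comp ?C (fun z => enc (GRing.inv (@?x z))) =>
     refine (@oinv C _ x _ _); [ solve [gauto] | ]
  | |- @comp ?C (fun z => vnat (nat_of_bool (@eq_op (@?T z) (@?x z) (@?y z)))) =>
     refine (@oeq0 C _ x _ _); [ solve [gauto] | ]
  end.

Ltac ogo := repeat first [ assumption | cif | ostep | cstep | solve [cleaf] ].

Lemma osum c (fi : ix c -> Phi) (n : ix c -> nat) (x : forall i, nat -> F (fi i)) :
  good desc pw fi -> comp (fun i => vnat (n i)) -> nbnd n -> @comp (ext n) (fun z => enc (x z.1 z.2)) ->
  comp (fun i => enc (\sum_(k < n i) x i k)).
Proof.
move=> g cn bn cx; have be := comp_env_bnd cn; have [H0 _ _] := Hconsts g.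
have [k0 Hk0] := Hsum g bn (comp_vbnd cx).
have bb : nbnd (fun i : ix c => poly_bound k0 (wt i)) by exists k0.
apply: (@comp_iter c n (fun i k => enc (\sum_(k < k) x i k))) => //.
- by exists (fun i => poly_bound k0 (wt i)) => // i k Di le; apply: (Hk0 (i, k)).
- by apply: (comp_ext H0) => i _; rewrite big_ord0.
set A := addenv _.
have bA : @vbnd (ext n) (fun z => enc (\sum_(k < z.2) x z.1 k)).
  by exists k0 => z [Dz lt]; apply: (Hk0 z); split=> //; apply: ltnW.
have gA : @good Phi desc pw A (fun z => fi z.1).
  split; last by case: (good_ext g bn).
  by apply: comp_weak => //; case: (good_ext g bn).
apply: (@comp_ext A (fun z => enc (\sum_(k < z.2) x z.1 k + x z.1 z.2))); last first.
  by move=> z _; rewrite big_ord_recr.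
refine (@oadd A (fun z => fi z.1) (fun z => \sum_(k < z.2) x z.1 k) (fun z => x z.1 z.2) gA _ _).
  by apply: comp_added => //; apply: vbnd_ext_env.
exact: comp_weak.
Qed.

Lemma elstep_comp c (fi : ix c -> Phi) (M : ix c -> nat) (U : forall i, nat -> nat -> F (fi i))
    (a : forall i, nat -> F (fi i)) :
  good desc pw fi -> comp (fun i => vnat (M i)) -> nbnd M ->
  comp (fun i => vtab (M i) (fun k => vtab (M i) (fun l => enc (U i k l)))) ->
  comp (fun i => vtab (M i) (fun l => enc (a i l))) ->
  comp (fun i => vtab (M i) (fun k => vtab (M i) (fun l => enc (elstep (M i) (a i) (U i) k l)))).
Proof.
move=> g cM bM tU ta; have be := comp_env_bnd cM.
have tc : comp (fun i => vtab (M i) (fun k => enc (elcol (M i) (a i) (U i) k))).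
  refine (@comp_tab c M (fun i k => enc (elcol (M i) (a i) (U i) k)) cM bM _).
  set X := ext _.
  refine (@osum X (fun z => fi z.1) (fun z => M z.1) (fun z l => U z.1 z.2 l * a z.1 l) _ _ _ _); rewrite /X.
  - by gauto.
  - by ogo.
  - by nauto.
  ogo.
  - by tnth2 (fun z => M z.1.1) (fun z => M z.1.1) (fun z k l => enc (U z.1.1 k l)) (fun z => z.1.2) (fun z => z.2);
      [ogo | ogo | dtac | ogo | dtac].
  - by tnth (fun z => M z.1.1) (fun z l => enc (a z.1.1 l)) (fun z => z.2); [ogo | ogo | dtac].
have ck : comp (fun i => vnat (elpvt (M i) (a i) (U i))).
  refine (@ncomp_find c M (fun i k => elcol (M i) (a i) (U i) k != 0) cM bM _).
  ogo.
  by tnth (fun z => M z.1) (fun z k => enc (elcol (M z.1) (a z.1) (U z.1) k)) (fun z => z.2); [ogo | ogo | dtac].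
refine (@comp_tab c M (fun i k => vtab (M i) (fun l => enc (elstep (M i) (a i) (U i) k l))) cM bM _).
refine (@comp_tab (ext M) (fun z => M z.1) (fun z l => enc (elstep (M z.1) (a z.1) (U z.1) z.2 l)) _ _ _).
- by ogo.
- by nauto.
set X := ext _.
(* Without a pivot [kk] equals [M] and is no valid table index, hence the case distinction. *)
pose kk (z : ix c) := elpvt (M z) (a z) (U z).
refine (@comp_ext X (fun z => vif (kk z.1.1 < M z.1.1)%N
  (enc (U z.1.1 z.1.2 z.2 + - (elcol (M z.1.1) (a z.1.1) (U z.1.1) z.1.2 *
      (elcol (M z.1.1) (a z.1.1) (U z.1.1) (kk z.1.1))^-1 * U z.1.1 (kk z.1.1) z.2)))
  (enc (U z.1.1 z.1.2 z.2))) _ _ _); last first.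
  move=> z [[Dz lt1] lt2]; rewrite /vif /elstep; case: ltnP => // le.
  by rewrite (elpvt_all0 le lt1) !mul0r subr0.
have cU (C : ctx) (pi : ix C -> ix c) (kx lx : ix C -> nat) :
    comp (fun z => vtab (M (pi z)) (fun k => vtab (M (pi z)) (fun l => enc (U (pi z) k l)))) ->
    comp (fun z => vnat (kx z)) -> comp (fun z => vnat (lx z)) ->
    (forall z, dom z -> (kx z < M (pi z))%N) -> (forall z, dom z -> (lx z < M (pi z))%N) ->
    comp (fun z => enc (U (pi z) (kx z) (lx z))).
  by move=> H1 H2 H3 H4 H5; tnth2 (fun z => M (pi z)) (fun z => M (pi z)) (fun z k l => enc (U (pi z) k l)) kx lx.
have ck' : comp (fun i => vnat (kk i)) by [].
rewrite /X; ogo.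
- by lku cU (fun z => z.1.1) (fun z => z.1.2) (fun z => z.2); [ogo | ogo | ogo | dtac | dtac].
- by tnth (fun z => M z.1.1) (fun z l => enc (elcol (M z.1.1) (a z.1.1) (U z.1.1) l)) (fun z => z.1.2); [ogo | ogo | dtac].
- by tnth (fun z => M z.1.1) (fun z l => enc (elcol (M z.1.1) (a z.1.1) (U z.1.1) l)) (fun z => kk z.1.1); [ogo | ogo | dtac].
- by lku cU (fun z => z.1.1) (fun z => kk z.1.1) (fun z => z.2); [ogo | ogo | ogo | dtac | dtac].
- by lku cU (fun z => z.1.1) (fun z => z.1.2) (fun z => z.2); [ogo | ogo | ogo | dtac | dtac].
Qed.

Lemma elU_comp c (fi : ix c -> Phi) (M n : ix c -> nat) (a : forall i, nat -> nat -> F (fi i)) :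
  good desc pw fi -> comp (fun i => vnat (M i)) -> nbnd M -> comp (fun i => vnat (n i)) -> nbnd n ->
  comp (fun i => vtab (M i) (fun k => vtab (n i) (fun j => enc (a i k j)))) ->
  comp (fun i => vtab (M i) (fun k => vtab (M i) (fun l => enc (elU (M i) (a i) (n i) k l)))).
Proof.
move=> g cM bM cn bn ta; have be := comp_env_bnd cM; have [H0 H1 _] := Hconsts g.
have ca : @comp (@ext (ext M) (fun z => n z.1)) (fun z => enc (a z.1.1 z.1.2 z.2)).
  by tnth2 (fun z => M z.1.1) (fun z => n z.1.1) (fun z k j => enc (a z.1.1 k j)) (fun z => z.1.2) (fun z => z.2);
      [ogo | ogo | dtac | ogo | dtac].
have bn1 : nbnd (fun i => (n i).+1) by nauto.
have [k0 Hk0] := @vbnd_tab (ext (fun i => (n i).+1)) (fun z => M z.1) (fun z k => vtab (M z.1) (fun l => enc (elU (M z.1) (a z.1) z.2 k l)))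
  (nbnd_up _ bM) (@vbnd_tab (@ext (ext (fun i => (n i).+1)) (fun z => M z.1)) (fun z => M z.1.1)
   (fun z l => enc (elU (M z.1.1) (a z.1.1) z.1.2 z.2 l)) (nbnd_up _ (nbnd_up _ bM)) (Helim g bM bn (comp_vbnd ca))).
have bb : nbnd (fun i : ix c => poly_bound k0 (wt i)) by exists k0.
pose st i j := vtab (M i) (fun k => vtab (M i) (fun l => enc (elU (M i) (a i) j k l))).
apply: (@comp_iter c n st) => //.
- by exists (fun i => poly_bound k0 (wt i)) => // i k Di le; apply: (Hk0 (i, k)).
- refine (@comp_tab c M (fun i k => vtab (M i) (fun l => enc (elU (M i) (a i) 0 k l))) cM bM _).
  refine (@comp_tab (ext M) (fun z => M z.1) (fun z l => enc (elU (M z.1) (a z.1) 0 z.2 l)) _ _ _).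
  + by ogo.
  + by nauto.
  set X := ext _.
  refine (@comp_ext X (fun z => vif (z.1.2 == z.2) (enc (1 : F (fi z.1.1))) (enc (0 : F (fi z.1.1)))) _ _ _).
    by rewrite /X; ogo.
  by move=> z _; rewrite /vif /=; case: eqP.
set A := addenv _.
have bA : @vbnd (ext n) (fun z => st z.1 z.2).
  by exists k0 => z [Dz lt]; apply: (Hk0 z); split=> //; apply: ltnW.
have gA : @good Phi desc pw A (fun z => fi z.1).
  split; last by case: (good_ext g bn).
  by apply: comp_weak => //; case: (good_ext g bn).
refine (@elstep_comp A (fun z => fi z.1) (fun z => M z.1) (fun z => elU (M z.1) (a z.1) z.2)
   (fun z l => a z.1 l z.2) gA _ _ _ _).
- by apply: comp_weak => //; apply: (comp_up bn cM).
- exact: (nbnd_up n bM).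
- by apply: comp_added => //; apply: vbnd_ext_env.
apply: comp_weak => //.
refine (@comp_tab (ext n) (fun z => M z.1) (fun z l => enc (a z.1 l z.2)) _ _ _).
- by ogo.
- by nauto.
by tnth2 (fun z => M z.1.1) (fun z => n z.1.1) (fun z k j => enc (a z.1.1 k j)) (fun z => z.2) (fun z => z.1.2);
      [ogo | ogo | dtac | ogo | dtac].
Qed.

Lemma elsolve_comp : solver_comp enc desc pw (fun phi => @elsolve (F phi)).
Proof.
move=> c fi m n a b g cm cn ta tb; have be := comp_env_bnd cm.
have bm := nbnd_tab (comp_vbnd ta); have bn := nbnd_tab (comp_vbnd tb).
pose M i := (m i).+1; pose aa i := elrow (m i) (a i) (b i).
have cM : comp (fun i => vnat (M i)) by rewrite /M; ogo.
have bM : nbnd M by rewrite /M; nauto.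
have taa : comp (fun i => vtab (M i) (fun k => vtab (n i) (fun j => enc (aa i k j)))).
  refine (@comp_tab c M (fun i k => vtab (n i) (fun j => enc (aa i k j))) cM bM _).
  refine (@comp_tab (ext M) (fun z => n z.1) (fun z j => enc (aa z.1 z.2 j)) _ _ _).
  - by ogo.
  - by nauto.
  set X := ext _.
  refine (@comp_ext X (fun z => vif (z.1.2 < m z.1.1)%N (enc (a z.1.1 z.1.2 z.2)) (enc (b z.1.1 z.2))) _ _ _); last first.
    by move=> z _; rewrite /vif /aa /elrow; case: ifP.
  rewrite /X; ogo.
  - by tnth2 (fun z => m z.1.1) (fun z => n z.1.1) (fun z k j => enc (a z.1.1 k j)) (fun z => z.1.2) (fun z => z.2);
      [ogo | ogo | dtac | ogo | dtac].
  - by tnth (fun z => n z.1.1) (fun z j => enc (b z.1.1 j)) (fun z => z.2); [ogo | ogo | dtac].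
have tU := elU_comp g cM bM cn bn taa.
pose U i := elU (M i) (aa i) (n i).
have cU (C : ctx) (pi : ix C -> ix c) (kx lx : ix C -> nat) :
    comp (fun z => vtab (M (pi z)) (fun k => vtab (M (pi z)) (fun l => enc (U (pi z) k l)))) ->
    comp (fun z => vnat (kx z)) -> comp (fun z => vnat (lx z)) ->
    (forall z, dom z -> (kx z < M (pi z))%N) -> (forall z, dom z -> (lx z < M (pi z))%N) ->
    comp (fun z => enc (U (pi z) (kx z) (lx z))).
  by move=> H1 H2 H3 H4 H5; tnth2 (fun z => M (pi z)) (fun z => M (pi z)) (fun z k l => enc (U (pi z) k l)) kx lx.
pose s i := elidx (m i) (n i) (a i) (b i).
have cs : comp (fun i => vnat (s i)).
  refine (@ncomp_find c M (fun i k => U i k (m i) != 0) cM bM _).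
  ogo; lku cU (fun z => z.1) (fun z => z.2) (fun z => m z.1); [by ogo | by ogo | by ogo | by dtac | ].
  by move=> z _; rewrite /M.
pose sol i l := - U i (s i) l / U i (s i) (m i).
refine (@comp_ext c (fun i => vif (s i < M i)%N (VPair (vnat 1) (vtab (m i) (fun l => enc (sol i l)))) (vnat 0)) _ _ _); last first.
  by move=> i _; rewrite /vif /elsolve; case: ifP.
ogo.
refine (@comp_tab (when _) m (fun i l => enc (sol i l)) _ _ _).
- by ogo.
- by nauto.
rewrite /sol; ogo.
- by lku cU (fun z => z.1) (fun z => s z.1) (fun z => z.2); [ogo | ogo | ogo | dtac | dtac; rewrite /M ltnS ltnW].
- by lku cU (fun z => z.1) (fun z => s z.1) (fun z => m z.1); [ogo | ogo | ogo | dtac | move=> z _; rewrite /M].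
Qed.

End FieldOps.

(** * Splitting off roots one by one *)

Section Deflation.
Variable F : fieldType.
Variable solve : nat -> nat -> (nat -> nat -> F) -> (nat -> F) -> option (nat -> F).
Hypothesis solveP : solver_spec solve.

(** Division by ['X - l%:P] as a linear system in the coefficients of the quotient; the sign is that
    of [chi_poly]. *)
Definition deflate n (c : nat -> F) (l : F) : nat -> F :=
  fun j => - pspan solve n.+1 n.+2 (fun i => 'X^i * ('X - l%:P)) (chi_poly n.+1 c) j.

Lemma deflateP n c l : root (chi_poly n.+1 c) l ->
  chi_poly n.+1 c = ('X - l%:P) * chi_poly n (deflate n c l).
Proof.
move=> /factor_theorem[q qE].
have q0 : q != 0.
  apply/eqP => q0; have := size_chi_poly n.+1 c; by rewrite qE q0 mul0r size_poly0.
have szq : size q = n.+1.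
  have := size_chi_poly n.+1 c; rewrite qE size_mul ?polyXsubC_eq0 // size_XsubC addn2 /=.
  by case.
pose rows i : {poly F} := 'X^i * ('X - l%:P).
have szr i : (i < n.+1)%N -> (size (rows i) <= n.+2)%N.
  move=> lt; apply: leq_trans (size_mul_leq _ _) _.
  by rewrite size_polyXn size_XsubC addn2 /= ltnS.
have sol : \sum_(i < n.+1) q`_i *: rows i = chi_poly n.+1 c.
  rewrite qE -{2}(coefK q) szq poly_def mulr_suml; apply: eq_bigr => i _.
  by rewrite /rows scalerAl.
have := pspanP solveP szr sol; set y := pspan _ _ _ _ _ => yE.
pose Q := \poly_(i < n.+1) y i.
have QE : chi_poly n.+1 c = ('X - l%:P) * Q.
  rewrite -yE /Q poly_def mulr_sumr; apply: eq_bigr => i _.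
  by rewrite /rows -scalerAr mulrC.
have Qq : Q = q.
  apply: (mulfI (x := 'X - l%:P)); first by rewrite polyXsubC_eq0.
  by rewrite -QE qE mulrC.
have yn : y n = 1.
  have : q \is monic by have := chi_monic n.+1 c; rewrite qE monicMr ?monicXsubC.
  by rewrite -Qq monicE /lead_coef Qq szq -Qq coef_poly ltnSn => /eqP.
rewrite QE chi_polyE; congr (_ * _); apply/polyP => j; rewrite !coef_poly.
case: ltnP => // le; rewrite ltnS in le; case: ltnP => [lt|ge].
  by rewrite /deflate opprK.
by have -> : j = n by apply: anti_leq; rewrite le ge.
Qed.

Lemma split_deflate n c l : root (chi_poly n.+1 c) l -> split_ok n.+1 c ->
  split_ok n (deflate n c l).
Proof.
move=> rt [r [E inj]]; have := deflateP rt; rewrite /chi_poly E => E'.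
have [i0 l0] : exists i0 : 'I_n.+1, l = r i0.
  move: rt; rewrite /chi_poly E -(big_mkseq_ord _ r n.+1 (fun x => 'X - x%:P)) root_prod_XsubC => /mapP[i].
  by rewrite mem_iota => /andP[_ lt] ->; exists (Ordinal lt).
exists (fun i => r (bump i0 i)); split.
  move: E'; rewrite (bigD1_ord i0) //= -l0 => /mulfI E'; apply/esym/E'.
  by rewrite polyXsubC_eq0.
move=> i j lti ltj /inj H; apply: (@can_inj _ _ _ _ (bumpK i0)); apply: H.
  exact: (ltn_ord (lift i0 (Ordinal lti))).
exact: (ltn_ord (lift i0 (Ordinal ltj))).
Qed.

Variable onert : nat -> (nat -> F) -> F.
Hypothesis onertP : forall n c, split_ok n.+1 c -> root (chi_poly n.+1 c) (onert n.+1 c).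

Fixpoint dfl n (c : nat -> F) k : nat -> F :=
  if k is k'.+1 then deflate (n - k'.+1) (dfl n c k') (onert (n - k') (dfl n c k')) else c.

Definition droots n (c : nat -> F) k : F := onert (n - k) (dfl n c k).

Lemma dfl_spec n c k : split_ok n c -> (k <= n)%N ->
  split_ok (n - k) (dfl n c k) /\
  chi_poly n c = \prod_(i < k) ('X - (droots n c i)%:P) * chi_poly (n - k) (dfl n c k).
Proof.
move=> sp; elim: k => [|k IH] le; first by rewrite subn0 big_ord0 mul1r.
have [sk Ek] := IH (ltnW le).
have nk : (n - k)%N = (n - k.+1).+1 by rewrite subnSK.
have rt : root (chi_poly (n - k.+1).+1 (dfl n c k)) (droots n c k).
  by rewrite /droots nk; apply: onertP; rewrite -nk.
split; first by apply: split_deflate => //; rewrite -nk.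
by rewrite big_ord_recr Ek nk (deflateP rt) /= mulrA.
Qed.

Lemma droots_spec : roots_spec droots.
Proof.
move=> n c l El li; have sp : split_ok n c by exists l.
have [_ E] := dfl_spec sp (leqnn n).
have E1 : chi_poly n c = \prod_(x <- mkseq (droots n c) n) ('X - x%:P).
  by rewrite E subnn big_mkseq_ord /chi_poly /= poly_def big_ord0 subr0 expr0 mulr1.
have E2 : chi_poly n c = \prod_(x <- mkseq l n) ('X - x%:P) by rewrite big_mkseq_ord.
have ul : uniq (mkseq l n) by apply/mkseq_uniqP => i j; rewrite !inE; apply: li.
have mem x : (x \in mkseq l n) = (x \in mkseq (droots n c) n).
  by rewrite -!root_prod_XsubC -E2 -E1.
rewrite perm_sym; apply: uniq_perm => //.
by rewrite -(eq_uniq _ mem) // !size_mkseq.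
Qed.

End Deflation.

Section DeflationComp.
Variables (Phi : Type) (F : Phi -> fieldType) (enc : forall phi, F phi -> value).
Variables (desc : Phi -> value) (pw : Phi -> nat).
Variable solve : forall phi, nat -> nat -> (nat -> nat -> F phi) -> (nat -> F phi) ->
  option (nat -> F phi).
Hypothesis solveP : forall phi, solver_spec (@solve phi).
Hypotheses (Hsolve : solver_comp enc desc pw solve) (Hconsts : consts_comp enc desc pw).
Variable onert : forall phi, nat -> (nat -> F phi) -> F phi.
Hypothesis onertP : forall phi n c, split_ok n.+1 c -> root (chi_poly n.+1 c) (@onert phi n.+1 c).

Definition onert_comp : Prop :=
  forall (c : ctx) (fi : ix c -> Phi) (n : ix c -> nat) (x : forall i, nat -> F (fi i)),
  good desc pw fi -> comp (fun i => vnat (n i)) -> nbnd n ->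
  comp (fun i => vtab (n i) (fun k => enc (x i k))) ->
  (forall i, dom i -> (0 < n i)%N /\ split_ok (n i) (x i)) ->
  comp (fun i => enc (onert (n i) (x i))).

(** Every polynomial met during deflation is a monic divisor of the first one, so this bound
    excludes growth over repeated deflations. *)
Definition divisor_bnd : Prop :=
  forall (c : ctx) (fi : ix c -> Phi) (n : ix c -> nat) (x : forall i, nat -> F (fi i)),
  good desc pw fi -> nbnd n -> @vbnd (ext n) (fun z => enc (x z.1 z.2)) ->
  (forall i, dom i -> split_ok (n i) (x i)) ->
  exists2 b : ix c -> nat, nbnd b & forall i (h : {poly F (fi i)}) j, dom i -> h \is monic ->
    h %| chi_poly (n i) (x i) -> (vsize (enc (- h`_j)) <= b i)%N.

Hypotheses (Honert : onert_comp) (Hdiv : divisor_bnd).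

Lemma deflate_comp c (fi : ix c -> Phi) (n : ix c -> nat) (x : forall i, nat -> F (fi i)) (l : forall i, F (fi i)) :
  good desc pw fi -> comp (fun i => vnat (n i)) -> nbnd n ->
  comp (fun i => vtab (n i).+1 (fun k => enc (x i k))) -> comp (fun i => enc (l i)) ->
  comp (fun i => vtab (n i) (fun k => enc (deflate (@solve _) (n i) (x i) (l i) k))).
Proof.
move=> gd cn bn tx cl; have be := comp_env_bnd cn; have [H0 H1 HN] := Hconsts gd.
have gX : good desc pw (fun z : ix (ext n) => fi z.1) by apply: good_ext.
refine (@comp_tab c n (fun i k => enc (deflate (@solve _) (n i) (x i) (l i) k)) cn bn _).
set X := ext _.
refine (@fopp Phi F enc desc pw solve solveP Hsolve Hconsts X (fun z => fi z.1) gX _ _).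
have cnl : @comp X (fun z => enc (- l z.1)).
  refine (@fopp Phi F enc desc pw solve solveP Hsolve Hconsts X (fun z => fi z.1) gX _ _).
  by rewrite /X; cgo.
refine (@fpspan Phi F enc desc pw solve Hsolve Hconsts X (fun z => fi z.1) gX
  (fun z => (n z.1).+1) (fun z => (n z.1).+2) (fun z i => 'X^i * ('X - (l z.1)%:P))
  (fun z => chi_poly (n z.1).+1 (x z.1)) _ _ _ _ _ _ (fun z => z.2) _ _); rewrite /X in cnl *.
- by cgo.
- by nauto.
- by cgo.
- by nauto.
- set Y := ext _.
  refine (@comp_ext Y (fun z => vif (z.2 == z.1.2.+1) (enc (1 : F (fi z.1.1.1)))
     (vif (z.2 == z.1.2) (enc (- l z.1.1.1)) (enc (0 : F (fi z.1.1.1))))) _ _ _).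
    by rewrite /Y; cgo.
  move=> z _; rewrite mulrBr coefB -exprSr coefXn mulrC coefCM coefXn /vif.
  case: eqP => [->|_]; first by rewrite gtn_eqF // mulr0 subr0.
  by case: eqP => _; rewrite ?mulr1 ?mulr0 ?subr0 ?sub0r.
- set Y := ext _.
  refine (@comp_ext Y (fun z => vif (z.2 < (n z.1.1).+1)%N (enc (- x z.1.1 z.2)) (enc (1 : F (fi z.1.1)))) _ _ _); last first.
    by move=> z [_ lt]; rewrite chi_polyE coef_poly lt /vif; case: ifP.
  apply: (@comp_vif Y).
  + by rewrite /Y; cgo.
  + set W := when _.
    have gW : good desc pw (fun z : ix W => fi z.1.1) by rewrite /W /Y; gauto.
    refine (@fopp Phi F enc desc pw solve solveP Hsolve Hconsts W (fun z => fi z.1.1) gW (fun z => x z.1.1 z.2) _).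
    by rewrite /W /Y; tnth (fun z => (n z.1.1).+1) (fun z k => enc (x z.1.1 k)) (fun z => z.2); [cgo | cgo | dtac].
  + by rewrite /Y; cgo.
- by cgo.
- by dtac; apply: ltnW.
Qed.

Lemma droots_comp : roots_comp enc desc pw (fun phi => droots (@solve phi) (@onert phi)).
Proof.
move=> c fi n x gd cn bn tx sp; have be := comp_env_bnd cn.
have cx : @comp (ext n) (fun z => enc (x z.1 z.2)).
  by tnth (fun z => n z.1) (fun z k => enc (x z.1 k)) (fun z => z.2); [cgo | cgo | dtac].
have [b bb Hb] := Hdiv gd bn (comp_vbnd cx) sp.
pose dd i k := dfl (@solve _) (@onert _) (n i) (x i) k.
have ddb i k j : dom i -> (k <= n i)%N -> (j < n i - k)%N -> (vsize (enc (dd i k j)) <= b i)%N.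
  move=> Di le lt; have [_ E] := dfl_spec (@solveP _) (@onertP _) (sp i Di) le.
  have := Hb i (chi_poly (n i - k) (dd i k)) j Di (chi_monic _ _).
  rewrite E dvdp_mulIr => /(_ isT).
  by rewrite [in X in (X <= _)%N -> _]chi_polyE coef_poly ltnS (ltnW lt) lt opprK.
have bst i k : dom i -> (k <= n i)%N ->
    (vsize (vtab (n i - k) (fun j => enc (dd i k j))) <= n i * (b i).+1 + 1)%N.
  move=> Di le; apply: leq_trans (vsize_vtab_le (B := b i) _) _; first by move=> j; apply: ddb.
  by rewrite leq_add2r leq_mul2r leq_subr orbT.
have bbs : nbnd (fun i => n i * (b i).+1 + 1)%N by nauto.
refine (@comp_tab c n (fun i k => enc (droots (@solve _) (@onert _) (n i) (x i) k)) cn bn _).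
set X := ext _.
have gX : good desc pw (fun z : ix X => fi z.1) by apply: good_ext.
have cnk : @comp X (fun z => vnat (n z.1 - z.2)) by rewrite /X; cgo.
have bnk : @nbnd X (fun z => n z.1 - z.2)%N by rewrite /X; nauto.
refine (@Honert X (fun z => fi z.1) (fun z => n z.1 - z.2)%N (fun z => dd z.1 z.2) gX cnk bnk _ _); last first.
  move=> z [Dz lt]; split; first by rewrite subn_gt0.
  by have [] := dfl_spec (@solveP _) (@onertP _) (sp _ Dz) (ltnW lt).
pose st (z : ix X) k := vtab (n z.1 - k) (fun j => enc (dd z.1 k j)).
have bX : @nbnd X (fun z => z.2) by rewrite /X; nauto.
have be' : vbnd (@env X) by rewrite /X; envb.
refine (@comp_iter X (fun z => z.2) st _ _ _ _ _) => //.
- by rewrite /X; cgo.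
- exists (fun z => n z.1 * (b z.1).+1 + 1)%N; first exact: (nbnd_up n bbs).
  by move=> z k [Dz lt] le; apply: bst => //; apply: leq_trans le (ltnW lt).
- refine (@comp_ext X (fun z => vtab (n z.1) (fun j => enc (x z.1 j))) _ _ _).
    by rewrite /X; cgo.
  by move=> z _; rewrite /st subn0.
set A := addenv _.
have bA : @vbnd (@ext X (fun z => z.2)) (fun z => st z.1 z.2).
  have [k0 Hk0] := bbs; exists k0 => z [[Dz lt1] lt2].
  apply: leq_trans (bst _ _ Dz _) (Hk0 _ Dz).
  by apply: ltnW; apply: ltn_trans lt2 lt1.
have up y : @comp (@ext X (fun z => z.2)) y -> @comp A y by apply: comp_weak.
have gA : @good Phi desc pw A (fun z => fi z.1.1).
  have [g1 g2] := good_ext gX bX; split=> //; exact: up.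
have cst : @comp A (fun z => st z.1 z.2).
  by apply: comp_added => //; apply: vbnd_ext_env.
have cnk1 : @comp A (fun z => vnat (n z.1.1 - z.2.+1)) by apply: up; rewrite /X in bX *; cgo.
have bnk1 : @nbnd A (fun z => n z.1.1 - z.2.+1)%N.
  by change (@nbnd (@ext X (fun z => z.2)) (fun z => n z.1.1 - z.2.+1)%N); rewrite /X in bX *; nauto.
have lt1 z : @dom A z -> (n z.1.1 - z.2)%N = (n z.1.1 - z.2.+1).+1.
  by case=> [[_ l1] l2]; rewrite subnSK //; apply: ltn_trans l2 l1.
refine (@deflate_comp A (fun z => fi z.1.1) (fun z => n z.1.1 - z.2.+1)%N (fun z => dd z.1.1 z.2)
   (fun z => onert (n z.1.1 - z.2) (dd z.1.1 z.2)) gA cnk1 bnk1 _ _).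
  by refine (@comp_ext A _ _ cst _) => z Dz; rewrite /st lt1.
refine (@Honert A (fun z => fi z.1.1) (fun z => n z.1.1 - z.2)%N (fun z => dd z.1.1 z.2) gA _ _ cst _).
- by apply: up; rewrite /X in bX *; cgo.
- by change (@nbnd (@ext X (fun z => z.2)) (fun z => n z.1.1 - z.2)%N); rewrite /X in bX *; nauto.
move=> z Dz; split; first by rewrite lt1.
case: Dz => [[Dz l1] l2].
by have [] := dfl_spec (@solveP _) (@onertP _) (sp _ Dz) (ltnW (ltn_trans l2 l1)).
Qed.

End DeflationComp.

(** * Rational numbers *)

(** A measure that starts below [2 ^ b] and is halved in each round reaches zero after at most [b]
    rounds. The program itself knows no bound and stops on the measure. *)
Lemma comp_halving c (st : ix c -> nat -> value) (mu : ix c -> nat -> nat) (b : ix c -> nat) :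
  nbnd b -> (forall i, dom i -> (mu i 0 < 2 ^ b i)%N) ->
  (forall i k, dom i -> mu i k != 0%N -> (2 * mu i k.+1 <= mu i k)%N) ->
  (forall i k, vfst (st i k) = vnat (mu i k)) ->
  (exists2 b', nbnd b' & forall i k, dom i -> (vsize (st i k) <= b' i)%N) ->
  (forall n : ix c -> nat, (forall i k, dom i -> (k < n i)%N -> mu i k != 0%N) ->
     nbnd n -> @comp (loopctx n st) (fun z => st z.1 z.2.+1)) ->
  comp (fun i => st i 0%N) ->
  exists n : ix c -> nat, (forall i, dom i -> mu i (n i) = 0%N) /\ comp (fun i => st i (n i)).
Proof.
move=> bb H0 Hh Hf [b' bb' Hb'] Hbody c0.
pose n i := find (fun k => mu i k == 0%N) (iota 0 (b i).+1).
have hs i : dom i -> has (fun k => mu i k == 0%N) (iota 0 (b i).+1).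
  move=> Di; apply: contraT => /hasPn nz.
  have ne k : (k < (b i).+1)%N -> mu i k != 0%N.
    by move=> lt; apply: nz; rewrite mem_iota.
  have le k : (k <= b i)%N -> (2 ^ k * mu i k <= mu i 0)%N.
    elim: k => [|k IH] lek; first by rewrite mul1n.
    apply: leq_trans (IH (ltnW lek)); rewrite expnSr -mulnA leq_mul2l.
    by apply/orP; right; apply: Hh => //; apply: ne; apply: ltnW.
  have := le _ (leqnn (b i)); have := H0 i Di; have := ne (b i) (ltnSn _); rewrite -lt0n.
  move=> p lt le2; have := leq_ltn_trans le2 lt; rewrite -{2}[(2 ^ b i)%N]muln1 ltn_mul2l.
  by case: (mu i (b i)) p => // m _; rewrite ltnS ltn0 andbF.
have nlt i : dom i -> (n i < (b i).+1)%N by move=> /hs; rewrite has_find size_iota.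
have nz i : dom i -> mu i (n i) = 0%N.
  by move=> Di; have := nth_find 0%N (hs i Di); rewrite nth_iota ?nlt // => /eqP.
have ne i k : dom i -> (k < n i)%N -> mu i k != 0%N.
  move=> Di lt; have := before_find 0%N lt; rewrite nth_iota; first by move=> ->.
  exact: ltn_trans lt (nlt i Di).
have bn : nbnd n by apply: (nbnd_le (pbd_S bb)) => i Di; apply: ltnW; apply: nlt.
exists n; split=> //.
apply: (@comp_while c n st bn) => //.
- by exists b' => // i k Di _; apply: Hb'.
- by move=> i k Di lt; rewrite Hf /=; apply: ne.
- by move=> i Di; rewrite Hf nz.
- exact: Hbody.
Qed.

Section Integers.
Variable c : ctx.
Implicit Types (x y : ix c -> int).

Lemma icompD x y : comp (fun i => VInt (x i)) -> comp (fun i => VInt (y i)) -> comp (fun i => VInt (x i + y i)).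
Proof. by move=> cx cy; apply: (comp_ext (comp_op Plus cx cy)). Qed.
Lemma icompB x y : comp (fun i => VInt (x i)) -> comp (fun i => VInt (y i)) -> comp (fun i => VInt (x i - y i)).
Proof. by move=> cx cy; apply: (comp_ext (comp_op Minus cx cy)). Qed.
Lemma icompM x y : comp (fun i => VInt (x i)) -> comp (fun i => VInt (y i)) -> comp (fun i => VInt (x i * y i)).
Proof. by move=> cx cy; apply: (comp_ext (comp_op Times cx cy)). Qed.
Lemma icompV x y : comp (fun i => VInt (x i)) -> comp (fun i => VInt (y i)) -> comp (fun i => VInt (divz (x i) (y i))).
Proof. by move=> cx cy; apply: (comp_ext (comp_op Quot cx cy)). Qed.
Lemma icomp_const z : vbnd (@env c) -> comp (fun _ : ix c => VInt z).
Proof. exact: comp_const. Qed.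
Lemma icompN x : comp (fun i => VInt (x i)) -> comp (fun i => VInt (- x i)).
Proof.
move=> cx; apply: (comp_ext (icompB (icomp_const 0 (comp_env_bnd cx)) cx)) => i _.
by rewrite sub0r.
Qed.
Lemma icomp_le x y : comp (fun i => VInt (x i)) -> comp (fun i => VInt (y i)) -> comp (fun i => vnat (x i <= y i)%R).
Proof. by move=> cx cy; apply: (comp_ext (comp_op Le cx cy)) => i _ /=; case: ifP. Qed.
Lemma icomp_abs x : comp (fun i => VInt (x i)) -> comp (fun i => vnat `|x i|).
Proof.
move=> cx; have be := comp_env_bnd cx.
have := comp_if (icomp_le (icomp_const 0 be) cx) (comp_when _ cx) (comp_when _ (icompN cx)) => H.
apply: (comp_ext H) => i _; case: ifP => h; rewrite /vnat; congr VInt; lia.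
Qed.

End Integers.

(** Two steps of Euclid's algorithm at once: one step need not halve the second number, two always
    do. *)
Definition gcd_step (s : nat * nat) : nat * nat :=
  let r := (s.1 %% s.2)%N in if r == 0%N then (s.2, 0%N) else (r, (s.2 %% r)%N).

Lemma gcd_stepP s : s.2 != 0%N -> gcdn (gcd_step s).1 (gcd_step s).2 = gcdn s.1 s.2.
Proof.
case: s => a b /= b0; rewrite /gcd_step /=; case: eqP => [r0|_] /=.
  by rewrite gcdn0 gcdnC -gcdn_modr r0 gcdn0.
by rewrite gcdn_modr gcdnC gcdn_modr gcdnC.
Qed.

Lemma gcd_step_half s : s.2 != 0%N -> (2 * (gcd_step s).2 <= s.2)%N.
Proof.
case: s => a b /= b0; rewrite /gcd_step /=; case: eqP => //= /eqP r0.
set r := (a %% b)%N in r0 *; have rb : (r < b)%N by rewrite ltn_mod lt0n.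
have rp : (0 < r)%N by rewrite lt0n.
case: (leqP (2 * r) b) => [le|lt].
  apply: leq_trans le; rewrite leq_mul2l /= ltnW // ltn_mod //.
have -> : (b %% r = b - r)%N.
  by rewrite -{1}(subnK (ltnW rb)) modnDr modn_small //; lia.
lia.
Qed.

Lemma gcd_step_le s : ((gcd_step s).1 + (gcd_step s).2 <= s.1 + s.2 + s.2)%N /\ ((gcd_step s).2 <= s.2)%N
  /\ (s.2 != 0%N -> (gcd_step s).1 <= s.2)%N.
Proof.
case: s => a b; rewrite /gcd_step /=; case: eqP => /= [_|/eqP r0].
  by split; [lia | split].
have h1 := leq_mod a b; have h2 := leq_mod b (a %% b)%N; split; first lia.
split=> // b0; rewrite ltnW // ltn_mod lt0n //.
Qed.

Lemma ncomp_gcd c (a b : ix c -> nat) : comp (fun i => vnat (a i)) -> comp (fun i => vnat (b i)) ->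
  comp (fun i => vnat (gcdn (a i) (b i))).
Proof.
move=> ca cb; have be := comp_env_bnd ca.
pose s i k := iter k gcd_step (a i, b i).
pose st i k := VPair (vnat (s i k).2) (vnat (s i k).1).
pose B i := (vsize (vnat (a i)) + vsize (vnat (b i)))%N.
have bB : nbnd B by apply: pbd_add; [exact: (comp_vbnd ca) | exact: (comp_vbnd cb)].
have la i : (a i < 2 ^ B i)%N.
  by apply: leq_trans (absz_lt_vsize (a i)) _; rewrite leq_pexp2l // leq_addr.
have lb i : (b i < 2 ^ B i)%N.
  by apply: leq_trans (absz_lt_vsize (b i)) _; rewrite leq_pexp2l // leq_addl.
have sl i k : ((s i k).1 < 2 ^ B i)%N /\ ((s i k).2 < 2 ^ B i)%N.
  elim: k => [|k [IH1 IH2]]; first by split; [apply: la | apply: lb].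
  rewrite /s iterS -/(s i k).
  have [_ [h2 h3]] := gcd_step_le (s i k).
  split; last by apply: leq_ltn_trans h2 IH2.
  have [z|nz] := eqVneq (s i k).2 0%N; last by apply: leq_ltn_trans (h3 nz) IH2.
  rewrite /gcd_step z modn0; case: eqP => //= _; exact: leq_ltn_trans (leq0n _) IH2.
have [n [Hn cn]] : exists n : ix c -> nat, (forall i, dom i -> (s i (n i)).2 = 0%N) /\ comp (fun i => st i (n i)).
  apply: (@comp_halving c st (fun i k => (s i k).2) B) => //.
  - by move=> i _; apply: lb.
  - by move=> i k _ nz; rewrite /s iterS; apply: gcd_step_half.
  - exists (fun i => B i + B i + 3)%N; first by rewrite /nbnd in bB *; pbdtac.
    move=> i k _; have [h1 h2] := sl i k; rewrite /st [vsize _]/= -!/(vsize (vnat _)).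
    have := @vsize_int_le (Posz (s i k).1) _ h1; have := @vsize_int_le (Posz (s i k).2) _ h2; rewrite /=; lia.
  - move=> n nz bn; set L := loopctx _ _.
    have bL : vbnd (@env L).
      have [k0 Hk0] : nbnd (fun i => B i + B i + 3)%N by rewrite /nbnd in bB *; pbdtac.
      exists k0 => z [Dz _]; apply: leq_trans (Hk0 z.1 Dz) => /=.
      have [h1 h2] := sl z.1 z.2; rewrite -!/(vsize (vnat _)).
      have := @vsize_int_le (Posz (s z.1 z.2).1) _ h1; have := @vsize_int_le (Posz (s z.1 z.2).2) _ h2; rewrite /=; lia.
    have cL := comp_id bL; have c2 := comp_fst cL; have c1 := comp_snd cL.
    have cr := ncomp_mod c1 c2; have c0 := ncomp_const 0 bL.
    have ct := bcomp_eq cr c0.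
    have := comp_if ct (comp_when _ (comp_pair c0 c2)) (comp_when _ (comp_pair (ncomp_mod c2 cr) cr)).
    move=> H; refine (@comp_ext L _ _ H _) => z _.
    by rewrite /st /s iterS -/(s z.1 z.2) /gcd_step; case: ifP.
  - by apply: comp_pair.
apply: (comp_ext (comp_snd cn)) => i Di.
have inv k : gcdn (s i k).1 (s i k).2 = gcdn (a i) (b i).
  elim: k => // k IH; rewrite -IH /s iterS -/(s i k).
  have [z|nz] := eqVneq (s i k).2 0%N; last exact: gcd_stepP.
  rewrite /gcd_step z modn0; case: eqP => [->|_] //=.
  by rewrite mod0n.
by rewrite -(inv (n i)) Hn // gcdn0.
Qed.

(** Encodings are in lowest terms, so numerator and denominator are divided by their gcd. *)
Lemma comp_frac c (n d : ix c -> int) : comp (fun i => VInt (n i)) -> comp (fun i => VInt (d i)) ->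
  (forall i, dom i -> 0 < d i) -> comp (fun i => enc_rat ((n i)%:~R / (d i)%:~R)).
Proof.
move=> cn cd d0; have cg := ncomp_gcd (icomp_abs cn) (icomp_abs cd).
have := comp_pair (icompV cn cg) (icompV cd cg) => H.
apply: (comp_ext H) => i Di; rewrite /enc_rat; have dp := d0 i Di.
set g := gcdn _ _.
have gp : (0 < g)%N by rewrite gcdn_gt0 !absz_gt0 (gt_eqF dp) orbT.
have [n' nE] : exists n', n i = n' * g%:Z.
  by apply/dvdzP; rewrite dvdzE /= dvdn_gcdl.
have [d' dE] : exists d', d i = d' * g%:Z.
  by apply/dvdzP; rewrite dvdzE /= dvdn_gcdr.
have g0 : (g%:Z : int) != 0 by rewrite eqz_nat -lt0n.
have d'p : 0 < d'.
  by move: dp; rewrite dE pmulr_lgt0 // ltz_nat.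
have cop : coprime `|n'| `|d'|.
  have : g = (gcdn `|n'| `|d'| * g)%N.
    by rewrite {1}/g nE dE !abszM /= -muln_gcdl.
  by move/eqP; rewrite -{1}[g]mul1n eqn_pmul2r // eq_sym.
have qE : (n i)%:~R / (d i)%:~R = n'%:~R / d'%:~R :> rat.
  rewrite nE dE !intrM invfM mulrACA divff ?mulr1 //.
  by rewrite intr_eq0.
rewrite qE coprimeq_num // coprimeq_den // gtr0_sg // mul1r (gt_eqF d'p).
congr (VPair (VInt _) (VInt _)); first by rewrite nE mulzK.
by rewrite dE mulzK // gtr0_norm.
Qed.

Definition unit_desc (_ : unit) : value := vnat 0.
Definition unit_pw (_ : unit) : nat := 0.

Lemma rat_ops : @ops_comp unit (fun=> rat) (fun=> enc_rat) unit_desc unit_pw.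
Proof.
move=> c fi x y gd cx cy; have be := comp_env_bnd cx.
have nx := comp_fst cx; have dx := comp_snd cx; have ny := comp_fst cy; have dy := comp_snd cy.
have c0 := icomp_const 0 be.
have czn : comp (fun i => vnat (x i == 0)).
  apply: (comp_ext (bcomp_eq (icomp_abs nx) (ncomp_const 0 be))) => i _.
  by rewrite absz_eq0 numq_eq0.
split=> //.
- have H : comp (fun i => enc_rat ((numq (x i) * denq (y i) + numq (y i) * denq (x i))%:~R / (denq (x i) * denq (y i))%:~R)).
    apply: comp_frac; [by apply: icompD; apply: icompM | by apply: icompM | by move=> i _; rewrite mulr_gt0].
  apply: (comp_ext H) => i _; congr enc_rat.
  rewrite -[in RHS](divq_num_den (x i)) -[in RHS](divq_num_den (y i)) intrD !intrM.
  by field; rewrite !intr_eq0 !denq_neq0.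
- have H : comp (fun i => enc_rat ((numq (x i) * numq (y i))%:~R / (denq (x i) * denq (y i))%:~R)).
    apply: comp_frac; [by apply: icompM | by apply: icompM | by move=> i _; rewrite mulr_gt0].
  apply: (comp_ext H) => i _; congr enc_rat.
  rewrite -[in RHS](divq_num_den (x i)) -[in RHS](divq_num_den (y i)) !intrM.
  by field; rewrite !intr_eq0 !denq_neq0.
- by apply: (comp_ext (comp_pair (icompN nx) dx)) => i _; rewrite /enc_rat numqN denqN.
have cpos : @comp (when (fun i => 0 < numq (x i))) (fun i => enc_rat (x i)^-1).
  have H : @comp (when (fun i => 0 < numq (x i))) (fun i => enc_rat ((denq (x i))%:~R / (numq (x i))%:~R)).
    apply: comp_frac; [exact: comp_when | exact: comp_when | by move=> i []].
  apply: (comp_ext H) => i _; congr enc_rat.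
  by rewrite -[in RHS](divq_num_den (x i)) invf_div.
have cneg : @comp (when (fun i => numq (x i) < 0)) (fun i => enc_rat (x i)^-1).
  have H : @comp (when (fun i => numq (x i) < 0)) (fun i => enc_rat ((- denq (x i))%:~R / (- numq (x i))%:~R)).
    apply: comp_frac; [by apply: comp_when; apply: icompN | by apply: comp_when; apply: icompN | by move=> i [_]; rewrite oppr_gt0].
  apply: (comp_ext H) => i _; congr enc_rat.
  by rewrite !intrN invrN mulrNN -[in RHS](divq_num_den (x i)) invf_div.
have cz := comp_const (enc_rat 0) be.
have t1 : comp (fun i => vnat (1 <= numq (x i))%R) by apply: icomp_le => //; apply: icomp_const.
have t2 : comp (fun i => vnat (numq (x i) <= -1)%R) by apply: icomp_le => //; apply: icomp_const.
have str (P Q : ix c -> Prop) (v : ix c -> value) : @comp (when P) v ->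
    (forall i, Q i -> P i) -> @comp (when Q) v.
  move=> cv PQ; refine (@comp_strengthen (when P) (@dom (when Q)) v cv _).
  by move=> i [Di Qi]; split=> //; apply: PQ.
have H := comp_if t2 (str _ _ _ cneg _) (comp_when _ cz).
have {}H := comp_if t1 (str _ _ _ cpos _) (comp_when _ (H _)).
apply: (comp_ext (H _ _)).
- by move=> i; lia.
- by move=> i; lia.
move=> i _; case: ifP => // h1; case: ifP => // h2.
have -> : x i = 0; last by rewrite invr0.
apply/eqP; rewrite -numq_eq0; apply/eqP; lia.
Qed.

Lemma numden_le (q : rat) (x y : int) : y != 0 -> q = x%:~R / y%:~R ->
  (`|numq q| <= `|x|)%N /\ (`|denq q| <= `|y|)%N.
Proof.
move=> y0 E; have y0' : y%:~R != 0 :> rat by rewrite intr_eq0.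
have H : x * denq q = numq q * y.
  apply: (@intr_inj rat); rewrite !intrM.
  have : q * y%:~R = x%:~R by rewrite E mulfVK.
  rewrite -{1}(divq_num_den q) => <-.
  by field; rewrite intr_eq0 denq_neq0.
have dv : (denq q %| y)%Z.
  have cop : coprimez (denq q) (numq q) by rewrite coprimezE coprime_sym coprime_num_den.
  by rewrite -(Gauss_dvdzr _ cop) -H dvdz_mull.
have le : (`|denq q| <= `|y|)%N by apply: dvdn_leq; rewrite ?absz_gt0.
split=> //; have := congr1 absz H; rewrite !abszM => Hn.
have yp : (0 < `|y|)%N by rewrite absz_gt0.
by rewrite -(leq_pmul2r yp) -Hn leq_mul2l le orbT.
Qed.

Lemma rat_size (q : rat) (x y : int) h : y != 0 -> q = x%:~R / y%:~R ->
  (`|x| < 2 ^ h)%N -> (`|y| < 2 ^ h)%N -> (vsize (enc_rat q) <= 2 * h + 3)%N.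
Proof.
move=> y0 E hx hy; have [h1 h2] := numden_le y0 E.
rewrite /enc_rat [vsize _]/= -!/(vsize (VInt _)).
have := vsize_int_le (leq_ltn_trans h1 hx); have := vsize_int_le (leq_ltn_trans h2 hy).
by rewrite /=; lia.
Qed.

Lemma rat_size_num q be : (vsize (enc_rat q) <= be)%N -> (`|numq q| <= 2 ^ be)%N /\ (`|denq q| <= 2 ^ be)%N.
Proof.
rewrite /enc_rat [vsize _]/= -!/(vsize (VInt _)) => le; split.
  by apply: leq_trans (ltnW (absz_lt_vsize _)) _; rewrite leq_pexp2l //; rewrite /= in le *; lia.
by apply: leq_trans (ltnW (absz_lt_vsize _)) _; rewrite leq_pexp2l //; rewrite /= in le *; lia.
Qed.

(** Over one common denominator a partial sum only adds numerators, and a linear system acquires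
    integer coefficients. *)
Lemma clear_denoms n (x : nat -> rat) be : (forall k, (k < n)%N -> (vsize (enc_rat (x k)) <= be)%N) ->
  let D := \prod_(k < n) denq (x k) in
  [/\ 0 < D, (`|D| <= 2 ^ (be * n))%N
    & forall k, (k < n)%N -> exists2 z : int, x k * D%:~R = z%:~R & (`|z| <= 2 ^ (be + be * n))%N].
Proof.
move=> Hx D.
have D0 : 0 < D by apply: prodr_gt0.
have Db : (`|D| <= 2 ^ (be * n))%N.
  rewrite /D; elim: (n) Hx => [|m IH] Hx; first by rewrite big_ord0 muln0.
  rewrite big_ord_recr abszM /= mulnSr expnD leq_mul ?IH //; first by move=> k lt; apply: Hx; apply: ltnW.
  by case: (rat_size_num (Hx m (ltnSn m))).
split=> // k lt; pose E := \prod_(j < n | j != Ordinal lt) denq (x j).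
have DE : D = denq (x k) * E by rewrite /D (bigD1 (Ordinal lt)).
exists (numq (x k) * E).
  by rewrite DE !intrM mulrA -{1}(divq_num_den (x k)) mulfVK ?intr_eq0.
rewrite abszM expnD leq_mul //; first by case: (rat_size_num (Hx k lt)).
apply: leq_trans Db; rewrite DE abszM leq_pmull //.
by rewrite absz_gt0.
Qed.

Lemma rat_sum_bnd : @sum_bnd unit (fun=> rat) (fun=> enc_rat) unit_desc unit_pw.
Proof.
move=> c fi n x gd bn [k0 Hk0].
pose B i := poly_bound k0 (@wt c i).
have bB : nbnd B by exists k0.
have bb : nbnd (fun i => 2 * (n i + (B i + B i * n i) + B i * n i).+1 + 3)%N.
  by rewrite /nbnd in bn bB *; pbdtac.
refine (@nbnd_le (ext (fun i => (n i).+1)) _ _ (nbnd_up _ bb) _) => z [Dz]; rewrite ltnS => lez.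
have Hx k : (k < n z.1)%N -> (vsize (enc_rat (x z.1 k)) <= B z.1)%N by move=> lt; apply: (Hk0 (z.1, k)).
have [D0 Db Hz] := clear_denoms Hx; move: D0 Db Hz; set D := \prod_(k < _) _ => D0 Db Hz.
have Hs j : (j <= n z.1)%N -> exists2 s : int, (\sum_(k < j) x z.1 k) * D%:~R = s%:~R
    & (`|s| <= j * 2 ^ (B z.1 + B z.1 * n z.1))%N.
  elim: j => [|j IH] lej; first by exists 0 => //; rewrite big_ord0 mul0r.
  have [s sE sb] := IH (ltnW lej); have [t tE tb] := Hz j lej.
  exists (s + t); first by rewrite big_ord_recr mulrDl /= sE tE intrD.
  by rewrite mulSn; lia.
have [s sE sb] := Hs _ lez.
apply: (@rat_size _ s D); first by rewrite (gt_eqF D0).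
- by rewrite -sE mulfK // intr_eq0 (gt_eqF D0).
- apply: leq_ltn_trans sb _; apply: (@leq_ltn_trans (2 ^ n z.1 * 2 ^ (B z.1 + B z.1 * n z.1))%N).
    by rewrite leq_mul2r; apply/orP; right; apply: leq_trans lez _; apply: ltnW; apply: ltn_expl.
  by rewrite -expnD ltn_exp2l //; lia.
- by apply: leq_ltn_trans Db _; rewrite ltn_exp2l //; lia.
Qed.

(** * Size of the entries in rational elimination *)

Section EliminationForm.
Variable F : fieldType.
Variables (M : nat) (a : nat -> nat -> F).

Lemma elform_col U r (f : nat -> nat) (Y : nat -> nat -> F) (b : nat -> F) i :
  (forall t, (t < r)%N -> (f t < M)%N) ->
  (forall i l, (i < M)%N -> (l < M)%N -> U i l = (i == l)%:R - \sum_(t < r) Y i t * (f t == l)%:R) ->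
  (i < M)%N -> elcol M b U i = b i - \sum_(t < r) Y i t * b (f t).
Proof.
move=> fM UE lt; rewrite /elcol.
transitivity (\sum_(l < M) ((i == l)%:R * b l - \sum_(t < r) Y i t * ((f t == l)%:R * b l))).
  apply: eq_bigr => l _; rewrite UE // mulrBl mulr_suml; congr (_ - _).
  by apply: eq_bigr => t _; exact/esym/mulrA.
have one (y : nat) : (y < M)%N -> \sum_(l < M) (y == l)%:R * b l = b y.
  move=> lty; rewrite -[RHS](@sum_delta _ M y) //; apply: eq_bigr => l _.
  by rewrite eq_sym; case: eqP => [->|_]; rewrite ?mul1r ?mul0r.
rewrite sumrB one // exchange_big /=; congr (_ - _); apply: eq_bigr => t _.
by rewrite -mulr_sumr one // fM.
Qed.

(** After [j] columns the rows [f t] are the pivots: each row of the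
    elimination matrix is a unit vector corrected by pivot rows only, so it is
    determined by the linear system it solves. *)
Lemma elU_form j : exists r (f : nat -> nat) (Y : nat -> nat -> F),
  [/\ forall t, (t < r)%N -> (f t < M)%N,
      forall i l, (i < M)%N -> (l < M)%N ->
        elU M a j i l = (i == l)%:R - \sum_(t < r) Y i t * (f t == l)%:R
    & forall w : nat -> F, (forall j', (j' < j)%N -> \sum_(t < r) w t * a (f t) j' = 0) ->
        forall t, (t < r)%N -> w t = 0].
Proof.
elim: j => [|j [r [f [Y [fM UE free]]]]].
  by exists 0%N, id, (fun _ _ => 0); split=> // i l _ _; rewrite big_ord0 subr0.
pose U := elU M a j; pose k := elpvt M (fun l => a l j) U.
have colE b i : (i < M)%N -> elcol M b U i = b i - \sum_(t < r) Y i t * b (f t).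
  exact: elform_col.
have [lt|le] := ltnP k M; last first.
  exists r, f, Y; split=> //.
    by move=> i l lti ltl; rewrite /= /elstep (elpvt_all0 le lti) !mul0r subr0 UE.
  by move=> w Hw; apply: free => j' lt; apply: Hw; apply: ltnW.
have ck := elpvt_neq0 lt; rewrite -/U -/k in ck.
pose c i := elcol M (fun l => a l j) U i.
pose rho i := c i / c k.
(* Row [i] loses [rho i] times the new pivot row [k]; this corrects the coefficients of the old
   pivots and adds [rho i] as that of [k]. *)
exists r.+1, (fun t => if (t < r)%N then f t else k),
  (fun i t => if (t < r)%N then Y i t - rho i * Y k t else rho i); split.
- by move=> t _; case: ifP => // ltr; apply: fM.
- move=> i l lti ltl; rewrite /= /elstep -/U -/k -/(c i) -/(c k) -/(rho i) /U !UE //.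
  rewrite big_ord_recr /= ltnn.
  under [X in _ = _ - (X + _)]eq_bigr => t _ do rewrite ltn_ord mulrBl -mulrA.
  rewrite sumrB -mulr_sumr; ring.
move=> w Hw.
have H1 j' : (j' < j.+1)%N -> \sum_(t < r) w t * a (f t) j' + w r * a k j' = 0.
  move=> lt'; rewrite -[RHS](Hw j' lt') big_ord_recr /= ltnn; congr (_ + _).
  by apply: eq_bigr => t _; rewrite ltn_ord.
have H2 j' : (j' < j)%N -> a k j' = \sum_(t < r) Y k t * a (f t) j'.
  move=> lt'; apply/eqP; rewrite -subr_eq0 -(colE (fun l => a l j')) //.
  by rewrite elU_ker.
have H3 t : (t < r)%N -> w t + w r * Y k t = 0.
  move: t; apply: free => j' lt'; have := H1 j' (ltnW lt'); rewrite (H2 j' lt') mulr_sumr -big_split /=.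
  move=> E; rewrite -[RHS]E; apply: eq_bigr => t _.
  by rewrite mulrDl; congr (_ + _); exact/esym/mulrA.
have wr : w r = 0.
  have := H1 j (ltnSn j).
  have -> : \sum_(t < r) w t * a (f t) j = - (w r * \sum_(t < r) Y k t * a (f t) j).
    rewrite mulr_sumr -sumrN; apply: eq_bigr => t _.
    have /eqP := H3 t (ltn_ord t); rewrite addr_eq0 => /eqP ->.
    by rewrite mulNr; congr (- _); exact/esym/mulrA.
  rewrite addrC -mulrBr -(colE (fun l => a l j)) // => /eqP; rewrite mulf_eq0 (negbTE ck) orbF.
  by move/eqP.
move=> t; rewrite ltnS leq_eqVlt => /orP[/eqP -> //|ltt].
by have := H3 t ltt; rewrite wr mul0r addr0.
Qed.

End EliminationForm.

Lemma absz_sum_le (I : finType) (G : I -> int) (B : nat) :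
  (forall i, (`|G i| <= B)%N) -> (absz (\sum_i G i)%R <= #|I| * B)%N.
Proof.
move=> H; rewrite -sum1_card big_distrl /=.
elim/big_rec2: _ => [|i y1 y2 _ IH] //.
by have := H i; rewrite mul1n; lia.
Qed.

Lemma absz_sum_ord r (G : 'I_r -> int) (B : nat) :
  (forall i, (`|G i| <= B)%N) -> (absz (\sum_i G i)%R <= r * B)%N.
Proof. by move/absz_sum_le; rewrite card_ord. Qed.

Lemma absz_prod (I : finType) (G : I -> int) : (absz (\prod_i G i)%R = \prod_i `|G i|)%N.
Proof. by elim/big_rec2: _ => // i y1 y2 _ <-; rewrite abszM. Qed.

Lemma det_bound r (A : 'M[int]_r) H : (forall i j, (`|A i j| <= H)%N) -> (`|\det A| <= r`! * H ^ r)%N.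
Proof.
move=> HA; rewrite -card_Sn; apply: absz_sum_le => s.
rewrite abszM abszX (_ : absz (-1) = 1%N) // exp1n mul1n absz_prod.
apply: leq_trans (leq_prod (E2 := fun=> H) _) _ => //.
by rewrite prod_nat_const card_ord.
Qed.

Lemma adj_bound r (A : 'M[int]_r) H i j : (0 < H)%N -> (forall i j, (`|A i j| <= H)%N) ->
  (`|(\adj A) i j| <= r`! * H ^ r)%N.
Proof.
case: r A i j => [|r] A i j H0 HA; first by case: i.
rewrite mxE /cofactor abszM abszX (_ : absz (-1) = 1%N) // exp1n mul1n.
apply: leq_trans (det_bound (H := H) _) _; first by move=> i' j'; rewrite !mxE.
by rewrite leq_mul ?leq_pexp2l // factS leq_pmull.
Qed.

Lemma expn_fact_bound r n : (r <= n)%N -> (r`! <= 2 ^ (n * n))%N.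
Proof.
move=> le; apply: (@leq_trans (n ^ r)%N).
  elim: r le => // r IH le; rewrite factS expnS.
  by apply: leq_mul => //; apply: IH; apply: ltnW.
case: (posnP n) => [n0|np]; first by move: le; rewrite n0 leqn0 => /eqP ->.
apply: (@leq_trans (n ^ n)%N); first by rewrite leq_pexp2l.
by rewrite expnM leq_exp2r // ltnW // ltn_expl.
Qed.

(** By [elU_form] a row is determined by coefficients [Y i t] that solve a square system cut out of
    the original entries. With denominators cleared, Cramer's rule writes them as quotients of
    bounded integers, independently of the course of the elimination. *)
Lemma elU_size M n (a : nat -> nat -> rat) be j i l :
  (forall k j, (k < M)%N -> (j < n)%N -> (vsize (enc_rat (a k j)) <= be)%N) ->
  (j <= n)%N -> (i < M)%N -> (l < M)%N ->
  (vsize (enc_rat (elU M a j i l)) <= 2 * (2 * n + n * n + (be + be * (M * n)) * n.+1 + 1).+1 + 3)%N.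
Proof.
move=> Ha lej lti ltl; set h := (be + be * (M * n))%N.
have [D0 Db Hz] : let D := \prod_(q < M * n) denq (a (q %/ n)%N (q %% n)%N) in
    [/\ 0 < D, (`|D| <= 2 ^ (be * (M * n)))%N
    & forall q, (q < M * n)%N -> exists2 z : int, a (q %/ n)%N (q %% n)%N * D%:~R = z%:~R & (`|z| <= 2 ^ h)%N].
  apply: (@clear_denoms (M * n)%N (fun q => a (q %/ n)%N (q %% n)%N) be) => q lt.
  have n0 : (0 < n)%N by case: (n) lt; rewrite ?muln0.
  by apply: Ha; rewrite ?ltn_divLR ?ltn_mod.
move: D0 Db Hz; set D := \prod_(q < _) _ => D0 Db Hz.
pose Z k j := numq (a k j * D%:~R).
have HZ k j' : (k < M)%N -> (j' < n)%N -> a k j' * D%:~R = (Z k j')%:~R /\ (`|Z k j'| <= 2 ^ h)%N.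
  move=> lk ljn; have n0 : (0 < n)%N by case: (n) ljn.
  have lt : (k * n + j' < M * n)%N.
    by apply: (@leq_trans (k.+1 * n)%N); [rewrite mulSnr ltn_add2l | rewrite leq_mul2r lk orbT].
  have [z] := Hz _ lt; rewrite divnMDl // divn_small // addn0 modnMDl modn_small // => zE zb.
  by rewrite /Z zE numq_int.
have [r [f [Y [fM UE free]]]] := elU_form M a j.
pose A' : 'M[rat]_(j, r) := \matrix_(j', t) a (f t) j'.
have rf : row_full A'.
  rewrite /row_full -mxrank_tr; apply/(@inj_row_free _ _ _ A'^T) => v vA.
  apply/rowP => t; rewrite [RHS]mxE.
  pose w k := if insub k is Some t' then v 0 t' else 0.
  have := free w; rewrite /w => /(_ _ t (ltn_ord t)); rewrite valK; apply=> j' lt.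
  have := congr1 (fun m : 'rV_j => m 0 (Ordinal lt)) vA; rewrite [RHS]mxE mxE => E0.
  by rewrite -[RHS]E0; apply: eq_bigr => t' _; rewrite valK !mxE.
have rj : (r <= n)%N by apply: leq_trans lej; have := rank_leq_row A'; rewrite (eqP rf).
(* Among the first [j] columns, [r] can be selected on which the pivot rows form an invertible
   matrix. *)
pose g := fullrankfun rf; have Bu := fullrowsub_unit rf; rewrite -/g in Bu.
set B := rowsub g A' in Bu.
have gn t : (g t < n)%N by apply: leq_trans lej.
pose Bz : 'M[int]_r := \matrix_(t', t) Z (f t) (g t').
pose bz : 'cV[int]_r := \col_t' Z i (g t').
pose y : 'cV[rat]_r := \col_t Y i t.
have BzE : map_mx intr Bz = D%:~R *: B.
  apply/matrixP => t' t; rewrite !mxE.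
  by have [<- _] := HZ (f t) (g t') (fM t (ltn_ord t)) (gn t'); rewrite mulrC.
have By : map_mx intr Bz *m y = map_mx intr bz.
  rewrite BzE -scalemxAl; apply/colP => t'; rewrite !mxE.
  have [<- _] := HZ i (g t') lti (gn t'); rewrite mulrC; congr (_ * _).
  have := elU_ker a lti (ltn_ord (g t')); rewrite (elform_col (fun k => a k (g t')) fM UE lti) => /eqP.
  rewrite subr_eq0 => /eqP ->; apply: eq_bigr => t _; rewrite !mxE; exact: mulrC.
pose dt := \det Bz; pose X := \adj Bz *m bz.
have dt0 : dt != 0.
  have : \det (map_mx intr Bz : 'M[rat]_r) != 0.
    by rewrite BzE detZ mulf_neq0 // ?expf_neq0 ?intr_eq0 ?(gt_eqF D0) // -unitfE -unitmxE.
  by rewrite det_map_mx intr_eq0.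
have yE : dt%:~R *: y = map_mx intr X.
  rewrite /X map_mxM -By mulmxA -map_mxM mul_adj_mx map_scalar_mx mul_scalar_mx //.
have YE (t : 'I_r) : dt%:~R * Y i t = (X t 0)%:~R.
  by have := congr1 (fun m : 'cV[rat]_r => m t 0) yE; rewrite !mxE.
have hb : (0 < 2 ^ h)%N by rewrite expn_gt0.
have Bzb t' t : (`|Bz t' t| <= 2 ^ h)%N by rewrite mxE; case: (HZ (f t) (g t') (fM t (ltn_ord t)) (gn t')).
have dtb := det_bound Bzb; have adjb t t' := adj_bound t t' hb Bzb.
have Xb (t : 'I_r) : (`|X t 0%R| <= r * (r`! * (2 ^ h) ^ r * 2 ^ h))%N.
  rewrite mxE; apply: absz_sum_ord => t'.
  rewrite abszM leq_mul // mxE; by case: (HZ i (g t') lti (gn t')).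
pose N : int := (i == l)%:R * dt - \sum_(t < r) X t 0 * (f t == l)%:R.
have Nb : (`|N| <= (1 + r * r) * (r`! * (2 ^ h) ^ r * 2 ^ h))%N.
  have h1 : (absz ((i == l)%:R * dt)%R <= r`! * (2 ^ h) ^ r * 2 ^ h)%N.
    rewrite abszM; apply: (@leq_trans (1 * (r`! * (2 ^ h) ^ r))%N).
      by apply: leq_mul => //; case: (i == l).
    by rewrite mul1n leq_pmulr.
  have h2 : (absz (\sum_(t < r) X t 0 * (f t == l)%:R)%R <= r * (r * (r`! * (2 ^ h) ^ r * 2 ^ h)))%N.
    apply: absz_sum_ord => t; rewrite abszM.
    apply: (@leq_trans (`|X t 0%R| * 1)%N); last by rewrite muln1.
    by apply: leq_mul => //; case: (f t == l).
  by rewrite /N mulnDl mul1n -mulnA; lia.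
have UN : elU M a j i l = N%:~R / dt%:~R.
  have sE : (\sum_(t < r) X t 0 * (f t == l)%:R)%:~R = \sum_(t < r) dt%:~R * Y i t * (f t == l)%:R :> rat.
    by rewrite rmorph_sum; apply: eq_bigr => t _ /=; rewrite intrM rmorph_nat YE.
  rewrite UE // /N intrB intrM rmorph_nat sE mulrBl mulfK ?intr_eq0 //.
  congr (_ - _); rewrite mulr_suml; apply: eq_bigr => t _.
  by rewrite mulrAC [_ * Y i t]mulrC mulfK ?intr_eq0.
have e1 : (r`! * (2 ^ h) ^ r * 2 ^ h <= 2 ^ (n * n + h * n.+1))%N.
  rewrite -mulnA -expnSr -expnM expnD leq_mul ?expn_fact_bound // leq_pexp2l //.
  by rewrite leq_mul2l ltnS rj orbT.
have e2 : (1 + r * r <= 2 ^ (2 * n))%N.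
  have lr := ltn_expl r (isT : (1 < 2)%N).
  apply: (@leq_trans (2 ^ (2 * r))%N); last by rewrite leq_pexp2l // leq_mul2l rj.
  by rewrite mul2n -addnn expnD; nia.
apply: (@rat_size _ N dt) => //.
  apply: leq_ltn_trans Nb _; apply: leq_ltn_trans (leq_mul e2 e1) _.
  by rewrite -expnD ltn_exp2l //; lia.
apply: leq_ltn_trans dtb _; apply: (@leq_ltn_trans (r`! * (2 ^ h) ^ r * 2 ^ h)%N).
  by rewrite leq_pmulr.
by apply: leq_ltn_trans e1 _; rewrite ltn_exp2l //; lia.
Qed.

Lemma rat_elim_bnd : @elim_bnd unit (fun=> rat) (fun=> enc_rat) unit_desc unit_pw.
Proof.
move=> c fi M n a gd bM bn [k0 Hk0].
pose B i := poly_bound k0 (@wt c i).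
have bB : nbnd B by exists k0.
have bb : nbnd (fun i => 2 * (2 * n i + n i * n i + (B i + B i * (M i * n i)) * (n i).+1 + 1).+1 + 3)%N.
  by rewrite /nbnd in bn bM bB *; pbdtac.
have b1 := nbnd_up (c := c) (fun i => (n i).+1) bb.
have b2 := nbnd_up (c := ext (fun i => (n i).+1)) (fun z => M z.1) b1.
have b3 := nbnd_up (c := @ext (ext (fun i => (n i).+1)) (fun z => M z.1)) (fun z => M z.1.1) b2.
refine (@nbnd_le _ _ _ b3 _) => z [[[Dz l1] l2] l3].
apply: elU_size => // k j lk lj.
by apply: (Hk0 ((z.1.1.1, k), j)).
Qed.

Lemma rat_solver : @solver_comp unit (fun=> rat) (fun=> enc_rat) unit_desc unit_pw (fun=> @elsolve rat).
Proof. exact: (elsolve_comp rat_ops (@consts_unit rat enc_rat) rat_sum_bnd rat_elim_bnd). Qed.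

(** * Rational roots: denominators and bounds *)

Definition rootD n (x : nat -> rat) : int := \prod_(k < n) denq (x k).
(** A bound for the numerators of the roots over the denominator [rootD]: Cauchy's bound, with its
    sum of moduli majorized by an integer product. *)
Definition rootR n (x : nat -> rat) : int := rootD n x * \prod_(k < n) (1 + `|numq (x k)|).

Section RationalRoots.
Variables (n : nat) (x : nat -> rat).
Local Notation D := (rootD n x).
Local Notation R := (rootR n x).

Lemma rootD_gt0 : 0 < D. Proof. exact: prodr_gt0. Qed.

Lemma chi_root_eq la : root (chi_poly n x) la -> la ^+ n = \sum_(k < n) x k * la ^+ k.
Proof. by rewrite /root /chi_poly hornerD hornerN hornerXn horner_poly subr_eq0 => /eqP. Qed.

(** Clearing denominators in the equation shows that the denominator of a root divides [rootD], as
    in the rational root theorem; the size of the root is bounded as in Cauchy's estimate. *)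
Lemma rat_root_int la : root (chi_poly n x) la -> exists2 z : int, la * D%:~R = z%:~R & `|z| <= R.
Proof.
move/chi_root_eq => E.
have Zx (k : 'I_n) : exists z : int, D%:~R * x k = z%:~R.
  exists (numq (x k) * \prod_(j < n | j != k) denq (x j)).
  rewrite /rootD (bigD1 k) //= !intrM -{2}(divq_num_den (x k)) mulrAC.
  by field; rewrite intr_eq0 denq_neq0.
have {Zx} [Z HZ] := choice_fun Zx.
set s := numq la; set t := denq la.
have t0 : t%:~R != 0 :> rat by rewrite intr_eq0 denq_neq0.
have ltE : la * t%:~R = s%:~R by rewrite -{1}(divq_num_den la) mulfVK.
have powE k : (k <= n)%N -> la ^+ k * t%:~R ^+ n = (s ^+ k * t ^+ (n - k))%:~R.
  move=> le; rewrite -{1}(subnKC le) exprD mulrA -exprMn ltE.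
  by rewrite intrM !rmorphXn.
have eqZ : D * s ^+ n = \sum_(k < n) Z k * (s ^+ k * t ^+ (n - k)).
  apply: (@intr_inj rat); rewrite intrM rmorph_sum /=.
  have -> : (s ^+ n)%:~R = la ^+ n * t%:~R ^+ n by rewrite powE // subnn expr0 mulr1.
  rewrite E mulr_suml mulr_sumr; apply: eq_bigr => k _.
  by rewrite -(mulrA (x k)) powE ?(ltnW (ltn_ord k)) // [in RHS]intrM (mulrA D%:~R) HZ.
have tD : (t %| D)%Z.
  have cop : coprimez t (s ^+ n).
    by rewrite coprimezE abszX coprimeXr // coprime_sym coprime_num_den.
  rewrite -(Gauss_dvdzl _ cop) eqZ; apply: rpred_sum => k _.
  rewrite -(subnSK (ltn_ord k)) exprS; do 2!apply: dvdz_mull; exact: dvdz_mulr.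
have /dvdzP[e De] := tD.
have zE : la * D%:~R = (s * e)%:~R by rewrite De mulrC intrM -mulrA [_ * la]mulrC ltE mulrC intrM.
exists (s * e) => //.
have leP : forall m, (forall k, (k < m)%N -> (0 : rat) <= `|x k|) ->
    1 + \sum_(k < m) `|x k| <= \prod_(k < m) (1 + `|x k|).
  elim=> [|m IH] _; first by rewrite !big_ord0 addr0.
  rewrite !big_ord_recr /=; set S := \sum_(k < m) _ in IH *; set P := \prod_(k < m) _ in IH *.
  have {}IH : 1 + S <= P by apply: IH.
  have S0 : 0 <= S by apply: sumr_ge0.
  have a0 : 0 <= `|x m| by apply: normr_ge0.
  rewrite mulrDr mulr1 addrA lerD //; apply: ler_peMl => //.
  by apply: le_trans IH; rewrite lerDl.
have labound : `|la| <= 1 + \sum_(k < n) `|x k|.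
  have S0 : 0 <= \sum_(k < n) `|x k| by apply: sumr_ge0.
  case: (lerP `|la| 1) => [le1|gt1]; first by apply: le_trans le1 _; rewrite lerDl.
  apply: (@le_trans _ _ (\sum_(k < n) `|x k|)); last by rewrite lerDr.
  have [n0|nm] : n = 0%N \/ exists m, n = m.+1 by case: (n); [left | right; eexists].
    by move: E; rewrite n0 big_ord0 expr0 => /eqP; rewrite oner_eq0.
  have : `|la| ^+ n <= (\sum_(k < n) `|x k|) * `|la| ^+ n.-1.
    rewrite -normrX E mulr_suml; apply: le_trans (ler_norm_sum _ _ _) _; apply: ler_sum => k _.
    rewrite normrM normrX ler_wpM2l // ler_weXn2l ?(ltW gt1) //.
    by rewrite -ltnS prednK // ?ltn_ord //; case: nm => ? ->.
  case: nm => m' nm; rewrite nm exprS /= ler_pM2r // exprn_gt0 //.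
  exact: lt_trans ltr01 gt1.
have : `|la| * D%:~R <= (\prod_(k < n) (1 + `|numq (x k)|))%:~R * D%:~R.
  rewrite ler_pM2r ?ltr0z ?rootD_gt0 //; apply: le_trans labound _; apply: le_trans (leP n _) _ => //.
  rewrite rmorph_prod; apply: ler_prod => k _; apply/andP; split; first by rewrite addr_ge0.
  rewrite /= intrD lerD // intr_norm -{1}(divq_num_den (x k)) normrM ler_piMr //.
  rewrite normfV invf_le1 ?normr_gt0 ?intr_eq0 ?denq_neq0 // -intr_norm ler1z.
  by have := denq_gt0 (x k); lia.
rewrite -(@ler_int rat) /rootR intrM [X in _ <= X]mulrC intr_norm -zE normrM.
by rewrite (@gtr0_norm _ D%:~R) ?ltr0z ?rootD_gt0.
Qed.

Lemma prod_coef_int (s : seq rat) b :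
  (forall la, la \in s -> exists2 z : int, la * D%:~R = z%:~R & `|z| <= R) ->
  exists2 w : int, (\prod_(la <- s) ('X - la%:P))`_b * D%:~R ^+ size s = w%:~R & `|w| <= (D + R) ^+ size s.
Proof.
elim: s b => [|la s IH] b H.
  rewrite big_nil coef1 expr0 mulr1; exists (b == 0%N)%:R; first by rewrite rmorph_nat.
  by rewrite expr0; case: (b == 0%N).
have Hs la' : la' \in s -> exists2 z : int, la' * D%:~R = z%:~R & `|z| <= R.
  by move=> ls; apply: H; rewrite in_cons ls orbT.
have [z zE zb] := H la (mem_head _ _).
rewrite big_cons mulrBl coefB coefXM coefCM /=.
have [w2 w2E w2b] := IH b Hs.
have [w1 w1E w1b] : exists2 w : int, (if b == 0%N then 0 else (\prod_(j <- s) ('X - j%:P))`_b.-1) * D%:~R ^+ size s = w%:~R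
    & `|w| <= (D + R) ^+ size s.
  case: (b == 0%N); last exact: IH.
  exists 0; first by rewrite mul0r.
  by rewrite normr0; apply: le_trans (normr_ge0 _) w2b.
exists (w1 * D - z * w2).
  rewrite intrB !intrM -w1E -w2E -zE exprS mulrBl; congr (_ - _); last exact: mulrACA.
  by rewrite mulrA mulrAC.
apply: le_trans (ler_normB _ _) _; rewrite !normrM exprS mulrDl (gtr0_norm rootD_gt0) mulrC lerD //.
  by rewrite ler_pM2l ?rootD_gt0.
by apply: ler_pM.
Qed.

End RationalRoots.

Lemma rootR_size n x be : (forall k, (k < n)%N -> (vsize (enc_rat (x k)) <= be)%N) ->
  (absz (rootD n x) <= 2 ^ (be * n))%N /\ (absz (rootD n x + rootR n x)%R <= 2 ^ (be * n + be.+1 * n).+1)%N.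
Proof.
move=> Hx; have [_ Db _] := clear_denoms Hx; rewrite -/(rootD n x) in Db; split=> //.
have Pb : (absz (\prod_(k < n) (1 + `|numq (x k)|))%R <= 2 ^ (be.+1 * n))%N.
  elim: (n) Hx => [|m IH] Hx; first by rewrite big_ord0 muln0.
  rewrite big_ord_recr abszM /= mulnSr expnD leq_mul ?IH //; first by move=> k lt; apply: Hx; apply: ltnW.
  have [h _] := rat_size_num (Hx m (ltnSn m)).
  rewrite expnS; have := expn_gt0 2 be; lia.
have Rb : (absz (rootR n x) <= 2 ^ (be * n + be.+1 * n))%N by rewrite /rootR abszM expnD leq_mul.
rewrite expnS mul2n -addnn.
have : (2 ^ (be * n) <= 2 ^ (be * n + be.+1 * n))%N by rewrite leq_pexp2l // leq_addr.
lia.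
Qed.

(** A monic divisor of a product of linear factors is the product of some of them, and its
    coefficients are bounded integers over a power of [rootD]. *)
Lemma rat_divisor_bnd : @divisor_bnd unit (fun=> rat) (fun=> enc_rat) unit_desc unit_pw.
Proof.
move=> c fi n x gd bn [k0 Hk0] sp.
pose B i := poly_bound k0 (@wt c i).
have bB : nbnd B by exists k0.
exists (fun i => 2 * (((B i * n i + (B i).+1 * n i).+1 * n i).+1 ) + 3)%N.
  by rewrite /nbnd in bn bB *; pbdtac.
move=> i h j Di mon; case: (sp i Di) => l [El _]; rewrite /chi_poly El -(big_mkseq_ord _ l (n i) (fun y => 'X - y%:P)).
case/dvdp_prod_XsubC => m; rewrite eqp_monic //; last by apply: monic_prod => la _; apply: monicXsubC.
move/eqP => hE; set s := mask m _ in hE.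
have szs : (size s <= n i)%N.
  have := size_subseq (mask_subseq m (mkseq l (n i))); by rewrite size_mkseq.
have Hs la : la \in s -> exists2 z : int, la * (rootD (n i) (x i))%:~R = z%:~R & `|z| <= rootR (n i) (x i).
  move=> /mem_mask ls; apply: rat_root_int; rewrite /chi_poly El.
  by rewrite -(big_mkseq_ord _ l (n i) (fun y => 'X - y%:P)) root_prod_XsubC.
have [w wE wb] := prod_coef_int j Hs; rewrite -hE in wE.
have Hx k : (k < n i)%N -> (vsize (enc_rat (x i k)) <= B i)%N by move=> lt; apply: (Hk0 (i, k)).
have [Db DRb] := rootR_size Hx.
have D0 := rootD_gt0 (n i) (x i); set D := rootD _ _ in D0 wE wb Db DRb; set R := rootR _ _ in wb DRb.
have R0 : 0 <= D + R.
  apply: addr_ge0; first exact: ltW.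
  by apply: mulr_ge0; [exact: ltW | apply: prodr_ge0 => k _; apply: addr_ge0].
have wb' : (absz w <= absz (D + R)%R ^ size s)%N.
  by rewrite -abszX -lez_nat !abszE (ger0_norm (exprn_ge0 _ R0)).
have e1 : (absz (D + R)%R ^ size s <= 2 ^ ((B i * n i + (B i).+1 * n i).+1 * n i))%N.
  apply: (@leq_trans ((2 ^ (B i * n i + (B i).+1 * n i).+1) ^ size s)%N).
    by case: (size s) => // ?; rewrite leq_exp2r.
  by rewrite -expnM leq_pexp2l // leq_mul2l szs orbT.
have e2 : (absz (D ^+ size s)%R <= 2 ^ ((B i * n i + (B i).+1 * n i).+1 * n i))%N.
  rewrite abszX; apply: (@leq_trans ((2 ^ (B i * n i)) ^ size s)%N).
    by case: (size s) => // ?; rewrite leq_exp2r.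
  by rewrite -expnM leq_pexp2l // leq_mul //; lia.
apply: (@rat_size _ (- w) (D ^+ size s)).
- by rewrite expf_neq0 // (gt_eqF D0).
- rewrite intrN -wE rmorphXn -mulNr mulfK // expf_neq0 // intr_eq0.
  by rewrite (gt_eqF D0).
- rewrite abszN; apply: leq_ltn_trans wb' _; apply: leq_ltn_trans e1 _.
  by rewrite ltn_exp2l.
- by apply: leq_ltn_trans e2 _; rewrite ltn_exp2l.
Qed.

Definition tay n (x : nat -> rat) (y : rat) k : rat := (chi_poly n x \Po ('X + y%:P))`_k.

Lemma tay_ge0 (s : seq rat) y b : (forall la, la \in s -> la <= y) ->
  0 <= ((\prod_(la <- s) ('X - la%:P)) \Po ('X + y%:P))`_b.
Proof.
elim: s b => [|la s IH] b H; first by rewrite big_nil comp_polyC coefC; case: ifP.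
have Hs la' : la' \in s -> la' <= y by move=> ls; apply: H; rewrite in_cons ls orbT.
rewrite big_cons comp_polyM comp_polyB comp_polyX comp_polyC -addrA -polyCB mulrDl coefD coefXM coefCM.
apply: addr_ge0; first by case: ifP => // _; apply: IH.
by apply: mulr_ge0; [rewrite subr_ge0; apply: H; apply: mem_head | apply: IH].
Qed.

(** A monic polynomial with nonnegative Taylor coefficients at [y] is positive at [y + e] for every
    positive [e]. *)
Lemma tay_max n x (l : nat -> rat) y : chi_poly n x = \prod_(i < n) ('X - (l i)%:P) ->
  (forall k, (k < n.+1)%N -> 0 <= tay n x y k) -> forall la, root (chi_poly n x) la -> la <= y.
Proof.
move=> El H la rt; rewrite leNgt; apply/negP => lt.
pose e := la - y; have e0 : 0 < e by rewrite subr_gt0.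
set Q := chi_poly n x \Po ('X + y%:P).
have s2 : size ('X + y%:P : {poly rat}) = 2%N by rewrite size_XaddC.
have szQ : size Q = n.+1 by rewrite size_comp_poly2 // size_chi_poly.
have Qn : Q`_n = 1.
  have -> : n = (size Q).-1 by rewrite szQ.
  rewrite -/(lead_coef Q) lead_coef_comp ?s2 // lead_coefXaddC expr1n mulr1.
  exact/monicP/chi_monic.
have : Q.[e] = 0.
  have ye : ('X + y%:P).[e] = la by rewrite !hornerE subrK.
  by rewrite horner_comp ye; apply/eqP.
rewrite horner_coef szQ big_ord_recr /= Qn mul1r => /eqP; rewrite paddr_eq0.
- by rewrite expf_eq0 (gt_eqF e0) andbF andbF.
- by apply: sumr_ge0 => k _; apply: mulr_ge0; [apply: H; apply: ltnW; rewrite ltnS | rewrite exprn_ge0 // ltW].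
- by rewrite exprn_ge0 // ltW.
Qed.

(** Multiplication by ['X + y%:P] on truncated coefficient sequences, so that the Taylor
    coefficients come from one Krylov sequence. *)
Definition shmx (y : rat) k l : rat := if l == k.+1 then 1 else if l == k then y else 0.

Lemma kry_shift N y i l : (l < N)%N ->
  kry N (shmx y) (fun l => if l == 0%N then 1 else 0) i l = (('X + y%:P) ^+ i)`_l.
Proof.
elim: i l => [|i IH] l lt; first by rewrite /= expr0 coef1; case: eqP.
rewrite kryS exprSr mulrDr coefD coefMX coefMC.
set P := ('X + y%:P) ^+ i in IH *.
transitivity (\sum_(k < N) ((if k == l.-1 :> nat then (if l == 0%N then 0 else P`_l.-1) else 0) + (if k == l :> nat then P`_l * y else 0))).
  apply: eq_bigr => k _; rewrite IH // /shmx.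
  case: (l) => [|m] /=.
    by rewrite if_same add0r eq_sym; case: eqP => [->|_]; rewrite ?mulr0.
  rewrite eqSS eq_sym; case: eqP => [->|ne].
    by rewrite ltn_eqF // addr0 mulr1.
  by rewrite add0r eq_sym; case: eqP => [->|_] //; rewrite mulr0.
rewrite big_split /= !sum_delta //; case: (l) lt => // m; exact: ltnW.
Qed.

Lemma tayE n x y k : (k < n.+1)%N ->
  tay n x y k = \sum_(i < n.+1) (chi_poly n x)`_i * kry n.+1 (shmx y) (fun l => if l == 0%N then 1 else 0) i k.
Proof.
move=> lt; rewrite /tay comp_polyE size_chi_poly coef_sum; apply: eq_bigr => i _.
by rewrite coefZ kry_shift.
Qed.

Definition below n (x : nat -> rat) (y : rat) : bool :=
  find (fun k => tay n x y k < 0) (iota 0 n.+1) == n.+1.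

Lemma belowP n x (l : nat -> rat) y : chi_poly n x = \prod_(i < n) ('X - (l i)%:P) ->
  reflect (forall la, root (chi_poly n x) la -> la <= y) (below n x y).
Proof.
move=> El; have -> : below n x y = all (fun k => 0 <= tay n x y k) (iota 0 n.+1).
  rewrite /below -[X in _ == X](size_iota 0 n.+1) eqn_leq find_size andTb leqNgt -has_find -all_predC.
  by apply: eq_all => k; rewrite /= leNgt.
apply: (iffP allP) => [H|H k _].
  apply: (tay_max El) => k lt; by apply: H; rewrite mem_iota.
rewrite /tay El -(big_mkseq_ord _ l n (fun y => 'X - y%:P)); apply: tay_ge0 => la las.
by apply: H; rewrite El -(big_mkseq_ord _ l n (fun y => 'X - y%:P)) root_prod_XsubC.
Qed.

Lemma below_comp c (n : ix c -> nat) (x : ix c -> nat -> rat) (y : ix c -> rat) :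
  comp (fun i => vnat (n i)) -> nbnd n -> comp (fun i => vtab (n i) (fun k => enc_rat (x i k))) ->
  comp (fun i => enc_rat (y i)) -> comp (fun i => vnat (below (n i) (x i) (y i))).
Proof.
move=> cn bn tx cy; have be := comp_env_bnd cn.
apply: bcomp_eq; last by cgo.
refine (@ncomp_find c (fun i => (n i).+1) (fun i k => tay (n i) (x i) (y i) k < 0) _ _ _).
- by cgo.
- by nauto.
set X := ext _.
have bX : vbnd (@env X) by rewrite /X; envb.
have gX : good unit_desc unit_pw (fun _ : ix X => tt) by apply: good_unit.
have ct : @comp X (fun z => enc_rat (tay (n z.1) (x z.1) (y z.1) z.2)).
  refine (@comp_ext X (fun z => enc_rat (\sum_(i < (n z.1).+1) (chi_poly (n z.1) (x z.1))`_i *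
     kry (n z.1).+1 (shmx (y z.1)) (fun l => if l == 0%N then 1 else 0) i z.2)) _ _ _); last first.
    by move=> z [_ lt]; rewrite tayE.
  refine (@fdot unit (fun=> rat) (fun=> enc_rat) unit_desc unit_pw (fun=> @elsolve rat) (fun=> @elsolve_spec rat) rat_solver (@consts_unit rat enc_rat) X (fun=> tt) gX
    (fun z => (n z.1).+1) (fun z i => (chi_poly (n z.1) (x z.1))`_i)
    (fun z i => kry (n z.1).+1 (shmx (y z.1)) (fun l => if l == 0%N then 1 else 0) i z.2) _ _ _ _).
  - by rewrite /X; cgo.
  - by rewrite /X; nauto.
  - set Y := ext _.
    refine (@comp_ext Y (fun z => vif (z.2 < n z.1.1)%N (enc_rat (- x z.1.1 z.2)) (enc_rat 1)) _ _ _); last first.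
      by move=> z [_ lt]; rewrite chi_polyE coef_poly lt /vif; case: ifP.
    apply: (@comp_vif Y).
    + by rewrite /Y /X; cgo.
    + have cx : @comp (when (fun z : ix Y => z.2 < n z.1.1)%N) (fun z => enc_rat (x z.1.1 z.2)).
        by rewrite /Y /X; tnth (fun z => n z.1.1) (fun z k => enc_rat (x z.1.1 k)) (fun z => z.2); [cgo | cgo | dtac].
      apply: (comp_ext (comp_pair (icompN (comp_fst cx)) (comp_snd cx))) => z _.
      by rewrite /enc_rat numqN denqN.
    + by rewrite /Y /X; cgo.
  set Y := ext _.
  have bY : vbnd (@env Y) by rewrite /Y /X; envb.
  have gY : good unit_desc unit_pw (fun _ : ix Y => tt) by apply: good_unit.
  refine (@fkry unit (fun=> rat) (fun=> enc_rat) unit_desc unit_pw (fun=> @elsolve rat) (fun=> @elsolve_spec rat) rat_solver (@consts_unit rat enc_rat) Y (fun=> tt) gY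
    (fun z => (n z.1.1).+1) (fun z => z.2) (fun z => z.1.2) (fun z => shmx (y z.1.1))
    (fun z l => if l == 0%N then 1 else 0) _ _ _ _ _ _ _ _).
  - by rewrite /Y /X; cgo.
  - by rewrite /Y /X; nauto.
  - by rewrite /Y /X; cgo.
  - by rewrite /Y /X; nauto.
  - by rewrite /Y /X; cgo.
  - by rewrite /Y /X; dtac.
  - set Z := ext _.
    refine (@comp_ext Z (fun z => vif (z.2 == z.1.2.+1) (enc_rat 1) (vif (z.2 == z.1.2) (enc_rat (y z.1.1.1.1)) (enc_rat 0))) _ _ _).
      by rewrite /Z /Y /X; cgo.
    by move=> z _; rewrite /vif /shmx; case: ifP => // _; case: ifP.
  - set Z := ext _.
    refine (@comp_ext Z (fun z => vif (z.2 == 0%N) (enc_rat 1) (enc_rat 0)) _ _ _).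
      by rewrite /Z /Y /X; cgo.
    by move=> z _; rewrite /vif; case: ifP.
apply: (comp_ext (bcomp_neg (icomp_le (icomp_const 0 bX) (comp_fst ct)))) => z _.
by rewrite numq_ge0 -ltNge.
Qed.

Lemma icomp_prod c (n : ix c -> nat) (d : ix c -> nat -> int) :
  comp (fun i => vnat (n i)) -> nbnd n -> @comp (ext n) (fun z => VInt (d z.1 z.2)) ->
  comp (fun i => VInt (\prod_(k < n i) d i k)).
Proof.
move=> cn bn cd; have be := comp_env_bnd cn; have [k0 Hk0] := comp_vbnd cd.
pose B i := poly_bound k0 (@wt c i).
have bB : nbnd B by exists k0.
have bb : nbnd (fun i => (B i * n i).+2) by rewrite /nbnd in bB bn *; pbdtac.
have Pb i k : dom i -> (k <= n i)%N -> (absz (\prod_(k < k) d i k)%R <= 2 ^ (B i * n i))%N.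
  move=> Di; elim: k => [|k IH] le; first by rewrite big_ord0 expn_gt0.
  have {}IH : (absz (\prod_(k < k) d i k)%R <= 2 ^ (B i * k))%N.
    clear -Hk0 Di le; elim: k le => [|k IH] le; first by rewrite big_ord0 muln0.
    rewrite big_ord_recr abszM /= mulnSr expnD leq_mul ?IH //; first by apply: ltnW.
    apply: leq_trans (ltnW (absz_lt_vsize _)) _; rewrite leq_pexp2l //.
    by apply: (Hk0 (i, k)); split=> //; apply: ltnW.
  rewrite big_ord_recr abszM /=; apply: (@leq_trans (2 ^ (B i * k.+1))%N).
    rewrite mulnSr expnD leq_mul //; apply: leq_trans (ltnW (absz_lt_vsize _)) _; rewrite leq_pexp2l //.
    exact: (Hk0 (i, k)).
  by rewrite leq_pexp2l // leq_mul2l le orbT.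
have Pv i k : dom i -> (k <= n i)%N -> (vsize (VInt (\prod_(k < k) d i k)) <= (B i * n i).+2)%N.
  move=> Di le; apply: vsize_int_le; apply: leq_ltn_trans (Pb i k Di le) _.
  by rewrite ltn_exp2l.
apply: (@comp_iter c n (fun i k => VInt (\prod_(k < k) d i k))) => //.
- by exists (fun i => (B i * n i).+2).
- by apply: (comp_ext (icomp_const 1 be)) => i _; rewrite big_ord0.
set A := addenv _.
have bA : @vbnd (ext n) (fun z => VInt (\prod_(k < z.2) d z.1 k)).
  by have [k1 Hk1] := bb; exists k1 => z [Dz lt]; apply: leq_trans (Pv _ _ Dz (ltnW lt)) (Hk1 _ Dz).
have c1 : @comp A (fun z => VInt (\prod_(k < z.2) d z.1 k)).
  by apply: comp_added => //; apply: vbnd_ext_env.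
have c2 : @comp A (fun z => VInt (d z.1 z.2)) by apply: comp_weak.
by apply: (comp_ext (icompM c1 c2)) => z _; rewrite big_ord_recr.
Qed.

(** * Bisection for the largest root *)

Definition bisect (P : int -> bool) (s : int * int) : int * int :=
  let m := divz (s.1 + s.2) 2 in
  if absz (s.2 - s.1 - 1)%R == 0%N then s else if P m then (s.1, m) else (m, s.2).

Lemma bisectP P k a b : ~~ P a -> P b -> a < b ->
  let s := iter k (bisect P) (a, b) in
  [/\ ~~ P s.1, P s.2, s.1 < s.2, a <= s.1 & s.2 <= b].
Proof.
move=> Pa Pb ab; elim: k => [|k] //; rewrite iterS /=.
move: (iter k _ _) => [lo hi] /= [Plo Phi lt al hb].
rewrite /bisect /=; case: eqP => // ne.
have := divz_eq (lo + hi) 2; have := modz_ge0 (lo + hi) (isT : (2 : int) != 0).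
have := ltz_pmod (lo + hi) (isT : (0 : int) < 2); set m := divz _ _; set r := modz _ _ => h1 h2 h3.
have lm : lo < m by lia.
have mh : m < hi by lia.
by case: ifP => [Pm|/negbT Pm]; split=> //=; lia.
Qed.

Lemma bisect_half P s : s.1 < s.2 -> absz (s.2 - s.1 - 1)%R != 0%N ->
  (2 * absz ((bisect P s).2 - (bisect P s).1 - 1)%R <= absz (s.2 - s.1 - 1)%R)%N.
Proof.
case: s => lo hi /= lt ne; rewrite /bisect /= (negbTE ne).
have := divz_eq (lo + hi) 2; have := modz_ge0 (lo + hi) (isT : (2 : int) != 0).
have := ltz_pmod (lo + hi) (isT : (0 : int) < 2); set m := divz _ _; set r := modz _ _ => h1 h2 h3.
by case: ifP => _ /=; lia.
Qed.

Definition max_root n (x : nat -> rat) (la : rat) : Prop :=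
  root (chi_poly n x) la /\ forall la', root (chi_poly n x) la' -> la' <= la.

Lemma max_root_eq n x la la' : max_root n x la -> max_root n x la' -> la = la'.
Proof. by case=> r1 m1 [r2 m2]; apply/le_anti; rewrite m2 //= m1. Qed.

Section Bisection.
Variables (n : nat) (x : nat -> rat).
Hypotheses (n0 : (0 < n)%N) (sp : split_ok n x).
Local Notation D := (rootD n x).
Local Notation R := (rootR n x).
Definition bcrit (a : int) : bool := below n x (a%:~R / D%:~R).

Let D0 : 0 < D%:~R :> rat. Proof. by rewrite ltr0z rootD_gt0. Qed.

Lemma bcritP a : reflect (forall la z, root (chi_poly n x) la -> la * D%:~R = z%:~R -> z <= a) (bcrit a).
Proof.
apply: (iffP idP) => H.
  move=> la z rt zE; case: sp => l [El _]; move/(belowP _ El): H => /(_ la rt).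
  by rewrite ler_pdivlMr // zE ler_int.
case: sp => l [El _]; apply/(belowP _ El) => la rt; have [z zE _] := rat_root_int rt.
by rewrite ler_pdivlMr // zE ler_int; apply: H zE.
Qed.

Let ex_root : exists2 la, root (chi_poly n x) la & exists2 z : int, la * D%:~R = z%:~R & `|z| <= R.
Proof.
case: sp => l [El _]; have rt : root (chi_poly n x) (l 0%N).
  rewrite /chi_poly El -(big_mkseq_ord _ l n (fun y => 'X - y%:P)) root_prod_XsubC.
  by apply/mapP; exists 0%N; rewrite ?mem_iota.
by exists (l 0%N) => //; apply: rat_root_int.
Qed.

Lemma rootR_ge0 : 0 <= R.
Proof. by have [la _ [z _ h]] := ex_root; apply: le_trans (normr_ge0 _) h. Qed.

Lemma bcrit_lo : ~~ bcrit (- R - 1).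
Proof.
apply/negP => /bcritP H; have [la rt [z zE h]] := ex_root.
by have := H la z rt zE; rewrite ler_norml in h; lia.
Qed.

Lemma bcrit_hi : bcrit R.
Proof.
apply/bcritP => la z rt zE; have [z' z'E h] := rat_root_int rt.
have -> : z = z' by apply: (@intr_inj rat); rewrite -zE -z'E.
by rewrite ler_norml in h; lia.
Qed.

(** All roots are integers divided by [rootD], so between adjacent integers the upper one is the
    only possible position of the largest root. *)
Lemma bisect_max a b : ~~ bcrit a -> bcrit b -> a < b -> absz (b - a - 1)%R = 0%N ->
  max_root n x (b%:~R / D%:~R).
Proof.
move=> na /bcritP Hb lt z0; have ba : b = a + 1 by lia.
have Hb' la : root (chi_poly n x) la -> la <= b%:~R / D%:~R.
  move=> rt; have [z zE _] := rat_root_int rt.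
  by rewrite ler_pdivlMr // zE ler_int; apply: Hb zE.
split=> //.
have [la [z [rt zE za]]] : exists la z, [/\ root (chi_poly n x) la, la * D%:~R = z%:~R & a < z].
  apply: NNPP => nex; move/negP: na; apply; apply/bcritP => la z rt zE.
  by rewrite leNgt; apply/negP => az; apply: nex; exists la, z.
have -> : b = z by have := Hb la z rt zE; lia.
by rewrite -zE mulfK ?gt_eqF.
Qed.

End Bisection.

Lemma rat_onert : exists onert : nat -> (nat -> rat) -> rat,
  (forall n x, split_ok n.+1 x -> root (chi_poly n.+1 x) (onert n.+1 x)) /\
  @onert_comp unit (fun=> rat) (fun=> enc_rat) unit_desc unit_pw (fun=> onert).
Proof.
(* The function is fixed by choice as the largest root; only afterwards is a program shown to
   compute it. *)
have /choice_fun[f Hf] : forall q : nat * (nat -> rat), exists la,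
    (0 < q.1)%N -> split_ok q.1 q.2 -> max_root q.1 q.2 la.
  move=> [n x]; case: (excluded_middle_informative ((0 < n)%N /\ split_ok n x)) => [[n0 sp]|nsp]; last first.
    by exists 0 => n0 sp; case: nsp.
  case: (sp) => l [El _].
  have [i Hi] : exists i : 'I_n, forall j : 'I_n, l j <= l i.
    have [i _ Hi] := @arg_maxP _ _ _ (Ordinal n0) predT (fun i : 'I_n => l i) isT.
    by exists i => j; apply: Hi.
  have rtE la : root (chi_poly n x) la = (la \in mkseq l n).
    by rewrite /chi_poly El -(big_mkseq_ord _ l n (fun y => 'X - y%:P)) root_prod_XsubC.
  exists (l i) => _ _; split; first by rewrite rtE; apply/mapP; exists (i : nat); rewrite // mem_iota /= ltn_ord.
  move=> la; rewrite rtE => /mapP[j]; rewrite mem_iota /= add0n => lt ->.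
  exact: (Hi (Ordinal lt)).
exists (fun n x => f (n, x)); split; first by move=> n x sp; case: (Hf (n.+1, x) isT sp).
move=> c fi n x gd cn bn tx Hn; have be := comp_env_bnd cn.
have cx : @comp (ext n) (fun z => enc_rat (x z.1 z.2)).
  by tnth (fun z => n z.1) (fun z k => enc_rat (x z.1 k)) (fun z => z.2); [cgo | cgo | dtac].
have cD : comp (fun i => VInt (rootD (n i) (x i))).
  exact: (@icomp_prod c n (fun i k => denq (x i k)) cn bn (comp_snd cx)).
have cR : comp (fun i => VInt (rootR (n i) (x i))).
  apply: icompM => //; apply: (@icomp_prod c n (fun i k => 1 + `|numq (x i k)|)) => //.
  apply: icompD; first by apply: icomp_const; envb.
  by apply: (comp_ext (icomp_abs (comp_fst cx))) => z _; rewrite /vnat abszE.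
pose P i := bcrit (n i) (x i); pose R i := rootR (n i) (x i).
pose s i k := iter k (bisect (P i)) (- R i - 1, R i).
pose mu i k := absz ((s i k).2 - (s i k).1 - 1)%R.
pose st i k := VPair (vnat (mu i k)) (VPair (env i) (VPair (VInt (s i k).1) (VInt (s i k).2))).
have sP i k : dom i -> [/\ ~~ P i (s i k).1, P i (s i k).2, (s i k).1 < (s i k).2, - R i - 1 <= (s i k).1 & (s i k).2 <= R i].
  move=> Di; have [np spl] := Hn i Di; apply: bisectP.
  - exact: bcrit_lo.
  - exact: bcrit_hi.
  - have := rootR_ge0 np spl; rewrite -/(R i); lia.
pose v i := vsize (VInt (R i)).
have bv : nbnd v by apply: (comp_vbnd cR).
have mub i k : dom i -> [/\ (mu i k < 2 ^ (v i + 3))%N, (absz (s i k).1 < 2 ^ (v i + 3))%N & (absz (s i k).2 < 2 ^ (v i + 3))%N].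
  move=> Di; have [_ _ h1 h2 h3] := sP i k Di.
  have := absz_lt_vsize (R i); rewrite -/(v i) addn3 !expnS => h4.
  by rewrite /mu; split; lia.
have bb : nbnd (fun i => 3 * (v i + 4) + vsize (env i) + 4)%N.
  by rewrite /nbnd /vbnd in bv be *; pbdtac.
have stb i k : dom i -> (vsize (st i k) <= 3 * (v i + 4) + vsize (env i) + 4)%N.
  move=> Di; have [h1 h2 h3] := mub i k Di.
  have vP a b : vsize (VPair a b) = (vsize a + vsize b).+1 by [].
  have g1 : (vsize (vnat (mu i k)) <= (v i + 3).+1)%N := @vsize_int_le (Posz (mu i k)) _ h1.
  have g2 := vsize_int_le h2; have g3 := vsize_int_le h3.
  by rewrite /st !vP; lia.
have bv3 : nbnd (fun i => v i + 3)%N by rewrite /nbnd in bv *; pbdtac.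
have [m [Hm cm]] : exists m : ix c -> nat, (forall i, dom i -> mu i (m i) = 0%N) /\ comp (fun i => st i (m i)).
  apply: (@comp_halving c st mu (fun i => v i + 3)%N bv3) => //.
  - by move=> i Di; case: (mub i 0%N Di).
  - move=> i k Di ne; rewrite /mu /s iterS -/(s i k); apply: bisect_half => //.
    by case: (sP i k Di).
  - by exists (fun i => 3 * (v i + 4) + vsize (env i) + 4)%N.
  - move=> m mz bm; set L := loopctx _ _.
    have bL : vbnd (@env L).
      by have [k1 Hk1] := bb; exists k1 => z [Dz _]; apply: leq_trans (stb _ _ Dz) (Hk1 _ Dz).
    have cL := comp_id bL; have ce := comp_fst (comp_snd cL).
    have clo : @comp L (fun z => VInt (s z.1 z.2).1) := comp_fst (comp_snd (comp_snd cL)).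
    have chi : @comp L (fun z => VInt (s z.1 z.2).2) := comp_snd (comp_snd (comp_snd cL)).
    have up y : @comp c y -> @comp L (fun z => y z.1).
      by move=> cy; apply: (@comp_sub c L fst y cy) => // z [].
    pose mid (z : ix L) := divz ((s z.1 z.2).1 + (s z.1 z.2).2) 2.
    have cmid : @comp L (fun z => VInt (mid z)) by apply: icompV; [apply: icompD | apply: icomp_const].
    have cy : @comp L (fun z => enc_rat ((mid z)%:~R / (rootD (n z.1) (x z.1))%:~R)).
      by apply: comp_frac => //; [exact: (up _ cD) | move=> z _; apply: rootD_gt0].
    have cP : @comp L (fun z => vnat (P z.1 (mid z))).
      apply: (@below_comp L (fun z => n z.1) (fun z => x z.1) _ (up _ cn) _ (up _ tx) cy).
      by have [k1 Hk1] := bn; exists k1 => z [Dz _]; apply: Hk1.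
    have cs : @comp L (fun z => VPair (VInt (s z.1 z.2.+1).1) (VInt (s z.1 z.2.+1).2)).
      have H := comp_if cP (comp_when _ (comp_pair clo cmid)) (comp_when _ (comp_pair cmid chi)).
      refine (@comp_ext L _ _ H _) => z [Dz lt].
      rewrite /s iterS -/(s z.1 z.2) /bisect -/(mid z); have := mz _ _ Dz lt; rewrite /mu => /negbTE ->.
      by case: ifP.
    have cm1 : @comp L (fun z => vnat (mu z.1 z.2.+1)).
      apply: icomp_abs; apply: icompB; last exact: icomp_const.
      by apply: icompB; [exact: (comp_snd cs) | exact: (comp_fst cs)].
    by apply: comp_pair => //; apply: comp_pair.
  - have c1 : comp (fun i => VPair (VInt (- R i - 1)) (VInt (R i))).
      by apply: comp_pair => //; apply: icompB; [apply: icompN | apply: icomp_const].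
    apply: comp_pair; last by apply: comp_pair => //; apply: comp_id.
    apply: icomp_abs; apply: icompB; last exact: icomp_const.
    by apply: icompB; [exact: (comp_snd c1) | exact: (comp_fst c1)].
have H := comp_frac (comp_snd (comp_snd (comp_snd cm))) cD (fun i _ => rootD_gt0 (n i) (x i)).
apply: (comp_ext H) => i Di; congr enc_rat; have [np spl] := Hn i Di.
apply: (@max_root_eq (n i) (x i)); last exact: (Hf (n i, x i) np spl).
have [h1 h2 h3 _ _] := sP i (m i) Di.
have := Hm i Di; rewrite /mu => h4.
exact: (bisect_max np spl h1 h2 h3 h4).
Qed.

Theorem rat_reconstructible : reconstructible enc_rat.
Proof.
have [onert [rP rC]] := rat_onert.
apply: (@reconstructible_field rat enc_rat (@elsolve rat) (droots (@elsolve rat) onert)).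
- exact: elsolve_spec.
- by apply: droots_spec => //; apply: elsolve_spec.
- exact: rat_solver.
apply: (@droots_comp unit (fun=> rat) (fun=> enc_rat) unit_desc unit_pw (fun=> @elsolve rat) (fun=> @elsolve_spec rat)
  rat_solver (@consts_unit rat enc_rat) (fun=> onert) (fun=> rP) rC rat_divisor_bnd).
Qed.

(** * Finite fields *)

Section Digits.
Variables (F : finFieldType) (p m : nat) (theta : F) (digits : F -> seq nat).
Hypothesis pb : power_basis p m theta digits.

Definition dig x j := nth 0%N (digits x) j.

Lemma pbchar : p \in [pchar F]. Proof. by case: pb. Qed.
Lemma pb_prime : prime p. Proof. by have := pbchar; rewrite inE => /andP[]. Qed.
Lemma pb_gt0 : (0 < p)%N. Proof. exact: prime_gt0 pb_prime. Qed.

Lemma pb_m_gt0 : (0 < m)%N.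
Proof. by case: pb => _ cF _; have := finNzRing_gt1 F; rewrite cF; case: (m). Qed.

Lemma dig_lt x j : (j < m)%N -> (dig x j < p)%N.
Proof. by case: pb => _ _ /(_ x)[sz /allP H _] lt; apply: H; rewrite mem_nth ?sz. Qed.

Lemma digE x : x = \sum_(j < m) (dig x j)%:R * theta ^+ j.
Proof. by case: pb => _ _ /(_ x)[]. Qed.

(** Digit expansions reach all of [F] and there are exactly [p ^ m] of them, so the expansion map is
    injective as well. *)
Lemma dig_uniq (s : nat -> nat) j : (forall j, (j < m)%N -> (s j < p)%N) -> (j < m)%N ->
  dig (\sum_(j < m) (s j)%:R * theta ^+ j) j = s j.
Proof.
move=> Hs ltj; pose phi (f : {ffun 'I_m -> 'I_p}) : F := \sum_(j < m) (f j)%:R * theta ^+ j.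
have inj : injective phi.
  have : #|[seq phi f | f in predT]| == #|{ffun 'I_m -> 'I_p}|.
    rewrite card_ffun !card_ord; case: (pb) => _ <- _; rewrite eqn_leq max_card /=.
    apply/subset_leq_card/subsetP => x _; apply/imageP.
    exists [ffun j : 'I_m => Ordinal (dig_lt x (ltn_ord j))] => //.
    by rewrite {1}(digE x) /phi; apply: eq_bigr => k _; rewrite ffunE.
  by move/image_injP => H f g; apply: H.
set x := \sum_(j < m) _.
pose f1 := [ffun j : 'I_m => Ordinal (dig_lt x (ltn_ord j))].
pose f2 := [ffun j : 'I_m => Ordinal (Hs j (ltn_ord j))].
have : phi f1 = phi f2.
  transitivity x; first by rewrite /phi [RHS](digE x); apply: eq_bigr => k _; rewrite ffunE.
  by rewrite /phi; apply: eq_bigr => k _; rewrite ffunE.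
by move/inj/ffunP/(_ (Ordinal ltj)); rewrite !ffunE => /(congr1 val).
Qed.

Lemma encE x : enc_digits digits x = vtab m (fun j => vnat (dig x j)).
Proof.
rewrite /enc_digits /vtab; case: pb => _ _ /(_ x)[sz _ _].
by congr vlist; rewrite -{1}(mkseq_nth 0%N (digits x)) sz /mkseq -map_comp.
Qed.

Lemma dig_sum (s : nat -> nat) j : (j < m)%N ->
  dig (\sum_(j < m) (s j)%:R * theta ^+ j) j = (s j %% p)%N.
Proof.
move=> lt; rewrite -(@dig_uniq (fun j => s j %% p)%N j) //; last by move=> k _; rewrite ltn_mod pb_gt0.
by congr dig; apply: eq_bigr => k _; rewrite (GRing.natr_mod_pchar pbchar).
Qed.

Lemma digD x y j : (j < m)%N -> dig (x + y) j = ((dig x j + dig y j) %% p)%N.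
Proof.
move=> lt; rewrite {1}(digE x) {1}(digE y) -big_split /=.
under eq_bigr => k _ do rewrite -mulrDl -natrD.
by rewrite (@dig_sum (fun k => dig x k + dig y k)%N).
Qed.

Lemma digN x j : (j < m)%N -> dig (- x) j = ((p - dig x j) %% p)%N.
Proof.
move=> lt; rewrite {1}(digE x) -sumrN.
have -> : \sum_(i < m) - ((dig x i)%:R * theta ^+ i) = \sum_(i < m) (p - dig x i)%:R * theta ^+ i.
  apply: eq_bigr => k _; rewrite natrB; last by apply: ltnW; apply: dig_lt.
  by rewrite (pcharf0 pbchar) sub0r mulNr.
by rewrite (@dig_sum (fun k => p - dig x k)%N).
Qed.

(** Multiplication by [theta] shifts the digits; the top digit is carried back through the known
    digits of [theta ^+ m]. *)
Lemma digX x j : (j < m)%N -> dig (theta * x) j =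
  (((if (0 < j)%N then dig x j.-1 else 0) + dig x m.-1 * dig (theta ^+ m) j) %% p)%N.
Proof.
move=> lt; have mp := prednK pb_m_gt0.
rewrite -(@dig_sum (fun j => (if (0 < j)%N then dig x j.-1 else 0) + dig x m.-1 * dig (theta ^+ m) j)%N) //.
congr dig.
under [RHS]eq_bigr => k _ do rewrite natrD mulrDl natrM -mulrA.
rewrite big_split /= -mulr_sumr -digE {1}(digE x) mulr_sumr.
have -> : \sum_(i < m) theta * ((dig x i)%:R * theta ^+ i) = \sum_(i < m) (dig x i)%:R * theta ^+ i.+1.
  by apply: eq_bigr => i _; rewrite mulrCA -exprS.
case: (m) mp => // k _ /=; rewrite big_ord_recr [in RHS]big_ord_recl /= mul0r add0r; congr (_ + _).
Qed.

Lemma digM x y j : (j < m)%N ->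
  dig (x * y) j = ((\sum_(k < m) dig y k * dig (theta ^+ k * x)%R j) %% p)%N.
Proof.
move=> lt; rewrite -(@dig_sum (fun j => \sum_(k < m) dig y k * dig (theta ^+ k * x)%R j)%N) //.
congr dig; rewrite {1}(digE y) mulr_sumr.
under [RHS]eq_bigr => l _ do rewrite natr_sum mulr_suml.
rewrite exchange_big /=; apply: eq_bigr => k _.
rewrite mulrCA {1}[x * _]mulrC {1}(digE (theta ^+ k * x)) mulr_sumr; apply: eq_bigr => l _.
by rewrite natrM mulrA.
Qed.

Lemma dig0 j : (j < m)%N -> dig 0 j = 0%N.
Proof.
move=> lt; rewrite -[RHS](@dig_uniq (fun=> 0%N) j) // => [|k _]; last exact: pb_gt0.
by congr dig; rewrite big1 // => k _; rewrite mul0r.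
Qed.

Lemma dig1 j : (j < m)%N -> dig 1 j = (j == 0%N).
Proof.
move=> lt; rewrite -[RHS](@dig_uniq (fun j => (j == 0%N) : nat) j) // => [|k _].
  congr dig; case: (m) lt => // k _; rewrite big_ord_recl /= expr0 mulr1 big1 ?addr0 //.
  by move=> i _; rewrite mul0r.
by apply: leq_ltn_trans (leq_b1 _) (prime_gt1 pb_prime).
Qed.

Lemma dig_eq0 x : (x == 0) = (find (fun j => dig x j != 0%N) (iota 0 m) == m).
Proof.
rewrite -[X in find _ _ == X](size_iota 0 m) eqn_leq find_size andTb leqNgt -has_find -all_predC.
apply/eqP/allP => [->|H]; first by move=> j; rewrite mem_iota /= => lt; rewrite dig0.
rewrite (digE x) big1 // => j _; have := H (j : nat); rewrite mem_iota /= ltn_ord => /(_ isT).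
by rewrite negbK => /eqP ->; rewrite mul0r.
Qed.

Lemma ff_card : #|F| = (p ^ m)%N. Proof. by case: pb. Qed.

(** The inverse is the power of exponent [p ^ m - 2]. The exponent is split so that the inner power
    can be built up in fewer than [m] rounds of [p]-th powers; counting up to [p ^ m] would take
    exponential time. *)
Lemma ff_inv (x : F) : x != 0 -> x^-1 = (x ^+ (p ^ m.-1 - 1)) ^+ p * x ^+ (p - 2).
Proof.
move=> x0; apply: (mulfI x0); rewrite mulfV // -exprM -exprD -exprS.
have p1 := prime_gt1 pb_prime.
have e : ((p ^ m.-1 - 1) * p + (p - 2)).+2 = (p ^ m)%N.
  rewrite -{2}(prednK pb_m_gt0) expnSr mulnBl mul1n.
  have : (p <= p ^ m.-1 * p)%N by rewrite leq_pmull // expn_gt0 pb_gt0.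
  lia.
apply: (mulfI x0); rewrite -exprS e -ff_card expf_card mulr1 //.
Qed.

End Digits.

Record ffield := FField {
  ffF : finFieldType;
  ffp : nat;
  ffm : nat;
  ffth : ffF;
  ffdig : ffF -> seq nat;
  ffpb : power_basis ffp ffm ffth ffdig }.

Definition ffield_F (phi : ffield) : fieldType := ffF phi.
Definition ffield_enc (phi : ffield) (x : ffield_F phi) : value := enc_digits (@ffdig phi) x.
Definition ffield_desc (phi : ffield) : value := finite_field_description (ffp phi) (ffm phi) (ffth phi) (@ffdig phi).
Definition ffield_pw (phi : ffield) : nat := (ffp phi + ffm phi)%N.

Local Notation fdesc := ffield_desc.
Local Notation fpw := ffield_pw.

(** * Arithmetic in finite fields *)

Section FFieldOps.
Variables (c : ctx) (fi : ix c -> ffield).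
Hypothesis gd : good fdesc fpw fi.
Local Notation p i := (ffp (fi i)).
Local Notation m i := (ffm (fi i)).
Local Notation dg := (dig (@ffdig _)).

Let be : vbnd (@env c). Proof. exact: (comp_env_bnd gd.1). Qed.

Lemma ff_bp : nbnd (fun i => p i).
Proof. by apply: (nbnd_le gd.2) => i _; apply: leq_addr. Qed.
Lemma ff_bm : nbnd (fun i => m i).
Proof. by apply: (nbnd_le gd.2) => i _; apply: leq_addl. Qed.
Lemma ff_cp : comp (fun i => vnat (p i)).
Proof. exact: (comp_fst gd.1). Qed.
Lemma ff_cm : comp (fun i => vnat (m i)).
Proof.
apply: (comp_ext (comp_size (comp_snd gd.1))) => i _; rewrite size_map.
by case: (ffpb (fi i)) => _ _ /(_ (ffth (fi i) ^+ m i))[->].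
Qed.
Lemma ff_cmod : comp (fun i => vtab (m i) (fun j => vnat (dg (ffth (fi i) ^+ m i) j))).
Proof. by apply: (comp_ext (comp_snd gd.1)) => i _; rewrite (encE (ffpb (fi i))). Qed.

Lemma ff_size i (x : ffield_F (fi i)) : (vsize (ffield_enc x) <= m i * (p i).+1 + 1)%N.
Proof.
rewrite /ffield_enc (encE (ffpb (fi i))); apply: vsize_vtab_le => j lt.
by apply: leq_trans (vsize_nat_le _) _; apply: (dig_lt (ffpb (fi i))).
Qed.

Lemma ff_sizeb : nbnd (fun i => m i * (p i).+1 + 1)%N.
Proof. by have b1 := ff_bp; have b2 := ff_bm; nauto. Qed.

Lemma ff_vbnd (x : forall i, ffield_F (fi i)) : vbnd (fun i => ffield_enc (x i)).
Proof. by apply: (nbnd_le ff_sizeb) => i _; apply: ff_size. Qed.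

Lemma ff_tab (x : forall i, ffield_F (fi i)) : comp (fun i => ffield_enc (x i)) ->
  comp (fun i => vtab (m i) (fun j => vnat (dg (x i) j))).
Proof. by move=> cx; apply: (comp_ext cx) => i _; rewrite /ffield_enc (encE (ffpb (fi i))). Qed.

Lemma ff_dig (x : forall i, ffield_F (fi i)) : comp (fun i => ffield_enc (x i)) ->
  @comp (ext (fun i => m i)) (fun z => vnat (dg (x z.1) z.2)).
Proof.
move/ff_tab => tx; have bm := ff_bm; have cm := ff_cm.
by tnth (fun z => m z.1) (fun z j => vnat (dg (x z.1) j)) (fun z => z.2); [cgo | cgo | dtac].
Qed.

Lemma ff_mk (x : forall i, ffield_F (fi i)) (s : ix c -> nat -> nat) :
  (forall i j, dom i -> (j < m i)%N -> dg (x i) j = s i j) ->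
  @comp (ext (fun i => m i)) (fun z => vnat (s z.1 z.2)) -> comp (fun i => ffield_enc (x i)).
Proof.
move=> H cs; have bm := ff_bm; have cm := ff_cm.
apply: (comp_ext (@comp_tab c (fun i => m i) (fun i j => vnat (s i j)) cm bm cs)) => i Di.
by rewrite /ffield_enc (encE (ffpb (fi i))); apply: eq_vtab => j lt; rewrite H.
Qed.

Lemma ff_theta (x : forall i, ffield_F (fi i)) : comp (fun i => ffield_enc (x i)) ->
  comp (fun i => ffield_enc (ffth (fi i) * x i : ffield_F (fi i))).
Proof.
move=> cx; have tx := ff_tab cx; have th := ff_cmod.
have bm := ff_bm; have cm := ff_cm; have bp := ff_bp; have cp := ff_cp.
apply: (@ff_mk (fun i => ffth (fi i) * x i) (fun i j => ((if (0 < j)%N then dg (x i) j.-1 else 0) +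
   dg (x i) (m i).-1 * dg (ffth (fi i) ^+ m i) j) %% p i)%N).
  by move=> i j _ lt; rewrite (digX (ffpb (fi i))).
set X := ext _.
have cx1 : @comp X (fun z => vif (0 < z.2)%N (vnat (dg (x z.1) (z.2 - 1)%N)) (vnat 0)).
  rewrite /X; cgo; tnth (fun z => m z.1) (fun z j => vnat (dg (x z.1) j)) (fun z => z.2 - 1)%N; [by cgo | by cgo | ].
  by move=> z [[_ lt] _] /=; apply: leq_ltn_trans lt; apply: leq_subr.
have cx1' : @comp X (fun z => vnat (if (0 < z.2)%N then dg (x z.1) z.2.-1 else 0)).
  by apply: (comp_ext cx1) => z _; rewrite /vif subn1; case: ifP.
have cx2 : @comp X (fun z => vnat (dg (x z.1) (m z.1).-1)).
  refine (@comp_ext X (fun z => vnat (dg (x z.1) (m z.1 - 1)%N)) _ _ _); last by move=> z _; rewrite subn1.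
  rewrite /X; tnth (fun z => m z.1) (fun z j => vnat (dg (x z.1) j)) (fun z => m z.1 - 1)%N; [by cgo | by cgo | ].
  by move=> z _; rewrite ltn_subrL /= (pb_m_gt0 (ffpb (fi z.1))).
have cx3 : @comp X (fun z => vnat (dg (ffth (fi z.1) ^+ m z.1) z.2)).
  by rewrite /X; tnth (fun z => m z.1) (fun z j => vnat (dg (ffth (fi z.1) ^+ m z.1) j)) (fun z => z.2); [cgo | cgo | dtac].
have cp' : @comp X (fun z => vnat (p z.1)) by rewrite /X; cgo.
exact: (ncomp_mod (ncompD cx1' (ncompM cx2 cx3)) cp').
Qed.

End FFieldOps.

Lemma ncomp_sum c (n : ix c -> nat) (a : ix c -> nat -> nat) :
  comp (fun i => vnat (n i)) -> nbnd n -> @comp (ext n) (fun z => vnat (a z.1 z.2)) ->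
  @nbnd (ext n) (fun z => a z.1 z.2) -> comp (fun i => vnat (\sum_(k < n i) a i k)).
Proof.
move=> cn bn ca [k0 Hk0]; have be := comp_env_bnd cn.
pose B i := (n i * poly_bound k0 (@wt c i))%N.
have bB : nbnd B by apply: pbd_mul => //; exists k0.
have Sb i k : dom i -> (k <= n i)%N -> (\sum_(k < k) a i k <= B i)%N.
  move=> Di le; apply: (@leq_trans (k * poly_bound k0 (wt i))%N); last by rewrite leq_mul2r le orbT.
  elim: k le => [|k IH] le; first by rewrite big_ord0.
  rewrite big_ord_recr mulSnr /=; apply: leq_add; first by apply: IH; apply: ltnW.
  exact: (Hk0 (i, k)).
have Vb i k : dom i -> (k <= n i)%N -> (vsize (vnat (\sum_(k < k) a i k)) <= (B i).+1)%N.
  by move=> Di le; apply: leq_trans (vsize_nat_le _) _; rewrite ltnS Sb.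
apply: (@comp_iter c n (fun i k => vnat (\sum_(k < k) a i k))) => //.
- by exists (fun i => (B i).+1) => //; apply: pbd_S.
- by apply: (comp_ext (ncomp_const 0 be)) => i _; rewrite big_ord0.
set A := addenv _.
have bA : @vbnd (ext n) (fun z => vnat (\sum_(k < z.2) a z.1 k)).
  by have [k1 Hk1] := pbd_S bB; exists k1 => z [Dz lt]; apply: leq_trans (Vb _ _ Dz (ltnW lt)) (Hk1 _ Dz).
have c1 : @comp A (fun z => vnat (\sum_(k < z.2) a z.1 k)).
  by apply: comp_added => //; apply: vbnd_ext_env.
have c2 : @comp A (fun z => vnat (a z.1 z.2)) by apply: comp_weak.
by apply: (comp_ext (ncompD c1 c2)) => z _; rewrite big_ord_recr.
Qed.

(** Iterating a computable operation on field elements needs no separate size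
    bound, because all elements have the same bit length. *)
Lemma ff_iter (c : ctx) (fi : ix c -> ffield) (n : ix c -> nat) (st : forall i, nat -> ffield_F (fi i)) :
  good fdesc fpw fi -> comp (fun i => vnat (n i)) -> nbnd n -> comp (fun i => ffield_enc (st i 0%N)) ->
  (forall (C : ctx) (pi : ix C -> ix c) (k : ix C -> nat), good fdesc fpw (fun z => fi (pi z)) ->
     (forall y, @comp c y -> comp (fun z => y (pi z))) ->
     comp (fun z => ffield_enc (st (pi z) (k z))) -> comp (fun z => ffield_enc (st (pi z) (k z).+1))) ->
  comp (fun i => ffield_enc (st i (n i))).
Proof.
move=> gd cn bn c0 H; have be := comp_env_bnd cn.
apply: (@comp_iter c n (fun i k => ffield_enc (st i k))) => //.
  exists (fun i => ffm (fi i) * (ffp (fi i)).+1 + 1)%N; first exact: ff_sizeb.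
  by move=> i k _ _; apply: ff_size.
set A := addenv _; have gX := good_ext gd bn.
have bA : @vbnd (ext n) (fun z => ffield_enc (st z.1 z.2)) by apply: (ff_vbnd gX).
apply: (H A (fun z => z.1) (fun z => z.2)).
- by split; [apply: comp_weak => //; case: gX | case: gX].
- by move=> y cy; apply: comp_weak => //; apply: comp_up.
- by apply: comp_added => //; apply: vbnd_ext_env.
Qed.

Lemma ff_mul c (fi : ix c -> ffield) (x y : forall i, ffield_F (fi i)) : good fdesc fpw fi ->
  comp (fun i => ffield_enc (x i)) -> comp (fun i => ffield_enc (y i)) -> comp (fun i => ffield_enc (x i * y i)).
Proof.
move=> gd cx cy; have be := comp_env_bnd cx.
have bm := ff_bm gd; have cm := ff_cm gd; have bp := ff_bp gd; have cp := ff_cp gd.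
have gX := good_ext gd bm; set X := ext _ in gX.
pose xt (z : ix X) : ffield_F (fi z.1) := ffth (fi z.1) ^+ z.2 * x z.1.
have cxt : @comp X (fun z => ffield_enc (xt z)).
  refine (@ff_iter X (fun z => fi z.1) (fun z => z.2) (fun z k => (ffth (fi z.1) ^+ k * x z.1 : ffield_F (fi z.1))) gX _ _ _ _).
  - by rewrite /X; cgo.
  - by rewrite /X; nauto.
  - by apply: (comp_ext (comp_up bm cx)) => z _; rewrite expr0 mul1r.
  move=> C pi k gC up ck; apply: (comp_ext (ff_theta gC ck)) => z _.
  by rewrite exprS mulrA.
have txt : comp (fun i => vtab (ffm (fi i)) (fun k => vtab (ffm (fi i)) (fun j => vnat (dig (@ffdig _) (ffth (fi i) ^+ k * x i) j)))).
  refine (@comp_tab c (fun i => ffm (fi i)) (fun i k => vtab (ffm (fi i)) (fun j => vnat (dig (@ffdig _) (ffth (fi i) ^+ k * x i) j))) cm bm _).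
  exact: (ff_tab cxt).
have ty := ff_tab cy.
apply: (@ff_mk c fi gd (fun i => x i * y i) (fun i j => (\sum_(k < ffm (fi i)) dig (@ffdig _) (y i) k *
   dig (@ffdig _) (ffth (fi i) ^+ k * x i)%R j) %% ffp (fi i))%N).
  by move=> i j _ lt; rewrite (digM (ffpb (fi i))).
apply: ncomp_mod; last by cgo.
set Y := ext _.
have c1 : @comp (@ext Y (fun z => ffm (fi z.1))) (fun z => vnat (dig (@ffdig _) (y z.1.1) z.2)).
  by rewrite /Y; tnth (fun z => ffm (fi z.1.1)) (fun z k => vnat (dig (@ffdig _) (y z.1.1) k)) (fun z => z.2); [cgo | cgo | dtac].
have c2 : @comp (@ext Y (fun z => ffm (fi z.1))) (fun z => vnat (dig (@ffdig _) (ffth (fi z.1.1) ^+ z.2 * x z.1.1)%R z.1.2)).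
  by rewrite /Y; tnth2 (fun z => ffm (fi z.1.1)) (fun z => ffm (fi z.1.1))
   (fun z k j => vnat (dig (@ffdig _) (ffth (fi z.1.1) ^+ k * x z.1.1)%R j)) (fun z => z.2) (fun z => z.1.2); [cgo | cgo | dtac | cgo | dtac].
apply: (@ncomp_sum Y (fun z => ffm (fi z.1)) (fun z k => dig (@ffdig _) (y z.1) k * dig (@ffdig _) (ffth (fi z.1) ^+ k * x z.1)%R z.2)%N).
- by rewrite /Y; cgo.
- by rewrite /Y; nauto.
- exact: ncompM.
set Z := ext _.
refine (@nbnd_le Z _ (fun z => ffp (fi z.1.1) * ffp (fi z.1.1))%N _ _); first by rewrite /Z /Y; nauto.
move=> z [[_ l1] l2] /=; apply: leq_mul; apply: ltnW; apply: (dig_lt (ffpb (fi z.1.1))) => //.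
Qed.

Lemma ff_consts : @consts_comp ffield ffield_F ffield_enc fdesc fpw.
Proof.
move=> c fi gd; have be := comp_env_bnd gd.1.
have bm := ff_bm gd; have cm := ff_cm gd; have bp := ff_bp gd; have cp := ff_cp gd.
split.
- apply: (@ff_mk c fi gd (fun i => 0) (fun _ _ => 0%N)); first by move=> i j _ lt; rewrite (dig0 (ffpb (fi i))).
  by cgo.
- apply: (@ff_mk c fi gd (fun i => 1) (fun _ j => (j == 0%N) : nat)); first by move=> i j _ lt; rewrite (dig1 (ffpb (fi i))).
  by cgo.
- apply: (@ff_mk c fi gd (fun i => -1) (fun i j => (ffp (fi i) - (j == 0%N)) %% ffp (fi i))%N).
    by move=> i j _ lt; rewrite (digN (ffpb (fi i))) // (dig1 (ffpb (fi i))).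
  by cgo.
Qed.

Lemma ff_pow c (fi : ix c -> ffield) (x : forall i, ffield_F (fi i)) (n : ix c -> nat) : good fdesc fpw fi ->
  comp (fun i => ffield_enc (x i)) -> comp (fun i => vnat (n i)) -> nbnd n -> comp (fun i => ffield_enc (x i ^+ n i)).
Proof.
move=> gd cx cn bn.
apply: (@ff_iter c fi n (fun i k => x i ^+ k)) => //.
  by case: (ff_consts gd).
move=> C pi k gC up ck; refine (@comp_ext C _ _ (ff_mul gC ck (up _ cx)) _) => z _.
by rewrite exprSr.
Qed.

Lemma ff_ops : @ops_comp ffield ffield_F ffield_enc fdesc fpw.
Proof.
move=> c fi x y gd cx cy; have be := comp_env_bnd gd.1.
have bm := ff_bm gd; have cm := ff_cm gd; have bp := ff_bp gd; have cp := ff_cp gd.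
have dx := ff_dig gd cx; have dy := ff_dig gd cy.
have cp' : @comp (ext (fun i => ffm (fi i))) (fun z => vnat (ffp (fi z.1))) by cgo.
have cz : comp (fun i => vnat (x i == 0)).
  refine (@comp_ext c (fun i => vnat (find (fun j => dig (@ffdig _) (x i) j != 0%N) (iota 0 (ffm (fi i))) == ffm (fi i))) _ _ _); last first.
    by move=> i _; rewrite (dig_eq0 (ffpb (fi i))).
  apply: bcomp_eq => //; refine (@ncomp_find c (fun i => ffm (fi i)) (fun i j => dig (@ffdig _) (x i) j != 0%N) cm bm _).
  by cgo.
split=> //.
- apply: (@ff_mk c fi gd (fun i => x i + y i) (fun i j => (dig (@ffdig _) (x i) j + dig (@ffdig _) (y i) j) %% ffp (fi i))%N).
    by move=> i j _ lt; rewrite (digD (ffpb (fi i))).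
  exact: (ncomp_mod (ncompD dx dy) cp').
- exact: ff_mul.
- apply: (@ff_mk c fi gd (fun i => - x i) (fun i j => (ffp (fi i) - dig (@ffdig _) (x i) j) %% ffp (fi i))%N).
    by move=> i j _ lt; rewrite (digN (ffpb (fi i))).
  exact: (ncomp_mod (ncompB cp' dx) cp').
have [H0 H1 _] := ff_consts gd.
have cw : comp (fun i => ffield_enc (x i ^+ (ffp (fi i) ^ (ffm (fi i) - 1) - 1))).
  apply: (@ff_iter c fi (fun i => ffm (fi i) - 1)%N (fun i k => x i ^+ (ffp (fi i) ^ k - 1))) => //.
  - by cgo.
  - by nauto.
  move=> C pi k gC up ck.
  have cpC : comp (fun z => vnat (ffp (fi (pi z)))) := ff_cp gC; have bpC := ff_bp gC.
  have beC := comp_env_bnd ck.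
  have c1 := ff_pow gC ck cpC bpC.
  have c2 := @ff_pow C _ (fun z => x (pi z)) (fun z => ffp (fi (pi z)) - 1)%N gC (up _ cx).
  refine (@comp_ext C _ _ (ff_mul gC c1 (c2 _ _)) _).
  - by cgo.
  - by nauto.
  move=> z _; rewrite -exprM -exprD; congr (ffield_enc (_ ^+ _)).
  have pp := pb_gt0 (ffpb (fi (pi z))).
  have : (ffp (fi (pi z)) <= ffp (fi (pi z)) ^ k z * ffp (fi (pi z)))%N by rewrite leq_pmull // expn_gt0 pp.
  rewrite expnSr mulnBl mul1n; lia.
have c2 : comp (fun i => ffield_enc (x i ^+ (ffp (fi i) - 2))).
  by apply: ff_pow => //; [cgo | nauto].
have c3 := ff_mul gd (ff_pow gd cw cp bp) c2.
apply: (comp_ext (comp_if cz (comp_when _ H0) (comp_when _ c3))) => i _.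
case: eqP => [->|/eqP ne]; first by rewrite invr0.
by rewrite (ff_inv (ffpb (fi i)) ne) -subn1.
Qed.

Lemma ff_sum_bnd : @sum_bnd ffield ffield_F ffield_enc fdesc fpw.
Proof.
move=> c fi n x gd bn _; have b1 : nbnd (fun i => (n i).+1) by nauto.
exact: (ff_vbnd (good_ext gd b1) (fun z => \sum_(k < z.2) x z.1 k)).
Qed.

Lemma ff_elim_bnd : @elim_bnd ffield ffield_F ffield_enc fdesc fpw.
Proof.
move=> c fi M n a gd bM bn _; set X := ext _.
have gX : good fdesc fpw (fun z : ix X => fi z.1.1.1) by rewrite /X; gauto.
exact: (ff_vbnd gX (fun z => elU (M z.1.1.1) (a z.1.1.1) z.1.1.2 z.1.2 z.2)).
Qed.

Lemma ff_divisor_bnd : @divisor_bnd ffield ffield_F ffield_enc fdesc fpw.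
Proof.
move=> c fi n x gd bn _ _; exists (fun i => ffm (fi i) * (ffp (fi i)).+1 + 1)%N; first exact: ff_sizeb.
by move=> i h j _ _ _; apply: ff_size.
Qed.

Lemma ff_solver : @solver_comp ffield ffield_F ffield_enc fdesc fpw (fun phi => @elsolve (ffield_F phi)).
Proof. exact: (elsolve_comp ff_ops ff_consts ff_sum_bnd ff_elim_bnd). Qed.

(** * Finding a root through its traces *)

Section TraceSearch.
Variables (F : fieldType) (p m n : nat) (theta : F) (c : nat -> F).

Definition comx i l : F := if i.+1 == n then c l else if l == i.+1 then 1 else 0.

(** [xpow e] lists the coefficients of [X^e] modulo [chi_poly n c], [xfrob i]
    those of [X^(p^i)], [xtr j] those of the trace of [theta^j X]; [xtrmx j] is
    the matrix of multiplication by the latter. *)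
Definition xpow e i : F := kry n comx (fun l => if l == 0%N then 1 else 0) e i.

Fixpoint xfrob i : nat -> F :=
  if i is i'.+1 then fun b => \sum_(l < n) xfrob i' l ^+ p * xpow (p * l) b else xpow 1.

Definition xtr j b : F := \sum_(i < m) (theta ^+ j) ^+ (p ^ i) * xfrob i b.

Definition xtrmx j i l : F := \sum_(b < n) xtr j b * xpow (b + l) i.

(** For a root [la] the vector of powers [la ^+ i] is a left eigenvector of each [xtrmx j], with
    eigenvalue the trace of [theta ^+ j * la]. Placing the blocks [xtrmx j] minus the scalar [s j]
    side by side makes it a kernel vector iff these traces are the prescribed ones. *)
Definition trow (s : nat -> nat) i q : F :=
  xtrmx (q %/ n) i (q %% n) - (s (q %/ n)%N)%:R * (if i == (q %% n)%N then 1 else 0).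

(** The pivot is sought at position 0 because vectors of powers have entry 1 there. *)
Definition ttest s J : bool := isSome (kersol (@elsolve F) n (J * n) (trow s) 0).

Definition tset (s : nat -> nat) J a j : nat := if j == J then a else s j.

(** The traces lie in the prime field, so each is found among [p] candidates; fixing one after the
    other takes at most [m * p] tests instead of [p ^ m]. *)
Fixpoint tdig J : nat -> nat :=
  if J is J'.+1 then tset (tdig J') J' (find (fun a => ttest (tset (tdig J') J' a) J'.+1) (iota 0 p))
  else fun=> 0%N.

(** Once all traces are fixed a single root is left, and the kernel vector with entry 1 at position
    0 is its vector of powers. Pairing it with [xpow 1] reads off the root also for [n = 1], where
    the vector has no entry of index 1. *)
Definition troot : F := \sum_(i < n) kervec (@elsolve F) n (m * n) (trow (tdig m)) 0 i * xpow 1 i.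

Lemma tdig_le J j : (tdig J j <= p)%N.
Proof.
elim: J j => // J IH j /=; rewrite /tset; case: eqP => // _.
by apply: leq_trans (find_size _ _) _; rewrite size_iota.
Qed.

Section Eval.
Hypotheses (n0 : (0 < n)%N) (chp : p \in [pchar F]).
Variable la : F.
Hypothesis rt : root (chi_poly n c) la.

Let E : la ^+ n = \sum_(k < n) c k * la ^+ k.
Proof. by move: rt; rewrite /root /chi_poly hornerD hornerN hornerXn horner_poly subr_eq0 => /eqP. Qed.

Let ev (f : nat -> F) := \sum_(i < n) f i * la ^+ i.

(** Reduction modulo [chi_poly n c] does not change the value at a root. *)
Lemma ev_xpow e : ev (xpow e) = la ^+ e.
Proof.
elim: e => [|e IH].
  rewrite /ev /xpow /= expr0; case: (n) n0 => // k _.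
  by rewrite big_ord_recl /= expr0 mulr1 big1 ?addr0 // => i _; rewrite mul0r.
rewrite /ev /xpow; under eq_bigr => l _ do rewrite kryS mulr_suml.
rewrite exchange_big exprSr -IH /ev mulr_suml /=; apply: eq_bigr => i _.
under eq_bigr => l _ do rewrite -mulrA.
rewrite -mulr_sumr -mulrA -exprSr -/(xpow e i); congr (_ * _); rewrite /comx.
case: eqP => [->|ne]; first by rewrite E.
have lt : (i.+1 < n)%N by rewrite ltn_neqAle ltn_ord andbT; apply/eqP.
rewrite -[RHS](@sum_delta _ n i.+1 (la ^+ i.+1)) //; apply: eq_bigr => l _.
by case: eqP => [->|_]; rewrite ?mul1r ?mul0r.
Qed.

Lemma frob_sum k (a : nat -> F) : (\sum_(i < k) a i) ^+ p = \sum_(i < k) a i ^+ p.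
Proof.
rewrite -(pFrobenius_autE chp) rmorph_sum; apply: eq_bigr => i _.
exact: pFrobenius_autE.
Qed.

Lemma ev_xfrob i : ev (xfrob i) = la ^+ (p ^ i).
Proof.
elim: i => [|i IH]; first by rewrite expn0; apply: ev_xpow.
rewrite /ev /=; under eq_bigr => b _ do rewrite mulr_suml.
rewrite exchange_big expnSr exprM -IH /ev /=.
rewrite (frob_sum n (fun i0 => xfrob i i0 * la ^+ i0)); apply: eq_bigr => l _.
under eq_bigr => b _ do rewrite -mulrA.
rewrite -mulr_sumr -/(ev (xpow (p * l))) ev_xpow exprMn; congr (_ * _).
by rewrite mulnC exprM.
Qed.

Definition trace j : F := \sum_(i < m) (theta ^+ j * la) ^+ (p ^ i).

Lemma ev_xtr j : ev (xtr j) = trace j.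
Proof.
rewrite /ev /xtr; under eq_bigr => b _ do rewrite mulr_suml.
rewrite exchange_big /=; apply: eq_bigr => i _.
under eq_bigr => b _ do rewrite -mulrA.
by rewrite -mulr_sumr -/(ev (xfrob i)) ev_xfrob exprMn.
Qed.

Lemma ev_xtrmx j l : \sum_(i < n) la ^+ i * xtrmx j i l = la ^+ l * trace j.
Proof.
rewrite /xtrmx; under eq_bigr => i _ do rewrite mulr_sumr.
rewrite exchange_big -ev_xtr /ev mulr_sumr /=; apply: eq_bigr => b _.
transitivity (xtr j b * ev (xpow (b + l))); last by rewrite ev_xpow exprD mulrA mulrC.
by rewrite /ev mulr_sumr; apply: eq_bigr => i _; rewrite mulrCA [la ^+ i * _]mulrC.
Qed.

Lemma ev_trow s q : \sum_(i < n) la ^+ i * trow s i q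
  = la ^+ (q %% n) * (trace (q %/ n) - (s (q %/ n)%N)%:R).
Proof.
rewrite /trow; under eq_bigr => i _ do rewrite mulrBr.
rewrite sumrB ev_xtrmx mulrBr; congr (_ - _).
have lt : (q %% n < n)%N by rewrite ltn_mod.
rewrite -[RHS](@sum_delta _ n (q %% n)%N) //; apply: eq_bigr => i _.
by case: eqP => [->|_]; rewrite ?mulr1 ?mulr0.
Qed.

End Eval.

End TraceSearch.

Section TraceFacts.
Variables (F : finFieldType) (p m : nat) (theta : F) (digits : F -> seq nat).
Hypothesis pb : power_basis p m theta digits.
Local Notation tr := (trace p m theta).
Let chp := pbchar pb.

(** The [p] elements of the prime field already exhaust the roots of ['X^p - 'X]. *)
Lemma frob_fix (y : F) : y ^+ p = y -> exists2 a, (a < p)%N & y = a%:R.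
Proof.
move=> yp; have p1 := prime_gt1 (pb_prime pb).
pose P : {poly F} := 'X^p - 'X.
have szP : size P = p.+1 by rewrite size_polyDl ?size_polyXn // size_polyN size_polyX ltnS.
have P0 : P != 0 by rewrite -size_poly_eq0 szP.
have rP z : z ^+ p = z -> root P z by move=> zp; rewrite /root hornerD hornerN hornerXn hornerX zp subrr.
have un : uniq (mkseq (fun a => a%:R : F) p).
  apply/mkseq_uniqP => a b; rewrite !inE.
  have W a' b' : (b' < p)%N -> a'%:R = b'%:R :> F -> (b' <= a')%N.
    move=> lb e; rewrite leqNgt; apply/negP => lt.
    have : (p %| b' - a')%N by rewrite (dvdn_pcharf chp) natrB ?(ltnW lt) // e subrr.
    by move/dvdn_leq; rewrite subn_gt0 => /(_ lt); lia.
  by move=> la lb e; apply: anti_leq; rewrite W // W.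
have [yin|ynin] := boolP (y \in mkseq (fun a => a%:R : F) p).
  by case/mapP: yin => a; rewrite mem_iota /= add0n => lt ->; exists a.
have := @max_poly_roots _ P (y :: mkseq (fun a => a%:R) p) P0.
rewrite /= ynin un rP //= szP size_mkseq ltnn => /(_ _ isT) H; exfalso; suff: false by [].
apply: H; apply/allP => z /mapP[a _ ->]; apply: rP.
by rewrite -(pFrobenius_autE chp) pFrobenius_aut_nat.
Qed.

Lemma trace_nat j la : exists2 a, (a < p)%N & tr la j = a%:R.
Proof.
apply: frob_fix; rewrite /trace; set y := theta ^+ j * la.
rewrite (frob_sum chp m (fun i => y ^+ (p ^ i))).
have E i : (y ^+ (p ^ i)) ^+ p = y ^+ (p ^ i.+1) by rewrite -exprM -expnSr.
under eq_bigr => i _ do rewrite E.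
have yq : y ^+ (p ^ m) = y by rewrite -(ff_card pb) expf_card.
have := pb_m_gt0 pb; case: (m) yq => // k yq _.
by rewrite big_ord_recr [RHS]big_ord_recl /= yq expn0 expr1 addrC.
Qed.

Lemma frob_pow (a : nat) i : (a%:R : F) ^+ (p ^ i) = a%:R.
Proof.
elim: i => [|i IH]; first by rewrite expr1.
by rewrite expnSr exprM IH -(pFrobenius_autE chp) pFrobenius_aut_nat.
Qed.

Lemma frobX_sum k i (a : nat -> F) : (\sum_(j < k) a j) ^+ (p ^ i) = \sum_(j < k) a j ^+ (p ^ i).
Proof.
elim: i => [|i IH]; first by rewrite expn0 expr1; apply: eq_bigr => j _.
rewrite expnSr exprM IH (frob_sum chp k (fun j => a j ^+ (p ^ i))); apply: eq_bigr => j _.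
by rewrite exprM.
Qed.

Lemma frobXB i (x y : F) : (x - y) ^+ (p ^ i) = x ^+ (p ^ i) - y ^+ (p ^ i).
Proof.
elim: i => [|i IH]; first by rewrite expn0 !expr1.
by rewrite expnSr !exprM IH -!(pFrobenius_autE chp) rmorphB.
Qed.

(** If a nonzero [y] had zero trace against the whole power basis, the trace would vanish on all of
    [F]; but it is a nonzero polynomial of degree at most [p ^ m.-1], too small for [p ^ m]
    roots. *)
Lemma trace_inj la mu : (forall j, (j < m)%N -> tr la j = tr mu j) -> la = mu.
Proof.
move=> H; apply/eqP; rewrite -subr_eq0; apply: contraT => y0; set y := la - mu in y0.
have ty j : (j < m)%N -> tr y j = 0.
  move=> lt; rewrite /trace -[RHS](subrr (tr la j)) {2}(H j lt) /trace -sumrB; apply: eq_bigr => i _.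
  by rewrite -frobXB -mulrBr.
have tz z : \sum_(i < m) z ^+ (p ^ i) = 0 :> F.
  have -> : z = (z / y) * y by rewrite mulfVK.
  rewrite (digE pb (z / y)); set d := dig digits (z / y).
  transitivity (\sum_(j < m) (d j)%:R * tr y j); last by rewrite big1 // => j _; rewrite ty // mulr0.
  under [RHS]eq_bigr => j _ do rewrite /trace mulr_sumr.
  rewrite exchange_big /=; apply: eq_bigr => i _.
  rewrite mulr_suml (frobX_sum m i (fun j => (d j)%:R * theta ^+ j * y)); apply: eq_bigr => j _.
  by rewrite -mulrA exprMn frob_pow.
pose P : {poly F} := \sum_(i < m) 'X^(p ^ i).
have p1 := prime_gt1 (pb_prime pb); have mp := prednK (pb_m_gt0 pb).
have szP : (size P <= (p ^ m.-1).+1)%N.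
  apply: size_sum_le => i _; rewrite size_polyXn ltnS.
  by apply: leq_pexp2l; [exact: (pb_gt0 pb) | rewrite -ltnS mp].
have P0 : P != 0.
  apply/eqP => P0; have : P`_1 = 0 by rewrite P0 coef0.
  rewrite /P coef_sum -mp big_ord_recl /= expn0 coefX /= big1 ?addr0; first by move/eqP; rewrite oner_eq0.
  move=> i _; rewrite coefXn; have -> // : (1 == p ^ bump 0 i)%N = false.
  by apply/negbTE; rewrite ltn_eqF // -(expn0 p) ltn_exp2l.
have := @max_poly_roots _ P (enum F) P0 _ (enum_uniq _).
rewrite -cardE (ff_card pb) => H1.
have : (p ^ m < size P)%N.
  apply: H1; apply/allP => z _; rewrite /root /P horner_sum; apply/eqP; rewrite -[RHS](tz z).
  by apply: eq_bigr => i _; rewrite hornerXn.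
move=> h; have := leq_trans h szP; rewrite ltnS -{1}mp leq_exp2l // ltnn //.
Qed.

Section Search.
Variables (n : nat) (c l : nat -> F).
Hypotheses (n0 : (0 < n)%N) (El : chi_poly n c = \prod_(i < n) ('X - (l i)%:P))
  (linj : forall i j, (i < n)%N -> (j < n)%N -> l i = l j -> i = j).

Let rtl (k : 'I_n) : root (chi_poly n c) (l k).
Proof.
rewrite El -(big_mkseq_ord _ l n (fun y => 'X - y%:P)) root_prod_XsubC.
by apply/mapP; exists (k : nat); rewrite // mem_iota /= ltn_ord.
Qed.

Let V : 'M[F]_n := \matrix_(i, k) l k ^+ i.

Let Vu : V \in unitmx.
Proof.
have -> : V = Vandermonde n (\row_k l k) by apply/matrixP => i k; rewrite !mxE.
rewrite unitmxE det_Vandermonde unitfE; apply/prodf_neq0 => i _; apply/prodf_neq0 => j lt.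
rewrite !mxE subr_eq0; apply/eqP => e; have := linj (ltn_ord j) (ltn_ord i) e => ji.
by rewrite ji ltnn in lt.
Qed.

Local Notation row := (trow p m n theta c).

(** The vectors of powers of the [n] distinct roots form a basis, by Vandermonde, on which each
    block acts diagonally; a kernel vector is supported on the roots with the prescribed traces. *)
Lemma trow_kernel s J (v : nat -> F) : (forall q, (q < J * n)%N -> \sum_(i < n) v i * row s i q = 0) ->
  exists w : 'I_n -> F, (forall i, (i < n)%N -> v i = \sum_k w k * l k ^+ i) /\
    forall k j, (j < J)%N -> w k * (tr (l k) j - (s j)%:R) = 0.
Proof.
move=> Hv; pose W := invmx V *m \col_i v (i : 'I_n).
have vE : V *m W = \col_i v (i : 'I_n) by rewrite mulKVmx.
have vE' i : (i < n)%N -> v i = \sum_k W k 0 * l k ^+ i.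
  move=> lt; have := congr1 (fun M : 'cV_n => M (Ordinal lt) 0) vE; rewrite !mxE => <-.
  by apply: eq_bigr => k _; rewrite !mxE mulrC.
exists (fun k => W k 0); split=> // k j lt.
pose u : 'cV[F]_n := \col_k (W k 0 * (tr (l k) j - (s j)%:R)).
suff u0 : u = 0 by have := congr1 (fun M : 'cV_n => M k 0) u0; rewrite !mxE.
suff : V *m u = 0 by move/(congr1 (mulmx (invmx V))); rewrite mulKmx // mulmx0.
apply/colP => i; rewrite !mxE.
have ltq : (j * n + i < J * n)%N.
  by apply: (@leq_trans (j.+1 * n)%N); [rewrite mulSnr ltn_add2l | rewrite leq_mul2r lt orbT].
rewrite -[RHS](Hv _ ltq).
transitivity (\sum_(k < n) \sum_(i' < n) W k 0 * l k ^+ i' * row s i' (j * n + i)).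
  apply: eq_bigr => k' _; under [RHS]eq_bigr => i' _ do rewrite -mulrA.
  rewrite -mulr_sumr (ev_trow m theta n0 chp (rtl k')) !mxE.
  have -> : ((j * n + i) %% n = i)%N by rewrite modnMDl modn_small.
  have -> : ((j * n + i) %/ n = j)%N by rewrite divnMDl // divn_small // addn0.
  by rewrite mulrCA.
rewrite exchange_big; apply: eq_bigr => i' _; rewrite vE' // mulr_suml.
by [].
Qed.

Let rowker s J (k : 'I_n) : (forall j, (j < J)%N -> tr (l k) j = (s j)%:R) ->
  forall q, (q < J * n)%N -> \sum_(i < n) l k ^+ i * row s i q = 0.
Proof.
move=> H q lt; rewrite (ev_trow m theta n0 chp (rtl k)) H ?subrr ?mulr0 //.
by rewrite ltn_divLR.
Qed.

Let ksome s J (k : 'I_n) : (forall j, (j < J)%N -> tr (l k) j = (s j)%:R) ->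
  kersol (@elsolve F) n (J * n) (row s) 0.
Proof.
move=> /rowker H; apply: (kersol_some (@elsolve_spec F) (x := fun i => l k ^+ i)) => //.
by rewrite expr0 oner_eq0.
Qed.

Let kv0 s J : kersol (@elsolve F) n (J * n) (row s) 0 -> kervec (@elsolve F) n (J * n) (row s) 0 0 = 1.
Proof. by rewrite /kervec; case: kersol. Qed.

Let kker s J q : (q < J * n)%N -> \sum_(i < n) kervec (@elsolve F) n (J * n) (row s) 0 i * row s i q = 0.
Proof. by move=> lt; apply: kervec_ker => //; apply: elsolve_spec. Qed.

(** A kernel vector with entry 1 at position 0 is nonzero, so some root carries weight; conversely,
    the powers of a suitable root give such a vector. *)
Lemma ttestP s J : reflect (exists k : 'I_n, forall j, (j < J)%N -> tr (l k) j = (s j)%:R)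
  (ttest p m n theta c s J).
Proof.
apply: (iffP idP) => [t|[k H]]; last exact: ksome H.
have [w [wE wk]] := @trow_kernel s J _ (kker s (J := J)).
have [k wk0] : exists k, w k != 0.
  apply: NNPP => nex; have := wE 0%N n0; rewrite (kv0 t) big1 => [/eqP|k _]; first by rewrite oner_eq0.
  have /eqP -> : w k == 0 by apply: contraT => ne; case: nex; exists k.
  by rewrite mul0r.
exists k => j lt; have /eqP := wk k j lt; rewrite mulf_eq0 (negbTE wk0) subr_eq0 /=.
by move/eqP.
Qed.

Lemma tdigP J : exists k : 'I_n, forall j, (j < J)%N -> tr (l k) j = (tdig p m n theta c J j)%:R.
Proof.
elim: J => [|J [k IH]]; first by exists (Ordinal n0).
have [a ltp ta] := trace_nat J (l k); rewrite /=.
pose t a := ttest p m n theta c (tset (tdig p m n theta c J) J a) J.+1.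
set a' := find _ _.
have ht : has t (iota 0 p).
  apply/hasP; exists a; first by rewrite mem_iota.
  apply/ttestP; exists k => j; rewrite ltnS leq_eqVlt /tset => /orP[/eqP ->|lt]; first by rewrite eqxx.
  by rewrite (ltn_eqF lt) IH.
have := nth_find 0%N ht; rewrite nth_iota -/a' -/t; last by move: ht; rewrite has_find size_iota.
by rewrite add0n => /ttestP.
Qed.

Lemma troot_root : root (chi_poly n c) (troot p m n theta c).
Proof.
have [k0 Hk0] := tdigP m; rewrite /troot; set s := tdig _ _ _ _ _ _ in Hk0 *.
have t := ksome Hk0.
have [w [wE wk]] := @trow_kernel s m _ (kker s (J := m)).
have w0 k : k != k0 -> w k = 0.
  move=> ne; apply/eqP; apply: contraT => wk0; case/eqP: ne; apply/val_inj/(linj (ltn_ord k) (ltn_ord k0)).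
  apply: trace_inj => j lt; rewrite Hk0 //.
  by have /eqP := wk k j lt; rewrite mulf_eq0 (negbTE wk0) subr_eq0 => /eqP.
have wE' i : (i < n)%N -> kervec (@elsolve F) n (m * n) (row s) 0 i = w k0 * l k0 ^+ i.
  move=> lt; rewrite wE // (bigD1 k0) //= big1 ?addr0 // => k ne.
  by rewrite w0 // mul0r.
have w1 : w k0 = 1 by have := wE' 0%N n0; rewrite (kv0 t) expr0 mulr1.
have -> : \sum_(i < n) kervec (@elsolve F) n (m * n) (row s) 0 i * xpow n c 1 i = l k0.
  rewrite -[RHS]expr1 -(ev_xpow n0 (rtl k0)); apply: eq_bigr => i _.
  by rewrite wE' // w1 mul1r mulrC.
exact: rtl.
Qed.

End Search.

End TraceFacts.

Local Notation hslv := (fun phi => @elsolve (ffield_F phi)).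
Local Notation hslvP := (fun phi => @elsolve_spec (ffield_F phi)).

Lemma good_addenv Phi desc pw c (fi : ix c -> Phi) x : good desc pw fi -> vbnd x ->
  @good Phi desc pw (addenv x) fi.
Proof. by case=> g1 g2 bx; split=> //; apply: comp_weak. Qed.

Ltac hgood := repeat first
  [ assumption
  | match goal with
    | |- @good ?Phi ?desc ?pw (@ext ?c ?n) ?f =>
        let f' := eval cbn beta iota delta [fst snd] in
          (fun (i : ix c) (k : nat) => f ((i, k) : ix (@ext c n))) in
        lazymatch f' with (fun i _ => @?w i) =>
          refine (@good_ext Phi desc pw c w n _ _); [ | solve [nauto] ] end
    | |- @good ?Phi ?desc ?pw (@when ?c ?P) ?f => refine (@good_when Phi desc pw c f P _)
    | |- @good ?Phi ?desc ?pw (@addenv ?c ?x) ?f => refine (@good_addenv Phi desc pw c f x _ _)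
    end ].

Ltac hstep := match goal with
  | |- @comp ?C (fun z => @ffield_enc (@?f z) (GRing.mul (@?x z) (@?y z))) =>
     refine (@ff_mul C f x y _ _ _); [ solve [hgood] | | ]
  | |- @comp ?C (fun z => @ffield_enc (@?f z) (GRing.add (@?x z) (@?y z))) =>
     refine (@oadd ffield ffield_F ffield_enc fdesc fpw ff_ops C f x y _ _ _); [ solve [hgood] | | ]
  | |- @comp ?C (fun z => @ffield_enc (@?f z) (GRing.opp (@?x z))) =>
     refine (@oopp ffield ffield_F ffield_enc fdesc fpw ff_ops C f x _ _); [ solve [hgood] | ]
  | |- @comp ?C (fun z => @ffield_enc (@?f z) (GRing.exp (@?x z) (@?j z))) =>
     refine (@ff_pow C f x j _ _ _ _); [ solve [hgood] | | | solve [nauto] ]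
  | |- @comp ?C (fun z => @ffield_enc (@?f z) (GRing.natmul (GRing.one _) (@?j z))) =>
     refine (@fnat ffield ffield_F ffield_enc fdesc fpw hslv hslvP ff_solver ff_consts C f _ j _ _);
       [ solve [hgood] | | solve [nauto] ]
  end.

Ltac hgo := repeat first [ assumption | cif | hstep | cstep | solve [cleaf] ].

Tactic Notation "htab" := match goal with
  | |- @comp ?C (fun i => vtab (@?n i) (@?x i)) => refine (@comp_tab C n x _ _ _);
     [ by hgo | by nauto | cbv beta ]
  end.

Tactic Notation "hdot" uconstr(f) uconstr(n) uconstr(x) uconstr(y) := match goal with
  |- @comp ?C _ => refine (@fdot ffield ffield_F ffield_enc fdesc fpw hslv hslvP ff_solver ff_consts C f _ n x y _ _ _ _);
    [ by hgood | by hgo | by nauto | | ]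
  end.

Section TraceComp.
Variables (c : ctx) (fi : ix c -> ffield) (n : ix c -> nat) (x : forall i, nat -> ffield_F (fi i)).
Hypotheses (gd : good fdesc fpw fi) (cn : comp (fun i => vnat (n i))) (bn : nbnd n).
Hypothesis n_gt0 : forall i, dom i -> (0 < n i)%N.
Local Notation p i := (ffp (fi i)).
Local Notation m i := (ffm (fi i)).
Local Notation th i := (ffth (fi i) : ffield_F (fi i)).

Let be : vbnd (@env c). Proof. exact: (comp_env_bnd gd.1). Qed.
Let H0 : comp (fun i => ffield_enc (0 : ffield_F (fi i))). Proof. by case: (ff_consts gd). Qed.
Let H1 : comp (fun i => ffield_enc (1 : ffield_F (fi i))). Proof. by case: (ff_consts gd). Qed.
Let cp : comp (fun i => vnat (p i)). Proof. exact: ff_cp. Qed.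
Let bp : nbnd (fun i => p i). Proof. exact: ff_bp. Qed.
Let cm : comp (fun i => vnat (m i)). Proof. exact: ff_cm. Qed.
Let bm : nbnd (fun i => m i). Proof. exact: ff_bm. Qed.

Local Notation rw i s := (trow (p i) (m i) (n i) (th i) (x i) s).
Local Notation tmx i := (xtrmx (p i) (m i) (n i) (th i) (x i)).

Lemma tab_trow (J : ix c -> nat) (s : ix c -> nat -> nat) :
  comp (fun i => vtab (m i) (fun j => vtab (n i) (fun k => vtab (n i) (fun l => ffield_enc (tmx i j k l))))) ->
  comp (fun i => vnat (J i)) -> nbnd J -> (forall i, dom i -> (J i <= m i)%N) ->
  comp (fun i => vtab (J i) (fun j => vnat (s i j))) ->
  (forall i j, dom i -> (j < J i)%N -> (s i j <= p i)%N) ->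
  comp (fun i => vtab (n i) (fun k => vtab (J i * n i) (fun q => ffield_enc (rw i (s i) k q)))).
Proof.
move=> tT cJ bJ leJ ts sle; htab; htab; set X := ext _.
have dv (z : ix X) : @dom X z -> (z.2 %/ n z.1.1 < J z.1.1)%N.
  by case=> [[Dz _] lt]; rewrite ltn_divLR // n_gt0.
have cq : @comp X (fun z => vnat (z.2 %/ n z.1.1)) by rewrite /X; hgo.
have cr : @comp X (fun z => vnat (z.2 %% n z.1.1)) by rewrite /X; hgo.
have cs : @comp X (fun z => vnat (s z.1.1 (z.2 %/ n z.1.1)%N)).
  refine (@comp_tabnth X (fun z => J z.1.1) (fun z j => vnat (s z.1.1 j)) (fun z => z.2 %/ n z.1.1)%N _ cq dv).
  by rewrite /X; hgo.
have bs : @nbnd X (fun z => s z.1.1 (z.2 %/ n z.1.1)%N).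
  refine (@nbnd_le X _ (fun z => p z.1.1) _ _); first by rewrite /X; nauto.
  by move=> z Dz; apply: sle; [case: Dz => [[]] | apply: dv].
have gX : good fdesc fpw (fun z : ix X => fi z.1.1) by rewrite /X; hgood.
have c1 : @comp X (fun z => ffield_enc (tmx z.1.1 (z.2 %/ n z.1.1)%N z.1.2 (z.2 %% n z.1.1)%N)).
  rewrite /X; tnth3 (fun z => m z.1.1) (fun z => n z.1.1) (fun z => n z.1.1)
    (fun z j k l => ffield_enc (tmx z.1.1 j k l)) (fun z => z.2 %/ n z.1.1)%N (fun z => z.1.2) (fun z => z.2 %% n z.1.1)%N;
    [by hgo | by hgo | | by hgo | by dtac | by hgo | ].
    by move=> z Dz; apply: leq_trans (dv z Dz) _; apply: leJ; case: Dz => [[]].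
  by move=> z [[Dz _] _]; rewrite ltn_mod n_gt0.
have c2 : @comp X (fun z => ffield_enc ((s z.1.1 (z.2 %/ n z.1.1)%N)%:R : ffield_F (fi z.1.1))).
  exact: (@fnat ffield ffield_F ffield_enc fdesc fpw hslv hslvP ff_solver ff_consts X _ gX _ cs bs).
have c3 : @comp X (fun z => ffield_enc (if z.1.2 == (z.2 %% n z.1.1)%N then 1 else 0 : ffield_F (fi z.1.1))).
  refine (@comp_ext X (fun z => vif (z.1.2 == (z.2 %% n z.1.1)%N) (ffield_enc (1 : ffield_F (fi z.1.1))) (ffield_enc (0 : ffield_F (fi z.1.1)))) _ _ _).
    by rewrite /X; hgo.
  by move=> z _; rewrite /vif; case: ifP.
have c4 := @oopp ffield ffield_F ffield_enc fdesc fpw ff_ops X _ _ gX (ff_mul gX c2 c3).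
exact: (@oadd ffield ffield_F ffield_enc fdesc fpw ff_ops X _ _ _ gX c1 c4).
Qed.

Lemma comp_ttest (J : ix c -> nat) (s : ix c -> nat -> nat) :
  comp (fun i => vtab (m i) (fun j => vtab (n i) (fun k => vtab (n i) (fun l => ffield_enc (tmx i j k l))))) ->
  comp (fun i => vnat (J i)) -> nbnd J -> (forall i, dom i -> (J i <= m i)%N) ->
  comp (fun i => vtab (J i) (fun j => vnat (s i j))) ->
  (forall i j, dom i -> (j < J i)%N -> (s i j <= p i)%N) ->
  comp (fun i => vnat (ttest (p i) (m i) (n i) (th i) (x i) (s i) (J i))).
Proof.
move=> tT cJ bJ leJ ts sle; have tr := tab_trow tT cJ bJ leJ ts sle.
refine (@fkersol ffield ffield_F ffield_enc fdesc fpw hslv ff_solver c fi gd n (fun i => J i * n i)%N (fun=> 0%N)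
  (fun i => rw i (s i)) cn bn _ _ _ n_gt0 tr).
- by hgo.
- by nauto.
- by hgo.
Qed.

(** Covers all exponents at which [xpow] is used: [p * l] for the Frobenius map, [b + l] in the
    multiplication matrix, and 1. *)
Definition xlen i := (p i * n i + n i + n i).+2.

Lemma xfrob_step (y : forall i, nat -> ffield_F (fi i)) :
  comp (fun i => vtab (xlen i) (fun e => vtab (n i) (fun l => ffield_enc (xpow (n i) (x i) e l)))) ->
  comp (fun i => vtab (n i) (fun b => ffield_enc (y i b))) ->
  comp (fun i => vtab (n i) (fun b => ffield_enc (\sum_(l < n i) y i l ^+ p i * xpow (n i) (x i) (p i * l) b))).
Proof.
move=> tX ty; htab.
hdot (fun z => fi z.1) (fun z => n z.1) (fun z l => y z.1 l ^+ p z.1)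
   (fun z l => xpow (n z.1) (x z.1) (p z.1 * l)%N z.2).
  hgo; by tnth (fun z => n z.1.1) (fun z k => ffield_enc (y z.1.1 k)) (fun z => z.2); [hgo | hgo | dtac].
tnth2 (fun z => xlen z.1.1) (fun z => n z.1.1) (fun z e l => ffield_enc (xpow (n z.1.1) (x z.1.1) e l))
  (fun z => p z.1.1 * z.2)%N (fun z => z.1.2); [by hgo | by hgo | | by hgo | by dtac].
move=> z [_ /ltnW lt]; rewrite /xlen ltnS; apply: leqW; rewrite -addnA; apply: leq_trans (leq_addr _ _).
by rewrite leq_mul2l lt orbT.
Qed.

End TraceComp.

Section TraceRoot.
Variables (c : ctx) (fi : ix c -> ffield) (n : ix c -> nat) (x : forall i, nat -> ffield_F (fi i)).
Hypotheses (gd : good fdesc fpw fi) (cn : comp (fun i => vnat (n i))) (bn : nbnd n).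
Hypothesis n_gt0 : forall i, dom i -> (0 < n i)%N.
Hypothesis tx : comp (fun i => vtab (n i) (fun k => ffield_enc (x i k))).
Local Notation p i := (ffp (fi i)).
Local Notation m i := (ffm (fi i)).
Local Notation th i := (ffth (fi i) : ffield_F (fi i)).

Let be : vbnd (@env c). Proof. exact: (comp_env_bnd gd.1). Qed.
Let H0 : comp (fun i => ffield_enc (0 : ffield_F (fi i))). Proof. by case: (ff_consts gd). Qed.
Let H1 : comp (fun i => ffield_enc (1 : ffield_F (fi i))). Proof. by case: (ff_consts gd). Qed.
Let cp : comp (fun i => vnat (p i)). Proof. exact: ff_cp. Qed.
Let bp : nbnd (fun i => p i). Proof. exact: ff_bp. Qed.
Let cm : comp (fun i => vnat (m i)). Proof. exact: ff_cm. Qed.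
Let bm : nbnd (fun i => m i). Proof. exact: ff_bm. Qed.

Local Notation N i := (xlen fi n i).
Let cN : comp (fun i => vnat (N i)). Proof. by rewrite /xlen; hgo. Qed.
Let bN : nbnd (fun i => N i). Proof. by rewrite /xlen; nauto. Qed.

Lemma tab_xpow : comp (fun i => vtab (N i) (fun e => vtab (n i) (fun l => ffield_enc (xpow (n i) (x i) e l)))).
Proof.
htab; htab; set X := ext _.
refine (@fkry ffield ffield_F ffield_enc fdesc fpw hslv hslvP ff_solver ff_consts X (fun z => fi z.1.1) _
  (fun z => n z.1.1) (fun z => z.1.2) (fun z => z.2) (fun z => comx (n z.1.1) (x z.1.1))
  (fun z l => if l == 0%N then 1 else 0) _ _ _ _ _ _ _ _); rewrite /X.
- by hgood.
- by hgo.
- by nauto.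
- by hgo.
- by nauto.
- by hgo.
- by dtac.
- set Y := ext _.
  refine (@comp_ext Y (fun z => vif (z.1.2.+1 == n z.1.1.1.1) (ffield_enc (x z.1.1.1.1 z.2))
    (vif (z.2 == z.1.2.+1) (ffield_enc (1 : ffield_F (fi z.1.1.1.1))) (ffield_enc (0 : ffield_F (fi z.1.1.1.1))))) _ _ _); last first.
    by move=> z _; rewrite /vif /comx; case: ifP => // _; case: ifP.
  rewrite /Y; hgo.
  by tnth (fun z => n z.1.1.1.1) (fun z k => ffield_enc (x z.1.1.1.1 k)) (fun z => z.2); [hgo | hgo | dtac].
- set Y := ext _.
  refine (@comp_ext Y (fun z => vif (z.2 == 0%N) (ffield_enc (1 : ffield_F (fi z.1.1.1))) (ffield_enc (0 : ffield_F (fi z.1.1.1)))) _ _ _).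
    by rewrite /Y; hgo.
  by move=> z _; rewrite /vif; case: ifP.
Qed.

Let xp (C : ctx) (pi : ix C -> ix c) (kx lx : ix C -> nat) :
  comp (fun z => vtab (N (pi z)) (fun e => vtab (n (pi z)) (fun l => ffield_enc (xpow (n (pi z)) (x (pi z)) e l)))) ->
  comp (fun z => vnat (kx z)) -> comp (fun z => vnat (lx z)) ->
  (forall z, dom z -> (kx z < N (pi z))%N) -> (forall z, dom z -> (lx z < n (pi z))%N) ->
  comp (fun z => ffield_enc (xpow (n (pi z)) (x (pi z)) (kx z) (lx z))).
Proof.
by move=> h1 h2 h3 h4 h5; tnth2 (fun z => N (pi z)) (fun z => n (pi z))
  (fun z e l => ffield_enc (xpow (n (pi z)) (x (pi z)) e l)) kx lx.
Qed.

Local Notation zf i := (xfrob (p i) (n i) (x i)).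

Lemma tab_xfrob : comp (fun i => vtab (m i) (fun k => vtab (n i) (fun b => ffield_enc (zf i k b)))).
Proof.
have tX := tab_xpow; htab; set X := ext _.
pose st (z : ix X) k := vtab (n z.1) (fun b => ffield_enc (zf z.1 k b)).
have cX : @comp X (fun z => vnat (n z.1)) by rewrite /X; hgo.
have bX : @nbnd X (fun z => z.2) by rewrite /X; nauto.
have bX' : vbnd (@env X) by rewrite /X; envb.
have bst (z : ix X) k : (vsize (st z k) <= n z.1 * (m z.1 * (p z.1).+1 + 1).+1 + 1)%N.
  by apply: vsize_vtab_le => b _; apply: ff_size.
have bb : @nbnd X (fun z => n z.1 * (m z.1 * (p z.1).+1 + 1).+1 + 1)%N by rewrite /X; nauto.
refine (@comp_iter X (fun z => z.2) st _ bX _ _ _).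
- by rewrite /X; hgo.
- by exists (fun z => n z.1 * (m z.1 * (p z.1).+1 + 1).+1 + 1)%N.
- rewrite /st /X; htab.
  by lku xp (fun z => z.1.1) (fun=> 1%N) (fun z => z.2); [hgo | hgo | hgo | move=> z _; rewrite /xlen | dtac].
have bA : @vbnd (@ext X (fun z => z.2)) (fun z => st z.1 z.2).
  by refine (@nbnd_le (@ext X (fun z => z.2)) _ _ (nbnd_up _ bb) _) => z _.
set A := addenv _.
have cst : @comp A (fun z => st z.1 z.2) by apply: comp_added => //; apply: vbnd_ext_env.
have up y : @comp c y -> @comp A (fun z => y z.1.1).
  move=> cy; rewrite /A; apply: comp_weak => //.
  exact: (@comp_up X (fun z => z.2) (fun z => y z.1) bX (@comp_up c (fun i => m i) y bm cy)).
have gA : good fdesc fpw (fun z : ix A => fi z.1.1).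
  by rewrite /A; apply: good_addenv => //; apply: (@good_ext _ _ _ X (fun z => fi z.1)) => //; apply: good_ext.
have bnA : @nbnd A (fun z => n z.1.1).
  exact: (nbnd_up (c := X) (fun z => z.2) (nbnd_up (c := c) (fun i => m i) bn)).
exact: (@xfrob_step A (fun z => fi z.1.1) (fun z => n z.1.1) (fun z => x z.1.1) gA (up _ cn) bnA
  (fun z => zf z.1.1 z.2) (up _ tX) cst).
Qed.

Lemma tab_thfrob : comp (fun i => vtab (m i) (fun j => vtab (m i) (fun k => ffield_enc ((th i ^+ j) ^+ (p i ^ k))))).
Proof.
have cth : comp (fun i => ffield_enc (th i)).
  by apply: (comp_ext (ff_theta gd H1)) => i _; rewrite mulr1.
htab; htab; set X := ext _.
have gX : good fdesc fpw (fun z : ix X => fi z.1.1) by rewrite /X; hgood.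
refine (@ff_iter X (fun z => fi z.1.1) (fun z => z.2) (fun z k => (th z.1.1 ^+ z.1.2) ^+ (p z.1.1 ^ k)) gX _ _ _ _).
- by rewrite /X; hgo.
- by rewrite /X; nauto.
- refine (@comp_ext X (fun z => ffield_enc (th z.1.1 ^+ z.1.2)) _ _ _); first by rewrite /X; hgo.
  by move=> z _; rewrite expn0 expr1.
move=> C pi k gC up ck.
refine (@comp_ext C _ _ (ff_pow gC ck (ff_cp gC) (ff_bp gC)) _) => z _.
by rewrite -exprM -expnSr.
Qed.

Lemma tab_xtr : comp (fun i => vtab (m i) (fun j => vtab (n i) (fun b => ffield_enc (xtr (p i) (m i) (n i) (th i) (x i) j b)))).
Proof.
have t1 := tab_thfrob; have t2 := tab_xfrob; htab; htab.
hdot (fun z => fi z.1.1) (fun z => m z.1.1) (fun z k => (th z.1.1 ^+ z.1.2) ^+ (p z.1.1 ^ k)) (fun z k => zf z.1.1 k z.2).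
  by tnth2 (fun z => m z.1.1.1) (fun z => m z.1.1.1) (fun z j k => ffield_enc ((th z.1.1.1 ^+ j) ^+ (p z.1.1.1 ^ k)))
    (fun z => z.1.1.2) (fun z => z.2); [hgo | hgo | dtac | hgo | dtac].
by tnth2 (fun z => m z.1.1.1) (fun z => n z.1.1.1) (fun z j k => ffield_enc (zf z.1.1.1 j k))
    (fun z => z.2) (fun z => z.1.2); [hgo | hgo | dtac | hgo | dtac].
Qed.

Local Notation tmx i := (xtrmx (p i) (m i) (n i) (th i) (x i)).

Lemma tab_xtrmx : comp (fun i => vtab (m i) (fun j => vtab (n i) (fun k => vtab (n i) (fun l => ffield_enc (tmx i j k l))))).
Proof.
have t1 := tab_xtr; have t2 := tab_xpow; htab; htab; htab.
hdot (fun z => fi z.1.1.1) (fun z => n z.1.1.1) (fun z b => xtr (p z.1.1.1) (m z.1.1.1) (n z.1.1.1) (th z.1.1.1) (x z.1.1.1) z.1.1.2 b)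
  (fun z b => xpow (n z.1.1.1) (x z.1.1.1) (b + z.2)%N z.1.2).
  by tnth2 (fun z => m z.1.1.1.1) (fun z => n z.1.1.1.1)
    (fun z j b => ffield_enc (xtr (p z.1.1.1.1) (m z.1.1.1.1) (n z.1.1.1.1) (th z.1.1.1.1) (x z.1.1.1.1) j b))
    (fun z => z.1.1.1.2) (fun z => z.2); [hgo | hgo | dtac | hgo | dtac].
lku xp (fun z => z.1.1.1.1) (fun z => z.2 + z.1.2)%N (fun z => z.1.1.2); [by hgo | by hgo | by hgo | | by dtac].
by move=> z [[_ l1] l2]; rewrite /xlen /= in l1 l2 *; lia.
Qed.

Local Notation td i := (tdig (p i) (m i) (n i) (th i) (x i)).

Lemma tab_tdig : comp (fun i => vtab (m i) (fun j => vnat (td i (m i) j))).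
Proof.
have tT := tab_xtrmx.
pose st i J := vtab (m i) (fun j => vnat (td i J j)).
have bst i J : (vsize (st i J) <= m i * (p i).+2 + 1)%N.
  by apply: vsize_vtab_le => j _; apply: leq_trans (vsize_nat_le _) _; rewrite ltnS tdig_le.
have bb : nbnd (fun i => m i * (p i).+2 + 1)%N by nauto.
refine (@comp_iter c (fun i => m i) st cm bm _ _ _).
- by exists (fun i => m i * (p i).+2 + 1)%N.
- by rewrite /st /=; hgo; htab; hgo.
have bA : @vbnd (ext (fun i => m i)) (fun z => st z.1 z.2).
  by refine (@nbnd_le (ext (fun i => m i)) _ _ (nbnd_up _ bb) _) => z _.
set A := addenv _.
have bE : vbnd (@env (ext (fun i => m i))) by envb.
have cst : @comp A (fun z => st z.1 z.2) by apply: comp_added.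
have up y : @comp c y -> @comp A (fun z => y z.1).
  by move=> cy; rewrite /A; apply: comp_weak => //; exact: (@comp_up c (fun i => m i) y bm cy).
have cJ : @comp A (fun z => vnat z.2) by rewrite /A; apply: comp_weak => //; apply: comp_ix.
have bJ : @nbnd A (fun z => z.2) by exact: (@nbnd_ix c (fun i => m i) bm).
have upb y : nbnd y -> @nbnd A (fun z => y z.1) by move=> h; exact: (nbnd_up (c := c) (fun i => m i) h).
have gA : good fdesc fpw (fun z : ix A => fi z.1) by rewrite /A; apply: good_addenv => //; apply: good_ext.
have cpA := up _ cp; have bpA := upb _ bp; have cmA := up _ cm; have bmA := upb _ bm.
have cnA := up _ cn; have bnA := upb _ bn; have tTA := up _ tT.
have beA : vbnd (@env A) by apply: (comp_env_bnd cst).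
have DA z : @dom A z -> dom z.1 /\ (z.2 < m z.1)%N by [].
pose aa (z : ix A) := find (fun a => ttest (p z.1) (m z.1) (n z.1) (th z.1) (x z.1) (tset (td z.1 z.2) z.2 a) z.2.+1) (iota 0 (p z.1)).
have ca : @comp A (fun z => vnat (aa z)).
  refine (@ncomp_find A (fun z => p z.1) (fun z a => ttest (p z.1) (m z.1) (n z.1) (th z.1) (x z.1) (tset (td z.1 z.2) z.2 a) z.2.+1) cpA bpA _).
  set Y := ext _.
  have gY : good fdesc fpw (fun z : ix Y => fi z.1.1) by apply: (@good_ext _ _ _ A (fun z => fi z.1)).
  refine (@comp_ttest Y (fun z => fi z.1.1) (fun z => n z.1.1) (fun z => x z.1.1) gY _ _ _
    (fun z => z.1.2.+1) (fun z => tset (td z.1.1 z.1.2) z.1.2 z.2) _ _ _ _ _ _).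
  - by rewrite /Y; hgo.
  - by rewrite /Y; nauto.
  - by move=> z [Dz _]; apply: n_gt0; case: (DA _ Dz).
  - by rewrite /Y; hgo.
  - by rewrite /Y; hgo.
  - by rewrite /Y; nauto.
  - by move=> z [Dz _]; case: (DA _ Dz).
  - refine (@comp_tab Y (fun z => z.1.2.+1) (fun z j => vnat (tset (td z.1.1 z.1.2) z.1.2 z.2 j)) _ _ _).
    + by rewrite /Y; hgo.
    + by rewrite /Y; nauto.
    set Z := ext _.
    refine (@comp_ext Z (fun z => vif (z.2 == z.1.1.2) (vnat z.1.2) (vnat (td z.1.1.1 z.1.1.2 z.2))) _ _ _); last first.
      by move=> z _; rewrite /vif /tset; case: ifP.
    rewrite /Z /Y; hgo.
    tnth (fun z => m z.1.1.1) (fun z j => vnat (td z.1.1.1 z.1.1.2 j)) (fun z => z.2); [by hgo | by hgo | ].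
    move=> z [[[Dz _] l1] /eqP l2]; have [_ l3] := DA _ Dz; rewrite /= in l1 l2 l3 *.
    by apply: leq_ltn_trans l3; rewrite -ltnS.
  - move=> z j [Dz lt] _; rewrite /tset; case: eqP => _; [exact: ltnW | exact: tdig_le].
refine (@comp_tab A (fun z => m z.1) (fun z j => vnat (td z.1 z.2.+1 j)) cmA bmA _).
set Y := ext _.
refine (@comp_ext Y (fun z => vif (z.2 == z.1.2) (vnat (aa z.1)) (vnat (td z.1.1 z.1.2 z.2))) _ _ _); last first.
  by move=> z _; rewrite /vif /= /tset; case: ifP.
rewrite /Y; hgo.
by tnth (fun z => m z.1.1) (fun z j => vnat (td z.1.1 z.1.2 j)) (fun z => z.2); [hgo | hgo | dtac].
Qed.

Lemma comp_troot : comp (fun i => ffield_enc (troot (p i) (m i) (n i) (th i) (x i))).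
Proof.
have tT := tab_xtrmx; have tX := tab_xpow.
have tr := @tab_trow c fi n x gd cn bn n_gt0 (fun i => m i) (fun i => td i (m i)) tT cm bm (fun i _ => leqnn _)
  tab_tdig (fun i j _ _ => tdig_le _ _ _ _ _ _ _).
hdot fi n (fun i k => kervec (@elsolve _) (n i) (m i * n i) (trow (p i) (m i) (n i) (th i) (x i) (td i (m i))) 0 k)
  (fun i k => xpow (n i) (x i) 1 k); last first.
  by lku xp (fun z => z.1) (fun=> 1%N) (fun z => z.2); [hgo | hgo | hgo | move=> z _; rewrite /xlen | dtac].
set X := ext _.
have gX : good fdesc fpw (fun z : ix X => fi z.1) by apply: good_ext.
refine (@fkervec ffield ffield_F ffield_enc fdesc fpw hslv hslvP ff_solver ff_consts X (fun z => fi z.1) gX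
  (fun z => n z.1) (fun z => m z.1 * n z.1)%N (fun=> 0%N)
  (fun z => trow (p z.1) (m z.1) (n z.1) (th z.1) (x z.1) (td z.1 (m z.1))) _ _ _ _ _ _ _ (fun z => z.2) _ _); rewrite /X.
- by hgo.
- by nauto.
- by hgo.
- by nauto.
- by hgo.
- by move=> z [Dz _]; apply: n_gt0.
- by hgo.
- by hgo.
- by dtac.
Qed.

End TraceRoot.

Definition ffonert (phi : ffield) n (x : nat -> ffield_F phi) : ffield_F phi :=
  troot (ffp phi) (ffm phi) n (ffth phi : ffield_F phi) x.

Lemma ffonertP phi n (x : nat -> ffield_F phi) : split_ok n.+1 x -> root (chi_poly n.+1 x) (ffonert n.+1 x).
Proof. by case=> l [El li]; apply: (troot_root (ffpb phi) (ltn0Sn n) El li). Qed.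

Lemma ffonert_comp : @onert_comp ffield ffield_F ffield_enc fdesc fpw ffonert.
Proof.
move=> c fi n x gd cn bn tx Hn.
by apply: comp_troot => // i Di; case: (Hn i Di).
Qed.

Theorem finite_reconstructible : finite_fields_reconstructible.
Proof.
pose I := @instance ffield ffield_F.
pose W (y : I) := (ir y + ide y + id_ y + ffp (iphi y) + trunc_log 2 #|ffF (iphi y)|)%N.
pose E (y : I) := VPair (ffield_desc (iphi y)) (parameters (ir y) (id_ y) (ide y)).
pose c := @inst_ctx ffield ffield_F ffield_enc (fun=> True) W E.
have bW (f : I -> nat) : (forall y, (f y <= W y)%N) -> @nbnd c f.
  by move=> H; apply: (@pbd_le _ _ _ _ _ (@pbd_id _ _ _)) => y _; apply: H.
have br : @nbnd c (fun y => ir y) by apply: bW => y; rewrite /W -!addnA leq_addr.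
have bd : @nbnd c (fun y => id_ y) by apply: bW => y; rewrite /W; lia.
have bde : @nbnd c (fun y => ide y) by apply: bW => y; rewrite /W; lia.
have bp : @nbnd c (fun y => ffp (iphi y)) by apply: bW => y; rewrite /W; lia.
(* From [#|F| = p ^ m] and [p >= 2], the degree [m] is at most the logarithm of the cardinality. *)
have bm : @nbnd c (fun y => ffm (iphi y)).
  apply: bW => y; apply: (@leq_trans (trunc_log 2 #|ffF (iphi y)|)); last by rewrite /W leq_addl.
  rewrite (ff_card (ffpb (iphi y))) trunc_log_max //.
  have := prime_gt1 (pb_prime (ffpb (iphi y))); case: (ffm (iphi y)) => // k p1.
  by rewrite leq_exp2r.
have fsz (phi : ffield) (z : ffield_F phi) : (vsize (ffield_enc z) <= ffm phi * (ffp phi).+1 + 1)%N.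
  exact: (@ff_size (@Ctx unit (fun=> True) (fun=> 0%N) (fun=> no_oracle) (fun=> vnat 0)) (fun=> phi) tt).
have bsz : @nbnd c (fun y => ffm (iphi y) * (ffp (iphi y)).+1 + 1)%N by nauto.
(* Field elements have uniformly bounded size, so the bit complexity is bounded by the other
   parameters. *)
have bB : @nbnd c (fun y => bit_complexity (@ffield_enc _) (@ialpha _ _ y) (@ipol _ _ y)).
  refine (@nbnd_le c _ (fun y => ir y * ((ffm (iphi y) * (ffp (iphi y)).+1 + 1) + (ide y).+1 * (ffm (iphi y) * (ffp (iphi y)).+1 + 1)))%N _ _).
    by nauto.
  move=> y [_ [_ _ _ le [[_ sz _] _ _]]]; rewrite /bit_complexity.
  set S := (ffm _ * _ + 1)%N.
  apply: (@leq_trans (\sum_(i < inn y) (S + (ide y).+1 * S))%N); last first.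
    by rewrite sum_nat_const card_ord leq_mul2r le orbT.
  apply: leq_sum => i _; apply: leq_add; first exact: fsz.
  apply: (@leq_trans (\sum_(j < size (@ipol _ _ y i)) S)%N); first by apply: leq_sum => j _; apply: fsz.
  by rewrite sum_nat_const card_ord leq_mul2r sz orbT.
have bv (f : I -> nat) : @nbnd c f -> @vbnd c (fun y => vnat (f y)).
  by move=> h; apply: (@pbd_le _ _ _ _ _ (pbd_S h)) => y _; apply: vsize_nat_le.
have be : @vbnd c E.
  apply: (@vbnd_pair c).
    apply: (@vbnd_pair c); first exact: bv.
    by apply: (@nbnd_le c _ _ bsz) => y _; apply: fsz.
  apply: (@vbnd_pair c); first exact: bv.
  apply: (@vbnd_pair c); first exact: bv.
  by apply: (@vbnd_pair c); [exact: bv | exact: pbd_const].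
have cE := @comp_id c be.
have gd : @good ffield ffield_desc ffield_pw c (fun y => iphi y).
  by split; [exact: (comp_fst cE) | rewrite /ffield_pw; nauto].
have cr : @comp c (fun y => vnat (ir y)) := comp_fst (comp_snd cE).
have cd : @comp c (fun y => vnat (id_ y)) := comp_fst (comp_snd (comp_snd cE)).
have ce : @comp c (fun y => vnat (ide y)) := comp_fst (comp_snd (comp_snd (comp_snd cE))).
have [q [k H]] := @reconstruct_family ffield ffield_F ffield_enc ffield_desc ffield_pw hslv
  (fun phi => droots (@elsolve (ffield_F phi)) (@ffonert phi)) hslvP
  (fun phi => droots_spec (@elsolve_spec (ffield_F phi)) (@ffonertP phi)) ff_solver ff_consts
  (@droots_comp ffield ffield_F ffield_enc ffield_desc ffield_pw hslv hslvP ff_solver ff_consts ffonert ffonertP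
     ffonert_comp ff_divisor_bnd) (fun=> True) W E gd cr br cd bd ce bde bB.
exists q, k => F p m theta digits pb r d delta n g alpha f inst.
exact: (H (@Instance ffield ffield_F (FField pb) r d delta n g alpha f) (conj Logic.I inst)).
Qed.

Theorem theorem4p16 :
  [/\ forall (F : fieldType) (enc : F -> value),
        polytime_field enc -> reconstructible enc,
      reconstructible enc_rat
    & finite_fields_reconstructible].
Proof.
split; [exact: polytime_field_reconstructible | exact: rat_reconstructible | exact: finite_reconstructible].
Qed.
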